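(* Let $n\ge2$, let $\mathbb{T}^n_\theta$ be a noncommutative $n$-torus, let $g=(g_{ij})$ be a Riemannian metric on $\mathbb{T}^n_\theta$, and let $\nu$ be a smooth positive density, i.e., a positive invertible element of $C^\infty(\mathbb{T}^n_\theta)$. Let $p>0$, and suppose that $q=\max(p,1)$ if $p\neq1$, or $p=1<q$. If $V=V^*\in L_q(\mathbb{T}^n_\theta)$, then the number $N^-(H_V^{(p)})$ of negative eigenvalues of $H_V^{(p)}=\Delta_{g,\nu}^{n/2p}+\lambda_\nu(V)$ satisfies $$N^-\big(H_V^{(p)}\big)-1\le C_{g,\nu}(2p,2q)^{2p}\,\big(\|V_-\|_{L_q}\big)^p.$$
   Context: Noncommutative torus. Let $n\ge2$ and let $\theta=(\theta_{jk})$ be a real antisymmetric $n\times n$ matrix with columns $\theta_1,\dots,\theta_n$. On $L_2(\mathbb{T}^n)$, $\mathbb{T}^n=\mathbb{R}^n/(2\pi\mathbb{Z})^n$, with inner product $(2\pi)^{-n}\int \xi\bar\eta\,dx$, let $(U_j\xi)(x)=e^{ix_j}\xi(x+\pi\theta_j)$; these unitaries satisfy $U_kU_j=e^{2i\pi\theta_{jk}}U_jU_k$. $C(\mathbb{T}^n_\theta)$ and $L_\infty(\mathbb{T}^n_\theta)$ are the $C^*$-algebra and von Neumann algebra generated by $U_1,\dots,U_n$. Set $U^k=U_1^{k_1}\cdots U_n^{k_n}$, $k\in\mathbb{Z}^n$. $\tau(T)=\langle T1|1\rangle$ is a faithful normal tracial state on $L_\infty(\mathbb{T}^n_\theta)$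 with $\tau(U^k)=0$ for $k\ne0$. $L_p(\mathbb{T}^n_\theta)$, $1\le p<\infty$, is the noncommutative $L_p$-space of $(L_\infty(\mathbb{T}^n_\theta),\tau)$, with norm $\|x\|_{L_p}=\tau(|x|^p)^{1/p}$; $\tau$ extends to $L_1(\mathbb{T}^n_\theta)$. $L_2(\mathbb{T}^n_\theta)$ has inner product $\langle u|v\rangle=\tau(uv^* )$ and orthonormal basis $(U^k)_{k\in\mathbb{Z}^n}$. $C^\infty(\mathbb{T}^n_\theta)$ is the Fréchet $*$-algebra of series $\sum u_kU^k$ with rapidly decaying coefficients; $\partial_j$ is the derivation with $\partial_jU^k=ik_jU^k$. $\lambda(x)$ denotes left multiplication by $x$. $W_2^s(\mathbb{T}^n_\theta)=\{\sum u_kU^k:\sum(1+|k|^2)^s|u_k|^2<\infty\}$, $s\ge0$. Metric, density, Laplace–Beltrami operator. A Riemannian metric is a positive invertible matrix $g=(g_{ij})\in M_n(C^\infty(\mathbb{T}^n_\theta))$ such that the entries of $g$ and of $g^{-1}=(g^{ij})$ are selfadjoint. $L_2(\mathbb{T}^n_\theta;\nu)$ is $L_2(\mathbb{T}^n_\theta)$ with the equivalent inner product $\langle u|v\rangle_\nu=(2\pi)^n\tau[v^*\nu u]$. $\Delta_{g,\nu}u=-\nu^{-1}\sum_{i,j}\partial_i\big(\sqrt\nu\,g^{ij}\sqrt\nu\,\partial_j(u)\big)$; with domain $W_2^2(\mathbb{T}^n_\theta)$ it is a nonnegative selfadjoint operator on $L_2(\mathbb{T}^n_\theta;\nu)$ with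 compact resolvent and kernel $\mathbb{C}\cdot1$. Its powers are defined by functional calculus; for $s>0$, $\Delta_{g,\nu}^{-s}1=0$, and $\Delta_{g,\nu}^{s/2}$ has domain $W_2^s(\mathbb{T}^n_\theta)$. Schrödinger operators. For $p,q$ as in the claim and $V=V^*\in L_q(\mathbb{T}^n_\theta)$, $\lambda_\nu(V)$ is the operator from $W_2^{n/2p}(\mathbb{T}^n_\theta)$ to its antilinear dual given by the symmetric form $Q_{\lambda_\nu(V)}(u,v)=(2\pi)^n\tau[v^*\nu^{1/2}V\nu^{1/2}u]$. $H_V^{(p)}=\Delta_{g,\nu}^{n/2p}+\lambda_\nu(V)$ is the bounded-below selfadjoint operator on $L_2(\mathbb{T}^n_\theta;\nu)$ associated with the closed quadratic form $\langle\Delta_{g,\nu}^{n/4p}u|\Delta_{g,\nu}^{n/4p}v\rangle_\nu+Q_{\lambda_\nu(V)}(u,v)$ on $W_2^{n/2p}(\mathbb{T}^n_\theta)$; it has compact resolvent. $N^-(H_V^{(p)})$ is the number of its negative eigenvalues counted with multiplicity. $V_-=\frac12(|V|-V)$. Constant. $\mathscr{L}_{r,\infty}^{(\nu)}$ is the weak Schatten class of compact operators $T$ on $L_2(\mathbb{T}^n_\theta;\nu)$ with $\|T\|_{\mathscr{L}_{r,\infty}^{(\nu)}}=\sup_{j\ge0}(j+1)^{1/r}\mu_j(T)<\infty$, where $\mu_0(T)\ge\mu_1(T)\ge\cdots$ are the singular values. For $x\in L_{2q}(\mathbb{T}^n_\theta)$, $\lambda_\nu(x)=\lambda(\nu^{-1/2}x\nu^{1/2})$,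 and $C_{g,\nu}(2p,2q)$ is the best (smallest, finite) constant $C$ such that $\|\lambda_\nu(x)\Delta_{g,\nu}^{-n/4p}\|_{\mathscr{L}_{2p,\infty}^{(\nu)}}\le C\|x\|_{L_{2q}}$ for all $x\in L_{2q}(\mathbb{T}^n_\theta)$. *)

(* Defs.v *)
From HB Require Import structures.
From mathcomp Require Import all_boot all_order all_algebra.
From mathcomp Require Import all_classical all_reals all_analysis.
From mathcomp Require Import complex ring.

Set Implicit Arguments.
Unset Strict Implicit.
Unset Printing Implicit Defensive.
Import Order.TTheory GRing.Theory Num.Theory.
Import numFieldNormedType.Exports.
Local Open Scope classical_set_scope.
Local Open Scope ring_scope.
Local Open Scope complex_scope.

(* A possibly unbounded operator on H is identified with its graph, a subset
   of H * H, and  d  is the inner product of the Hilbert space: linear in its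
   first argument, conjugate linear in the second. Each notion below that
   depends on the inner product takes it as an argument, because the same
   vector space carries several equivalent inner products. *)
Section operators.
Context {R : realType} {H : lmodType R[i]}.

Definition op := set (H * H).

Implicit Types (d : H -> H -> R[i]) (A : op) (x y z : H).

Definition hnorm d x : R := Num.sqrt (complex.Re (d x x)).

Definition opdom A : set H := [set x | exists y, A (x, y)].
Definition opid : op := [set w | w.2 = w.1].
Definition opzero : op := [set w | w.2 = 0].
Definition opcomp A A' : op :=
  [set w | exists y, A' (w.1, y) /\ A (y, w.2)].
Definition opadd A A' : op :=
  [set w | exists y z, [/\ A (w.1, y), A' (w.1, z) & w.2 = y + z]].
Definition opscale (c : R[i]) A : op :=
  [set w | exists y, A (w.1, y) /\ w.2 = c *: y].
Definition opsub A A' : op := opadd A (opscale (-1) A').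
Definition opinv A : op := [set w | A (w.2, w.1)].
Definition adj d A : op :=
  [set w | forall x y, A (x, y) -> d y w.1 = d x w.2].
Definition opclosure d A : op :=
  [set w | forall e : R, 0 < e -> exists x y,
     [/\ A (x, y), hnorm d (x - w.1) < e & hnorm d (y - w.2) < e]].
Definition opexpz A (m : int) : op :=
  match m with
  | Posz a => iter a (opcomp A) opid
  | Negz a => iter a.+1 (opcomp (opinv A)) opid
  end.
Definition app A x : H := xget 0 [set y | A (x, y)].

Definition linear_op A :=
  [/\ A (0, 0),
      (forall c x y x' y', A (x, y) -> A (x', y') ->
         A (c *: x + x', c *: y + y')) &
      (forall y, A (0, y) -> y = 0)].
Definition bounded_op d A :=
  [/\ linear_op A, opdom A = setT &
      exists M : R, forall x y, A (x, y) -> hnorm d y <= M * hnorm d x].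
Definition closed_op d A := linear_op A /\ opclosure d A = A.
Definition densely_defined d A :=
  forall x (e : R), 0 < e -> exists2 x', opdom A x' & hnorm d (x' - x) < e.
Definition positive_op d A :=
  bounded_op d A /\ forall x y, A (x, y) -> 0 <= d y x.

Definition commutant d (S : set op) : set op :=
  [set T | bounded_op d T /\ forall A, S A -> opcomp T A = opcomp A T].

Definition lin_indep m (u : 'I_m -> H) :=
  forall c : 'I_m -> R[i], \sum_(i < m) c i *: u i = 0 -> forall i, c i = 0.

(* dim ker(A - l), possibly +oo *)
Definition eigen_mult A (l : R) : \bar R :=
  ereal_sup [set (m%:R)%:E | m in [set m : nat |
    exists2 u : 'I_m -> H, lin_indep u & forall i, A (u i, l%:C *: u i)]].

Definition negative_eigenvalues A : \bar R :=
  (\esum_(l in [set l : R | (l < 0)%R]) eigen_mult A l)%E.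

(* A projection-valued measure E on the Borel sets of the line, together with
   the scalar measures  B |-> < E(B) x | x >. *)
Record pvm := PVM {
  pvm_proj : set R -> H -> H ;
  pvm_meas : H -> {measure set (measurableTypeR R) -> \bar R} }.

Definition is_pvm d (E : pvm) :=
  [/\ forall B : set (measurableTypeR R), measurable B ->
        (forall c x y, pvm_proj E B (c *: x + y) =
           c *: pvm_proj E B x + pvm_proj E B y) /\
        (forall x y, d (pvm_proj E B x) y = d x (pvm_proj E B y)),
      forall B B' : set (measurableTypeR R), measurable B -> measurable B' ->
        forall x, pvm_proj E (B `&` B') x = pvm_proj E B (pvm_proj E B' x),
      forall x, pvm_proj E setT x = x &
      forall x (B : set (measurableTypeR R)), measurable B ->
        pvm_meas E x B = (complex.Re (d (pvm_proj E B x) x))%:E].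

(* The operator  int f dE : its domain consists of the x such that
   int |f|^2 d< E x | x > is finite, and  y = (int f dE) x  is expressed by
   < y | z > = int f d< E x | z >, where the complex measure < E x | z > is
   written by means of the scalar measures through polarization. *)
Definition pvm_dom (E : pvm) (f : R -> R) : set H :=
  [set x | (\int[pvm_meas E x]_(t in setT) ((f t) ^+ 2)%:E < +oo)%E].
Definition pvm_integral d (E : pvm) (f : R -> R) : op :=
  [set w | pvm_dom E f w.1 /\ forall z, pvm_dom E f z ->
     d w.2 z = 4%:R^-1 * \sum_(k < 4) (0 +i* 1) ^+ k *
       (Rintegral (pvm_meas E (w.1 + (0 +i* 1) ^+ k *: z)) setT f)%:C].

Definition is_spectral_measure d A (E : pvm) :=
  is_pvm d E /\ A = pvm_integral d E id.

(* The spectral measure of a selfadjoint operator A. *)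
Definition spectral_measure d A : pvm :=
  match pselect (exists E, is_spectral_measure d A E) with
  | left h => projT1 (cid h)
  | right _ => PVM (fun _ => id) (fun _ => mzero)
  end.

(* Borel functional calculus; it is the empty relation if A has no spectral
   measure. *)
Definition fcalc d (f : R -> R) A : op :=
  [set w | is_spectral_measure d A (spectral_measure d A) /\
           pvm_integral d (spectral_measure d A) f w].

(* Powers of a nonnegative selfadjoint operator. As 0 `^ s = 0 for s <> 0, the
   negative powers vanish on the kernel. *)
Definition oppow d A (s : R) : op := fcalc d (fun t => t `^ s) A.

Definition opabs d A : op := oppow d (opcomp (adj d A) A) 2^-1.

Definition compact_op d A :=
  bounded_op d A /\
  forall x_ y_ : nat -> H, (forall k, A (x_ k, y_ k)) ->
    (exists M : R, forall k, hnorm d (x_ k) <= M) ->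
    exists (phi : nat -> nat) (y : H),
      (forall k, (phi k < phi k.+1)%N) /\
      (hnorm d (y_ (phi k) - y) @[k --> \oo] --> (0 : R)).

(* The (j+1)-th largest eigenvalue of |A|, counted with multiplicity, for a
   compact operator A (0 if |A| has at most j positive eigenvalues): the largest
   t such that at least j+1 eigenvalues are >= t. *)
Definition singular_value d A (j : nat) : R :=
  sup [set t : R | t = 0 \/ 0 < t /\
    (((j.+1)%:R)%:E <=
       \esum_(s in [set s : R | (t <= s)%R]) eigen_mult (opabs d A) s)%E].

Definition weak_schatten_norm d (r : R) A : \bar R :=
  ereal_sup (range (fun j : nat =>
    ((j.+1)%:R `^ r^-1 * singular_value d A j)%:E)).

Definition weak_schatten d (r : R) A :=
  compact_op d A /\ (weak_schatten_norm d r A < +oo)%E.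

End operators.
Arguments op {R} H.

Section l2.
Variables (R : realType) (n : nat).

Definition Zn := 'rV[int]_n.

Definition normc2 (z : R[i]) : R := complex.Re z ^+ 2 + complex.Im z ^+ 2.

Definition l2 : {pred Zn -> R[i]^o} := fun f =>
  `[< (\esum_(k in [set: Zn]) (normc2 (f k))%:E < +oo)%E >].

Lemma normc2_ge0 z : 0 <= normc2 z.
Proof. by rewrite addr_ge0 ?sqr_ge0. Qed.

Lemma normc2_axpy (a x y : R[i]) :
  normc2 (a * x + y) <= 2 * normc2 a * normc2 x + 2 * normc2 y.
Proof.
case: a x y => [a b] [x y] [z t]; rewrite /normc2 /=.
rewrite -subr_ge0.
have -> : 2 * (a ^+ 2 + b ^+ 2) * (x ^+ 2 + y ^+ 2) + 2 * (z ^+ 2 + t ^+ 2) -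
    ((a * x - b * y + z) ^+ 2 + (a * y + b * x + t) ^+ 2) =
    (a * x - b * y - z) ^+ 2 + (a * y + b * x - t) ^+ 2 by ring.
by rewrite addr_ge0 ?sqr_ge0.
Qed.

Lemma esum_scale_lty (c : R) (f : Zn -> R) : 0 <= c -> (forall k, 0 <= f k) ->
  (\esum_(k in [set: Zn]) (f k)%:E < +oo)%E ->
  (\esum_(k in [set: Zn]) (c * f k)%:E < +oo)%E.
Proof.
move=> c0 f0 foo.
apply: (@le_lt_trans _ _ (c%:E * \esum_(k in [set: Zn]) (f k)%:E)%E).
  apply: ub_ereal_sup => _ [F [finF _] <-].
  under eq_fsbigr do rewrite EFinM.
  rewrite -ge0_mule_fsumr; last by move=> k; rewrite lee_fin.
  by rewrite lee_wpmul2l ?lee_fin//; apply: ereal_sup_ubound; exists F.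
by apply: lte_mul_pinfty; rewrite ?lee_fin.
Qed.

Lemma l2_submod_closed : submod_closed l2.
Proof.
split=> [|a u v /asboolP u2 /asboolP v2]; apply/asboolP.
  by rewrite esum1// => k _; rewrite /normc2 /= expr0n addr0.
have a0 : 0 <= 2 * normc2 a by rewrite mulr_ge0 ?normc2_ge0.
have U := esum_scale_lty a0 (fun k => normc2_ge0 (u k)) u2.
have V := esum_scale_lty (ler0n R 2) (fun k => normc2_ge0 (v k)) v2.
apply: le_lt_trans (lte_add_pinfty U V).
rewrite -esumD; try by move=> k _; rewrite lee_fin mulr_ge0 ?normc2_ge0.
by apply: le_esum => k _; rewrite -EFinD lee_fin; exact: normc2_axpy.
Qed.

HB.instance Definition _ := GRing.isSubmodClosed.Build _ _ l2 l2_submod_closed.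

Record L2 := MkL2 { L2coef :> Zn -> R[i]^o ; L2P : L2coef \in l2 }.
HB.instance Definition _ := [isSub for L2coef].
HB.instance Definition _ := [Choice of L2 by <:].
HB.instance Definition _ := [SubChoice_isSubLmodule of L2 by <:].

Lemma vacuum_l2 : (fun k : Zn => (k == 0)%:R : R[i]^o) \in l2.
Proof.
apply/asboolP.
rewrite (eq_esum (b := fun k => if k \in [set (0 : Zn)] then 1%E else 0%E)).
  by rewrite -esum_mkcond esum_set1 ?ltry.
move=> k _; have [->|k0] := eqVneq k 0.
  by rewrite mem_set// /normc2 /= expr1n expr0n addr0.
by rewrite memNset; [rewrite /normc2 /= expr0n addr0|move=> /= /eqP; exact/negP].
Qed.

End l2.

(* L_2(T^n) is represented by Fourier coefficients: u : L2 stands for the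
   function  sum_k u_k exp(i k.x), and the normalized inner product
   (2 pi)^-n int u conj(v) dx  becomes  sum_k u_k conj(v_k). *)
Section torus.
Variables (R : realType) (n : nat) (theta : 'M[R]_n).
Local Notation L2 := (L2 R n).
Local Notation Zn := (Zn n).
Local Notation op := (op L2).

Definition rsum (f : Zn -> R) : R :=
  fine (\esum_(k in [set: Zn]) (Num.max (f k) 0)%:E)%E -
  fine (\esum_(k in [set: Zn]) (Num.max (- f k) 0)%:E)%E.

Definition dot (u v : L2) : R[i] :=
  rsum (fun k => complex.Re ((u k : R[i]) * (v k)^*)) +i*
  rsum (fun k => complex.Im ((u k : R[i]) * (v k)^*)).

(* the constant function 1 *)
Definition vacuum : L2 := MkL2 (vacuum_l2 R n).

Definition expi (t : R) : R[i] := cos t +i* sin t.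

(* (U_j u)(x) = exp(i x_j) u(x + pi theta_j), where theta_j is the j-th column
   of theta; on Fourier modes,
   U_j exp(i k.x) = exp(i pi k.theta_j) exp(i (k + e_j).x). *)
Definition U (j : 'I_n) : op :=
  [set w : L2 * L2 | forall k : Zn, w.2 (k + delta_mx 0 j) =
     expi (pi * \sum_(l < n) (k 0 l)%:~R * theta l j) * (w.1 k : R[i])].

Definition Linf : set op :=
  commutant dot (commutant dot
    [set T | exists j, T = U j \/ T = adj dot (U j)]).

Definition tau (T : op) : R[i] := dot (app T vacuum) vacuum.

(* Closed densely defined operators affiliated with Linf. As tau is finite,
   they are all tau-measurable. *)
Definition affiliated (x : op) :=
  [/\ closed_op dot x, densely_defined dot x &
      forall T, commutant dot Linf T -> opcomp T x `<=` opcomp x T].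

(* tau(f(a)) = int f(t) d tau(E_a(t)) for a selfadjoint and affiliated, f >= 0 *)
Definition tau_fun (f : R -> R) (a : op) : \bar R :=
  (\int[pvm_meas (spectral_measure dot a) vacuum]_(t in setT) (f t)%:E)%E.

Definition Lpnorm (p : R) (x : op) : \bar R :=
  (tau_fun (fun t => t `^ p)%R (opabs dot x) `^ p^-1)%E.

Definition Lp (p : R) (x : op) := affiliated x /\ (Lpnorm p x < +oo)%E.

(* t = tau(x), where tau is extended from Linf to L_1 by continuity *)
Definition tau_L1 (x : op) (t : R[i]) :=
  Lp 1 x /\ forall e : R, 0 < e -> exists y : op,
    [/\ Linf y, (Lpnorm 1 (opsub x y) < e%:E)%E &
        Normc.normc (tau y - t) < e].

Definition Upow (k : Zn) : op :=
  \big[opcomp/opid]_(j < n) opexpz (U j) (k 0 j).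

(* L_2(T^n_theta) is identified with L2 by the unitary x |-> x 1; thus U^k
   becomes the vector U^k 1. *)
Definition Ubasis (k : Zn) : L2 := app (Upow k) vacuum.

Definition coef (u : L2) (k : Zn) : R[i] := dot u (Ubasis k).

(* The operator x affiliated with Linf with x 1 = u: it maps T 1 to T u for T in
   the commutant of Linf. *)
Definition lmul (u : L2) : op :=
  opclosure dot
    [set w : L2 * L2 | exists T,
       [/\ commutant dot Linf T, T (vacuum, w.1) & T (u, w.2)]].

Definition bracket2 (k : Zn) : R := 1 + \sum_(j < n) ((k 0 j)%:~R : R) ^+ 2.

Definition sobolev (s : R) (u : L2) :=
  (\esum_(k in [set: Zn]) (bracket2 k `^ s * normc2 (coef u k))%:E < +oo)%E.

Definition smooth (a : op) :=
  Linf a /\ forall N : nat, exists M : R, forall k,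
    bracket2 k ^+ N * normc2 (coef (app a vacuum) k) <= M.

Definition deriv (j : 'I_n) : op :=
  [set w : L2 * L2 | forall k, coef w.2 k = (0 +i* 1) * (k 0 j)%:~R * coef w.1 k].

(* h is the inverse of g *)
Definition riemannian_metric (g h : 'M[op]_n) :=
  [/\ forall i j, smooth (g i j) /\ smooth (h i j),
      forall i j, adj dot (g i j) = g i j /\ adj dot (h i j) = h i j,
      forall i k,
        \big[opadd/opzero]_(j < n) opcomp (g i j) (h j k) =
          (if i == k then opid else opzero) /\
        \big[opadd/opzero]_(j < n) opcomp (h i j) (g j k) =
          (if i == k then opid else opzero) &
      forall u : 'I_n -> L2,
        0 <= \sum_(i < n) \sum_(j < n) dot (app (g i j) (u j)) (u i)].

Definition smooth_density (nu : op) :=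
  [/\ smooth nu, positive_op dot nu & smooth (opinv nu)].

Definition dotnu (nu : op) (u v : L2) : R[i] :=
  ((2 * pi) ^+ n)%:C * dot (app nu u) v.

Definition sqrt_density (nu : op) : op := oppow dot nu 2^-1.

(* h is the inverse of the metric *)
Definition laplacian (h : 'M[op]_n) (nu : op) : op :=
  let s := sqrt_density nu in
  [set w : L2 * L2 | sobolev 2 w.1 /\
     opscale (-1) (opcomp (opinv nu)
       (\big[opadd/opzero]_(i < n) \big[opadd/opzero]_(j < n)
          opcomp (deriv i)
            (opcomp s (opcomp (h i j) (opcomp s (deriv j)))))) w].

Definition laplacian_pow (h : 'M[op]_n) (nu : op) (s : R) : op :=
  oppow (dotnu nu) (laplacian h nu) s.

(* c is the value at (u, v) of the quadratic form of the Schroedinger operator;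
   the form (2 pi)^n tau[v^* nu^(1/2) V nu^(1/2) u] involves the strong product,
   that is, the closure of the product, of unbounded operators. *)
Definition schrodinger_form (h : 'M[op]_n) (nu : op) (p : R) (V : op)
    (u v : L2) (c : R[i]) :=
  let s := sqrt_density nu in
  let D := laplacian_pow h nu (n%:R / (4 * p)) in
  exists (a b : L2) (t : R[i]),
    [/\ D (u, a), D (v, b),
        tau_L1 (opclosure dot (opcomp (adj dot (lmul v))
          (opcomp s (opcomp V (opcomp s (lmul u)))))) t &
        c = dotnu nu a b + ((2 * pi) ^+ n)%:C * t].

(* The operator associated with the form, of domain W_2^(n/2p): it maps u to f
   when Q(u, v) = < f | v >_nu for all v in the form domain. *)
Definition schrodinger (h : 'M[op]_n) (nu : op) (p : R) (V : op) : op :=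
  [set w : L2 * L2 | sobolev (n%:R / (2 * p)) w.1 /\
     forall v, sobolev (n%:R / (2 * p)) v ->
       schrodinger_form h nu p V w.1 v (dotnu nu w.2 v)].

Definition lambda_nu (nu x : op) : op :=
  let s := sqrt_density nu in
  opclosure dot (opcomp (opinv s) (opcomp x s)).

(* C_{g,nu}(2p, 2q), as an infimum in the extended reals (so that +oo would
   mean that no constant is admissible) *)
Definition cwikel_constant (h : 'M[op]_n) (nu : op) (p q : R) : \bar R :=
  ereal_inf [set C%:E | C in [set C : R | 0 <= C /\
    forall x : op, Lp (2 * q) x ->
      let T := opcomp (lambda_nu nu x)
                 (laplacian_pow h nu (- (n%:R / (4 * p)))) in
      weak_schatten (dotnu nu) (2 * p) T /\
      (weak_schatten_norm (dotnu nu) (2 * p) T <=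
         C%:E * Lpnorm (2 * q) x)%E]].

Definition negative_part (V : op) : op :=
  opclosure dot (opscale 2^-1 (opsub (opabs dot V) V)).

End torus.

(* Main.v *)
(* Let D be the Laplacian, s = n/4p, and x+, x- the square roots of V+ and V-.  An eigenvector u of a
   negative eigenvalue lies in the form domain, so u = D^(-s) a + c 1 with a = D^s u, and the form of
   the Schroedinger operator at u is |a|^2 + |X+ u|^2 - |X- u|^2, where X+ and X- denote lambda_nu(x+)
   and lambda_nu(x-).  On the span of N independent eigenvectors this form is negative definite; one
   linear condition makes c vanish, and there |a| < |T a| with T = X- D^(-s).  A vector a of this kind
   can moreover be taken orthogonal to any N - 2 prescribed vectors, so T has N - 1 singular values
   >= 1, whence (N - 1)^(1/2p) <= |T|_{2p,oo} <= C |x-|_{2q} = C |V-|_q^(1/2).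

   Let r = nu^(1/2).  That the trace of the strong product (lmul v)^* r V r (lmul u) is
   <x+ r u, x+ r v> - <x- r u, x- r v> is seen by letting contractions N of the commutant tend
   strongly to 1: N can be chosen to map 1 into the domain of the product, where the trace is given
   by <V (N r u), N r v>. *)
Require Import Defs.
From HB Require Import structures.
From mathcomp Require Import all_boot all_order all_algebra.
From mathcomp Require Import all_classical all_reals all_analysis.
From mathcomp Require Import measurable_realfun complex ring lra.

Set Implicit Arguments.
Unset Strict Implicit.
Unset Printing Implicit Defensive.
Import Order.TTheory GRing.Theory Num.Theory.
Import numFieldNormedType.Exports.
Local Open Scope classical_set_scope.
Local Open Scope ring_scope.
Local Open Scope complex_scope.

(** * Inner product spaces *)

(** Operators are graphs, and [fcalc], hence every power of the Laplacian, is the empty relation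
    unless a spectral measure exists. The spectral theorem is therefore proved for arbitrary
    selfadjoint graphs, and uniqueness of spectral measures frees the calculus from the choice made
    by [spectral_measure]. For the Laplacian the measure is read off an eigenvector: a value of the
    form at it contains a pair of the graph of D^s.

    Negative powers vanish on the kernel of D, which is C 1. This is the 1 subtracted from the
    number of eigenvalues, and it forces X+ and X- to be defined at 1 as well; [q >= 1] gives this,
    since L_2q then lies in L_2.

    The trace on L_1 is only a limit and the strong product only a closure, so neither can be
    evaluated at the vector 1 directly. Maps of the commutant preserve domains of affiliated
    operators, and a noncommutative Hoelder inequality makes the L_1 error uniform over contractions
    of the commutant.

    The infimum [cwikel_constant] may be +oo and +oo times 0 is 0, so a vanishing negative part and
    an infinite number of eigenvalues are treated apart. *)

Section ComplexParts.
Context {R : realType}.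
Implicit Types z w : R[i].

Lemma ReD z w : complex.Re (z + w) = complex.Re z + complex.Re w.
Proof. by case: z w => [a b] [c e]. Qed.
Lemma ReN z : complex.Re (- z) = - complex.Re z.
Proof. by case: z. Qed.
Lemma ImD z w : complex.Im (z + w) = complex.Im z + complex.Im w.
Proof. by case: z w => [a b] [c e]. Qed.
Lemma ImN z : complex.Im (- z) = - complex.Im z.
Proof. by case: z. Qed.
Lemma ReM z w : complex.Re (z * w) =
  complex.Re z * complex.Re w - complex.Im z * complex.Im w.
Proof. by case: z w => [a b] [c e]. Qed.
Lemma ImM z w : complex.Im (z * w) =
  complex.Re z * complex.Im w + complex.Im z * complex.Re w.
Proof. by case: z w => [a b] [c e]. Qed.
Lemma complexP z w : complex.Re z = complex.Re w ->
  complex.Im z = complex.Im w -> z = w.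
Proof. by case: z w => [a b] [c e] /= -> ->. Qed.

End ComplexParts.

Section RealLimits.
Context {R : realType}.
Implicit Types a b : nat -> R.

Lemma cvg0_le a b : (forall n, `|a n| <= b n) -> b n @[n --> \oo] --> (0 : R) ->
  a n @[n --> \oo] --> (0 : R).
Proof.
move=> h hb; apply/norm_cvg0P; apply: (squeeze_cvgr _ (cvg_cst 0) hb).
by near=> n; rewrite normr_ge0 h.
Unshelve. all: by end_near. Qed.
Lemma cvg0Z c a : a n @[n --> \oo] --> (0 : R) -> c * a n @[n --> \oo] --> (0 : R).
Proof. by move=> h; rewrite -[X in _ --> X](mulr0 c); apply: cvgMr. Qed.
Lemma cvg0Zr c a : a n @[n --> \oo] --> (0 : R) -> a n * c @[n --> \oo] --> (0 : R).
Proof. by move=> h; rewrite -[X in _ --> X](mul0r c); apply: cvgMl. Qed.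
Lemma cvg0D a b : a n @[n --> \oo] --> (0 : R) -> b n @[n --> \oo] --> (0 : R) ->
  a n + b n @[n --> \oo] --> (0 : R).
Proof. by move=> ha hb; rewrite -[X in _ --> X](addr0 0); apply: cvgD. Qed.
Lemma cvg_real_unique a (l m : R) : a n @[n --> \oo] --> l -> a n @[n --> \oo] --> m -> l = m.
Proof. exact: (cvg_unique (@norm_hausdorff R R^o)). Qed.
Lemma cvg_real_le a b (l m : R) : (forall n, a n <= b n) ->
  a n @[n --> \oo] --> l -> b n @[n --> \oo] --> m -> l <= m.
Proof. by move=> h ha hb; apply: (ler_cvg_to ha hb); near=> n.
Unshelve. all: by end_near. Qed.
Lemma cvg_harm : (n.+1%:R^-1 : R) @[n --> \oo] --> (0 : R).
Proof. exact: cvg_harmonic. Qed.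

End RealLimits.

Section InnerProduct.
Context {R : realType} {H : lmodType R[i]} (d : H -> H -> R[i]).
Implicit Types (x y z : H) (u v : nat -> H) (f : H -> H).

Definition hcvg u x := hnorm d (u n - x) @[n --> \oo] --> (0 : R).

Definition hcauchy u := forall e : R, 0 < e ->
  exists N, forall n m, (N <= n)%N -> (N <= m)%N -> hnorm d (u n - u m) < e.

(** A predicate on the form rather than a structure on the type: the same vector space carries [dot]
    and the weighted [dotnu], and pairs carry [dprod]. *)
Record hilbert : Prop := Hilbert {
  ip_linear : forall c x y z, d (c *: x + y) z = c * d x z + d y z ;
  ip_conj : forall x y, d y x = (d x y)^* ;
  ip_ge0 : forall x, 0 <= complex.Re (d x x) ;
  ip_eq0 : forall x, complex.Re (d x x) = 0 -> x = 0 ;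
  ip_complete : forall u, hcauchy u -> exists x, hcvg u x }.

(** Most identities are tested on real parts alone; the imaginary part of [d x y] is the real part
    of [d x (i y)] ([imd]), so nothing is lost on complex subspaces. *)
Definition rdot x y := complex.Re (d x y).

Definition lin f := forall c x y, f (c *: x + y) = c *: f x + f y.
Definition sym f := forall x y, rdot (f x) y = rdot x (f y).
Definition contr f := forall x, hnorm d (f x) <= hnorm d x.

Definition subsp (G : set H) := G 0 /\ forall c x y, G x -> G y -> G (c *: x + y).
Definition hclosed (G : set H) := forall u x, (forall n, G (u n)) -> hcvg u x -> G x.
Definition hclosure (G : set H) : set H :=
  [set x | forall e : R, 0 < e -> exists2 y, G y & hnorm d (y - x) < e].

Section Lin.
Variables (f : H -> H) (hf : lin f).
Lemma linD x y : f (x + y) = f x + f y.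
Proof. by rewrite -{1}[x]scale1r hf scale1r. Qed.
Lemma lin0 : f 0 = 0.
Proof. by apply: (addrI (f 0)); rewrite -linD !addr0. Qed.
Lemma linZ c x : f (c *: x) = c *: f x.
Proof. by rewrite -[c *: x]addr0 hf lin0 !addr0. Qed.
Lemma linN x : f (- x) = - f x.
Proof. by rewrite -scaleN1r linZ scaleN1r. Qed.
Lemma linB x y : f (x - y) = f x - f y.
Proof. by rewrite linD linN. Qed.
Lemma lin_sum I (r : seq I) (P : pred I) (F : I -> H) :
  f (\sum_(i <- r | P i) F i) = \sum_(i <- r | P i) f (F i).
Proof. by apply: (big_morph f linD lin0). Qed.
End Lin.

Lemma lin_comp f g : lin f -> lin g -> lin (f \o g).
Proof. by move=> hf hg c x y /=; rewrite hg hf. Qed.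
Lemma lin_add f g : lin f -> lin g -> lin (fun x => f x + g x).
Proof. by move=> hf hg c x y /=; rewrite hg hf scalerDr addrACA. Qed.
Lemma lin_scale (c : R[i]) f : lin f -> lin (fun x => c *: f x).
Proof. by move=> hf a x y /=; rewrite hf scalerDr !scalerA mulrC. Qed.
Lemma lin_sub f g : lin f -> lin g -> lin (fun x => f x - g x).
Proof. by move=> hf hg c x y /=; rewrite hg hf scalerBr opprD addrACA. Qed.

Section Subsp.
Variables (G : set H) (hG : subsp G).
Lemma subspD x y : G x -> G y -> G (x + y).
Proof. by move=> ? ?; rewrite -[x]scale1r; apply: hG.2. Qed.
Lemma subspZ c x : G x -> G (c *: x).
Proof. by move=> ?; rewrite -[_ *: x]addr0; apply: hG.2 => //; exact: hG.1. Qed.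
Lemma subspN x : G x -> G (- x).
Proof. by move=> ?; rewrite -scaleN1r; apply: subspZ. Qed.
Lemma subspB x y : G x -> G y -> G (x - y).
Proof. by move=> ? ?; apply: subspD => //; apply: subspN. Qed.
End Subsp.

Hypothesis hd : hilbert.

Lemma rdC x y : rdot x y = rdot y x.
Proof. by rewrite /rdot (ip_conj hd x y); case: (d x y). Qed.
Lemma rdDl x y z : rdot (x + y) z = rdot x z + rdot y z.
Proof. by rewrite /rdot -[x]scale1r (ip_linear hd) mul1r scale1r ReD. Qed.
Lemma rd0l z : rdot 0 z = 0.
Proof. by apply: (addrI (rdot 0 z)); rewrite -rdDl !addr0. Qed.
Lemma d0l z : d 0 z = 0.
Proof.
have := ip_linear hd 0 0 0 z; rewrite scaler0 addr0 mul0r add0r => _.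
apply: (addrI (d 0 z)); rewrite addr0.
by have := ip_linear hd 1 0 0 z; rewrite scaler0 addr0 mul1r => <-.
Qed.
Lemma dZl c x z : d (c *: x) z = c * d x z.
Proof. by rewrite -[c *: x]addr0 (ip_linear hd) d0l addr0. Qed.
Lemma dDl x y z : d (x + y) z = d x z + d y z.
Proof. by rewrite -[x]scale1r (ip_linear hd) mul1r scale1r. Qed.
Lemma dNl x z : d (- x) z = - d x z.
Proof. by rewrite -scaleN1r dZl mulN1r. Qed.
Lemma dBl x y z : d (x - y) z = d x z - d y z.
Proof. by rewrite dDl dNl. Qed.
Lemma dDr x y z : d x (y + z) = d x y + d x z.
Proof. by rewrite (ip_conj hd (y + z)) dDl rmorphD /= -!(ip_conj hd). Qed.
Lemma dZr c x z : d x (c *: z) = c^* * d x z.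
Proof. by rewrite (ip_conj hd (c *: z)) dZl rmorphM /= -!(ip_conj hd). Qed.
Lemma d0r x : d x 0 = 0.
Proof. by rewrite (ip_conj hd 0) d0l rmorph0. Qed.
Lemma d_suml I (r : seq I) (P : pred I) (F : I -> H) z :
  d (\sum_(i <- r | P i) F i) z = \sum_(i <- r | P i) d (F i) z.
Proof. by apply: (big_morph (d^~ z) (fun x y => dDl x y z) (d0l z)). Qed.
Lemma d_sumr I (r : seq I) (P : pred I) (F : I -> H) z :
  d z (\sum_(i <- r | P i) F i) = \sum_(i <- r | P i) d z (F i).
Proof. by apply: (big_morph (d z) (fun x y => dDr z x y) (d0r z)). Qed.

Lemma rdNl x z : rdot (- x) z = - rdot x z.
Proof. by rewrite /rdot dNl ReN. Qed.
Lemma rdBl x y z : rdot (x - y) z = rdot x z - rdot y z.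
Proof. by rewrite rdDl rdNl. Qed.
Lemma rdZl (a : R) x z : rdot (a%:C *: x) z = a * rdot x z.
Proof. by rewrite /rdot dZl ReM /= mul0r subr0. Qed.
Lemma rdDr x y z : rdot x (y + z) = rdot x y + rdot x z.
Proof. by rewrite rdC rdDl !(rdC _ x). Qed.
Lemma rdNr x z : rdot x (- z) = - rdot x z.
Proof. by rewrite rdC rdNl rdC. Qed.
Lemma rdBr x y z : rdot x (y - z) = rdot x y - rdot x z.
Proof. by rewrite rdDr rdNr. Qed.
Lemma rdZr (a : R) x z : rdot x (a%:C *: z) = a * rdot x z.
Proof. by rewrite rdC rdZl rdC. Qed.
Lemma rd0r z : rdot z 0 = 0.
Proof. by rewrite rdC rd0l. Qed.
Definition rdE := (rdDl, rdDr, rdNl, rdNr, rdZl, rdZr, rd0l, rd0r).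

Lemma imd x y : complex.Im (d x y) = rdot x ((0 +i* 1) *: y).
Proof. by rewrite /rdot dZr ReM /= mul0r mulN1r opprK add0r. Qed.
Lemma rd_ext x y : (forall z, rdot x z = rdot y z) -> x = y.
Proof.
move=> h; apply/eqP; rewrite -subr_eq0; apply/eqP/(ip_eq0 hd).
by rewrite -/(rdot _ _) rdBl h subrr.
Qed.
Lemma sym_d f : lin f -> sym f -> forall x y, d (f x) y = d x (f y).
Proof.
move=> hl hs x y; apply: complexP; first exact: hs.
by rewrite !imd -(linZ hl); exact: hs.
Qed.

Lemma rd_ge0 x : 0 <= rdot x x. Proof. exact: ip_ge0 hd x. Qed.
Lemma rd_eq0 x : rdot x x = 0 -> x = 0. Proof. exact: ip_eq0 hd x. Qed.
Lemma dxx x : d x x = (rdot x x)%:C.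
Proof.
apply: complexP => //=; have := ip_conj hd x x.
case: (d x x) => a b /= [] /eqP; rewrite -subr_eq0 opprK -mulr2n mulrn_eq0 /=.
by move/eqP.
Qed.

Lemma hnorm2 x : hnorm d x ^+ 2 = rdot x x.
Proof. by rewrite sqr_sqrtr // rd_ge0. Qed.
Lemma hnorm_ge0 x : 0 <= hnorm d x. Proof. exact: sqrtr_ge0. Qed.
Lemma hnorm0 : hnorm d 0 = 0. Proof. by rewrite /hnorm -/(rdot _ _) rd0l sqrtr0. Qed.
Lemma hnorm_eq0 x : hnorm d x = 0 -> x = 0.
Proof. by move=> h; apply: rd_eq0; rewrite -hnorm2 h expr0n. Qed.
Lemma hnormN x : hnorm d (- x) = hnorm d x.
Proof. by rewrite /hnorm -!/(rdot _ _) rdNl rdNr opprK. Qed.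
Lemma hnormC x y : hnorm d (x - y) = hnorm d (y - x).
Proof. by rewrite -hnormN opprB. Qed.

Lemma cauchy_schwarz x y : `|rdot x y| <= hnorm d x * hnorm d y.
Proof.
rewrite -ler_sqr ?nnegrE ?mulr_ge0 ?hnorm_ge0 // real_normK ?num_real //.
rewrite exprMn !hnorm2.
have [/rd_eq0 ->|yy] := eqVneq (rdot y y) 0; first by rewrite !rdE mulr0 expr0n.
have yy0 : 0 < rdot y y by rewrite lt_def yy rd_ge0.
have := rd_ge0 ((rdot y y)%:C *: x - (rdot x y)%:C *: y).
rewrite !rdE (rdC y x) => h.
have {}h : 0 <= rdot y y * (rdot x x * rdot y y - rdot x y ^+ 2).
  by apply: le_trans h _; rewrite le_eqVlt; apply/orP; left; apply/eqP; ring.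
by rewrite -subr_ge0 -(pmulr_rge0 _ yy0).
Qed.

Lemma rd_le x y : rdot x y <= hnorm d x * hnorm d y.
Proof. exact: le_trans (ler_norm _) (cauchy_schwarz x y). Qed.

Lemma hnormD x y : hnorm d (x + y) <= hnorm d x + hnorm d y.
Proof.
rewrite -ler_sqr ?nnegrE ?addr_ge0 ?hnorm_ge0 // hnorm2 sqrrD !hnorm2 !rdE.
have := rd_le x y; rewrite (rdC y x); lra.
Qed.
Lemma hnormB x y : hnorm d (x - y) <= hnorm d x + hnorm d y.
Proof. by rewrite -(hnormN y); exact: hnormD. Qed.
Lemma hnorm_tri x y z : hnorm d (x - z) <= hnorm d (x - y) + hnorm d (y - z).
Proof. by rewrite (le_trans _ (hnormD _ _)) // addrA subrK. Qed.
Lemma le_hnorm x y : rdot x x <= rdot y y -> hnorm d x <= hnorm d y.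
Proof. exact: ler_wsqrtr. Qed.
Lemma le_hnormP x (a : R) : 0 <= a -> rdot x x <= a ^+ 2 -> hnorm d x <= a.
Proof. by move=> a0; rewrite -hnorm2 ler_sqr // nnegrE hnorm_ge0. Qed.
Lemma rdZZ (c : R[i]) x : rdot (c *: x) (c *: x) = normc2 c * rdot x x.
Proof.
rewrite /rdot dZl dZr dxx /normc2; case: c => a b /=; simpc => /=; ring.
Qed.
Lemma hnormZ (c : R[i]) x : hnorm d (c *: x) = Num.sqrt (normc2 c) * hnorm d x.
Proof. by rewrite /hnorm -!/(rdot _ _) rdZZ sqrtrM // normc2_ge0. Qed.
Lemma hnormZr (a : R) x : hnorm d (a%:C *: x) = `|a| * hnorm d x.
Proof. by rewrite hnormZ /normc2 /= expr0n addr0 sqrtr_sqr. Qed.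
Lemma parallelogram x y : rdot (x + y) (x + y) + rdot (x - y) (x - y) =
  2 * rdot x x + 2 * rdot y y.
Proof. rewrite !rdE; ring. Qed.

Lemma hcvgP u x : hcvg u x <-> forall e : R, 0 < e ->
  exists N, forall n, (N <= n)%N -> hnorm d (u n - x) < e.
Proof.
split=> [/cvgrPdist_lt h e e0|h].
  have [N _ hN] := h e e0; exists N => n Nn.
  by have := hN n Nn; rewrite /= sub0r normrN ger0_norm // hnorm_ge0.
apply/cvgrPdist_lt => e e0; have [N hN] := h e e0.
exists N => // n /= Nn; by rewrite sub0r normrN ger0_norm ?hnorm_ge0 ?hN.
Qed.

Lemma hcvg_le u x (a : nat -> R) : (forall n, hnorm d (u n - x) <= a n) ->
  a n @[n --> \oo] --> (0 : R) -> hcvg u x.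
Proof.
by move=> h ha; apply: cvg0_le ha => n; rewrite ger0_norm ?hnorm_ge0.
Qed.

Lemma hcvg_cst x : hcvg (fun=> x) x.
Proof. by rewrite /hcvg; under eq_fun do rewrite subrr hnorm0; exact: cvg_cst. Qed.
Lemma hcvgD u v x y : hcvg u x -> hcvg v y -> hcvg (fun n => u n + v n) (x + y).
Proof.
move=> hu hv; apply: (@hcvg_le _ _ (fun n => hnorm d (u n - x) + hnorm d (v n - y))).
  by move=> n; rewrite opprD addrACA hnormD.
exact: cvg0D.
Qed.
Lemma hcvgZ c u x : hcvg u x -> hcvg (fun n => c *: u n) (c *: x).
Proof.
move=> hu; rewrite /hcvg; under eq_fun do rewrite -scalerBr hnormZ.
exact: cvg0Z.
Qed.
Lemma hcvgN u x : hcvg u x -> hcvg (fun n => - u n) (- x).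
Proof.
by move=> /(hcvgZ (-1)); rewrite scaleN1r; under [fun n => _ *: _]eq_fun do rewrite scaleN1r.
Qed.
Lemma hcvgB u v x y : hcvg u x -> hcvg v y -> hcvg (fun n => u n - v n) (x - y).
Proof. by move=> hu hv; apply: hcvgD => //; apply: hcvgN. Qed.
Lemma hcvg_unique u x y : hcvg u x -> hcvg u y -> x = y.
Proof.
move=> hx hy; apply/eqP; rewrite -subr_eq0; apply/eqP/hnorm_eq0.
have h := hcvgB hx hy.
have : hnorm d (y - x) @[n --> \oo] --> (0 : R).
  move: h; rewrite /hcvg; under eq_fun do rewrite subrr sub0r opprB.
  by [].
by rewrite hnormC; apply: cvg_real_unique; exact: cvg_cst.
Qed.
Lemma hcvg_rd u v x y : hcvg u x -> hcvg v y ->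
  rdot (u n) (v n) @[n --> \oo] --> rdot x y.
Proof.
move=> hu hv.
have -> : (fun n => rdot (u n) (v n)) = (fun n => rdot (u n - x) (v n - y) +
   rdot (u n - x) y + rdot x (v n - y) + rdot x y).
  by apply/funext => n; rewrite !rdE; ring.
rewrite -[X in _ --> X]add0r -[X in _ --> X + _](addr0 0) -[X in _ --> X + _ + _](addr0 0).
have aux w z b (a : nat -> R) : hcvg w z -> (forall n, `|a n| <= hnorm d (w n - z) * b) ->
  a n @[n --> \oo] --> (0 : R).
  by move=> hw ha; apply: cvg0_le ha _; exact: cvg0Zr.
apply: cvgD; last exact: cvg_cst; apply: cvgD; last first.
  by apply: aux hv _ => n; rewrite mulrC; exact: cauchy_schwarz.
apply: cvgD; last by apply: aux hu _ => n; exact: cauchy_schwarz.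
apply: cvg0_le (fun n => cauchy_schwarz _ _) _.
by rewrite -[X in _ --> X](mulr0 0); apply: cvgM.
Qed.
Lemma hcvg_rdl u x y : hcvg u x -> rdot (u n) y @[n --> \oo] --> rdot x y.
Proof. by move=> h; apply: hcvg_rd => //; exact: hcvg_cst. Qed.
Lemma rd_lim u x y m : hcvg u x -> rdot (u n) y @[n --> \oo] --> m -> rdot x y = m.
Proof. by move=> /hcvg_rdl h; apply: cvg_real_unique. Qed.
Lemma hcvg_norm u x : hcvg u x -> hnorm d (u n) @[n --> \oo] --> hnorm d x.
Proof.
move=> h; apply/cvgrPdist_le => e e0; have /cvgrPdist_le/(_ e e0) := h.
apply: filterS => n; rewrite sub0r normrN ger0_norm ?hnorm_ge0 //; apply: le_trans.
rewrite ler_norml; apply/andP; split.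
  by rewrite lerNl opprB lerBlDr (le_trans _ (hnormD _ _)) // subrK.
by rewrite lerBlDr hnormC (le_trans _ (hnormD _ _)) // subrK.
Qed.
Lemma hcvg_bnd (M : R) f u x : lin f -> (forall y, hnorm d (f y) <= M * hnorm d y) ->
  hcvg u x -> hcvg (fun n => f (u n)) (f x).
Proof.
move=> hf hM hu; apply: (@hcvg_le _ _ (fun n => M * hnorm d (u n - x))).
  by move=> n; rewrite -(linB hf).
exact: cvg0Z.
Qed.
Lemma hcvg_contr f u x : lin f -> contr f ->
  hcvg u x -> hcvg (fun n => f (u n)) (f x).
Proof. by move=> hf hc; apply: (@hcvg_bnd 1) => // y; rewrite mul1r. Qed.
Lemma hcvg_eventually (N : nat) u v x : (forall n, (N <= n)%N -> u n = v n) ->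
  hcvg u x -> hcvg v x.
Proof.
move=> e /hcvgP hu; apply/hcvgP => r r0; have [M hM] := hu r r0; exists (maxn N M) => n.
by rewrite geq_max => /andP[Nn Mn]; rewrite -e //; exact: hM.
Qed.

(** The form in which monotone bounded sequences of projections or of positive operators are shown
    to converge strongly: there the squared increments of [u] are at most increments of a convergent
    numerical sequence. *)
Lemma cauchy_dom u (a : nat -> R) (l : R) : a n @[n --> \oo] --> l ->
  (forall n m, (n <= m)%N -> hnorm d (u m - u n) ^+ 2 <= `|a m - a n|) -> hcauchy u.
Proof.
move=> /cvgrPdist_lt ha h e e0.
have e2 : 0 < e ^+ 2 / 2 by rewrite divr_gt0 // exprn_gt0.
have [N _ hN] := ha _ e2; exists N.
suff aux n m : (N <= n)%N -> (n <= m)%N -> hnorm d (u m - u n) < e.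
  move=> n m Nn Nm; have [nm|/ltnW mn] := leqP n m; last exact: aux.
  by rewrite hnormC; exact: aux.
move=> Nn nm; rewrite -ltr_sqr ?nnegrE ?hnorm_ge0 ?ltW //.
apply: le_lt_trans (h _ _ nm) _; rewrite -(subrKA l) (le_lt_trans (ler_normD _ _)) //.
by rewrite [e ^+ 2]splitr ltrD // ?hN //= distrC hN //= (leq_trans Nn).
Qed.

Lemma cauchy_le u (b : nat -> R) : b n @[n --> \oo] --> (0 : R) ->
  (forall n m, (n <= m)%N -> hnorm d (u m - u n) ^+ 2 <= b n) -> hcauchy u.
Proof.
move=> /cvgrPdist_lt hb h e e0.
have e2 : 0 < e ^+ 2 by rewrite exprn_gt0.
have [N _ hN] := hb _ e2; exists N.
suff aux n m : (N <= n)%N -> (n <= m)%N -> hnorm d (u m - u n) < e.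
  move=> n m Nn Nm; have [nm|/ltnW mn] := leqP n m; last exact: aux.
  by rewrite hnormC; exact: aux.
move=> Nn nm; rewrite -ltr_sqr ?nnegrE ?hnorm_ge0 ?ltW //.
apply: le_lt_trans (h _ _ nm) _; have := hN _ Nn; rewrite /= sub0r normrN.
exact/le_lt_trans/ler_norm.
Qed.

Section Projection.
Variables (G : set H) (hG : subsp G) (cG : hclosed G).

Lemma half_sum x y : (2^-1)%:C *: (x + y) + (2^-1)%:C *: (x - y) = x.
Proof.
rewrite scalerDr scalerBr addrACA subrr addr0 -scalerDl.
suff -> : (2^-1)%:C + (2^-1)%:C = 1 :> R[i] by rewrite scale1r.
by apply: complexP => /=; rewrite ?addr0 //; field.
Qed.

Lemma half_sum0 x : (2^-1)%:C *: (x + x) = x.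
Proof. by have := half_sum x x; rewrite subrr scaler0 addr0. Qed.

Lemma proj_exists x : exists2 y, G y & forall z, G z -> rdot (x - y) z = 0.
Proof.
pose D := [set rdot (x - y) (x - y) | y in G].
have D0 : D !=set0 by exists (rdot (x - 0) (x - 0)); exists 0 => //; exact: hG.1.
have Dlb : has_lbound D by exists 0 => _ [y _ <-]; exact: rd_ge0.
have /choice[u hu] : forall n : nat, exists y, G y /\
    rdot (x - y) (x - y) < inf D + n.+1%:R^-1.
  move=> n; have n0 : (0 : R) < n.+1%:R^-1 by rewrite invr_gt0.
  by have [_ [y Gy <-] hy] := inf_adherent n0 (conj D0 Dlb); exists y.
have lbD y : G y -> inf D <= rdot (x - y) (x - y).
  by move=> Gy; apply: ge_inf => //; exists y.
have Gmid a b : G a -> G b -> G ((2^-1)%:C *: (a + b)).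
  by move=> ? ?; apply: subspZ => //; exact: subspD.
have hc : hcauchy u.
  (* By the parallelogram law the squared distance is at most 2/(n+1) + 2/(m+1), because the
     midpoint of two points of [G] is no closer to [x] than the infimum. *)
  apply: (@cauchy_le u (fun n => 4 * n.+1%:R^-1)); first exact/cvg0Z/cvg_harm.
  move=> n m nm; rewrite hnorm2.
  have /lbD := Gmid _ _ (hu n).1 (hu m).1.
  have -> : x - (2^-1)%:C *: (u n + u m) =
      (2^-1)%:C *: ((x - u n) + (x - u m)).
    by rewrite addrACA -opprD scalerBr half_sum0.
  have := parallelogram (x - u n) (x - u m).
  have -> : x - u n - (x - u m) = u m - u n by rewrite opprB addrC addrA subrK.
  have := (hu n).2; have := (hu m).2; rewrite !rdZl !rdZr.
  have hm : m.+1%:R^-1 <= n.+1%:R^-1 :> R by rewrite lef_pV2 ?posrE // ler_nat.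
  by move: n.+1%:R^-1 m.+1%:R^-1 hm => *; lra.
have [y hy] := ip_complete hd hc.
have Gy : G y by apply: cG hy => n; case: (hu n).
exists y => // z Gz.
have hle (t : R) : inf D <= rdot (x - y - t%:C *: z) (x - y - t%:C *: z).
  by rewrite -addrA -opprD; apply: lbD; apply: subspD => //; exact: subspZ.
have hiy : rdot (x - y) (x - y) <= inf D.
  apply: (@cvg_real_le _ (fun n => rdot (x - u n) (x - u n)) (fun n => inf D + n.+1%:R^-1)).
  - by move=> n; apply/ltW; case: (hu n).
  - by apply: hcvg_rd; apply: hcvgB => //; exact: hcvg_cst.
  - by rewrite -[X in _ --> X]addr0; apply: cvgD; [exact: cvg_cst|exact: cvg_harm].
have {hle hiy} h (t : R) : 0 <= - 2 * t * rdot (x - y) z + t ^+ 2 * rdot z z.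
  have := le_trans hiy (hle t); move: (x - y) => w.
  rewrite rdBl !rdBr !rdZl !rdZr (rdC z).
  by move: (rdot w z) (rdot w w) (rdot z z) => a b c; lra.
have [/rd_eq0 ->|z0] := eqVneq (rdot z z) 0; first exact: rd0r.
(* The minimizer of the quadratic in [t]; there the inequality says that minus a square is
   nonnegative. *)
have := h (rdot (x - y) z / rdot z z).
have -> : - 2 * (rdot (x - y) z / rdot z z) * rdot (x - y) z +
  (rdot (x - y) z / rdot z z) ^+ 2 * rdot z z = - (rdot (x - y) z ^+ 2 / rdot z z) by field.
rewrite oppr_ge0 pmulr_lle0 ?invr_gt0 ?lt_def ?z0 ?rd_ge0 // => h2.
by apply/eqP; rewrite -sqrf_eq0 eq_le h2 sqr_ge0.
Qed.

Definition proj x := s2val (cid2 (proj_exists x)).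
Lemma proj_in x : G (proj x). Proof. exact: s2valP (cid2 (proj_exists x)). Qed.
Lemma proj_orth x z : G z -> rdot (x - proj x) z = 0.
Proof. exact: s2valP' (cid2 (proj_exists x)) z. Qed.
Lemma proj_uniq x y : G y -> (forall z, G z -> rdot (x - y) z = 0) -> proj x = y.
Proof.
move=> Gy hy; apply/eqP; rewrite -subr_eq0; apply/eqP/rd_eq0.
have Gz : G (proj x - y) by apply: subspB => //; exact: proj_in.
rewrite -[X in rdot X _](subrKA x) (addrC (proj x - x)) rdDl hy //.
by rewrite -[proj x - x]opprB rdNl proj_orth // oppr0 addr0.
Qed.
(** [G] is a complex subspace, so vanishing real parts against [G] also kill the imaginary parts,
    through [i z]. *)
Lemma orth_i x : (forall z, G z -> rdot x z = 0) -> forall (c : R[i]) z, G z -> rdot (c *: x) z = 0.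
Proof.
move=> h c z Gz; rewrite /rdot dZl ReM -/(rdot _ _) h // imd h ?mulr0 ?subr0 //.
exact: subspZ.
Qed.
Lemma proj_lin : lin proj.
Proof.
move=> c x y; apply: proj_uniq; first by apply: hG.2; exact: proj_in.
move=> z Gz; rewrite opprD addrACA -scalerBr rdDl proj_orth // addr0.
by apply: orth_i Gz => // ?; exact: proj_orth.
Qed.
Lemma proj_id x : G x -> proj x = x.
Proof. by move=> Gx; apply: proj_uniq => // z _; rewrite subrr rd0l. Qed.
Lemma proj_idem x : proj (proj x) = proj x.
Proof. exact/proj_id/proj_in. Qed.
Lemma proj_sym : sym proj.
Proof.
move=> x y; rewrite -[y in LHS](subrK (proj y)) -[x in RHS](subrK (proj x)).
rewrite rdDr rdDl [rdot (proj x) (y - _)]rdC !proj_orth ?add0r //; exact: proj_in.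
Qed.
Lemma proj_contr : contr proj.
Proof.
move=> x; apply: le_hnorm; rewrite -[x in leRHS](subrK (proj x)).
have h : rdot (x - proj x) (proj x) = 0 by apply: proj_orth; exact: proj_in.
move: (x - proj x) h => a h.
by rewrite rdDl !rdDr h (rdC (proj x) a) h addr0 add0r lerDr rd_ge0.
Qed.
End Projection.

Lemma hclosure_sub (G : set H) : G `<=` hclosure G.
Proof. by move=> x Gx e e0; exists x => //; rewrite subrr hnorm0. Qed.
Lemma hclosureP (G : set H) x : hclosure G x <-> exists u, (forall n, G (u n)) /\ hcvg u x.
Proof.
split=> [h|[u [Gu hu]] e e0].
  have /choice[u hu] : forall n : nat, exists y, G y /\ hnorm d (y - x) < n.+1%:R^-1.
    by move=> n; have [|y ? ?] := h n.+1%:R^-1; [rewrite invr_gt0|exists y].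
  exists u; split; first by move=> n; case: (hu n).
  by apply: hcvg_le cvg_harm => n; apply/ltW; case: (hu n).
by have /hcvgP/(_ e e0)[N hN] := hu; exists (u N) => //; exact: hN.
Qed.
Lemma hclosure_closed (G : set H) : hclosed (hclosure G).
Proof.
move=> u x Gu /hcvgP hu e e0; have e2 : 0 < e / 2 by rewrite divr_gt0.
have [N /(_ N (leqnn _)) hN] := hu _ e2; have [y Gy hy] := Gu N _ e2.
by exists y => //; rewrite (le_lt_trans (hnorm_tri _ (u N) _)) // [e]splitr ltrD.
Qed.
Lemma hclosure_id (G : set H) : hclosed G -> hclosure G = G.
Proof.
move=> cG; apply/seteqP; split; last exact: hclosure_sub.
by move=> x /hclosureP[u [Gu hu]]; exact: cG hu.
Qed.
Lemma hclosure_subsp (G : set H) : subsp G -> subsp (hclosure G).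
Proof.
move=> hG; split=> [|c x y /hclosureP[u [Gu hu]] /hclosureP[v [Gv hv]]].
  by apply: hclosure_sub; exact: hG.1.
apply/hclosureP; exists (fun n => c *: u n + v n); split=> [n|]; first exact: hG.2.
by apply: hcvgD => //; exact: hcvgZ.
Qed.
Lemma hclosure_le (G G' : set H) : G `<=` G' -> hclosed G' -> hclosure G `<=` G'.
Proof. by move=> GG' cG' x /hclosureP[u [Gu hu]]; apply: cG' hu => n; exact: GG'. Qed.
Lemma dense_orth (G : set H) : subsp G ->
  (forall z, (forall y, G y -> rdot z y = 0) -> z = 0) -> forall x, hclosure G x.
Proof.
move=> hG h x; have hG' := hclosure_subsp hG; have cG' := @hclosure_closed G.
suff -> : x = proj hG' cG' x by exact: proj_in.
apply/eqP; rewrite -subr_eq0; apply/eqP/h => y Gy.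
by apply: proj_orth; exact: hclosure_sub.
Qed.
Lemma closed_le_norm f (M : R) : lin f -> (forall x, hnorm d (f x) <= M * hnorm d x) ->
  hclosed [set x | f x = 0].
Proof.
move=> hf hM u x hu /(hcvg_bnd hf hM) h; apply: hcvg_unique h _.
by under eq_fun do rewrite hu; exact: hcvg_cst.
Qed.

End InnerProduct.

(** * Direct sum of two copies of a Hilbert space *)

Section Product.
Context {R : realType} {H : lmodType R[i]} (d : H -> H -> R[i]).
Hypothesis hd : hilbert d.
(** With this inner product the graph of an operator is a subspace of a Hilbert space, so closures,
    resolvents and cores become questions about orthogonal projections. *)
Definition dprod (w w' : H * H) : R[i] := d w.1 w'.1 + d w.2 w'.2.

Lemma rd_prod w w' : rdot dprod w w' = rdot d w.1 w'.1 + rdot d w.2 w'.2.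
Proof. by rewrite /rdot /dprod ReD. Qed.
Lemma hnorm_prod1 w : hnorm d w.1 <= hnorm dprod w.
Proof. by apply: ler_wsqrtr; rewrite -!/(rdot _ _ _) rd_prod lerDl rd_ge0. Qed.
Lemma hnorm_prod2 w : hnorm d w.2 <= hnorm dprod w.
Proof. by apply: ler_wsqrtr; rewrite -!/(rdot _ _ _) rd_prod lerDr rd_ge0. Qed.
Lemma hnorm_prodD w : hnorm dprod w <= hnorm d w.1 + hnorm d w.2.
Proof.
have h := @hnorm_ge0 _ _ d; rewrite -ler_sqr ?nnegrE ?addr_ge0 ?sqrtr_ge0 //.
rewrite sqr_sqrtr -/(rdot _ _ _) rd_prod ?addr_ge0 ?rd_ge0 // -!hnorm2 //.
by rewrite sqrrD lerD2r lerDl mulrn_wge0 // mulr_ge0.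
Qed.
Lemma hilbert_prod : hilbert dprod.
Proof.
split=> [c x y z|x y|x|x|u hu].
- by rewrite /dprod /= !(ip_linear hd); ring.
- by rewrite /dprod rmorphD /= -!(ip_conj hd).
- by rewrite /dprod ReD addr_ge0 //; exact: ip_ge0.
- rewrite /dprod ReD => /eqP; rewrite paddr_eq0 ?(ip_ge0 hd) //.
  by case: x => a b /= /andP[/eqP/(ip_eq0 hd) -> /eqP/(ip_eq0 hd) ->].
- have [|x hx] := ip_complete hd (u := fun n => (u n).1).
    move=> e e0; have [N hN] := hu e e0; exists N => n m Nn Nm.
    exact: le_lt_trans (hnorm_prod1 (u n - u m)) (hN _ _ Nn Nm).
  have [|y hy] := ip_complete hd (u := fun n => (u n).2).
    move=> e e0; have [N hN] := hu e e0; exists N => n m Nn Nm.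
    exact: le_lt_trans (hnorm_prod2 (u n - u m)) (hN _ _ Nn Nm).
  exists (x, y); apply: (@cvg0_le _ _ (fun n => hnorm d ((u n).1 - x) + hnorm d ((u n).2 - y))).
    by move=> n; rewrite ger0_norm ?sqrtr_ge0 //; exact: hnorm_prodD.
  exact: cvg0D.
Qed.
Lemma hcvg_prod u v x y : hcvg d u x -> hcvg d v y ->
  hcvg dprod (fun n => (u n, v n)) (x, y).
Proof.
move=> hu hv; apply: (@cvg0_le _ _ (fun n => hnorm d (u n - x) + hnorm d (v n - y))).
  by move=> n; rewrite ger0_norm ?sqrtr_ge0 //; exact: hnorm_prodD.
exact: cvg0D.
Qed.
Lemma hcvg_fst u x : hcvg dprod u x -> hcvg d (fun n => (u n).1) x.1.
Proof.
by apply: cvg0_le => n; rewrite ger0_norm ?sqrtr_ge0 //; exact: hnorm_prod1 (u n - x).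
Qed.
Lemma hcvg_snd u x : hcvg dprod u x -> hcvg d (fun n => (u n).2) x.2.
Proof.
by apply: cvg0_le => n; rewrite ger0_norm ?sqrtr_ge0 //; exact: hnorm_prod2 (u n - x).
Qed.
Lemma opclosureE (A : op H) : opclosure d A = hclosure dprod A.
Proof.
apply/seteqP; split=> w h e e0.
  have e2 : 0 < e / 2 by rewrite divr_gt0.
  have [x [y [Axy hx hy]]] := h _ e2; exists (x, y) => //.
  by rewrite (le_lt_trans (hnorm_prodD _)) // [e]splitr ltrD.
have [[x y] Axy hxy] := h e e0; exists x, y; split => //.
  exact: le_lt_trans (hnorm_prod1 ((x, y) - w)) hxy.
exact: le_lt_trans (hnorm_prod2 ((x, y) - w)) hxy.
Qed.
End Product.

(** * Bounded Borel functional calculus *)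

Section BoundedBorel.
Context {R : realType}.
Implicit Types (f g : R -> R).

Definition bmeas f := measurable_fun setT f /\ exists M : R, forall t, `|f t| <= M.

Lemma bmeas_cst (c : R) : bmeas (fun=> c).
Proof. by split; [exact: measurable_cst|exists `|c|]. Qed.
Lemma bmeasD f g : bmeas f -> bmeas g -> bmeas (fun t => f t + g t).
Proof.
move=> [mf [M hM]] [mg [N hN]]; split; first exact: measurable_funD.
by exists (M + N) => t; rewrite (le_trans (ler_normD _ _)) // lerD.
Qed.
Lemma bmeasM f g : bmeas f -> bmeas g -> bmeas (fun t => f t * g t).
Proof.
move=> [mf [M hM]] [mg [N hN]]; split; first exact: measurable_funM.
by exists (M * N) => t; rewrite normrM ler_pM.
Qed.
Lemma bmeasZ c f : bmeas f -> bmeas (fun t => c * f t).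
Proof. by move=> ?; apply: bmeasM => //; exact: bmeas_cst. Qed.
Lemma bmeas_indic (B : set R) : measurable B -> bmeas (\1_B : R -> R).
Proof.
move=> mB; split; first exact: measurable_indic.
exists 1 => t; rewrite indicE; case: (_ \in _); rewrite ?normr1 ?normr0 //.
Qed.
Lemma bmeasB f g : bmeas f -> bmeas g -> bmeas (fun t => f t - g t).
Proof.
move=> hf hg; have := bmeasD hf (bmeasZ (-1) hg).
by under eq_fun do rewrite mulN1r.
Qed.

Section Digits.
Variable (f : R -> R).
Hypotheses (mf : measurable_fun setT f) (f01 : forall t, 0 <= f t <= 1).

(** The remainder after [n] binary digits, rescaled by 2^n so that it stays in [0, 1]; the next
    digit is 1 exactly when it is at least 1/2. *)
Fixpoint digit_rem n : R -> R :=
  if n is n.+1 then fun t => 2 * digit_rem n t - \1_(digit_rem n @^-1` `[2^-1, +oo[) t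
  else f.
Definition digit_set n := digit_rem n @^-1` `[2^-1, +oo[.
Definition digit_sum n (t : R) : R := \sum_(k < n) 2^-1 ^+ k.+1 * \1_(digit_set k) t : R.

Lemma digit_rem_meas n : measurable_fun setT (digit_rem n).
Proof.
elim: n => [|n IH] //=; apply: measurable_funB; first exact: measurable_funM.
apply: measurable_indic; rewrite -[X in measurable X]setTI; exact: IH.
Qed.
Lemma digit_set_meas n : measurable (digit_set n).
Proof.
by rewrite -[X in measurable X]setTI; apply: digit_rem_meas.
Qed.
Lemma digit_rem01 n t : 0 <= digit_rem n t <= 1.
Proof.
elim: n => [|n IH] //=; rewrite indicE.
have [/set_mem|/negP h] := boolP (t \in _).
  by rewrite /= in_itv /= andbT /=; move: IH => /= ? ?; lra.
have : ~~ (2^-1 <= digit_rem n t) by apply/negP => h'; apply: h; rewrite inE /= in_itv /= andbT.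
by rewrite -ltNge; move: IH => /= ? ?; lra.
Qed.
Lemma digit_sumE n t : f t = digit_sum n t + 2^-1 ^+ n * digit_rem n t.
Proof.
elim: n => [|n IH]; first by rewrite /digit_sum big_ord0 expr0 add0r mul1r.
rewrite IH /digit_sum big_ord_recr /= -addrA; congr (_ + _).
by rewrite exprS /digit_set; field.
Qed.
End Digits.

(* Binary digits write a bounded function as a uniform limit of simple ones. *)
Lemma bmeas_ind (K : (R -> R) -> Prop) :
  (forall B : set R, measurable B -> K (\1_B : R -> R)) ->
  (forall f g, bmeas f -> bmeas g -> K f -> K g -> K (fun t => f t + g t)) ->
  (forall c f, bmeas f -> K f -> K (fun t => c * f t)) ->
  (forall f (u : nat -> R -> R), bmeas f -> (forall n, bmeas (u n) /\ K (u n)) ->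
     (forall n t, `|f t - u n t| <= 2^-1 ^+ n) -> K f) ->
  forall f, bmeas f -> K f.
Proof.
move=> K1 KD KZ Klim.
have sumP n (c : nat -> R) (B : nat -> set R) : (forall k, measurable (B k)) ->
    let g := fun t => \sum_(k < n) c k * \1_(B k) t in bmeas g /\ K g.
  move=> mB; elim: n => [|n [IH1 IH2]] /=.
    have -> : (fun t => \sum_(k < 0) c k * \1_(B k) t : R) = fun t => 0 * \1_(B 0%N) t.
      by apply/funext => t; rewrite big_ord0 mul0r.
    split; [apply: bmeasZ|apply: KZ; last exact: K1]; exact: bmeas_indic.
  have -> : (fun t => \sum_(k < n.+1) c k * \1_(B k) t : R) =
      fun t => \sum_(k < n) c k * \1_(B k) t + c n * \1_(B n) t.
    by apply/funext => t; rewrite big_ord_recr.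
  have h := bmeas_indic (mB n).
  split; first by apply: bmeasD => //; exact: bmeasZ.
  by apply: KD => //; [exact: bmeasZ|apply: KZ => //; exact: K1].
have K01 f : measurable_fun setT f -> (forall t, 0 <= f t <= 1) -> K f.
  move=> mf f01; apply: (@Klim _ (digit_sum f)).
  - split=> //; exists 1 => t; rewrite ler_norml; have := f01 t; lra.
  - by move=> n; apply: (sumP n (fun k => 2^-1 ^+ k.+1)) => k; exact: digit_set_meas.
  - move=> n t; rewrite {1}(digit_sumE f n t) addrC addKr.
    have /andP[r0 r1] := digit_rem01 f01 n t.
    by rewrite ger0_norm ?mulr_ge0 // ler_piMr.
move=> f [mf [M hM]].
have M0 : 0 <= M by exact: le_trans (normr_ge0 _) (hM 0).
(* An affine change brings the values into [0, 1]; adding 1 keeps the divisor nonzero when the bound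
   [M] is 0. *)
pose N := M + 1; have N0 : 0 < N by rewrite ltr_wpDl.
pose g t := (f t + N) / (2 * N).
have mg : measurable_fun setT g by apply: measurable_funM => //; exact: measurable_funD.
have g01 t : 0 <= g t <= 1.
  have : - N <= f t <= N by rewrite -ler_norml (le_trans (hM t)) // lerDl.
  rewrite /g ler_pdivlMr ?ler_pdivrMr ?mulr_gt0 // mul0r mul1r.
  by move=> /andP[? ?]; apply/andP; split; lra.
have -> : f = fun t => (2 * N) * g t + (- N) * \1_setT t.
  apply/funext => t; rewrite indicE in_setT mulr1 /g.
  by rewrite mulrC divfK ?addrK // mulf_neq0 // gt_eqF.
have bg : bmeas g by split=> //; exists 1 => t; rewrite ler_norml; have := g01 t; lra.
have bT := bmeas_indic (@measurableT _ R).
apply: KD; [exact: bmeasZ|exact: bmeasZ|apply: KZ => //; exact: K01|].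
by apply: KZ => //; exact: K1.
Qed.

End BoundedBorel.

Section SymForms.
Context {R : realType} {H : lmodType R[i]} (d : H -> H -> R[i]) (hd : hilbert d).
Local Notation rd := (rdot d).
Local Notation sym := (sym d).
Local Notation hcvg := (hcvg d).
Implicit Types (f g : H -> H) (x y z : H).

Lemma sym_polar f x y : lin f -> sym f ->
  rd (f x) y = 4^-1 * (rd (f (x + y)) (x + y) - rd (f (x - y)) (x - y)).
Proof.
move=> lf sf; rewrite (linD lf) (linB lf) !rdDl // !rdNl // !rdDr // !rdNr //.
by rewrite (sf y x) (rdC hd y (f x)); field.
Qed.
Lemma sym_ext f g : lin f -> lin g -> sym f -> sym g ->
  (forall x, rd (f x) x = rd (g x) x) -> f =1 g.
Proof.
move=> lf lg sf sg h x; apply: (rd_ext hd) => y.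
by rewrite !(sym_polar x y) // !h.
Qed.
(** For a symmetric map the quadratic form controls the norm: polarization and the parallelogram law
    bound [rd (f x) y] by [M / 2] times the sum of the squared norms of [x] and [y]. *)
Lemma sym_bound f (M : R) : lin f -> sym f ->
  (forall x, `|rd (f x) x| <= M * rd x x) -> forall x, hnorm d (f x) <= M * hnorm d x.
Proof.
move=> lf sf hM x.
have [/(hnorm_eq0 hd) ->|b0] := eqVneq (hnorm d x) 0.
  by rewrite (lin0 lf) (hnorm0 hd) mulr0.
have [->|a0] := eqVneq (hnorm d (f x)) 0.
  have := hM x; rewrite -(hnorm2 hd) => h.
  have xx : 0 < hnorm d x by rewrite lt_def b0 hnorm_ge0.
  rewrite -(pmulr_lge0 _ xx) -mulrA -expr2; exact: le_trans h.
have xp : 0 < hnorm d x by rewrite lt_def b0 hnorm_ge0.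
have fp : 0 < hnorm d (f x) by rewrite lt_def a0 hnorm_ge0.
have key y : rd (f x) y <= M / 2 * (rd x x + rd y y).
  rewrite (sym_polar x y) //.
  have := hM (x + y); have := hM (x - y); rewrite !ler_norml.
  have := parallelogram hd x y.
  move: (rd (f (x + y)) _) (rd (f (x - y)) _) (rd (x + y) _) (rd (x - y) _) => a b c e.
  move=> h /andP[h1 _] /andP[_ h2].
  have : a - b <= M * (c + e) by rewrite mulrDr; lra.
  by rewrite h; nra.
(* The vector parallel to [f x] with the norm of [x] makes the bound optimal. *)
have := key ((hnorm d x / hnorm d (f x))%:C *: f x).
rewrite !(rdZr hd) (rdZl hd) -!(hnorm2 hd).
have -> : hnorm d x / hnorm d (f x) * hnorm d (f x) ^+ 2 = hnorm d x * hnorm d (f x).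
  by field.
have -> : M / 2 * (hnorm d x ^+ 2 + hnorm d x / hnorm d (f x) * (hnorm d x * hnorm d (f x))) = hnorm d x * (M * hnorm d x).
  by field.
by rewrite ler_pM2l.
Qed.
Lemma lin_lim (u : nat -> H -> H) f : (forall n, lin (u n)) ->
  (forall x, hcvg (u^~ x) (f x)) -> lin f.
Proof.
move=> lu hu c x y; apply: (hcvg_unique hd (hu _)).
under eq_fun do rewrite lu.
by apply: hcvgD => //; exact: hcvgZ.
Qed.
Lemma sym_lim (u : nat -> H -> H) f : (forall n, sym (u n)) ->
  (forall x, hcvg (u^~ x) (f x)) -> sym f.
Proof.
move=> su hu x y; apply: (cvg_real_unique (a := fun n => rd (u n x) y)).
  exact: hcvg_rdl.
under eq_fun do rewrite su (rdC hd).
by rewrite (rdC hd); exact: hcvg_rdl.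
Qed.
Lemma contr_lim (u : nat -> H -> H) f : (forall n, contr d (u n)) ->
  (forall x, hcvg (u^~ x) (f x)) -> contr d f.
Proof.
move=> cu hu x; apply: (@cvg_real_le _ (fun n => hnorm d (u n x)) (fun=> hnorm d x)) => //.
- by move=> n; exact: cu.
- exact: (hcvg_norm hd (hu x)).
- exact: cvg_cst.
Qed.
End SymForms.

(** * The calculus of a projection-valued measure for bounded functions *)

Section Pvm.
Context {R : realType} {H : lmodType R[i]} (d : H -> H -> R[i]) (hd : hilbert d).
Variables (E : pvm) (hE : is_pvm d E).
Local Notation rd := (rdot d).
Local Notation sym := (sym d).
Local Notation hcvg := (hcvg d).
Implicit Types (f g : R -> R) (x y z : H) (B C : set R).
Local Notation P := (pvm_proj E).
Local Notation mu := (pvm_meas E).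

Lemma P_lin B : measurable B -> lin (P B).
Proof. by move=> mB; case: hE => /(_ B mB)[]. Qed.
Lemma P_sym B : measurable B -> sym (P B).
Proof. by move=> mB x y; case: hE => /(_ B mB)[_ h] _ _ _; rewrite /rd h. Qed.
Lemma P_I B C x : measurable B -> measurable C -> P (B `&` C) x = P B (P C x).
Proof. by move=> mB mC; case: hE => _ /(_ B C mB mC). Qed.
Lemma P_T x : P setT x = x.
Proof. by case: hE. Qed.
Lemma muE x B : measurable B -> mu x B = (rd (P B x) x)%:E.
Proof. by case: hE => _ _ _ + mB => /(_ x B mB). Qed.
Lemma P_idem B x : measurable B -> P B (P B x) = P B x.
Proof. by move=> mB; rewrite -P_I // setIid. Qed.
Lemma P_comm B C x : measurable B -> measurable C -> P B (P C x) = P C (P B x).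
Proof. by move=> mB mC; rewrite -!P_I // setIC. Qed.
Lemma P_norm B x : measurable B -> rd (P B x) x = rd (P B x) (P B x).
Proof. by move=> mB; rewrite [RHS](P_sym mB) rdC // P_idem // rdC. Qed.
Lemma muT x : mu x setT = (rd x x)%:E.
Proof. by rewrite muE // P_T. Qed.
Lemma mu_lty x : (mu x setT < +oo)%E.
Proof. by rewrite muT ltry. Qed.
Lemma P_0 x : P set0 x = 0.
Proof.
apply: (rd_eq0 hd); rewrite -P_norm //.
by have := @muE x _ measurable0; rewrite measure0 => -[].
Qed.
Lemma P_setU B C x : measurable B -> measurable C -> B `&` C = set0 ->
  P (B `|` C) x = P B x + P C x.
Proof.
move=> mB mC BC; have mBC : measurable (B `|` C) by exact: measurableU.
apply: (sym_ext hd (f := P (B `|` C)) (g := fun x => P B x + P C x)).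
- exact: P_lin.
- by apply: lin_add; exact: P_lin.
- exact: P_sym.
- by move=> y z; rewrite rdDl // rdDr // !P_sym.
- move=> y; rewrite rdDl //; have : mu y (B `|` C) = (mu y B + mu y C)%E by exact: measureU.
  by rewrite !muE // => -[].
Qed.
Lemma P_C B x : measurable B -> P (~` B) x = x - P B x.
Proof.
move=> mB; rewrite -{2}(P_T x) -(setUv B) P_setU //; first by rewrite addrC addKr.
- exact: measurableC.
- exact: setICr.
Qed.
Lemma P_contr B : measurable B -> contr d (P B).
Proof.
move=> mB x; apply: le_hnorm; rewrite -P_norm //.
have := @muT x; have := @muE x _ mB => h1 h2.
by rewrite -lee_fin -h1 -h2 le_measure ?inE.
Qed.
Lemma P_sub B C x : measurable B -> measurable C -> B `<=` C -> P B (P C x) = P B x.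
Proof. by move=> mB mC BC; rewrite -P_I // (_ : B `&` C = B) //; exact/setIidPl. Qed.
(** The squared distance from [x] to its projection is the scalar measure of the complement, so
    continuity from below of that measure gives strong convergence. *)
Lemma P_cvg (B : nat -> set R) x : (forall n, measurable (B n)) ->
  nondecreasing_seq B -> \bigcup_n B n = setT -> hcvg (fun n => P (B n) x) x.
Proof.
move=> mB ndB UB.
have h := nondecreasing_cvg_mu (mu := mu x) mB (bigcup_measurable (fun n _ => mB n)) ndB.
have {h} h : rd (P (B n) x) x @[n --> \oo] --> rd x x.
  have {}h := h; rewrite UB muT in h.
  have -> : (fun n => rd (P (B n) x) x) = fine \o (mu x \o B).
    by apply/funext => n /=; rewrite muE.
  exact: fine_cvg.
have {}h : rd x x - rd (P (B n) x) x @[n --> \oo] --> (0 : R).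
  by rewrite -(subrr (rd x x)); apply: cvgB => //; exact: cvg_cst.
apply/hcvgP => e e0; have e2 : 0 < e ^+ 2 by rewrite exprn_gt0.
have /cvgrPdist_lt/(_ _ e2)[N _ hN] := h; exists N => n Nn.
have := hN n Nn; rewrite /= sub0r normrN => hn.
rewrite -ltr_sqr ?nnegrE ?hnorm_ge0 ?ltW // (hnorm2 hd).
apply: le_lt_trans hn; apply: le_trans (ler_norm _).
rewrite !rdBl // !rdBr // (rdC hd x) -P_norm //; lra.
Qed.

Definition qint x f := Rintegral (mu x) setT f.

Lemma bmeas_integrable x f : bmeas f -> (mu x).-integrable setT (EFin \o f).
Proof.
move=> [mf [M hM]]; apply: measurable_bounded_integrable => //; first exact: mu_lty.
by exists M; split; [exact: num_real|move=> N MN t _ /=; exact: le_trans (hM t) (ltW MN)].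
Qed.
Lemma qintD x f g : bmeas f -> bmeas g -> qint x (fun t => f t + g t) = qint x f + qint x g.
Proof. by move=> hf hg; apply: RintegralD => //; exact: bmeas_integrable. Qed.
Lemma qintZ x c f : bmeas f -> qint x (fun t => c * f t) = c * qint x f.
Proof. by move=> hf; apply: RintegralZl => //; exact: bmeas_integrable. Qed.
Lemma qintB x f g : bmeas f -> bmeas g -> qint x (fun t => f t - g t) = qint x f - qint x g.
Proof. by move=> hf hg; apply: RintegralB => //; exact: bmeas_integrable. Qed.
Lemma qint_indic x B : measurable B -> qint x \1_B = rd (P B x) x.
Proof. by move=> mB; rewrite /qint /Rintegral integral_indic // setIT muE. Qed.
Lemma qint_le x f g : bmeas f -> bmeas g -> (forall t, f t <= g t) -> qint x f <= qint x g.
Proof. by move=> hf hg h; apply: le_Rintegral => //; exact: bmeas_integrable. Qed.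
Lemma qint_cst x (c : R) : qint x (fun=> c) = c * rd x x.
Proof. by rewrite /qint Rintegral_cst // muT. Qed.
Lemma qint_bound x f M : bmeas f -> (forall t, `|f t| <= M) -> `|qint x f| <= M * rd x x.
Proof.
move=> hf hM; rewrite ler_norml -mulNr -!qint_cst.
by rewrite !qint_le //; try exact: bmeas_cst; move=> t; have := hM t; rewrite ler_norml => /andP[].
Qed.

(** Indicators give the projections themselves. In a uniform limit the operators are Cauchy in norm,
    since [sym_bound] turns the estimate of quadratic forms into one of operators. *)
Lemma phi_exists f : bmeas f ->
  exists F : H -> H, [/\ lin F, sym F & forall x, rd (F x) x = qint x f].
Proof.
move: f; apply: bmeas_ind.
- move=> B mB; exists (P B); split; [exact: P_lin|exact: P_sym|].
  by move=> x; rewrite qint_indic.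
- move=> f g hf hg [F [lF sF qF]] [G [lG sG qG]]; exists (fun x => F x + G x); split.
  + exact: lin_add.
  + by move=> x y; rewrite rdDl // rdDr // sF sG.
  + by move=> x; rewrite rdDl // qintD // qF qG.
- move=> c f hf [F [lF sF qF]]; exists (fun x => c%:C *: F x); split.
  + exact: lin_scale.
  + by move=> x y; rewrite rdZl // rdZr // sF.
  + by move=> x; rewrite rdZl // qintZ // qF.
- move=> f u hf hu hfu.
  have /choice[F hF] := fun n => (hu n).2.
  have bd n m x : hnorm d (F m x - F n x) <= (2^-1 ^+ m + 2^-1 ^+ n) * hnorm d x.
    case: (hF n) (hF m) => ln sn qn [lm sm qm].
    apply: (sym_bound hd (f := fun x => F m x - F n x)); first exact: lin_sub.
      by move=> y z; rewrite rdBl // rdBr // sn sm.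
    have bn := (hu n).1; have bm := (hu m).1.
    move=> y; rewrite rdBl // qn qm -qintB //.
    apply: qint_bound; first exact: bmeasB.
    move=> t; rewrite -(subrKA (f t)) (le_trans (ler_normD _ _)) // lerD //.
    by rewrite distrC.
  have e0 : (2^-1 : R) ^+ n @[n --> \oo] --> (0 : R).
    by apply: cvg_expr; rewrite ger0_norm //; lra.
  have /choice[G hG] : forall x, exists y, hcvg (fun n => F n x) y.
    move=> x; apply: (ip_complete hd).
    apply: (cauchy_le hd (b := fun n => (2^-1 ^+ n + 2^-1 ^+ n) ^+ 2 * rd x x)).
      by apply: cvg0Zr; rewrite -[X in _ --> X](expr0n _ 2); apply: cvg_comp (cvg0D e0 e0) (@exprn_continuous _ 2%N _).
    move=> n m nm; rewrite -(hnorm2 hd x) -exprMn ler_sqr ?nnegrE ?hnorm_ge0 //.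
      apply: le_trans (bd n m x) _; rewrite ler_wpM2r ?hnorm_ge0 // lerD2r.
      by rewrite ler_wiXn2l //; lra.
    by rewrite mulr_ge0 ?hnorm_ge0 // addr_ge0 // exprn_ge0.
  exists G; split.
  + by apply: (lin_lim hd _ hG) => n; case: (hF n).
  + by apply: (sym_lim hd _ hG) => n; case: (hF n).
  + move=> x; apply: (cvg_real_unique (a := fun n => rd (F n x) x)).
      exact: hcvg_rdl.
    apply/cvgrPdist_le => e ep.
    have /cvgrPdist_le/(_ _ ep) := cvg0Zr (rd x x) e0.
    apply: filterS => n; rewrite sub0r normrN => h.
    case: (hF n) => _ _ ->; apply: le_trans h; apply: le_trans (ler_norm _).
    have bn := (hu n).1; rewrite -qintB //.
    by apply: qint_bound; [exact: bmeasB|exact: hfu].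
Qed.

(** The bounded operator int f dE, pinned down by its quadratic form ([phi_uniq]). *)
Definition phi f : H -> H :=
  if pselect (bmeas f) is left h then projT1 (cid (phi_exists h)) else fun=> 0.

Lemma phiP f : bmeas f -> [/\ lin (phi f), sym (phi f) & forall x, rd (phi f x) x = qint x f].
Proof. by rewrite /phi; case: pselect => // h _; case: cid. Qed.
Lemma phi_lin f : bmeas f -> lin (phi f). Proof. by move=> /phiP[]. Qed.
Lemma phi_sym f : bmeas f -> sym (phi f). Proof. by move=> /phiP[]. Qed.
Lemma phiE f x : bmeas f -> rd (phi f x) x = qint x f. Proof. by move=> /phiP[]. Qed.
Lemma phi_uniq f F : bmeas f -> lin F -> sym F -> (forall x, rd (F x) x = qint x f) -> phi f =1 F.
Proof.
by move=> hf lF sF qF; apply: (sym_ext hd); [exact: phi_lin| |exact: phi_sym| |] => // x;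
  rewrite phiE.
Qed.
Lemma phi_indic B x : measurable B -> phi \1_B x = P B x.
Proof.
move=> mB; apply: phi_uniq; [exact: bmeas_indic|exact: P_lin|exact: P_sym|].
by move=> y; rewrite qint_indic.
Qed.
Lemma phiD f g x : bmeas f -> bmeas g -> phi (fun t => f t + g t) x = phi f x + phi g x.
Proof.
move=> hf hg; apply: (phi_uniq (F := fun x => phi f x + phi g x)); first exact: bmeasD.
- by apply: lin_add; exact: phi_lin.
- by move=> y z; rewrite rdDl // rdDr // !phi_sym.
- by move=> y; rewrite rdDl // qintD // !phiE.
Qed.
Lemma phiZ c f x : bmeas f -> phi (fun t => c * f t) x = c%:C *: phi f x.
Proof.
move=> hf; apply: (phi_uniq (F := fun x => c%:C *: phi f x)); first exact: bmeasZ.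
- by apply: lin_scale; exact: phi_lin.
- by move=> y z; rewrite rdZl // rdZr // !phi_sym.
- by move=> y; rewrite rdZl // qintZ // !phiE.
Qed.
Lemma phiB f g x : bmeas f -> bmeas g -> phi (fun t => f t - g t) x = phi f x - phi g x.
Proof.
move=> hf hg; rewrite -scaleN1r -[-1](rmorphN1 (real_complex R)) -phiZ // -phiD //; last exact: bmeasZ.
by congr (phi _ _); apply/funext => t; rewrite mulN1r.
Qed.
Lemma phi_bound f M x : bmeas f -> (forall t, `|f t| <= M) -> hnorm d (phi f x) <= M * hnorm d x.
Proof.
move=> hf hM; apply: (sym_bound hd); [exact: phi_lin|exact: phi_sym|].
by move=> y; rewrite phiE // qint_bound.
Qed.
Lemma phi_bnd f : bmeas f -> exists M, forall x, hnorm d (phi f x) <= M * hnorm d x.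
Proof. by move=> hf; have [_ [M hM]] := hf; exists M => x; exact: phi_bound. Qed.
Lemma phi_cvg f (u : nat -> R -> R) x : bmeas f -> (forall n, bmeas (u n)) ->
  (forall n t, `|f t - u n t| <= 2^-1 ^+ n) -> hcvg (fun n => phi (u n) x) (phi f x).
Proof.
move=> hf hu h; apply: (@hcvg_le _ _ d _ _ (fun n => 2^-1 ^+ n * hnorm d x)).
  move=> n; rewrite hnormC // -phiB //; apply: phi_bound => //; exact: bmeasB.
by apply: cvg0Zr; apply: cvg_expr; rewrite ger0_norm //; lra.
Qed.
Lemma bounded_lim F M f (u : nat -> R -> R) x : lin F ->
  (forall y, hnorm d (F y) <= M * hnorm d y) -> bmeas f -> (forall n, bmeas (u n)) ->
  (forall n t, `|f t - u n t| <= 2^-1 ^+ n) -> hcvg (fun n => F (phi (u n) x)) (F (phi f x)).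
Proof. by move=> lF bF hf hu h; exact: (hcvg_bnd lF bF (phi_cvg x hf hu h)). Qed.

Lemma phi_comm F M f x : lin F -> (forall y, hnorm d (F y) <= M * hnorm d y) ->
  (forall B y, measurable B -> F (P B y) = P B (F y)) -> bmeas f ->
  F (phi f x) = phi f (F x).
Proof.
move=> lF bF cF hf; move: f hf x; apply: (bmeas_ind (K := fun f => forall x, F (phi f x) = phi f (F x))).
- by move=> B mB x; rewrite !phi_indic // cF.
- by move=> f g hf hg IHf IHg x; rewrite !phiD // (linD lF) IHf IHg.
- by move=> c f hf IH x; rewrite !phiZ // (linZ lF) IH.
- move=> f u hf hu h x; have bu n := (hu n).1.
  apply: (hcvg_unique hd (bounded_lim x lF bF hf bu h)).
  by under eq_fun do rewrite (hu _).2; exact: phi_cvg.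
Qed.

(** Multiplicativity is obtained by two inductions: here one factor is an indicator and the other
    varies, and [phiM] then varies the first factor. *)
Lemma phi_indicM B g x : measurable B -> bmeas g ->
  phi (fun t => \1_B t * g t) x = P B (phi g x).
Proof.
move=> mB; have bB := bmeas_indic mB; move=> hg; move: g hg x.
apply: (bmeas_ind (K := fun g => forall x, phi (fun t => \1_B t * g t) x = P B (phi g x))).
- move=> C mC x; rewrite phi_indic // -P_I // -phi_indic; last exact: measurableI.
  by rewrite indicI.
- move=> f g hf hg IHf IHg x; rewrite phiD // (linD (P_lin mB)) -IHf -IHg -phiD; try exact: bmeasM.
  by congr (phi _ _); apply/funext => t; rewrite mulrDr.
- move=> c f hf IH x; rewrite phiZ // (linZ (P_lin mB)) -IH -phiZ; last exact: bmeasM.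
  by congr (phi _ _); apply/funext => t; rewrite mulrCA.
- move=> f u hf hu h x; have bu n := (hu n).1.
  have h' : hcvg (fun n => phi (fun t => \1_B t * u n t) x) (phi (fun t => \1_B t * f t) x).
    apply: phi_cvg; [exact: bmeasM|by move=> n; exact: bmeasM|].
    move=> n t; rewrite -mulrBr normrM (le_trans _ (h n t)) // ler_piMl //.
    by rewrite indicE; case: (_ \in _); rewrite ?normr1 ?normr0.
  apply: (hcvg_unique hd h').
  under eq_fun do rewrite (hu _).2.
  apply: (bounded_lim (M := 1) x (P_lin mB)) => // y; rewrite mul1r; exact: P_contr.
Qed.
Lemma phiM f g x : bmeas f -> bmeas g -> phi (fun t => f t * g t) x = phi f (phi g x).
Proof.
move=> hf hg; have [_ [N hN]] := hg; move: f hf x.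
apply: (bmeas_ind (K := fun f => forall x, phi (fun t => f t * g t) x = phi f (phi g x))).
- by move=> B mB x; rewrite phi_indicM // phi_indic.
- move=> f f' hf hf' IHf IHf' x; rewrite phiD // -IHf -IHf' -phiD; try exact: bmeasM.
  by congr (phi _ _); apply/funext => t; rewrite mulrDl.
- move=> c f hf IH x; rewrite phiZ // -IH -phiZ; last exact: bmeasM.
  by congr (phi _ _); apply/funext => t; rewrite mulrA.
- move=> f u hf hu h x; have bu n := (hu n).1.
  apply: (hcvg_unique hd _ (phi_cvg (phi g x) hf bu h)).
  under eq_fun do rewrite -(hu _).2.
  apply: (@hcvg_le _ _ d _ _ (fun n => (2^-1 ^+ n * N) * hnorm d x)).
    move=> n; rewrite hnormC // -phiB; try exact: bmeasM.
    apply: phi_bound; first by apply: bmeasB; exact: bmeasM.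
    by move=> t; rewrite -mulrBl normrM ler_pM.
  by apply: cvg0Zr; apply: cvg0Zr; apply: cvg_expr; rewrite ger0_norm //; lra.
Qed.
Lemma phi_P f B x : bmeas f -> measurable B -> phi f (P B x) = P B (phi f x).
Proof.
move=> hf mB; rewrite -(phi_indic _ mB) -phi_indicM // -phiM //; last exact: bmeas_indic.
by congr (phi _ _); apply/funext => t; rewrite mulrC.
Qed.
Lemma phi_norm f x : bmeas f -> rd (phi f x) (phi f x) = qint x (fun t => f t ^+ 2).
Proof.
move=> hf; rewrite [LHS]phi_sym // rdC // -phiM // phiE //.
by apply: bmeasM.
Qed.

End Pvm.

(** * Unbounded spectral integrals *)

Section PvmIntegral.
Context {R : realType} {H : lmodType R[i]} (d : H -> H -> R[i]) (hd : hilbert d).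
Variables (E : pvm) (hE : is_pvm d E).
Local Notation rd := (rdot d).
Local Notation hcvg := (hcvg d).
Implicit Types (f g : R -> R) (x y z : H) (C : set R) (B : nat -> set R).
Local Notation P := (pvm_proj E).
Local Notation mu := (pvm_meas E).
Local Notation phi := (phi hd hE).
Local Notation qint := (qint E).

(** An unbounded integral is studied through truncations: where [f] is bounded on [C], the truncated
    function falls under the bounded calculus. *)
Definition cutf f C := fun t => \1_C t * f t : R.
Definition bdon f C := exists M, forall t, C t -> `|f t| <= M.
Definition exhaust B := [/\ forall n, measurable (B n), nondecreasing_seq B & \bigcup_n B n = setT].
Definition lev f (n : nat) : set R := f @^-1` `[- n%:R, n%:R].

Lemma cutfM f C t : C t -> cutf f C t = f t.
Proof. by move=> Ct; rewrite /cutf indicE mem_set // mul1r. Qed.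
Lemma cutfN f C t : ~ C t -> cutf f C t = 0.
Proof. by move=> Ct; rewrite /cutf indicE memNset // mul0r. Qed.
Lemma cutf_meas f C : measurable_fun setT f -> measurable C -> measurable_fun setT (cutf f C).
Proof. by move=> mf mC; apply: measurable_funM => //; exact: measurable_indic. Qed.
Lemma bmeas_cut f C : measurable_fun setT f -> measurable C -> bdon f C -> bmeas (cutf f C).
Proof.
move=> mf mC [M hM]; split; first exact: cutf_meas.
exists `|M| => t; have [Ct|Ct] := pselect (C t).
  by rewrite cutfM // (le_trans (hM t Ct)) // ler_norm.
by rewrite cutfN // normr0.
Qed.
Lemma lev_bd f n : bdon f (lev f n).
Proof. by exists n%:R => t; rewrite /lev /= in_itv /= ler_norml. Qed.
Lemma lev_meas f n : measurable_fun setT f -> measurable (lev f n).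
Proof. by move=> mf; rewrite -[X in measurable X]setTI; apply: mf. Qed.
Lemma lev_exhaust f : measurable_fun setT f -> exhaust (lev f).
Proof.
move=> mf; split; first by move=> n; exact: lev_meas.
  move=> n m nm; apply/subsetPset => t; rewrite /lev /= !in_itv /= -!ler_norml => h.
  by rewrite (le_trans h) // ler_nat.
apply/seteqP; split => // t _; have [n hn] : exists n : nat, `|f t| <= n%:R.
  by exists (Num.truncn `|f t|).+1; rewrite ltW // truncnS_gt.
by exists n => //; rewrite /lev /= in_itv /= -ler_norml.
Qed.
Lemma exhaustI B B' : exhaust B -> exhaust B' -> exhaust (fun n => B n `&` B' n).
Proof.
move=> [mB nB UB] [mB' nB' UB']; split; first by move=> n; exact: measurableI.
  move=> n m nm; apply/subsetPset.
  by apply: setISS; apply/subsetPset; [exact: nB|exact: nB'].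
apply/seteqP; split => // t _.
have : (\bigcup_n B n) t by rewrite UB.
have : (\bigcup_n B' n) t by rewrite UB'.
move=> [n _ hn] [m _ hm]; exists (maxn n m) => //; split.
  by move: t hm {hn}; apply/subsetPset/nB; exact: leq_maxr.
by move: t hn {hm}; apply/subsetPset/nB'; exact: leq_maxl.
Qed.
Lemma exhaust_near B t : exhaust B -> \forall n \near \oo, B n t.
Proof.
move=> [_ nB UB]; have : (\bigcup_n B n) t by rewrite UB.
by move=> [N _ hN]; exists N => // n /= Nn; move: t hN; apply/subsetPset/nB.
Qed.
Lemma cutf_cvg f B t : exhaust B -> cutf f (B n) t @[n --> \oo] --> f t.
Proof.
move=> hB; apply: cvg_near_cst; apply: filterS (exhaust_near t hB) => n; exact: cutfM.
Qed.
Lemma exhaust_P B x : exhaust B -> hcvg (fun n => P (B n) x) x.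
Proof. by move=> [mB nB UB]; exact: P_cvg. Qed.

Lemma cut_mono x g B : (forall t, 0 <= g t) -> measurable_fun setT g -> exhaust B ->
  (\int[mu x]_(t in setT) (cutf g (B n) t)%:E)%E @[n --> \oo] -->
  (\int[mu x]_(t in setT) (g t)%:E)%E.
Proof.
move=> g0 mg hB; have [mB nB UB] := hB.
have -> : (\int[mu x]_(t in setT) (g t)%:E)%E =
    (\int[mu x]_(t in setT) (limn (fun n => (cutf g (B n) t)%:E)))%E.
  apply: eq_integral => t _; apply/esym/cvg_lim => //.
  by apply/cvg_EFin; [near=> n|exact: cutf_cvg].
apply: cvg_monotone_convergence => //.
- by move=> n; apply/measurable_EFinP; exact: cutf_meas.
- by move=> n t _; rewrite lee_fin /cutf mulr_ge0.
- move=> t _ n m nm; rewrite lee_fin; have [Bt|Bt] := pselect (B n t).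
    rewrite !cutfM //; move: t Bt; exact/subsetPset/nB.
  by rewrite (cutfN _ Bt) /cutf mulr_ge0.
Unshelve. all: by end_near. Qed.

Section OneFunction.
Variables (f : R -> R) (mf : measurable_fun setT f).

Lemma mf2 : measurable_fun setT (fun t => f t ^+ 2).
Proof. exact: measurable_funX. Qed.

Lemma cut_sqr C : (fun t => cutf f C t ^+ 2) = cutf (fun t => f t ^+ 2) C.
Proof.
by apply/funext => t; rewrite /cutf exprMn; congr (_ * _); rewrite indicE; case: (_ \in _);
  rewrite ?expr1n ?expr0n.
Qed.
Lemma phi_cut_norm C x : measurable C -> bdon f C ->
  (rd (phi (cutf f C) x) (phi (cutf f C) x))%:E =
  (\int[mu x]_(t in setT) (cutf (fun t => f t ^+ 2) C t)%:E)%E.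
Proof.
move=> mC bC; have bf := bmeas_cut mf mC bC; rewrite phi_norm // cut_sqr /qint /Rintegral fineK //.
apply: integrable_fin_num => //; apply: (bmeas_integrable hE).
by rewrite -cut_sqr; exact: bmeasM.
Qed.

Lemma pvm_domP B x : exhaust B -> (forall n, bdon f (B n)) ->
  pvm_dom E f x <-> exists M, forall n, rd (phi (cutf f (B n)) x) (phi (cutf f (B n)) x) <= M.
Proof.
move=> hB bB; have [mB nB UB] := hB.
have h := @cut_mono x _ B (fun t => sqr_ge0 (f t)) mf2 hB.
split=> [hx|[M hM]].
  exists (fine (\int[mu x]_(t in setT) (f t ^+ 2)%:E)%E) => n.
  rewrite -lee_fin phi_cut_norm // fineK; last first.
    rewrite ge0_fin_numE //; apply: integral_ge0 => t _; rewrite lee_fin; exact: sqr_ge0.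
  apply: ge0_le_integral => //.
  - by move=> t _; rewrite lee_fin /cutf mulr_ge0 ?sqr_ge0.
  - by apply/measurable_EFinP; apply: cutf_meas => //; exact: mf2.
  - by apply/measurable_EFinP; exact: mf2.
  - move=> t _; rewrite lee_fin /cutf; apply: ler_piMl; first exact: sqr_ge0.
    by rewrite indicE; case: (_ \in _).
apply: (@le_lt_trans _ _ M%:E); last exact: ltry.
apply: (cvge_le _ h); near=> n; rewrite -phi_cut_norm // lee_fin; exact: hM.
Unshelve. all: by end_near. Qed.

Let L := lev f.
Let hL : exhaust L := lev_exhaust mf.
Let bL n : bdon f (L n) := lev_bd f n.

Lemma cut_comp C C' x : measurable C -> measurable C' -> bdon f C' -> C `<=` C' ->
  P C (phi (cutf f C') x) = phi (cutf f C) x.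
Proof.
move=> mC mC' bC' CC'; rewrite -phi_indicM //; last exact: bmeas_cut.
congr (phi _ _); apply/funext => t; have [Ct|Ct] := pselect (C t).
  by rewrite indicE mem_set // mul1r (cutfM f Ct) (cutfM f (CC' t Ct)).
by rewrite [RHS]cutfN // indicE memNset // mul0r.
Qed.
Lemma phi_cutP C x : measurable C -> bdon f C -> phi (cutf f C) (P C x) = phi (cutf f C) x.
Proof.
move=> mC bC; have bf := bmeas_cut mf mC bC; rewrite phi_P // cut_comp //.
Qed.

Lemma pvm_dom_lin c x z : pvm_dom E f x -> pvm_dom E f z -> pvm_dom E f (c *: x + z).
Proof.
move=> /(pvm_domP x hL bL)[M hM] /(pvm_domP z hL bL)[N hN]; apply/(pvm_domP _ hL bL).
exists ((Num.sqrt (normc2 c) * Num.sqrt M + Num.sqrt N) ^+ 2) => n.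
have bf := bmeas_cut mf (lev_meas n mf) (bL n).
rewrite (phi_lin hd hE bf) -(hnorm2 hd) ler_sqr ?nnegrE ?hnorm_ge0 //.
  rewrite (le_trans (hnormD hd _ _)) // lerD //.
    by rewrite (hnormZ hd) ler_wpM2l ?sqrtr_ge0 // ler_wsqrtr //; exact: hM.
  by rewrite ler_wsqrtr //; exact: hN.
Qed.
Lemma pvm_dom_P C x : measurable C -> bdon f C -> pvm_dom E f (P C x).
Proof.
move=> mC bC; apply/(pvm_domP _ hL bL); have bf := bmeas_cut mf mC bC.
have [M hM] := phi_bnd hd hE bf; exists ((M * hnorm d x) ^+ 2) => n.
have bfn := bmeas_cut mf (lev_meas n mf) (bL n).
have -> : phi (cutf f (L n)) (P C x) = P (L n) (phi (cutf f C) x).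
  rewrite -!(phi_indicM hd hE) //; try exact: lev_meas.
  rewrite -(phi_indic hd hE _ mC) -phiM //; last exact: bmeas_indic.
  by congr (phi _ _); apply/funext => t; rewrite /cutf; ring.
rewrite -(hnorm2 hd) ler_sqr ?nnegrE ?hnorm_ge0 //.
  apply: le_trans (P_contr hd hE _ _) (hM x); exact: lev_meas.
exact: le_trans (hnorm_ge0 _ _) (hM x).
Qed.

Lemma dom_integrable x : pvm_dom E f x -> (mu x).-integrable setT (EFin \o f).
Proof.
(* The scalar measures are finite, so 1 + f^2 is an integrable majorant of |f|. *)
move=> hx; apply: (@le_integrable _ _ R (mu x) setT measurableT (EFin \o f) (EFin \o (fun t => 1 + f t ^+ 2))).
- exact/measurable_EFinP.
- move=> t _ /=; rewrite lee_fin [leRHS]ger0_norm ?addr_ge0 ?sqr_ge0 //.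
  rewrite ler_norml; have := sqr_ge0 (f t - 1); have := sqr_ge0 (f t + 1).
  by rewrite sqrrB sqrrD; move=> *; apply/andP; split; lra.
- have -> : EFin \o (fun t => 1 + f t ^+ 2) = ((EFin \o cst 1%R) \+ (EFin \o (fun t => f t ^+ 2)%R))%E.
    by [].
  apply: integrableD => //.
    by apply: (bmeas_integrable hE); exact: bmeas_cst.
  apply/integrableP; split; first by apply/measurable_EFinP; exact: mf2.
  apply: le_lt_trans hx; rewrite le_eqVlt; apply/orP; left; apply/eqP.
  by apply: eq_integral => t _ /=; rewrite ger0_norm // sqr_ge0.
Qed.

Lemma qint_cut_cvg B x : pvm_dom E f x -> exhaust B ->
  qint x (cutf f (B n)) @[n --> \oo] --> qint x f.
Proof.
move=> hx hB; have [mB _ _] := hB; have fi := dom_integrable hx.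
have [|||||_ _] := @dominated_convergence _ _ _ (mu x) setT measurableT
  (fun n => EFin \o cutf f (B n)) (EFin \o f) (EFin \o (fun t => `|f t|)).
- by move=> n; apply/measurable_EFinP; exact: cutf_meas.
- exact/measurable_EFinP.
- by apply: aeW => t _; apply/cvg_EFin; [near=> n|exact: cutf_cvg].
- exact: integrable_norm.
- apply: aeW => t n _; rewrite lee_fin /cutf normrM ler_piMl // indicE.
  by case: (_ \in _); rewrite ?normr1 ?normr0.
- move=> h; have hf := integrable_fin_num measurableT fi.
  by rewrite -(fineK hf) in h; exact: (fine_cvg h).
Unshelve. all: by end_near. Qed.

Definition qpolar x z := 4^-1 * (qint (x + z) f - qint (x - z) f).
(** The right side in the definition of [pvm_integral]; [cpolarE] splits it into two real
    polarizations. *)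
Definition cpolar x z : R[i] := 4%:R^-1 * \sum_(k < 4) (0 +i* 1) ^+ k *
   (Rintegral (mu (x + (0 +i* 1) ^+ k *: z)) setT f)%:C.

Lemma cpolarE x z : cpolar x z = qpolar x z +i* qpolar x ((0 +i* 1) *: z).
Proof.
have i2 : (0 +i* 1) ^+ 2 = -1 :> R[i] by rewrite expr2; simpc.
have i3 : (0 +i* 1) ^+ 3 = - (0 +i* 1) :> R[i] by rewrite exprS i2 mulrN1.
rewrite /cpolar !big_ord_recl big_ord0 /= /bump /= !add1n expr0 expr1 i2 i3.
rewrite !scale1r scaleN1r scaleNr addr0 /qpolar -/(qint _ _) -!/(qint _ _).
have -> : 4%:R^-1 = (4^-1)%:C :> R[i] by rewrite fmorphV rmorph_nat.
by rewrite -!/(qint _ _); simpc; apply: complexP => /=; ring.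
Qed.

Lemma rd_cut_cvg B x z : pvm_dom E f x -> pvm_dom E f z -> exhaust B ->
  (forall n, bdon f (B n)) -> rd (phi (cutf f (B n)) x) z @[n --> \oo] --> qpolar x z.
Proof.
move=> hx hz hB bB; have [mB _ _] := hB.
have e n : rd (phi (cutf f (B n)) x) z =
    4^-1 * (qint (x + z) (cutf f (B n)) - qint (x - z) (cutf f (B n))).
  have bf := bmeas_cut mf (mB n) (bB n).
  by rewrite (sym_polar hd x z (phi_lin hd hE bf) (phi_sym hd hE bf)) !phiE.
under eq_fun do rewrite e.
apply: cvgMr; apply: cvgB; apply: qint_cut_cvg => //.
  by rewrite -[x]scale1r; exact: pvm_dom_lin.
by rewrite addrC -scaleN1r; exact: pvm_dom_lin.
Qed.

(** Replaces the weak definition by a local one, an equation of bounded operators on every level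
    set. For the converse, the norm of the second component bounds all truncations, which gives the
    domain, and the polarized form is their limit. *)
Lemma pvm_integral_levP w : pvm_integral d E f w <->
  forall n, P (L n) w.2 = phi (cutf f (L n)) w.1.
Proof.
case: w => x b; have mL n : measurable (L n) by exact: lev_meas.
split=> [[/= hx hb] n|h /=].
  apply: (rd_ext hd) => y; rewrite (P_sym hE (mL n)).
  have hz : pvm_dom E f (P (L n) y) by exact: pvm_dom_P.
  have -> : rd b (P (L n) y) = qpolar x (P (L n) y).
    by rewrite /rd hb // -/(cpolar _ _) cpolarE.
  apply/esym/(cvg_real_unique _ (rd_cut_cvg hx hz hL bL)).
  apply: cvg_near_cst; exists n => // m /= nm.
  rewrite -(P_sym hE (mL n)) cut_comp //.
  by apply/subsetPset; case: hL => _ + _; apply.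
have hx : pvm_dom E f x.
  apply/(pvm_domP x hL bL); exists (rd b b) => n; rewrite -h /=.
  by rewrite -!(hnorm2 hd) ler_sqr ?nnegrE ?hnorm_ge0 //; exact: (P_contr hd hE (mL n)).
split=> //= z hz; rewrite -/(cpolar _ _) cpolarE; apply: complexP => /=.
  apply: (rd_lim hd (exhaust_P b hL)).
  under eq_fun do rewrite h; exact: rd_cut_cvg.
have hiz : pvm_dom E f ((0 +i* 1) *: z).
  rewrite -[_ *: z]addr0; apply: pvm_dom_lin => //.
  by rewrite -(lin0 (P_lin hE measurable0)); apply: pvm_dom_P => //; exists 0.
rewrite (imd hd); apply: (rd_lim hd (exhaust_P b hL)).
by under eq_fun do rewrite h; exact: rd_cut_cvg.
Qed.

Lemma pvm_integral_loc w C : pvm_integral d E f w -> measurable C -> bdon f C ->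
  P C w.2 = phi (cutf f C) w.1.
Proof.
move=> /pvm_integral_levP h mC [M hM].
have [n hn] : exists n : nat, M <= n%:R.
  by exists (Num.truncn M).+1; rewrite ltW // truncnS_gt.
have CL : C `<=` L n.
  by move=> t Ct; rewrite /L /lev /= in_itv /= -ler_norml (le_trans (hM t Ct)).
have mL := lev_meas n mf.
by rewrite -(P_sub hE _ mC mL CL) h cut_comp.
Qed.

(** Level sets of [f] may be replaced by any exhausting sequence on which [f] is bounded, as is
    needed when several functions are truncated at once. *)
Lemma pvm_integral_exh B w : exhaust B -> (forall n, bdon f (B n)) ->
  (forall n, P (B n) w.2 = phi (cutf f (B n)) w.1) -> pvm_integral d E f w.
Proof.
move=> hB bB h; have [mB _ _] := hB; apply/pvm_integral_levP => n.
have mL := lev_meas n mf; have bfL := bmeas_cut mf mL (bL n).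
apply: (hcvg_unique hd (exhaust_P _ hB)).
have -> : (fun k => P (B k) (P (L n) w.2)) = fun k => P (B k) (phi (cutf f (L n)) w.1).
  apply/funext => k; have bfB := bmeas_cut mf (mB k) (bB k).
  rewrite (P_comm hE _ (mB k) mL) h -!(phi_indicM hd hE) //.
  by congr (phi _ _); apply/funext => t; rewrite /cutf; ring.
exact: exhaust_P.
Qed.

Lemma pvm_integral_cvg B w : pvm_integral d E f w -> exhaust B -> (forall n, bdon f (B n)) ->
  hcvg (fun n => phi (cutf f (B n)) w.1) w.2.
Proof.
move=> hw hB bB; have [mB _ _] := hB.
rewrite (_ : (fun n => _) = fun n => P (B n) w.2); first exact: exhaust_P.
by apply/funext => n; rewrite (pvm_integral_loc hw).
Qed.

(** The increments of the truncations are orthogonal to the earlier ones, so their squared norms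
    telescope and bounded truncations converge. *)
Lemma pvm_integral_dom x : pvm_dom E f x -> exists b, pvm_integral d E f (x, b).
Proof.
move=> /(pvm_domP x hL bL)[M hM]; have mL n : measurable (L n) by exact: lev_meas.
pose u n := phi (cutf f (L n)) x; pose a n := rd (u n) (u n).
have sub n m : (n <= m)%N -> P (L n) (u m) = u n.
  by move=> nm; apply: cut_comp => //; apply/subsetPset; case: hL => _ + _; apply.
have ortho n m : (n <= m)%N -> hnorm d (u m - u n) ^+ 2 = a m - a n.
  move=> nm; rewrite (hnorm2 hd) -(sub n m nm) !rdBl // !rdBr // (rdC hd (u m) (P _ _)).
  by rewrite -(P_norm hd hE) // (sub n m nm) /a -(sub n m nm) -(P_norm hd hE) //; ring.
have nda : nondecreasing_seq a.
  by move=> n m nm; rewrite -subr_ge0 -ortho // sqr_ge0.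
have ca : cvgn a.
  by apply: nondecreasing_is_cvgn => //; exists M => _ [n _ <-]; exact: hM.
have [|b hb] := ip_complete hd (u := u).
  by apply: (cauchy_dom hd ca) => n m nm; rewrite ortho // ler_norm.
exists b; apply/pvm_integral_levP => n /=.
have := hcvg_contr (P_lin hE (mL n)) (P_contr hd hE (mL n)) hb.
move=> h; apply: (hcvg_unique hd h).
apply: (@cvg_near_cst _ _ _ _ _ _); exists n => // m /= nm.
by rewrite (sub n m nm) subrr (hnorm0 hd).
Qed.

Lemma pvm_integral_lin : linear_op (pvm_integral d E f).
Proof.
have mL n : measurable (L n) by exact: lev_meas.
have bf n := bmeas_cut mf (mL n) (bL n).
split=> [|c x y x' y' h h'|y h].
- apply/pvm_integral_levP => n /=.
  by rewrite (lin0 (P_lin hE (mL n))) (lin0 (phi_lin hd hE (bf n))).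
- apply/pvm_integral_levP => n /=; rewrite (P_lin hE (mL n)) (phi_lin hd hE (bf n)).
  by congr (_ *: _ + _); [exact: (pvm_integral_levP _).1 h n|exact: (pvm_integral_levP _).1 h' n].
- apply: (hcvg_unique hd (exhaust_P y hL)).
  under eq_fun do rewrite ((pvm_integral_levP _).1 h _) /= (lin0 (phi_lin hd hE (bf _))).
  exact: hcvg_cst.
Qed.

Lemma pvm_integral_fun x b b' : pvm_integral d E f (x, b) -> pvm_integral d E f (x, b') -> b = b'.
Proof.
move=> h h'; have [_ hl hu] := pvm_integral_lin.
apply/eqP; rewrite -subr_eq0; apply/eqP/hu.
have := hl (-1) _ _ _ _ h' h; rewrite !scaleN1r addNr addrC; exact.
Qed.

Lemma pvm_integral_adj : adj d (pvm_integral d E f) = pvm_integral d E f.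
Proof.
have mL n : measurable (L n) by exact: lev_meas.
have bf n := bmeas_cut mf (mL n) (bL n).
apply/seteqP; split=> [[x b] h|[x b] h].
  apply/pvm_integral_levP => n /=; apply: (rd_ext hd) => y.
  rewrite (P_sym hE) // (phi_sym hd hE) //.
  (* Vectors localized to a level set lie in the domain; testing the adjoint relation on them is
     enough. *)
  have hy : pvm_integral d E f (P (L n) y, phi (cutf f (L n)) y).
    apply/pvm_integral_levP => m /=.
    rewrite -[in RHS](phi_indic hd hE _ (mL n)) -phiM //; last exact: bmeas_indic.
    rewrite -phi_indicM //; congr (phi _ _); apply/funext => t.
    by rewrite /cutf; ring.
  by have := h _ _ hy; rewrite /= => /(congr1 (@complex.Re R)); rewrite -!/(rd _ _) !(rdC hd x) (rdC hd b).
move=> y c hyc /=.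
have h1 := pvm_integral_cvg h hL bL; have h2 := pvm_integral_cvg hyc hL bL.
have r z : pvm_integral d E f (y, z) -> rd z x = rd y b.
  move=> hz; have h3 := pvm_integral_cvg hz hL bL.
  apply: (rd_lim hd h3).
  under eq_fun do rewrite /= (phi_sym hd hE) // (rdC hd).
  by rewrite (rdC hd); exact: hcvg_rdl.
apply: complexP; first exact: r.
have hib : hcvg (fun n => (0 +i* 1) *: phi (cutf f (L n)) x) ((0 +i* 1) *: b) by exact: hcvgZ.
rewrite !(imd hd); apply: (rd_lim hd h2).
under eq_fun do rewrite /= (phi_sym hd hE) // (linZ (phi_lin hd hE (bf _))) (rdC hd).
by rewrite (rdC hd); exact: hcvg_rdl.
Qed.

End OneFunction.
End PvmIntegral.

(** The power -1 is the inverse for nonnegative bases only, hence the detour through the square; the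
    value 0 at a zero of [f] comes out right. *)
Lemma measurable_funVr {R : realType} (f : R -> R) :
  measurable_fun setT f -> measurable_fun setT (fun t => (f t)^-1).
Proof.
move=> mf; have -> : (fun t => (f t)^-1) = fun t => f t * (f t ^+ 2) `^ (-1).
  apply/funext => t; rewrite powR_inv1 ?sqr_ge0 //.
  by have [->|n0] := eqVneq (f t) 0; rewrite ?invr0 ?mul0r //; field.
apply: measurable_funM => //.
exact: (measurableT_comp (@measurable_powR R (-1)) (measurable_funX 2 mf)).
Qed.

(** * Products, images and uniqueness of spectral integrals *)

Section PvmAlgebra.
Context {R : realType} {H : lmodType R[i]} (d : H -> H -> R[i]) (hd : hilbert d).
Local Notation rd := (rdot d).
Local Notation hcvg := (hcvg d).
Implicit Types (f g : R -> R) (x y z : H) (C : set R) (B : nat -> set R).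

Lemma pvm_comp (E : pvm) (hE : is_pvm d E) f g w :
  measurable_fun setT f -> measurable_fun setT g ->
  opcomp (pvm_integral d E f) (pvm_integral d E g) w <->
  pvm_dom E g w.1 /\ pvm_integral d E (fun t => f t * g t) w.
Proof.
move=> mf mg; case: w => x c.
(* Both factors are bounded on [B n], so the question reduces to products in the bounded
   calculus. *)
pose B n := lev f n `&` lev g n.
have hB : exhaust B by apply: exhaustI; exact: lev_exhaust.
have [mB _ _] := hB.
have bdf n : bdon f (B n) by have [M hM] := lev_bd f n; exists M => t [/hM].
have bdg n : bdon g (B n) by have [M hM] := lev_bd g n; exists M => t [_ /hM].
have mfg : measurable_fun setT (fun t => f t * g t) by exact: measurable_funM.
have bdfg n : bdon (fun t => f t * g t) (B n).
  have [M hM] := bdf n; have [N hN] := bdg n; exists (M * N) => t Bt.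
  by rewrite normrM ler_pM //; [exact: hM|exact: hN].
have bf n := bmeas_cut mf (mB n) (bdf n); have bg n := bmeas_cut mg (mB n) (bdg n).
have key n y : phi hd hE (cutf (fun t => f t * g t) (B n)) y =
    phi hd hE (cutf f (B n)) (phi hd hE (cutf g (B n)) y).
  rewrite -phiM //; congr (phi _ _ _); apply/funext => t; rewrite /cutf indicE.
  by case: (_ \in _); rewrite ?mul1r ?mul0r.
split=> [[b /= [hg hf]]|[/= /(pvm_integral_dom hd hE mg)[b hg] hfg]].
  split; first by case: hg.
  apply: (pvm_integral_exh mfg hB bdfg) => n /=.
  rewrite key -(pvm_integral_loc hd hE mg hg (mB n) (bdg n)) /=.
  rewrite (phi_cutP hd hE mf) //; exact: (pvm_integral_loc hd hE mf hf).
exists b; split => //=; apply: (pvm_integral_exh mf hB bdf) => n /=.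
rewrite (pvm_integral_loc hd hE mfg hfg (mB n) (bdfg n)) key /=.
rewrite -(pvm_integral_loc hd hE mg hg (mB n) (bdg n)) /=.
exact: (phi_cutP hd hE mf).
Qed.

Section Push.
Variables (E : pvm (R := R) (H := H)) (hE : is_pvm d E) (f : R -> R) (mf : measurable_fun setT f).

(** The image of [E] under [f], which is the spectral measure of int f dE. *)
Definition pvm_push : pvm (R := R) (H := H) := PVM (fun C => pvm_proj E (f @^-1` C))
  (fun x => @measure_function_pushforward__canonical__measure_function_Measure _ _
    (measurableTypeR R) (measurableTypeR R) R (pvm_meas E x) f mf).

Lemma mpre C : measurable C -> measurable (f @^-1` C).
Proof. by move=> mC; rewrite -[X in measurable X]setTI; apply: mf. Qed.

Lemma pvm_pushP : is_pvm d pvm_push.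
Proof.
split=> /=.
- by move=> C mC; case: hE => /(_ _ (mpre mC)).
- by move=> C C' mC mC' x; rewrite preimage_setI; apply: (P_I hE); exact: mpre.
- by move=> x; rewrite preimage_setT; exact: (P_T hE).
- move=> x C mC; rewrite /= /pushforward; case: hE => _ _ _; apply; exact: mpre.
Qed.

Lemma bmeas_comp g : bmeas g -> bmeas (g \o f).
Proof.
move=> [mg [M hM]]; split; last by exists M => t /=.
exact: (measurableT_comp mg mf).
Qed.

Lemma phi_push g x : bmeas g -> phi hd pvm_pushP g x = phi hd hE (g \o f) x.
Proof.
move=> hg; move: g hg x.
apply: (bmeas_ind (K := fun g => forall x, phi hd pvm_pushP g x = phi hd hE (g \o f) x)).
- move=> C mC x; rewrite phi_indic //= -(phi_indic hd hE _ (mpre mC)).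
  by congr (phi _ _ _); apply/funext => t /=; rewrite !indicE; congr (_%:R); apply/idP/idP; rewrite !inE.
- move=> g h hg hh IHg IHh x; rewrite phiD // IHg IHh -phiD //; exact: bmeas_comp.
- move=> c g hg IH x; rewrite phiZ // IH -phiZ //; exact: bmeas_comp.
- move=> g u hg hu h x; have bu n := (hu n).1.
  apply: (hcvg_unique hd (phi_cvg hd pvm_pushP x hg bu h)).
  under eq_fun do rewrite (hu _).2.
  by apply: phi_cvg => [|n|n t] /=; [exact: bmeas_comp|exact: bmeas_comp|exact: h].
Qed.

Lemma pvm_integral_push g : measurable_fun setT g ->
  pvm_integral d pvm_push g = pvm_integral d E (g \o f).
Proof.
move=> mg; have mgf : measurable_fun setT (g \o f) by exact: (measurableT_comp mg mf).
have e w n : (pvm_proj pvm_push (lev g n) w.2 = phi hd pvm_pushP (cutf g (lev g n)) w.1) =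
    (pvm_proj E (lev (g \o f) n) w.2 = phi hd hE (cutf (g \o f) (lev (g \o f) n)) w.1).
  rewrite phi_push; last exact: bmeas_cut (lev_meas n mg) (lev_bd g n).
  by rewrite /=; congr (_ = phi _ _ _ _); apply/funext => t.
apply/seteqP; split=> w.
  move=> /(pvm_integral_levP hd pvm_pushP mg) h; apply/(pvm_integral_levP hd hE mgf) => n.
  by rewrite -e.
move=> /(pvm_integral_levP hd hE mgf) h; apply/(pvm_integral_levP hd pvm_pushP mg) => n.
by rewrite e.
Qed.

Lemma pvm_push_spectral : is_spectral_measure d (pvm_integral d E f) pvm_push.
Proof.
split; first exact: pvm_pushP.
by rewrite pvm_integral_push //; exact: measurable_id.
Qed.
End Push.

Lemma pvm_integral_eqmu (E F : pvm) f :
  (forall x C, measurable C -> pvm_meas E x C = pvm_meas F x C) ->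
  pvm_integral d E f = pvm_integral d F f.
Proof.
move=> h.
have hi x (g : R -> \bar R) : (\int[pvm_meas E x]_(t in setT) g t = \int[pvm_meas F x]_(t in setT) g t)%E.
  by apply: eq_measure_integral => C mC _; exact: h.
have hD : pvm_dom E f = pvm_dom F f by apply/funext => x; rewrite /pvm_dom /= hi.
rewrite /pvm_integral hD; apply/seteqP; split=> w [hw h'] /=; split=> // z hz;
  rewrite (h' z hz); congr (_ * _); apply: eq_bigr => k _; by rewrite /Rintegral hi.
Qed.

Lemma P_cvgU (E : pvm) (hE : is_pvm d E) B x : (forall n, measurable (B n)) ->
  nondecreasing_seq B -> hcvg (fun n => pvm_proj E (B n) x) (pvm_proj E (\bigcup_n B n) x).
Proof.
move=> mB nB; have mU : measurable (\bigcup_n B n) by exact: bigcup_measurable.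
(* Adding the complement of the union turns the sequence into one that exhausts the line, without
   effect on a vector already projected to the union. *)
have e n : pvm_proj E (B n) x = pvm_proj E (B n `|` ~` (\bigcup_n B n)) (pvm_proj E (\bigcup_n B n) x).
  rewrite -(P_I hE) //; last by apply: measurableU => //; exact: measurableC.
  congr (pvm_proj _ _ _); rewrite setIUl setICl setU0.
  by apply/esym/setIidPl => t Bt; exists n.
under eq_fun do rewrite e.
apply: (P_cvg hd hE).
- by move=> n; apply: measurableU => //; exact: measurableC.
- move=> n m nm; apply/subsetPset; apply: setSU; exact/subsetPset/nB.
- apply/seteqP; split => // t _; have [[n _ Bt]|Bt] := pselect ((\bigcup_n B n) t).
    by exists n => //; left.
  by exists 0%N => //; right.
Qed.

Section Growth.
Variables (E : pvm (R := R) (H := H)) (hE : is_pvm d E).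
Local Notation P := (pvm_proj E).
Local Notation phi := (phi hd hE).
Local Notation I := (pvm_integral d E id).
Let mid : measurable_fun setT (id : R -> R) := @measurable_id _ _ setT.

(** [v k] stands for (A - a)^k u. Geometric growth at rate [r] characterizes the spectral subspace
    of [a - r, a + r] without reference to a spectral measure, which is what makes uniqueness and
    commutation provable. *)
Definition growth (A : op H) (a r : R) (u : H) := exists v : nat -> H,
  [/\ v 0%N = u, forall k, A (v k, v k.+1 + a%:C *: v k) &
      exists K, forall k, hnorm d (v k) <= K * r ^+ k].

Lemma meas_pow a k : measurable_fun setT (fun t : R => (t - a) ^+ k).
Proof. by apply: measurable_funX; apply: measurable_funB. Qed.

Lemma growth_of_itv a r u : 0 < r -> P `[a - r, a + r]%classic u = u -> growth I a r u.
Proof.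
move=> r0 hu; pose C := `[a - r, a + r]%classic; have mC : measurable C by exact: measurable_itv.
have Cr t : C t -> `|t - a| <= r.
  by rewrite /C /= in_itv /= ler_norml => /andP[? ?]; apply/andP; split; lra.
have bdp k : bdon (fun t => (t - a) ^+ k) C.
  by exists (r ^+ k) => t Ct; rewrite normrX; apply: lerXn2r; rewrite ?nnegrE ?normr_ge0 ?(ltW r0) //; exact: Cr.
have bp k := bmeas_cut (meas_pow a k) mC (bdp k).
exists (fun k => phi (cutf (fun t => (t - a) ^+ k) C) u); split.
- rewrite -[RHS]hu -(phi_indic hd hE _ mC); congr (phi _ _); apply/funext => t.
  by rewrite /cutf expr0 mulr1.
- move=> k; apply/(pvm_integral_levP hd hE mid) => n /=.
  have mL := lev_meas n mid; have bL := bmeas_cut mid mL (lev_bd id n).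
  rewrite -phiZ // -phiD //; last exact: bmeasZ.
  rewrite -phi_indicM //; last by apply: bmeasD => //; exact: bmeasZ.
  rewrite -phiM //; congr (phi _ _); apply/funext => t; rewrite /cutf exprS.
  by move: (_ ^+ k) (\1_C t) (\1_(lev _ _) t) => X Y Z; ring.
- exists (hnorm d u) => k; rewrite mulrC; apply: phi_bound => // t.
  have [Ct|Ct] := pselect (C t); last by rewrite cutfN // normr0 exprn_ge0 // ltW.
  by rewrite cutfM // normrX; apply: lerXn2r; rewrite ?nnegrE ?normr_ge0 ?(ltW r0) //; exact: Cr.
Qed.

(** At distance at least s > r from [a] the operator A - a has an inverse of norm at most 1/s, so
    that part of [u] is bounded by K (r/s)^k for every [k] and vanishes. *)
Lemma itv_of_growth a r u : 0 < r -> growth I a r u -> P `[a - r, a + r]%classic u = u.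
Proof.
move=> r0 [v [v0 hv [K hK]]]; pose C := `[a - r, a + r]%classic.
have mC : measurable C by exact: measurable_itv.
pose D (m : nat) : set R := [set t | r + m.+1%:R^-1 <= `|t - a|] `&` lev id m.
have mid' : measurable_fun setT (fun t : R => `|t - a|).
  by apply: measurableT_comp => //; apply: measurable_funB.
have mD m : measurable (D m).
  apply: measurableI; last exact: lev_meas.
  have -> : [set t | r + m.+1%:R^-1 <= `|t - a|] = (fun t : R => `|t - a|) @^-1` `[r + m.+1%:R^-1, +oo[%classic.
    by apply/seteqP; split=> t /=; rewrite in_itv /= andbT.
  by rewrite -[X in measurable X]setTI; apply: mid'.
have PD0 m : P (D m) u = 0.
  set s := r + m.+1%:R^-1; have s0 : 0 < s by rewrite addr_gt0 // invr_gt0.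
  have rs : r < s by rewrite ltrDl invr_gt0.
  have bid : bdon id (D m) by exists m%:R => t [_]; rewrite /lev /= in_itv /= -ler_norml.
  have bi := bmeas_cut mid (mD m) bid.
  pose h t := \1_(D m) t * (t - a)^-1.
  have hs t : `|h t| <= s^-1.
    rewrite /h indicE; case: (boolP (t \in _)) => [/set_mem [ht _]|_]; last first.
      by rewrite mul0r normr0 invr_ge0 ltW.
    by rewrite mul1r normfV lef_pV2 ?posrE // (lt_le_trans s0).
  have bh : bmeas h.
    split; last by exists s^-1.
    apply: measurable_funM; first exact: measurable_indic.
    by apply: measurable_funVr; apply: measurable_funB.
  have bg : bmeas (cutf (fun t => t - a) (D m)).
    apply: bmeas_cut => //; first exact: measurable_funB.
    have [M hM] := bid; exists (M + `|a|) => t Dt.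
    by rewrite (le_trans (ler_normB _ _)) // lerD2r; exact: hM.
  have step k : hnorm d (P (D m) (v k)) <= s^-1 * hnorm d (P (D m) (v k.+1)).
    have -> : P (D m) (v k) = phi h (P (D m) (v k.+1)).
      have hl := pvm_integral_loc hd hE mid (hv k) (mD m) bid.
      have -> : P (D m) (v k.+1) = phi (cutf (fun t => t - a) (D m)) (v k).
        have := hl; rewrite /= (linD (P_lin hE (mD m))) (linZ (P_lin hE (mD m))).
        move=> /(canRL (addrK _)) ->.
        have b1 := bmeas_indic (mD m).
        have -> : cutf (fun t => t - a) (D m) = fun t => cutf id (D m) t - a * \1_(D m) t.
          by apply/funext => t; rewrite /cutf; ring.
        by rewrite phiB ?phiZ ?phi_indic //; exact: bmeasZ.
      rewrite -phiM // -(phi_indic hd hE _ (mD m)); congr (phi _ _).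
      apply/funext => t; rewrite /h /cutf indicE.
      case: (boolP (t \in _)) => [/set_mem [ht _]|_]; last by rewrite !mul0r.
      rewrite !mul1r mulVf //; apply/eqP => t0.
      by move: ht; rewrite /= t0 normr0 leNgt s0.
    exact: phi_bound.
  have steps k : hnorm d (P (D m) u) <= s^-1 ^+ k * hnorm d (P (D m) (v k)).
    elim: k => [|k IH]; first by rewrite expr0 mul1r v0.
    apply: le_trans IH _; rewrite exprSr -mulrA ler_wpM2l //.
    by rewrite exprn_ge0 // invr_ge0 ltW.
  have bound k : hnorm d (P (D m) u) <= (r / s) ^+ k * K.
    apply: le_trans (steps k) _.
    have -> : (r / s) ^+ k * K = s^-1 ^+ k * (K * r ^+ k) by rewrite exprMn; ring.
    rewrite ler_wpM2l ?exprn_ge0 ?invr_ge0 ?(ltW s0) //.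
    by apply: le_trans (hK k); exact: (P_contr hd hE (mD m)).
  apply: (hnorm_eq0 hd); apply/eqP; rewrite eq_le hnorm_ge0 andbT.
  apply: (cvg_real_le bound (cvg_cst _)); rewrite -[X in _ --> X](mul0r K).
  apply: cvgMl; apply: cvg_expr.
  by rewrite ger0_norm ?divr_ge0 ?ltW // ltr_pdivrMr // mul1r.
pose B m := C `|` D m.
have hB : \bigcup_m B m = setT.
  apply/seteqP; split=> // t _; have [Ct|Ct] := pselect (C t); first by exists 0%N => //; left.
  have rt : r < `|t - a|.
    rewrite ltNge; apply/negP => h; apply: Ct; rewrite /C /= in_itv /=.
    by move: h; rewrite ler_norml => /andP[? ?]; apply/andP; split; lra.
  have e0 : 0 < `|t - a| - r by rewrite subr_gt0.
  exists (maxn (Num.truncn (`|t - a| - r)^-1) (Num.truncn `|t|).+1) => //; right; split => /=.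
    rewrite -lerBrDl -[leRHS]invrK lef_pV2 ?posrE ?invr_gt0 //.
    apply/ltW/(lt_le_trans (truncnS_gt _)); rewrite ler_nat ltnS; exact: leq_maxl.
  rewrite /lev /= in_itv /= -ler_norml.
  apply/ltW/(lt_le_trans (truncnS_gt _)); rewrite ler_nat; exact: leq_maxr.
have nB : nondecreasing_seq B.
  move=> n m nm; apply/subsetPset; apply: setUS => t [/= h1 h2]; split=> /=.
    by apply: le_trans h1; rewrite lerD2l lef_pV2 ?posrE // ler_nat.
  move: h2; rewrite /lev /= !in_itv /= -!ler_norml => h; apply: le_trans h _.
  by rewrite ler_nat.
have := P_cvg hd hE u (fun m => measurableU _ _ mC (mD m)) nB hB.
apply: (hcvg_unique hd); rewrite (_ : (fun n => _) = fun=> P C u); first exact: hcvg_cst.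
apply/funext => m; rewrite (P_setU hd hE) //; first by rewrite PD0 addr0.
apply/seteqP; split=> // t [Ct [/= ht _]]; move: Ct; rewrite /C /= in_itv /= => /andP[? ?].
have : `|t - a| <= r by rewrite ler_norml; apply/andP; split; lra.
by rewrite leNgt (lt_le_trans _ ht) // ltrDl invr_gt0.
Qed.

End Growth.

Section Intertwine.
Variables (E F : pvm (R := R) (H := H)) (hE : is_pvm d E) (hF : is_pvm d F).
Variables (T T' : H -> H) (M : R).
Hypotheses (lT : lin T) (lT' : lin T') (bT : forall x, hnorm d (T x) <= M * hnorm d x)
  (bT' : forall x, hnorm d (T' x) <= M * hnorm d x)
  (adjT : forall x y, rd (T x) y = rd x (T' y)).
Let A := pvm_integral d E id.
Let B := pvm_integral d F id.

Lemma growth_map (S : H -> H) (A1 A2 : op H) a r u : lin S ->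
  (forall x, hnorm d (S x) <= M * hnorm d x) ->
  (forall x y, A1 (x, y) -> A2 (S x, S y)) -> growth A1 a r u -> growth A2 a r (S u).
Proof.
move=> lS bS hS [v [v0 hv [K hK]]]; exists (S \o v); split.
- by rewrite /= v0.
- by move=> k /=; rewrite -(linZ lS) -(linD lS); exact: hS.
- exists (`|M| * K) => k /=; apply: le_trans (bS _) _; rewrite -mulrA.
  apply: (@le_trans _ _ (`|M| * hnorm d (v k))); first by rewrite ler_wpM2r ?hnorm_ge0 ?ler_norm.
  by rewrite ler_wpM2l.
Qed.

(** Intertwining maps carry growth vectors to growth vectors, hence spectral subspaces of intervals
    into each other. Knowing this for [T] and for its adjoint makes [T] commute with the
    projections; monotone limits and Dynkin's theorem reach all Borel sets. *)
Lemma intertwine : (forall x y, A (x, y) -> B (T x, T y)) ->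
  (forall x y, B (x, y) -> A (T' x, T' y)) ->
  forall C, measurable C -> forall x, T (pvm_proj E C x) = pvm_proj F C (T x).
Proof.
move=> hT hT'.
have key a b : a < b -> forall x, T (pvm_proj E `[a, b]%classic x) = pvm_proj F `[a, b]%classic (T x).
  move=> ab x; pose c := (a + b) / 2; pose r := (b - a) / 2.
  have r0 : 0 < r by rewrite divr_gt0 // subr_gt0.
  have ea : a = c - r by rewrite /c /r; lra.
  have eb : b = c + r by rewrite /c /r; lra.
  rewrite {1 2}ea {1 2}eb.
  set C := `[_, _]%classic; have mC : measurable C by exact: measurable_itv.
  have h1 y : pvm_proj F C (T (pvm_proj E C y)) = T (pvm_proj E C y).
    apply: (itv_of_growth hF r0); apply: (growth_map lT bT hT).
    by apply: (growth_of_itv hE r0); exact: (P_idem hE).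
  have h2 y : pvm_proj E C (T' (pvm_proj F C y)) = T' (pvm_proj F C y).
    apply: (itv_of_growth hE r0); apply: (growth_map lT' bT' hT').
    by apply: (growth_of_itv hF r0); exact: (P_idem hF).
  apply: (rd_ext hd) => y; rewrite -h1 (P_sym hF mC) adjT (P_sym hE mC) h2.
  by rewrite -adjT -(P_sym hF mC).
have lim (D : nat -> set R) : (forall n, measurable (D n)) -> nondecreasing_seq D ->
    (forall n x, T (pvm_proj E (D n) x) = pvm_proj F (D n) (T x)) ->
    forall x, T (pvm_proj E (\bigcup_n D n) x) = pvm_proj F (\bigcup_n D n) (T x).
  move=> mD nD hD x; apply: (hcvg_unique hd (hcvg_bnd lT bT (P_cvgU hE x mD nD))).
  by under eq_fun do rewrite hD; exact: P_cvgU.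
apply: (@dynkin_induction _ (measurableTypeR R) (@ocitv R)) => //.
- exact: ocitvI.
- by move=> x; rewrite (P_T hE) (P_T hF).
- move=> _ /ocitvP[-> x|[[a b] /= ab ->]].
    by rewrite (P_0 hd hE) (P_0 hd hF) (lin0 lT).
  (* The index starts at 2 so that the left end stays strictly below [b], as [key] requires. *)
  have -> : `]a, b]%classic = \bigcup_n `[a + n.+2%:R^-1 * (b - a), b]%classic.
    apply/seteqP; split=> t /=.
      rewrite in_itv /= => /andP[at_ tb].
      have ta : 0 < (t - a) / (b - a) by rewrite divr_gt0 ?subr_gt0.
      exists (Num.truncn ((t - a) / (b - a))^-1) => //=.
      rewrite in_itv /= tb andbT -lerBrDl -ler_pdivlMr ?subr_gt0 //.
      rewrite -[leRHS]invrK lef_pV2 ?posrE ?invr_gt0 //.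
      by apply/ltW/(lt_trans (truncnS_gt _)); rewrite ltr_nat.
    move=> [n _ /=]; rewrite !in_itv /= => /andP[h ->]; rewrite andbT.
    by apply: lt_le_trans h; rewrite ltrDl mulr_gt0 ?subr_gt0 ?invr_gt0.
  apply: lim.
  - by move=> n; exact: measurable_itv.
  - move=> n m nm; apply/subsetPset => t /=; rewrite !in_itv /= => /andP[h ->].
    rewrite andbT; apply: le_trans h; rewrite lerD2l ler_wpM2r ?subr_ge0 ?(ltW ab) //.
    by rewrite lef_pV2 ?posrE // ler_nat.
  - move=> n x; apply: key; rewrite -ltrBrDl -ltr_pdivlMr ?subr_gt0 // divff ?subr_eq0 ?gt_eqF //.
    by rewrite invf_lt1 // ltr1n.
- move=> C mC hC x; rewrite (P_C hd hE) // (P_C hd hF) // (linB lT) hC //.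
- move=> D mD tD hD x.
  have mB n : measurable (\big[setU/set0]_(i < n) D i) by apply: bigsetU_measurable.
  rewrite -(bigcup_bigsetU_bigcup D); apply: lim; first by move=> n; exact: mB.
    by move=> n m nm; apply/subsetPset; exact: subset_bigsetU.
  move=> n; elim: n.+1 => {n} [y|n IH y].
    by rewrite big_ord0 (P_0 hd hE) (P_0 hd hF) (lin0 lT).
  have dB : \big[setU/set0]_(i < n) D i `&` D n = set0.
    rewrite setIC; apply/seteqP; split => // t [Dt]; rewrite -bigcup_mkord => -[k /= kn Dk].
    have /trivIsetP/(_ n k Logic.I Logic.I) := tD.
    by rewrite neq_ltn kn orbT => /(_ isT) e; have : (D n `&` D k) t by []; rewrite e.
  have e1 := P_setU hd hE y (mB n) (mD n) dB.
  have e2 := P_setU hd hF (T y) (mB n) (mD n) dB.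
  by rewrite big_ord_recr /= e1 e2 (linD lT) IH hD.
Qed.
End Intertwine.

Lemma pvm_unique (E F : pvm) : is_pvm d E -> is_pvm d F ->
  pvm_integral d E id = pvm_integral d F id ->
  forall C, measurable C -> forall x, pvm_proj E C x = pvm_proj F C x.
Proof.
move=> hE hF e C mC x.
by apply: (@intertwine E F hE hF id id 1) => // [y|y|y z|y z]; rewrite ?mul1r ?e.
Qed.

Lemma spectral_uniq (A : op H) E F : is_spectral_measure d A E -> is_spectral_measure d A F ->
  forall x C, measurable C -> pvm_meas E x C = pvm_meas F x C.
Proof.
move=> [hE hA] [hF hA'] x C mC; rewrite (muE hE) // (muE hF) //.
by rewrite (pvm_unique hE hF) // -hA -hA'.
Qed.

Lemma spectral_measureP (A : op H) E : is_spectral_measure d A E ->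
  is_spectral_measure d A (spectral_measure d A).
Proof.
by move=> h; rewrite /spectral_measure; case: pselect => [e|[]]; [case: cid|exists E].
Qed.

Lemma spectral_measure_mu (A : op H) E : is_spectral_measure d A E ->
  forall x C, measurable C -> pvm_meas (spectral_measure d A) x C = pvm_meas E x C.
Proof. by move=> h x C mC; apply: (spectral_uniq (spectral_measureP h) h). Qed.

(** [spectral_measure] is a choice; by uniqueness any spectral measure at hand computes the same
    integrals. *)
Lemma fcalcE (A : op H) E f : is_spectral_measure d A E ->
  fcalc d f A = pvm_integral d E f.
Proof.
move=> h; rewrite -(pvm_integral_eqmu f (spectral_measure_mu h)).
by apply/seteqP; split=> [w []//|w hw]; split=> //; exact: spectral_measureP h.
Qed.

Lemma pvm_integral_map (E : pvm) (hE : is_pvm d E) f (T : H -> H) M x y :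
  measurable_fun setT f -> lin T -> (forall x, hnorm d (T x) <= M * hnorm d x) ->
  (forall C x, measurable C -> T (pvm_proj E C x) = pvm_proj E C (T x)) ->
  pvm_integral d E f (x, y) -> pvm_integral d E f (T x, T y).
Proof.
move=> mf lT bT cT h; apply/(pvm_integral_levP hd hE mf) => n /=.
rewrite -cT; last exact: lev_meas.
rewrite -(phi_comm hd hE _ lT bT cT); last exact: bmeas_cut (lev_meas n mf) (lev_bd f n).
by congr (T _); exact: (pvm_integral_levP hd hE mf _).1 h n.
Qed.

(** On the set [-m, -1/(m+1)] the form is at most -1/(m+1) times the squared norm, so nonnegativity
    leaves only the zero vector; these sets increase to the negative half-line. *)
Lemma pvm_neg0 (E : pvm) (hE : is_pvm d E) :
  (forall x y, pvm_integral d E id (x, y) -> 0 <= rd y x) ->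
  forall x, pvm_proj E `]-oo, 0[%classic x = 0.
Proof.
move=> hpos x; have mid := @measurable_id _ _ (setT : set R).
pose D (m : nat) : set R := `[- m%:R, - m.+1%:R^-1]%classic.
have mD m : measurable (D m) by exact: measurable_itv.
have bD m : bdon id (D m).
  exists m%:R => t; rewrite /D /= in_itv /= ler_norml => /andP[-> h] /=.
  by rewrite (le_trans h) // (@le_trans _ _ 0) // oppr_le0 invr_ge0.
have PD m : pvm_proj E (D m) x = 0.
  set y := pvm_proj E (D m) x; have bi := bmeas_cut mid (mD m) (bD m).
  have hy : pvm_integral d E id (y, phi hd hE (cutf id (D m)) y).
    apply/(pvm_integral_levP hd hE mid) => n /=.
    have mL := lev_meas n mid; have bL := bmeas_cut mid mL (lev_bd id n).
    rewrite /y -(phi_indic hd hE x (mD m)) -!phiM //; try exact: bmeas_indic.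
      rewrite -phi_indicM //; last by apply: bmeasM => //; exact: bmeas_indic.
      congr (phi _ _ _ _); apply/funext => t; rewrite /cutf [\1_(D m) t]indicE.
      by case: (t \in D m) => /=; ring.
  have := hpos _ _ hy; rewrite phiE // => h.
  have c0 : (0 : R) < m.+1%:R^-1 by rewrite invr_gt0.
  have h2 : qint E y (cutf id (D m)) <= - m.+1%:R^-1 * rd y y.
    have -> : rd y y = qint E y \1_(D m).
      by rewrite (qint_indic hE) // /y (P_idem hE).
    have b1 := bmeas_indic (mD m).
    rewrite -(qintZ hE) //; apply: (qint_le hE) => //; first exact: bmeasZ.
    move=> t; rewrite /cutf indicE; case: (boolP (t \in _)) => [/set_mem|_]; last by rewrite mul0r mulr0.
    by rewrite /D /= in_itv /= mul1r mulr1 => /andP[].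
  apply: (rd_eq0 hd); apply/eqP; rewrite eq_le rd_ge0 // andbT.
  have : m.+1%:R^-1 * rd y y <= 0 by move: (le_trans h h2); rewrite mulNr oppr_ge0.
  by rewrite pmulr_rle0.
have -> : `]-oo, (0 : R)[%classic = \bigcup_m D m.
  apply/seteqP; split=> t; rewrite /D /= ?in_itv /=.
    move=> t0; exists (maxn (Num.truncn (- t)).+1 (Num.truncn (- t)^-1)) => //=.
    rewrite in_itv /=; apply/andP; split.
      by rewrite lerNl; apply/ltW/(lt_le_trans (truncnS_gt _)); rewrite ler_nat leq_maxl.
    rewrite lerNr -[leRHS]invrK lef_pV2 ?posrE ?invr_gt0 ?oppr_gt0 //.
    by apply/ltW/(lt_le_trans (truncnS_gt _)); rewrite ler_nat ltnS leq_maxr.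
  move=> [m _ /=]; rewrite !in_itv /= => /andP[_ h]; apply: le_lt_trans h _.
  by rewrite oppr_lt0 invr_gt0.
have nD : nondecreasing_seq D.
  move=> n m nm; apply/subsetPset => t; rewrite /D /= !in_itv /= => /andP[h1 h2].
  apply/andP; split; first by apply: le_trans h1; rewrite lerN2 ler_nat.
  by apply: le_trans h2 _; rewrite lerN2 lef_pV2 ?posrE // ler_nat.
apply: (hcvg_unique hd (P_cvgU hE x mD nD)); under eq_fun do rewrite PD.
exact: hcvg_cst.
Qed.

(** Serves identities such as t^(1/2) t^(1/2) = t, which fail for negative [t], where the measure of
    a nonnegative operator vanishes. *)
Lemma pvm_integral_ae (E : pvm) (hE : is_pvm d E) f g C :
  measurable_fun setT f -> measurable_fun setT g -> measurable C ->
  (forall x, pvm_proj E C x = 0) -> (forall t, ~ C t -> f t = g t) ->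
  pvm_integral d E f = pvm_integral d E g.
Proof.
move=> mf mg mC C0.
suff h f' g' w : measurable_fun setT f' -> measurable_fun setT g' ->
    (forall t, ~ C t -> f' t = g' t) -> pvm_integral d E f' w -> pvm_integral d E g' w.
  move=> fg; apply/seteqP; split=> w; apply: h => // t Ct; apply/esym; exact: fg.
move=> mf' mg' fg hw; apply/(pvm_integral_levP hd hE mg') => n.
pose B := lev g' n `&` ~` C; have mL := lev_meas n mg'.
have mC' : measurable (~` C) by exact: measurableC.
have mB : measurable B by exact: measurableI.
have bB : bdon f' B by have [M hM] := lev_bd g' n; exists M => t [ht Ct]; rewrite fg //; exact: hM.
have PC y : pvm_proj E (~` C) y = y by rewrite (P_C hd hE) // C0 subr0.
rewrite -[RHS]PC -phi_indicM //; last exact: bmeas_cut (lev_bd g' n).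
rewrite -[w.2]PC -(P_I hE) // (pvm_integral_loc hd hE mf' hw mB bB).
congr (phi _ _ _ _); apply/funext => t; rewrite /cutf /B !indicE.
have [Ct|Ct] := pselect (C t).
  by rewrite [_ \in ~` C]memNset // memNset ?mul0r // => -[].
rewrite fg // mulrA; congr (_ * _); rewrite -natrM; congr (_%:R); rewrite in_setI andbC.
by case: (_ \in _); case: (_ \in _).
Qed.

End PvmAlgebra.

(** * The spectral theorem *)

Section SquareRoot.
Context {R : realType} {H : lmodType R[i]} (d : H -> H -> R[i]) (hd : hilbert d).
Local Notation rd := (rdot d).
Local Notation sym := (sym d).
Local Notation hcvg := (hcvg d).
Local Notation contr := (contr d).
Implicit Types (F G : H -> H) (x y z : H).

Definition pos F := forall x, 0 <= rd (F x) x.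

Lemma contr_sym F : lin F -> sym F -> pos F -> (forall x, rd (F x) x <= rd x x) -> contr F.
Proof.
move=> lF sF pF h x; rewrite -[leRHS]mul1r; apply: (sym_bound hd lF sF) => y.
by rewrite mul1r ger0_norm.
Qed.
Lemma contr_qform F x : contr F -> `|rd (F x) x| <= rd x x.
Proof.
move=> cF; apply: le_trans (cauchy_schwarz hd _ _) _.
by rewrite -(hnorm2 hd) expr2 ler_wpM2r ?hnorm_ge0.
Qed.
(** Expand the nonnegative form of [F] at x - F x, and bound the form at F x by its squared norm. *)
Lemma pos_cs F x : lin F -> sym F -> pos F -> contr F -> rd (F x) (F x) <= rd (F x) x.
Proof.
move=> lF sF pF cF; have := pF (x - F x); rewrite (linB lF) !rdBl // !rdBr //.
have := contr_qform (F x) cF; rewrite ler_norml => /andP[_].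
have -> : rd (F (F x)) x = rd (F x) (F x) by rewrite sF.
lra.
Qed.
Lemma pos_eq0 F x : lin F -> sym F -> pos F -> contr F -> rd (F x) x = 0 -> F x = 0.
Proof.
move=> lF sF pF cF h; apply: (rd_eq0 hd); apply/eqP; rewrite eq_le rd_ge0 // andbT.
by rewrite -h; exact: pos_cs.
Qed.

Variables (S : H -> H) (lS : lin S) (sS : sym S) (pS : pos S) (S1 : forall x, rd (S x) x <= rd x x).
Let T x := x - S x.
Let lT : lin T. Proof. exact: lin_sub. Qed.
Let sT : sym T. Proof. by move=> x y; rewrite rdBl // rdBr // sS. Qed.
Let pT : pos T. Proof. by move=> x; rewrite rdBl // subr_ge0. Qed.
Let cT : contr T.
Proof. by apply: contr_sym => // x; rewrite rdBl // gerBl. Qed.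

(* The iteration [z <- (T + z^2) / 2] increases because its successive differences are polynomials
   in [T] with nonnegative coefficients. *)
Inductive posgen : (H -> H) -> Prop :=
| Posgen_id : posgen id
| Posgen_mul F : posgen F -> posgen (fun x => T (F x))
| Posgen_add F G : posgen F -> posgen G -> posgen (fun x => F x + G x)
| Posgen_scale a F : 0 <= a -> posgen F -> posgen (fun x => a%:C *: F x).

Lemma posgen_lin F : posgen F -> lin F.
Proof.
elim=> [|{}F _ IH|{}F G _ IHF _ IHG|a {}F _ _ IH] //.
- exact: (lin_comp lT IH).
- exact: lin_add.
- exact: lin_scale.
Qed.
Lemma posgen_comm F G : posgen F -> lin G -> (forall x, G (T x) = T (G x)) ->
  forall x, G (F x) = F (G x).
Proof.
move=> hF lG cG; elim: hF => [|{}F _ IH|{}F F' _ IHF _ IHG|a {}F _ _ IH] x //.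
- by rewrite cG IH.
- by rewrite (linD lG) IHF IHG.
- by rewrite (linZ lG) IH.
Qed.
Lemma posgen_sym F : posgen F -> sym F.
Proof.
elim=> [|{}F hF IH|{}F G _ IHF _ IHG|a {}F _ _ IH] x y //.
- by rewrite sT IH (posgen_comm hF lT).
- by rewrite rdDl // rdDr // IHF IHG.
- by rewrite rdZl // rdZr // IH.
Qed.
Lemma posgen_pos2 F : posgen F -> pos F /\ pos (fun x => T (F x)).
Proof.
elim=> [|{}F hF [IH1 IH2]|{}F G _ [IH1 IH2] _ [IH3 IH4]|a {}F a0 _ [IH1 IH2]].
- by split=> x; [exact: rd_ge0|exact: pT].
- split=> x; first exact: IH2.
  by rewrite sT (posgen_comm hF lT) //; exact: IH1.
- split=> x; first by rewrite rdDl // addr_ge0.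
  by rewrite (linD lT) rdDl // addr_ge0.
- split=> x; first by rewrite rdZl // mulr_ge0.
  by rewrite (linZ lT) rdZl // mulr_ge0.
Qed.
Lemma posgen_pos F : posgen F -> pos F. Proof. by move=> /posgen_pos2[]. Qed.
Lemma posgen_comp F G : posgen F -> posgen G -> posgen (fun x => F (G x)).
Proof.
move=> hF hG; elim: hF => [|{}F _ IH|{}F F' _ IHF _ IHG|a {}F a0 _ IH] //.
- exact: (Posgen_mul IH).
- exact: (Posgen_add IHF IHG).
- exact: (Posgen_scale a0 IH).
Qed.
Lemma posgen_swap F G x : posgen F -> posgen G -> F (G x) = G (F x).
Proof. by move=> hF hG; apply: (posgen_comm hG (posgen_lin hF)) => y; rewrite (posgen_comm hF lT). Qed.

Fixpoint sqz n : H -> H :=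
  if n is n.+1 then fun x => (2^-1)%:C *: (T x + sqz n (sqz n x)) else fun x => (0 : R)%:C *: x.

Lemma sqz_gen n : posgen (sqz n).
Proof.
elim: n => [|n IH] /=; first by apply: (@Posgen_scale 0 id) => //; exact: Posgen_id.
apply: (@Posgen_scale 2^-1 (fun x => T x + sqz n (sqz n x))) => //.
apply: Posgen_add; last exact: posgen_comp.
by apply: (@Posgen_mul id); exact: Posgen_id.
Qed.
Lemma sqz_step n : exists2 G, posgen G & forall x, sqz n.+1 x = sqz n x + G x.
Proof.
elim: n => [|n [G hG hn]].
  exists (sqz 1); first exact: sqz_gen.
  move=> x; have -> : sqz 0 x = 0 by rewrite /= scale0r.
  by rewrite add0r.
exists (fun x => (2^-1)%:C *: (sqz n.+1 (G x) + sqz n (G x))).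
  apply: (@Posgen_scale 2^-1 (fun x => sqz n.+1 (G x) + sqz n (G x))) => //.
  by apply: Posgen_add; apply: posgen_comp => //; exact: sqz_gen.
move=> x; have gn := sqz_gen n; have gn1 := sqz_gen n.+1.
have -> : sqz n.+2 x = (2^-1)%:C *: (T x + sqz n.+1 (sqz n.+1 x)) by [].
have -> : sqz n.+1 (sqz n.+1 x) = sqz n (sqz n x) + (sqz n.+1 (G x) + sqz n (G x)).
  rewrite (hn x) (linD (posgen_lin gn1)) (hn (sqz n x)) -(posgen_swap x gn hG).
  by rewrite -addrA [sqz n.+1 (G x) + _]addrC.
by rewrite addrA scalerDr.
Qed.
Lemma sqz_diff n m : (n <= m)%N -> exists2 G, posgen G & forall x, sqz m x = sqz n x + G x.
Proof.
move=> /subnKC <-; elim: (m - n)%N => [|k [G hG hk]].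
  exists (fun x => (0 : R)%:C *: x); first by apply: (@Posgen_scale 0 id) => //; exact: Posgen_id.
  by move=> x; rewrite addn0 scale0r addr0.
have [G' hG' hk'] := sqz_step (n + k); exists (fun x => G x + G' x); first exact: Posgen_add.
by move=> x; rewrite addnS hk' hk addrA.
Qed.
Lemma sqz_contr n : contr (sqz n).
Proof.
elim: n => [|n IH] x /=; first by rewrite scale0r (hnorm0 hd) hnorm_ge0.
rewrite (hnormZr hd) ger0_norm //; have := hnormD hd (T x) (sqz n (sqz n x)).
by have := cT x; have := IH (sqz n x); have := IH x; lra.
Qed.

(** The difference of two iterates is a positive contraction, so by [pos_cs] its squared norm at [x]
    is at most the increment of a bounded monotone quadratic form. *)
Lemma sqz_cvg : exists Z : H -> H, forall x, hcvg (fun n => sqz n x) (Z x).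
Proof.
suff /choice[Z hZ] : forall x, exists y, hcvg (fun n => sqz n x) y by exists Z.
move=> x; apply: (ip_complete hd).
pose a n := rd (sqz n x) x.
have nda : nondecreasing_seq a.
  by move=> n m /sqz_diff[G hG e]; rewrite /a e rdDl // lerDl; exact: posgen_pos.
have ca : cvgn a.
  apply: nondecreasing_is_cvgn => //; exists (rd x x) => _ [n _ <-].
  exact: le_trans (ler_norm _) (contr_qform _ (sqz_contr n)).
apply: (cauchy_dom hd ca) => n m nm; have [G hG e] := sqz_diff nm.
rewrite e addrC addKr (hnorm2 hd).
rewrite rdDl // [rd (sqz n x) x + _]addrC addrK.
apply: le_trans (ler_norm _); apply: pos_cs; [exact: posgen_lin|exact: posgen_sym|exact: posgen_pos|].
apply: contr_sym; [exact: posgen_lin|exact: posgen_sym|exact: posgen_pos|].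
move=> y; have : rd (sqz m y) y <= rd y y.
  exact: le_trans (ler_norm _) (contr_qform _ (sqz_contr m)).
rewrite e rdDl //; apply: le_trans; rewrite lerDr; exact/posgen_pos/sqz_gen.
Qed.

(** The limit satisfies Z = (T + Z^2) / 2 with T = 1 - S, so Y = 1 - Z has Y^2 = 1 - 2 Z + Z^2 = 1 -
    T = S. What commutes with S commutes with all iterates, hence with Y. *)
Lemma sqrt_exists : exists Y : H -> H, [/\ lin Y, sym Y, pos Y, contr Y &
  (forall x, Y (Y x) = S x) /\
  forall F (M : R), lin F -> (forall x, hnorm d (F x) <= M * hnorm d x) ->
    (forall x, F (S x) = S (F x)) -> forall x, F (Y x) = Y (F x)].
Proof.
have [Z hZ] := sqz_cvg.
have lZ : lin Z by apply: (lin_lim hd _ hZ) => n; exact/posgen_lin/sqz_gen.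
have sZ : sym Z by apply: (sym_lim hd _ hZ) => n; exact/posgen_sym/sqz_gen.
have cZ : contr Z by apply: (contr_lim hd _ hZ) => n; exact: sqz_contr.
have pZ : pos Z.
  move=> x; apply: (@cvg_real_le _ (fun=> 0) (fun n => rd (sqz n x) x)).
  - by move=> n; exact/posgen_pos/sqz_gen.
  - exact: cvg_cst.
  - exact: hcvg_rdl.
have ZE x : Z x = (2^-1)%:C *: (T x + Z (Z x)).
  have h : hcvg (fun n => sqz n.+1 x) (Z x).
    by rewrite /hcvg (cvg_shiftS (fun n => hnorm d (sqz n x - Z x))); exact: hZ.
  apply: (hcvg_unique hd h) => /=; apply: hcvgZ => //; apply: hcvgD => //; first exact: hcvg_cst.
  apply: (@hcvg_le _ _ d _ _ (fun n => hnorm d (sqz n x - Z x) + hnorm d (sqz n (Z x) - Z (Z x)))).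
    move=> n; apply: le_trans (hnorm_tri hd _ (sqz n (Z x)) _) _; rewrite lerD2r.
    by rewrite -(linB (posgen_lin (sqz_gen n))); exact: sqz_contr.
  by apply: cvg0D; exact: hZ.
pose Y x := x - Z x.
have lY : lin Y by exact: lin_sub.
have sY : sym Y by move=> x y; rewrite rdBl // rdBr // sZ.
have pY : pos Y.
  move=> x; rewrite rdBl // subr_ge0; exact: le_trans (ler_norm _) (contr_qform _ cZ).
exists Y; split=> //.
  by apply: contr_sym => // x; rewrite rdBl // gerBl.
split=> [x|F M lF bF cF x].
  rewrite /Y (linB lZ) opprB addrA.
  have e2 : Z x + Z x = T x + Z (Z x) by rewrite {1 2}(ZE x) -scalerDr half_sum0.
  have -> : x - Z x + Z (Z x) - Z x = x + Z (Z x) - (Z x + Z x).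
    by rewrite opprD addrA; congr (_ - _); rewrite addrAC.
  by apply/eqP; rewrite e2 subr_eq /T addrA (addrC (S x)) subrK.
rewrite /Y (linB lF); congr (_ - _).
apply: (hcvg_unique hd (hcvg_bnd lF bF (hZ x))).
have e n : F (sqz n x) = sqz n (F x).
  by apply: (posgen_comm (sqz_gen n) lF) => y; rewrite /T (linB lF) cF.
by under eq_fun do rewrite e; exact: hZ.
Qed.
End SquareRoot.

Section SpectralProjection.
Context {R : realType} {H : lmodType R[i]} (d : H -> H -> R[i]) (hd : hilbert d).
Local Notation rd := (rdot d).
Local Notation sym := (sym d).
Local Notation contr := (contr d).

(** Invariance of [G] under [F] and under its adjoint makes [G] reducing. *)
Lemma proj_comm (G : set H) (hG : subsp G) (cG : hclosed d G) (F F' : H -> H) x :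
  (forall x y, rd (F x) y = rd x (F' y)) ->
  (forall x, G x -> G (F x)) -> (forall x, G x -> G (F' x)) ->
  F (proj hd hG cG x) = proj hd hG cG (F x).
Proof.
move=> aF GF GF'; set E := proj hd hG cG.
have sE : sym E := proj_sym hd hG cG.
have iE y : G (E y) := proj_in hd hG cG y.
have h1 y : E (F (E y)) = F (E y) by apply: proj_id; exact/GF/iE.
have h2 y : E (F' (E y)) = F' (E y) by apply: proj_id; exact/GF'/iE.
apply: (rd_ext hd) => y; rewrite -h1 (sE (F (E x)) y) aF (sE x) h2.
by rewrite -aF (sE (F x)).
Qed.

(** Take the projection onto the kernel of |D| + D, with |D| the square root of D^2. On this kernel
    D = -|D|. The range of |D| - D lies in it because (|D| + D)(|D| - D) = 0, so D = |D| on the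
    orthogonal complement. *)
Lemma specproj_exists (D : H -> H) : lin D -> sym D -> contr D ->
  exists E : H -> H, [/\ lin E, sym E, contr E, forall x, E (E x) = E x &
   [/\ forall x, E x = x -> rd (D x) x <= 0, forall x, E x = 0 -> 0 <= rd (D x) x,
      forall x, D x = 0 -> E x = x &
      forall F F' (M : R), lin F -> lin F' -> (forall x, hnorm d (F x) <= M * hnorm d x) ->
       (forall x, hnorm d (F' x) <= M * hnorm d x) ->
       (forall x y, rd (F x) y = rd x (F' y)) ->
       (forall x, F (D x) = D (F x)) -> (forall x, F' (D x) = D (F' x)) ->
       forall x, F (E x) = E (F x)]].
Proof.
move=> lD sD cD.
have [|||x|Y [lY sY pY cY [YE Yc]]] := @sqrt_exists _ _ d hd (fun x => D (D x)).
- exact: (lin_comp lD lD).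
- by move=> x y; rewrite !sD.
- by move=> x; rewrite sD rd_ge0.
- rewrite sD -!(hnorm2 hd) ler_sqr ?nnegrE ?hnorm_ge0 //.
have YD x : D (Y x) = Y (D x).
  by apply: (Yc D 1) => // y; rewrite mul1r.
pose W x := Y x + D x.
have lW : lin W by exact: lin_add.
have bW x : hnorm d (W x) <= 2 * hnorm d x.
  by rewrite (le_trans (hnormD hd _ _)) // mulr_natl mulr2n lerD.
pose G := [set x | W x = 0].
have hG : subsp G.
  by split=> [|c x y]; rewrite /G /= ?(lin0 lW) // lW => -> ->; rewrite scaler0 addr0.
have cG : hclosed d G by exact: closed_le_norm.
have inG x : proj hd hG cG x = x <-> W x = 0.
  by split=> [<-|h]; [exact: (proj_in hd hG cG)|exact: proj_id].
exists (proj hd hG cG); split.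
- exact: proj_lin.
- exact: proj_sym.
- exact: proj_contr.
- exact: proj_idem.
split=> [x /inG h|x h|x h|F F' M lF lF' bF bF' aF cF cF' x].
- have -> : D x = - Y x by apply/eqP; rewrite -addr_eq0 addrC; apply/eqP.
  by rewrite rdNl // oppr_le0.
- have ort y : W y = 0 -> rd x y = 0.
    move=> Wy; have := proj_orth hd hG cG x (z := y) Wy; by rewrite h subr0.
  pose V y := Y y - D y.
  have lV : lin V by exact: lin_sub.
  have WV y : W (V y) = 0.
    by rewrite /W /V (linB lY) (linB lD) YE YD addrA subrK subrr.
  have sV : sym V by move=> y z; rewrite /V rdBl // rdBr // sY sD.
  have : V x = 0.
    apply: (rd_eq0 hd); rewrite sV.
    by apply: ort; exact: WV.
  by move=> /eqP; rewrite subr_eq0 => /eqP <-.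
- apply/inG; rewrite /W h addr0; apply: (rd_eq0 hd).
  by rewrite sY YE h (lin0 lD) rd0r.
- have FY := Yc F M lF bF (fun y => etrans (cF _) (congr1 D (cF y))).
  have FY' := Yc F' M lF' bF' (fun y => etrans (cF' _) (congr1 D (cF' y))).
  apply: (@proj_comm G hG cG F F' x aF) => y; rewrite /G /= /W => e.
    by rewrite -FY -cF -(linD lF) e (lin0 lF).
  by rewrite -FY' -cF' -(linD lF') e (lin0 lF').
Qed.
End SpectralProjection.

Lemma stieltjes_exists {R : realType} (f : R -> R) : {homo f : x y / x <= y} ->
  (forall x, f t @[t --> x^'+] --> f x) ->
  exists mu : {measure set (measurableTypeR R) -> \bar R},
    forall a b, a <= b -> mu `]a, b]%classic = (f b - f a)%:E.
Proof.
move=> nf rf; pose F := HB.pack_for (cumulative R R) f (isCumulative.Build R _ R f nf rf).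
exists (lebesgue_stieltjes_measure F : {measure set (measurableTypeR R) -> \bar R}) => a b ab.
rewrite /= /lebesgue_stieltjes_measure /measure_extension measurable_mu_extE /=; last exact: is_ocitv.
by rewrite wlength_itv_bnd.
Qed.

(** * From a resolution of the identity to a projection-valued measure *)

Section PvmOfFamily.
Context {R : realType} {H : lmodType R[i]} (d : H -> H -> R[i]) (hd : hilbert d).
Local Notation rd := (rdot d).
Local Notation sym := (sym d).
Local Notation hcvg := (hcvg d).
Implicit Types (x y z : H) (B C : set R).

Variable E : R -> H -> H.
Hypotheses (lE : forall t, lin (E t)) (sE : forall t, sym (E t))
  (iE : forall s t x, s <= t -> E t (E s x) = E s x)
  (rE : forall t x, hcvg (fun n => E (t + n.+1%:R^-1) x) (E t x))
  (yE : forall x, hcvg (fun n => E n%:R x) x)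
  (nyE : forall x, hcvg (fun n => E (- n%:R) x) 0).

Let q x t := rd (E t x) x.

Lemma family_qE x t : q x t = rd (E t x) (E t x).
Proof. by rewrite /q -[in LHS](iE x (lexx t)) sE. Qed.
Lemma family_comm s t x : s <= t -> E s (E t x) = E s x.
Proof. by move=> st; apply: (rd_ext hd) => y; rewrite !sE iE. Qed.
Lemma family_diff s t x : s <= t -> rd (E t x - E s x) (E t x - E s x) = q x t - q x s.
Proof.
move=> st; rewrite !rdBl // !rdBr // -!family_qE.
have -> : rd (E s x) (E t x) = q x s by rewrite -sE iE.
have -> : rd (E t x) (E s x) = q x s by rewrite (rdC hd) -sE iE.
by ring.
Qed.
Lemma family_nd x : {homo q x : s t / s <= t}.
Proof. by move=> s t st; rewrite -subr_ge0 -family_diff // rd_ge0. Qed.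
Lemma family_rc x t : q x s @[s --> t^'+] --> q x t.
Proof.
apply/cvgrPdist_lt => e e0.
have h : q x (t + n.+1%:R^-1) @[n --> \oo] --> q x t by exact: hcvg_rdl.
have /cvgrPdist_lt/(_ _ e0)[N _ /(_ N (leqnn N))/= hN] := h.
near=> s; have ts : t <= s by [].
have sN : s <= t + N.+1%:R^-1.
  by near: s; apply: nbhs_right_le; rewrite ltrDl invr_gt0.
have h1 := family_nd x ts; have h2 := family_nd x sN.
apply: le_lt_trans hN; rewrite !ler0_norm ?subr_le0 ?(le_trans h1) //.
by rewrite lerN2 lerD2l lerN2.
Unshelve. all: by end_near. Qed.

Lemma family_meas_exists x : exists mu : {measure set (measurableTypeR R) -> \bar R},
  forall a b, a <= b -> mu `]a, b]%classic = (q x b - q x a)%:E.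
Proof. by apply: stieltjes_exists; [exact: family_nd|exact: family_rc]. Qed.

Let mu x := projT1 (cid (family_meas_exists x)).
Let muE x a b : a <= b -> mu x `]a, b]%classic = (q x b - q x a)%:E.
Proof. by rewrite /mu; case: cid => m h /=; exact: h. Qed.

Let muT x : mu x setT = (rd x x)%:E.
Proof.
pose I (n : nat) : set R := `]- n%:R, n%:R]%classic.
have UI : \bigcup_n I n = setT.
  apply/seteqP; split=> // t _; exists (Num.truncn `|t|).+1 => //.
  rewrite /I /= in_itv /=; have := truncnS_gt `|t|; rewrite ltr_norml => /andP[-> /ltW ->] //.
have h1 : (mu x \o I) n @[n --> \oo] --> mu x setT.
  rewrite -UI; apply: nondecreasing_cvg_mu => //.
  - by move=> n; exact: measurable_itv.
  - by apply: bigcup_measurable => n _; exact: measurable_itv.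
  - move=> n m nm; apply/subsetPset => t; rewrite /I /= !in_itv /= => /andP[h h'].
    by rewrite (le_lt_trans _ h) ?lerN2 ?ler_nat //= (le_trans h') // ler_nat.
have h2 : (mu x \o I) n @[n --> \oo] --> (rd x x)%:E.
  have -> : mu x \o I = fun n : nat => (q x n%:R - q x (- n%:R))%:E.
    by apply/funext => n /=; rewrite /I muE // ge0_cp.
  apply/cvg_EFin; first by near=> n.
  rewrite -[X in _ --> X]subr0 -[X in _ --> _ - X](rd0l hd x).
  by apply: cvgB; apply: hcvg_rdl.
exact: (cvg_unique (@ereal_hausdorff R) h1 h2).
Unshelve. all: by end_near. Qed.

(** The property carried through Dynkin's induction: the scalar measures of [B] are the quadratic
    form of one projection. Commutation is part of it because the operators whose calculus is built
    must later commute with the projections. *)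
Definition family_repr B (P : H -> H) := [/\ lin P, sym P, forall x, P (P x) = P x,
  forall x, mu x B = (rd (P x) x)%:E &
  forall F (M : R), lin F -> (forall x, hnorm d (F x) <= M * hnorm d x) ->
    (forall t x, F (E t x) = E t (F x)) -> forall x, F (P x) = P (F x)].

Lemma repr_norm B P x : family_repr B P -> rd (P x) x = rd (P x) (P x).
Proof. by move=> [_ sP iP _ _]; rewrite -{1}(iP x) sP. Qed.

(** At y = P x monotonicity of the measure squeezes the form of [Q] between the squared norm of [y]
    and itself, which forces Q y = y. *)
Lemma repr_sub B C P Q x : measurable B -> measurable C -> B `<=` C ->
  family_repr B P -> family_repr C Q -> Q (P x) = P x.
Proof.
move=> mB mC BC [lP sP iP qP _] [lQ sQ iQ qQ _].
apply/eqP; rewrite eq_sym -subr_eq0; apply/eqP/(rd_eq0 hd).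
set y := P x; have hy : rd (Q y) y <= rd y y <= rd (Q y) y.
  apply/andP; split; first by rewrite -lee_fin -qQ -muT le_measure ?inE.
  have -> : rd y y = rd (P y) y by rewrite /y iP.
  by rewrite -lee_fin -qP -qQ le_measure ?inE.
have e : rd (Q y) (Q y) = rd (Q y) y by rewrite -{3}(iQ y) [in RHS]sQ.
by rewrite !rdBl // !rdBr // (rdC hd y) e; move: hy; lra.
Qed.

(** At y = Q x the set [C] already has the full mass of the measure, so nothing is left for the
    disjoint set [B]. *)
Lemma repr_disj B C P Q x : measurable B -> measurable C -> B `&` C = set0 ->
  family_repr B P -> family_repr C Q -> P (Q x) = 0.
Proof.
move=> mB mC BC hP hQ; have [lP sP iP qP _] := hP; have [lQ sQ iQ qQ _] := hQ.
apply: (rd_eq0 hd); rewrite -(repr_norm _ hP); set y := Q x.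
have : mu y (B `|` C) = (mu y B + mu y C)%E by exact: measureU.
rewrite qP qQ => e; have : (mu y (B `|` C) <= mu y setT)%E.
  by apply: le_measure => //; rewrite inE //; exact: measurableU.
rewrite e muT -EFinD lee_fin {3}/y iQ -/y gerDr => h.
by apply/eqP; rewrite eq_le h (repr_norm _ hP) rd_ge0.
Qed.

Lemma repr_exists B : measurable B -> exists P, family_repr B P.
Proof.
have setUP B1 B2 P1 P2 : measurable B1 -> measurable B2 -> B1 `&` B2 = set0 ->
    family_repr B1 P1 -> family_repr B2 P2 ->
    family_repr (B1 `|` B2) (fun x => P1 x + P2 x).
  move=> m1 m2 d12 h1 h2; have [l1 s1 i1 q1 c1] := h1; have [l2 s2 i2 q2 c2] := h2; split.
  - exact: lin_add.
  - by move=> x y; rewrite rdDl // rdDr // s1 s2.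
  - move=> x; rewrite (linD l1) (linD l2) i1 i2 (repr_disj x m1 m2 d12 h1 h2).
    by rewrite (repr_disj x m2 m1 _ h2 h1) ?addr0 ?add0r // setIC.
  - move=> x; have -> : mu x (B1 `|` B2) = (mu x B1 + mu x B2)%E by exact: measureU.
    by rewrite q1 q2 rdDl.
  - by move=> F M lF bF cF x; rewrite (linD lF) (c1 F M) // (c2 F M).
move: B; apply: (@dynkin_induction _ (measurableTypeR R) (@ocitv R)) => //.
- exact: ocitvI.
- exists id; split=> //; exact: muT.
- move=> _ /ocitvP[->|[[a b] /= ab ->]].
    exists (fun=> 0); split=> //; first by move=> c x y; rewrite scaler0 addr0.
    + by move=> x y; rewrite rd0l // rd0r.
    + by move=> x; rewrite measure0 rd0l.
    + by move=> F M lF _ _ x; rewrite (lin0 lF).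
  exists (fun x => E b x - E a x); split.
  + exact: lin_sub.
  + by move=> x y; rewrite rdBl // rdBr // !sE.
  + move=> x; rewrite !(linB (lE _)) (iE x (lexx b)) (iE x (ltW ab)) (iE x (lexx a)).
    by rewrite (family_comm x (ltW ab)) subrr subr0.
  + by move=> x; rewrite muE ?(ltW ab) // rdBl.
  + by move=> F M lF bF cF x; rewrite (linB lF) !cF.
- move=> B mB [P hP]; have [lP sP iP qP cP] := hP; exists (fun x => x - P x); split.
  + exact: lin_sub.
  + by move=> x y; rewrite rdBl // rdBr // sP.
  + by move=> x; rewrite (linB lP) iP subrr subr0.
  + move=> x; have : mu x setT = (mu x B + mu x (~` B))%E.
      rewrite -(setUv B); apply: measureU => //; first exact: measurableC.
      exact: setICr.
    rewrite muT qP rdBl // => e.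
    move: e; case: (mu x (~` B)) => [r|//|//]; rewrite -EFinD => -[->].
    by rewrite addrC addKr.
  + by move=> F M lF bF cF x; rewrite (linB lF) (cP F M).
- move=> D mD tD hD; have /choice[P hP] := hD.
  pose S n x := \sum_(k < n) P k x.
  have mB n : measurable (\big[setU/set0]_(i < n) D i) by apply: bigsetU_measurable.
  have hS n : family_repr (\big[setU/set0]_(i < n) D i) (S n).
    elim: n => [|n IH].
      have -> : S 0%N = fun=> 0 by apply/funext => x; rewrite /S big_ord0.
      rewrite big_ord0; split=> //; first by move=> c x y; rewrite scaler0 addr0.
      + by move=> x y; rewrite rd0l // rd0r.
      + by move=> x; rewrite measure0 rd0l.
      + by move=> F M lF _ _ x; rewrite (lin0 lF).
    have -> : S n.+1 = fun x => S n x + P n x.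
      by apply/funext => x; rewrite /S big_ord_recr.
    rewrite big_ord_recr /=; apply: (setUP _ _ _ _ (mB n) (mD n) _ IH (hP n)).
    rewrite setIC; apply/seteqP; split => // t [Dt]; rewrite -bigcup_mkord => -[k /= kn Dk].
    have /trivIsetP/(_ n k Logic.I Logic.I) := tD.
    by rewrite neq_ltn kn orbT => /(_ isT) e; have : (D n `&` D k) t by []; rewrite e.
  have sub n m x : (n <= m)%N -> S m (S n x) = S n x.
    by move=> nm; apply: (repr_sub x (mB n) (mB m) _ (hS n) (hS m)); exact: subset_bigsetU.
  have mU : measurable (\bigcup_k D k) by exact: bigcup_measurable.
  have cmu x : (mu x (\big[setU/set0]_(i < n) D i)) @[n --> \oo] --> mu x (\bigcup_k D k).
    have -> : \bigcup_k D k = \bigcup_n \big[setU/set0]_(i < n) D i.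
      apply/seteqP; split=> [t [k _ Dk]|t [n _]].
        by exists k.+1 => //; rewrite -bigcup_mkord; exists k => //=.
      by rewrite -bigcup_mkord => -[k _ Dk]; exists k.
    apply: nondecreasing_cvg_mu => //; first exact: bigcup_measurable.
    by move=> n m nm; apply/subsetPset; exact: subset_bigsetU.
  have fmu x : mu x (\bigcup_k D k) \is a fin_num.
    rewrite ge0_fin_numE //; apply: (@le_lt_trans _ _ (mu x setT)); last by rewrite muT ltry.
    by apply: le_measure; rewrite ?inE.
  have cS x : rd (S n x) x @[n --> \oo] --> fine (mu x (\bigcup_k D k)).
    have -> : (fun n => rd (S n x) x) = fine \o (fun n => mu x (\big[setU/set0]_(i < n) D i)).
      by apply/funext => n /=; have [_ _ _ -> _] := hS n.
    by apply: fine_cvg; rewrite fineK //; exact: cmu.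
  (* The partial sums are increasing projections whose forms converge by countable additivity;
     [cauchy_dom] then gives the strong limit. *)
  have /choice[Q hQ] : forall x, exists y, hcvg (fun n => S n x) y.
    move=> x; apply: (ip_complete hd); apply: (cauchy_dom hd (cS x)) => n m nm.
    rewrite (hnorm2 hd); have [_ sn _ _ _] := hS n; have [_ sm _ _ _] := hS m.
    have e : rd (S n x) (S m x) = rd (S n x) x by rewrite -sm sub.
    rewrite !rdBl // !rdBr // (rdC hd (S m x) (S n x)) e -!(repr_norm _ (hS _)).
    by rewrite subrr subr0; exact: ler_norm.
  have lS n : lin (S n) by have [] := hS n.
  have sS n : sym (S n) by have [] := hS n.
  have sQ : sym Q by exact: (sym_lim hd _ hQ).
  exists Q; split => //.
  + exact: (lin_lim hd _ hQ).
  + move=> x; have h n : Q (S n x) = S n x.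
      apply: (hcvg_unique hd (hQ _)); apply: (@cvg_near_cst _ _ _ _ _ _).
      by exists n => // m /= nm; rewrite sub // subrr (hnorm0 hd).
    apply: (rd_ext hd) => y; rewrite sQ; apply/esym.
    apply: (rd_lim hd (hQ x)); under eq_fun do rewrite -h sQ.
    exact: hcvg_rdl.
  + by move=> x; rewrite -[LHS]fineK //; congr EFin; apply/esym/(rd_lim hd (hQ x)).
  + move=> F M lF bF cF x; apply: (hcvg_unique hd (hcvg_bnd lF bF (hQ x))).
    have e n : F (S n x) = S n (F x) by have [_ _ _ _ /(_ F M lF bF cF)] := hS n.
    by under eq_fun do rewrite e; exact: hQ.
Qed.

Definition family_proj B : H -> H :=
  if pselect (measurable B) is left h then projT1 (cid (repr_exists h)) else fun=> 0.
Lemma family_projP B : measurable B -> family_repr B (family_proj B).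
Proof. by rewrite /family_proj; case: pselect => // h _; case: cid. Qed.

Definition pvm_of_family : pvm (R := R) (H := H) := PVM family_proj mu.

Lemma pvm_of_familyP : is_pvm d pvm_of_family.
Proof.
split=> /=.
- move=> B mB; have [lP sP _ _ _] := family_projP mB.
  by split=> // x y; exact: (sym_d hd lP sP).
- move=> B C mB mC x; have mI : measurable (B `&` C) by exact: measurableI.
  have mD : measurable (B `\` C) by exact: measurableD.
  have hI := family_projP mI; have hB := family_projP mB; have hC := family_projP mC.
  have hD := family_projP mD.
  have [lI sI iI qI _] := hI; have [lB sB iB qB _] := hB.
  have [lD sD iD qD _] := hD; have [lC sC iC qC _] := hC.
  have e : family_proj B =1 fun y => family_proj (B `&` C) y + family_proj (B `\` C) y.
    apply: (sym_ext hd) => //.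
    + exact: lin_add.
    + by move=> y z; rewrite rdDl // rdDr // sI sD.
    + move=> y; have : mu y B = (mu y (B `&` C) + mu y (B `\` C))%E.
        have {1}-> : B = (B `&` C) `|` (B `\` C).
          apply/seteqP; split=> [t Bt|t [[]|[]] //].
          by have [Ct|Ct] := pselect (C t); [left|right].
        apply: measureU => //.
        by apply/seteqP; split=> // t [[_ ?] []].
      by rewrite qB qI qD rdDl // => -[].
  rewrite e (repr_disj x mD mC _ hD hC) ?addr0; last first.
    by apply/seteqP; split=> // t [[_ ?]].
  apply: (rd_ext hd) => y; rewrite !sI !sC.
  by rewrite (repr_sub y mI mC _ hI hC) //; exact: subIsetr.
- move=> x; have [lT sT _ qT _] := family_projP (@measurableT _ (measurableTypeR R)).
  by apply: (sym_ext hd (g := id) lT _ sT) => // y; have := qT y; rewrite muT => -[].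
- by move=> x B mB; have [_ _ _ -> _] := family_projP mB.
Qed.

Lemma pvm_of_family_ocitv a b x : a <= b ->
  pvm_proj pvm_of_family `]a, b]%classic x = E b x - E a x.
Proof.
move=> ab /=; have [lP sP _ qP _] := family_projP (measurable_itv `]a, b]).
apply: (sym_ext hd (g := fun x => E b x - E a x)) => //.
- exact: lin_sub.
- by move=> y z; rewrite rdBl // rdBr // !sE.
- by move=> y; have := qP y; rewrite muE // rdBl // => -[].
Qed.

Lemma pvm_of_family_comm F (M : R) B x : lin F -> (forall x, hnorm d (F x) <= M * hnorm d x) ->
  (forall t x, F (E t x) = E t (F x)) -> measurable B ->
  F (pvm_proj pvm_of_family B x) = pvm_proj pvm_of_family B (F x).
Proof. by move=> lF bF cF mB; have [_ _ _ _ /(_ F M lF bF cF)] := family_projP mB. Qed.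

End PvmOfFamily.

Section SpectralTheorem.
Context {R : realType} {H : lmodType R[i]} (d : H -> H -> R[i]) (hd : hilbert d).
Local Notation rd := (rdot d).
Local Notation sym := (sym d).
Local Notation hcvg := (hcvg d).
Local Notation contr := (contr d).
Implicit Types (x y z : H).

(** The graph is complex linear, so testing real parts on it decides membership in the adjoint. *)
Lemma adjP (A : op H) : linear_op A -> forall w,
  adj d A w <-> forall x y, A (x, y) -> rd y w.1 = rd x w.2.
Proof.
move=> lA w; split=> [h x y /h|h x y Axy]; first by rewrite /rd => ->.
apply: complexP; first exact: h.
have [h0 hl _] := lA; have := h _ _ (hl (- (0 +i* 1)) _ _ _ _ Axy h0).
have e v z : complex.Im (d v z) = rd (- (0 +i* 1) *: v) z.
  by rewrite /rd (dZl hd) ReM /=; ring.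
by rewrite !addr0 -!e.
Qed.

Lemma graph_subsp (A : op H) : linear_op A -> subsp A.
Proof. by move=> [h0 hl _]; split=> // c [x y] [x' y'] /= ? ?; exact: hl. Qed.

Lemma closed_graph (A : op H) : opclosure d A = A -> hclosed (dprod d) A.
Proof.
move=> e u x hu hx; rewrite -e (opclosureE hd).
apply/hclosureP; by exists u.
Qed.

Lemma adj_closed (A : op H) : linear_op A -> hclosed (dprod d) (adj d A).
Proof.
move=> lA u w hu hw; apply/(adjP lA) => x y Axy.
rewrite (rdC hd) (rdC hd x); apply: (rd_lim hd (hcvg_fst hd hw)).
have e n : rd (u n).1 y = rd (u n).2 x by rewrite (rdC hd) ((adjP lA _).1 (hu n) _ _ Axy) (rdC hd).
by under eq_fun do rewrite e; exact: (hcvg_rdl hd (hcvg_snd hd hw)).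
Qed.

(* Projecting (z, 0) onto the graph of A gives the pair ((1 + A^2)^-1 z, A (1 + A^2)^-1 z). *)
Lemma graph_resolvent (A : op H) z : linear_op A -> hclosed (dprod d) A ->
  exists c b, A (c, b) /\ adj d A (b, z - c).
Proof.
move=> lA cA; have hd2 := hilbert_prod hd; have sA := graph_subsp lA.
pose w := proj hd2 sA cA (z, 0); exists w.1, w.2; split.
  by have := proj_in hd2 sA cA (z, 0); rewrite -/w; case: w.
apply/(adjP lA) => x y Axy /=.
have := proj_orth hd2 sA cA (z, 0) Axy; rewrite -/w rd_prod /= sub0r rdNl //.
by move=> /eqP; rewrite subr_eq0 => /eqP e; rewrite (rdC hd) -e (rdC hd).
Qed.

(* von Neumann: [1 + Z^* Z] is onto, as one sees by projecting [(z, 0)] onto the graph of [Z]. *)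
Lemma adj_comp_selfadj (Z : op H) : closed_op d Z -> densely_defined d Z ->
  linear_op (opcomp (adj d Z) Z) /\ adj d (opcomp (adj d Z) Z) = opcomp (adj d Z) Z.
Proof.
move=> [lZ cZ] dZ; set S := opcomp _ _.
have Z0 : forall y, adj d Z (0, y) -> y = 0.
  move=> y /(adjP lZ) h; apply: (hnorm_eq0 hd); apply/eqP; rewrite eq_le hnorm_ge0 andbT.
  apply/ler_addgt0Pr => e e0; rewrite add0r.
  have [x' [x'' hx'] /ltW he] := dZ y e e0.
  have : rd x' y = 0 by have := h _ _ hx'; rewrite rd0r.
  move=> h0; have [->|y0] := eqVneq (hnorm d y) 0; first exact: ltW.
  have yp : 0 < hnorm d y by rewrite lt_def y0 hnorm_ge0.
  rewrite -(ler_pM2l yp) -expr2 (hnorm2 hd).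
  have -> : rd y y = rd (y - x') y by rewrite rdBl // h0 subr0.
  apply: le_trans (rd_le hd _ _) _; rewrite mulrC ler_wpM2l ?hnorm_ge0 //.
  by rewrite (hnormC hd).
have hl : forall c w w', S w -> S w' -> S (c *: w + w').
  move=> c [x z] [x' z'] [y [/= h1 h2]] [y' [/= h1' h2']]; exists (c *: y + y'); split=> /=.
    by have [_ hl _] := lZ; exact: hl.
  apply/(adjP lZ) => v v' hv /=; have := h2 _ _ hv; have := h2' _ _ hv => /= e1 e2.
  by rewrite /rd !(dDr hd) !(dZr hd) e1 e2.
have a0 : adj d Z (0, 0) by move=> x y _ /=; rewrite !(d0r hd).
have lS : linear_op S.
  split; first by exists 0; split => //=; have [] := lZ.
    by move=> c x y x' y'; exact: hl.
  move=> z [y [/= h1 h2]]; have [_ _ hu] := lZ; rewrite (hu _ h1) in h2; exact: Z0 h2.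
split=> //.
have symS x y x' y' : S (x, y) -> S (x', y') -> rd y x' = rd x y'.
  move=> [z [/= h1 h2]] [z' [/= h1' h2']].
  have e1 := (adjP lZ _).1 h2 _ _ h1'; have e2 := (adjP lZ _).1 h2' _ _ h1.
  by rewrite /= in e1 e2; rewrite (rdC hd) -e1 (rdC hd) e2.
have res z : exists c, S (c, z - c).
  have [c [b [h1 h2]]] := graph_resolvent z lZ (closed_graph cZ).
  by exists c, b.
apply/seteqP; split=> [[p q] /(adjP lS) h|[p q] hpq]; last first.
  by apply/(adjP lS) => x y hxy /=; exact: symS hxy hpq.
(* [c] solves (1 + S) c = p + q. Since (p, q) is in the adjoint, p - c is orthogonal to the range of
   1 + S, which is everything. *)
have [c hc] := res (p + q).
suff e : p = c by move: hc; rewrite -e addrC addKr.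
apply/eqP; rewrite -subr_eq0; apply/eqP/(rd_ext hd) => z; rewrite rd0l //.
have [x hx] := res z; have := h _ _ hx; have := symS _ _ _ _ hx hc => /= e1 e2.
have : rd (z - x) (p - c) = rd x (q - (p + q - c)) by rewrite rdBr // e2 e1 -rdBr.
have -> : q - (p + q - c) = - (p - c) by rewrite [p + q]addrC -addrA opprD addrA subrr add0r.
by rewrite rdBl // rdNr // (rdC hd (p - c)) => /eqP; rewrite subr_eq addNr => /eqP.
Qed.

(* With [Bo = A (1 + A^2)^-1] and [Co = (1 + A^2)^-1], the sign of [A - t] is that of the bounded
   operator [Bo - t Co]. *)
Section Family.
Variables (Bo Co : H -> H) (lB : lin Bo) (lC : lin Co) (sB : sym Bo) (sC : sym Co)
  (cB : contr Bo) (cC : contr Co) (pC : pos d Co) (iC : forall x, Co x = 0 -> x = 0)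
  (BC : forall x, Bo (Co x) = Co (Bo x)).

(** A positive factor that makes the operator a contraction, as [specproj_exists] wants, and leaves
    its sign unchanged. *)
Let sc (t : R) := (1 + `|t|)^-1.
Let sc_gt0 t : 0 < sc t. Proof. by rewrite invr_gt0 ltr_wpDr. Qed.
Let Dt t x := (sc t)%:C *: (Bo x - t%:C *: Co x).
Let lD t : lin (Dt t).
Proof. by apply: lin_scale; apply: lin_sub => //; exact: lin_scale. Qed.
Let sD t : sym (Dt t).
Proof. by move=> x y; rewrite rdZl // rdZr // rdBl // rdBr // rdZl // rdZr // sB sC. Qed.
Let cD t : contr (Dt t).
Proof.
move=> x; rewrite (hnormZr hd) gtr0_norm //.
have := hnormB hd (Bo x) (t%:C *: Co x); rewrite (hnormZr hd) => h.
rewrite mulrC ler_pdivrMr ?ltr_wpDr // (le_trans h) // mulrDr mulr1 lerD ?cB // mulrC.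
by rewrite ler_wpM2r // cC.
Qed.
Let rdD t x : rd (Dt t x) x = sc t * (rd (Bo x) x - t * rd (Co x) x).
Proof. by rewrite rdZl // rdBl // rdZl. Qed.

Definition sfam t : H -> H := projT1 (cid (specproj_exists hd (lD t) (sD t) (cD t))).
Lemma sfamP t : [/\ lin (sfam t), sym (sfam t), contr (sfam t) & forall x, sfam t (sfam t x) = sfam t x].
Proof. by rewrite /sfam; case: cid => F /= []. Qed.
Lemma sfam_le t x : sfam t x = x -> rd (Bo x) x <= t * rd (Co x) x.
Proof.
rewrite /sfam; case: cid => F /= [_ _ _ _ [h _ _ _]] /h.
by rewrite rdD pmulr_rle0 // subr_le0.
Qed.
Lemma sfam_ge t x : sfam t x = 0 -> t * rd (Co x) x <= rd (Bo x) x.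
Proof.
rewrite /sfam; case: cid => F /= [_ _ _ _ [_ h _ _]] /h.
by rewrite rdD pmulr_rge0 // subr_ge0.
Qed.
(** Vectors at the value [t] itself are put on the lower side; this makes the family continuous from
    the right. *)
Lemma sfam_ker t x : Bo x = t%:C *: Co x -> sfam t x = x.
Proof.
rewrite /sfam; case: cid => F /= [_ _ _ _ [_ _ h _]] e; apply: h.
by rewrite /Dt e subrr scaler0.
Qed.
Lemma sfam_comm t F : lin F -> sym F -> contr F -> (forall x, F (Bo x) = Bo (F x)) ->
  (forall x, F (Co x) = Co (F x)) -> forall x, F (sfam t x) = sfam t (F x).
Proof.
move=> lF sF cF FB FC; have FD x : F (Dt t x) = Dt t (F x).
  by rewrite /Dt (linZ lF) (linB lF) FB (linZ lF) FC.
rewrite /sfam; case: cid => G /= [_ _ _ _ [_ _ _ h]].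
by apply: (h F F 1) => // x; rewrite mul1r.
Qed.
Let lE t : lin (sfam t). Proof. by case: (sfamP t). Qed.
Let sE t : sym (sfam t). Proof. by case: (sfamP t). Qed.
Let cE t : contr (sfam t). Proof. by case: (sfamP t). Qed.
Let iE t x : sfam t (sfam t x) = sfam t x. Proof. by case: (sfamP t). Qed.

Lemma sfamB t x : Bo (sfam t x) = sfam t (Bo x). Proof. exact: sfam_comm. Qed.
Lemma sfamC t x : Co (sfam t x) = sfam t (Co x).
Proof. by apply: sfam_comm. Qed.
Lemma sfam_sfam s t x : sfam s (sfam t x) = sfam t (sfam s x).
Proof. by apply: sfam_comm => // y; rewrite ?sfamB ?sfamC. Qed.

Lemma C_eq0 x : rd (Co x) x <= 0 -> x = 0.
Proof.
move=> h; apply: iC; apply: (pos_eq0 hd lC sC pC cC).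
by apply/eqP; rewrite eq_le h; exact: pC.
Qed.

(** A vector below [s] and above [t] would satisfy t <C y, y> <= <B y, y> <= s <C y, y>; as s < t
    and C is positive and injective, it is zero. *)
Lemma sfam_mono s t x : s <= t -> sfam t (sfam s x) = sfam s x.
Proof.
rewrite le_eqVlt => /predU1P[->|st]; first exact: iE.
apply/eqP; rewrite eq_sym -subr_eq0; apply/eqP; set y := _ - _.
have h1 : sfam s y = y by rewrite /y (linB (lE s)) iE sfam_sfam iE.
have h2 : sfam t y = 0 by rewrite /y (linB (lE t)) iE subrr.
apply: C_eq0; have := le_trans (sfam_ge h2) (sfam_le h1).
by rewrite -subr_ge0 -mulrBl nmulr_rge0 // subr_lt0.
Qed.

Lemma sfam_dec s t x : s <= t -> rd (sfam t x - sfam s x) (sfam t x - sfam s x) =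
  rd (sfam t x) x - rd (sfam s x) x.
Proof.
move=> st; pose F y := sfam t y - sfam s y.
have sF : sym F by move=> y z; rewrite /F rdBl // rdBr // !sE.
have iF y : F (F y) = F y.
  by rewrite /F !(linB (lE _)) !iE sfam_mono // sfam_sfam sfam_mono // subrr subr0.
by rewrite -/(F x) -sF iF /F rdBl.
Qed.

Lemma sfam_seq_cvg (a : nat -> R) : (forall n m, (n <= m)%N -> a n <= a m) \/
  (forall n m, (n <= m)%N -> a m <= a n) ->
  exists Q : H -> H, forall x, hcvg (fun n => sfam (a n) x) (Q x).
Proof.
move=> ha; suff /choice[Q hQ] : forall x, exists y, hcvg (fun n => sfam (a n) x) y by exists Q.
move=> x; apply: (ip_complete hd); pose b n := rd (sfam (a n) x) x.
have nd s t : s <= t -> rd (sfam s x) x <= rd (sfam t x) x.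
  by move=> st; rewrite -subr_ge0 -sfam_dec // rd_ge0.
have bb n : `|b n| <= rd x x by apply: contr_qform.
have cb : cvgn b.
  case: ha => ha.
    apply: nondecreasing_is_cvgn => [n m /ha/nd //|].
    by exists (rd x x) => _ [n _ <-]; exact: le_trans (ler_norm _) (bb n).
  apply: nonincreasing_is_cvgn => [n m /ha/nd //|].
  exists (- rd x x) => _ [n _ <-]; have := bb n; by rewrite ler_norml => /andP[].
apply: (cauchy_dom hd cb) => n m nm; rewrite (hnorm2 hd).
case: ha => /(_ n m nm) ha; first by rewrite sfam_dec // ler_norm.
rewrite distrC; apply: le_trans (ler_norm _); rewrite -sfam_dec //.
by rewrite -opprB rdNl // rdNr // opprK.
Qed.

Lemma sfam_lim_form (a : nat -> R) Q : (forall x, hcvg (fun n => sfam (a n) x) (Q x)) ->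
  [/\ lin Q, sym Q, forall t x, Q (sfam t x) = sfam t (Q x), forall x, Q (Bo x) = Bo (Q x) &
   forall x, Q (Co x) = Co (Q x)].
Proof.
move=> hQ; split.
- exact: (lin_lim hd _ hQ).
- exact: (sym_lim hd _ hQ).
- move=> t x; apply: (hcvg_unique hd (hQ _)).
  under eq_fun do rewrite sfam_sfam; exact: hcvg_contr.
- move=> x; apply: (hcvg_unique hd (hQ _)).
  under eq_fun do rewrite -sfamB; exact: hcvg_contr.
- move=> x; apply: (hcvg_unique hd (hQ _)).
  under eq_fun do rewrite -sfamC; exact: hcvg_contr.
Qed.

(** The jump at [t] lies in the space [G] of vectors below every t + 1/(n+1) and above [t]. There
    the form of B - t C vanishes; [G] is invariant under this symmetric operator, so the operator
    itself vanishes on [G], and [sfam_ker] places the jump below [t]. *)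
Lemma sfam_right t x : hcvg (fun n => sfam (t + n.+1%:R^-1) x) (sfam t x).
Proof.
pose a n := t + n.+1%:R^-1 : R.
have ha n m : (n <= m)%N -> a m <= a n by move=> nm; rewrite /a lerD2l lef_pV2 ?posrE // ler_nat.
have at_ n : t <= a n by rewrite lerDl invr_ge0.
have [|Q hQ] := @sfam_seq_cvg a; first by right.
have [lQ sQ QE QB QC] := sfam_lim_form hQ.
suff e : Q x = sfam t x by rewrite -e.
apply/eqP; rewrite -subr_eq0; apply/eqP.
have Qt y : Q (sfam t y) = sfam t y.
  apply: (hcvg_unique hd (hQ _)); under eq_fun do rewrite sfam_mono //; exact: hcvg_cst.
have aQ n y : sfam (a n) (Q y) = Q y.
  apply: (hcvg_unique hd (hcvg_contr (lE _) (cE _) (hQ y))).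
  by apply: (hcvg_eventually (N := n) _ (hQ y)) => m nm; rewrite sfam_mono //; exact: ha.
pose G := [set z | (forall n, sfam (a n) z = z) /\ sfam t z = 0].
pose N z := Bo z - t%:C *: Co z.
have lN : lin N by apply: lin_sub => //; exact: lin_scale.
have sN : sym N by move=> y z; rewrite rdBl // rdBr // rdZl // rdZr // sB sC.
have GN z : G z -> G (N z).
  move=> [h1 h2]; split=> [n|]; rewrite /N (linB (lE _)) (linZ (lE _)) -sfamB -sfamC ?h1 //.
  by rewrite h2 (lin0 lB) (lin0 lC) scaler0 subr0.
have GD y z : G y -> G z -> G (y + z) /\ G (y - z).
  move=> [h1 h2] [h1' h2']; split; split=> [n|].
  - by rewrite (linD (lE _)) h1 h1'.
  - by rewrite (linD (lE _)) h2 h2' addr0.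
  - by rewrite (linB (lE _)) h1 h1'.
  - by rewrite (linB (lE _)) h2 h2' subr0.
have N0 z : G z -> rd (N z) z = 0.
  move=> [h1 h2]; rewrite rdBl // rdZl //; apply/eqP; rewrite subr_eq0 eq_le sfam_ge // andbT.
  apply: (@cvg_real_le _ (fun=> rd (Bo z) z) (fun n => a n * rd (Co z) z)).
  - by move=> n; exact: sfam_le.
  - exact: cvg_cst.
  - apply: cvgMl; rewrite -[X in _ --> X](addr0 t); apply: cvgD; first exact: cvg_cst.
    exact: cvg_harm.
have Gz : G (Q x - sfam t x).
  split=> [n|]; rewrite (linB (lE _)) ?aQ ?iE.
    by rewrite sfam_mono.
  by rewrite -QE Qt subrr.
have Nz : N (Q x - sfam t x) = 0.
  have [h1 h2] := GD _ _ Gz (GN _ Gz).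
  by apply: (rd_eq0 hd); rewrite (sym_polar hd _ _ lN sN) !N0 // subrr mulr0.
have [_ <-] := Gz; apply/esym/sfam_ker; apply/eqP; rewrite -subr_eq0; exact/eqP.
Qed.

Lemma arch_le0 (c b : R) : (forall n : nat, n%:R * c <= b) -> c <= 0.
Proof.
move=> h; rewrite leNgt; apply/negP => c0.
have := h (Num.truncn (b / c)).+1; rewrite -ler_pdivlMr // leNgt truncnS_gt //.
Qed.

(** What the limit misses lies above every integer [n], so n <C z, z> is bounded in [n] and C z =
    0. *)
Lemma sfam_top x : hcvg (fun n => sfam n%:R x) x.
Proof.
have [|Q hQ] := @sfam_seq_cvg (fun n => n%:R); first by left => n m nm; rewrite ler_nat.
suff e : Q x = x by rewrite -{2}e.
apply/eqP; rewrite eq_sym -subr_eq0; apply/eqP/C_eq0; set z := _ - _.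
apply: (@arch_le0 _ (rd (Bo z) z)) => n; apply: sfam_ge.
rewrite /z (linB (lE _)); apply/eqP; rewrite subr_eq0; apply/eqP/esym.
apply: (hcvg_unique hd (hcvg_contr (lE _) (cE _) (hQ x))).
apply: (hcvg_eventually (N := n) _ (hcvg_cst hd _)) => m nm.
by rewrite sfam_sfam sfam_mono // ler_nat.
Qed.
Lemma sfam_bot x : hcvg (fun n => sfam (- n%:R) x) 0.
Proof.
have [|Q hQ] := @sfam_seq_cvg (fun n => - n%:R); first by right => n m nm; rewrite lerN2 ler_nat.
suff e : Q x = 0 by rewrite -e.
apply: C_eq0; set z := Q x.
apply: (@arch_le0 _ (- rd (Bo z) z)) => n.
rewrite lerNr -mulNr; apply: sfam_le.
apply: (hcvg_unique hd (hcvg_contr (lE _) (cE _) (hQ x))).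
by apply: (hcvg_eventually (N := n) _ (hQ x)) => m nm; rewrite sfam_mono // lerN2 ler_nat.
Qed.

Let E := pvm_of_family hd lE sE (fun s t x h => sfam_mono x h) sfam_right sfam_top sfam_bot.
Let hE : is_pvm d E := pvm_of_familyP _ _ _ _ _ _ _.
Local Notation P := (pvm_proj E).
Let oc (s t : R) : set R := `]s, t]%classic.
Let moc s t : measurable (oc s t). Proof. exact: measurable_itv. Qed.
Let POC s t x : s <= t -> P (oc s t) x = sfam t x - sfam s x.
Proof. exact: pvm_of_family_ocitv. Qed.
Let mid := @measurable_id _ _ (setT : set R).
Let bdid s t : bdon id (oc s t).
Proof.
exists (`|s| + `|t|) => u; rewrite /oc /= in_itv /= ler_norml => /andP[h1 h2].
have := ler_norm t; have := ler_norm (- s); rewrite normrN.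
by have := normr_ge0 s; have := normr_ge0 t; move=> *; apply/andP; split; lra.
Qed.
Let bcut s t := bmeas_cut mid (moc s t) (bdid s t).
Let PB B x : measurable B -> Bo (P B x) = P B (Bo x).
Proof.
move=> mB; have b1 y : hnorm d (Bo y) <= 1 * hnorm d y by rewrite mul1r.
by apply: (pvm_of_family_comm hd lE sE _ sfam_right sfam_top sfam_bot _ _ b1) => // u y; exact: sfamB.
Qed.
Let PC B x : measurable B -> Co (P B x) = P B (Co x).
Proof.
move=> mB; have b1 y : hnorm d (Co y) <= 1 * hnorm d y by rewrite mul1r.
by apply: (pvm_of_family_comm hd lE sE _ sfam_right sfam_top sfam_bot _ _ b1) => // u y; exact: sfamC.
Qed.

(** With B = A C, its vanishing says that A is int id dE on the interval (s, t]. *)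
Let Nj s t x := P (oc s t) (Bo x) - phi hd hE (cutf id (oc s t)) (Co x).

(** One factor t - s bounds B - t C on the spectral subspace, where its form lies between -(t - s)
    times that of C and 0; the other bounds the integral of t - u over the interval. *)
Lemma Nj_base s t x : s <= t -> hnorm d (Nj s t x) <= 2 * (t - s) * hnorm d (P (oc s t) x).
Proof.
move=> st; set J := oc s t; have mJ : measurable J by exact: moc.
have lP := P_lin hE mJ; have sP := P_sym hE mJ.
pose F y := P J (Bo (P J y) - t%:C *: Co (P J y)).
have lF : lin F.
  by move=> c y z; rewrite /F lP lB lC scalerDr scalerA mulrC -scalerA opprD addrACA -scalerBr lP.
have sF : sym F.
  by move=> y z; rewrite /F sP rdBl // rdZl // sB sC -rdZr // -rdBr // sP.
have pt y : sfam t (P J y) = P J y.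
  by rewrite POC // (linB (lE t)) iE sfam_mono.
have ps y : sfam s (P J y) = 0.
  by rewrite POC // (linB (lE s)) iE sfam_sfam sfam_mono // subrr.
have qF y : `|rd (F y) y| <= (t - s) * rd y y.
  rewrite /F sP; set z := P J y; rewrite rdBl // rdZl //.
  have h1 := sfam_le (pt y); have h2 := sfam_ge (ps y); rewrite -/z in h1 h2.
  have h3 : rd (Co z) z <= rd z z := le_trans (ler_norm _) (contr_qform hd z cC).
  have h4 : rd z z <= rd y y.
    by rewrite -!(hnorm2 hd) ler_sqr ?nnegrE ?hnorm_ge0 //; exact: (P_contr hd hE mJ).
  have h5 : (t - s) * rd (Co z) z <= (t - s) * rd y y.
    by rewrite ler_wpM2l ?subr_ge0 // (le_trans h3).
  rewrite ler0_norm ?subr_le0 //; lra.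
have eF : P J (Bo x) - t%:C *: P J (Co x) = F (P J x).
  by rewrite /F !(P_idem hE) // (linB lP) (linZ lP) PB // PC // !(P_idem hE).
pose g := cutf (fun u => t - u) J.
have bg : bmeas g.
  apply: bmeas_cut => //; first exact: measurable_funB.
  have [M hM] := bdid s t; exists (`|t| + M) => u Ju.
  by rewrite (le_trans (ler_normB _ _)) // lerD2l; exact: hM.
have -> : Nj s t x = F (P J x) + phi hd hE g (Co (P J x)).
  rewrite -eF PC // (phi_P hd hE) // -phi_indicM //.
  have -> : (fun u => \1_J u * g u) = fun u => t * \1_J u - cutf id J u.
    apply/funext => u; rewrite /g /cutf indicE; case: (_ \in _); rewrite ?mul1r ?mul0r ?mulr1 ?mulr0 ?subrr //.
  have b1 := bmeas_indic mJ; rewrite phiB ?phiZ ?phi_indic //; [|exact: bmeasZ|exact: bcut].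
  by rewrite /Nj -/J addrA subrK.
have k1 : hnorm d (F (P J x)) <= (t - s) * hnorm d (P J x) by exact: (sym_bound hd lF sF qF).
suff k2 : hnorm d (phi hd hE g (Co (P J x))) <= (t - s) * hnorm d (P J x).
  by apply: le_trans (hnormD hd _ _) _; lra.
apply: (@le_trans _ _ ((t - s) * hnorm d (Co (P J x)))); last first.
  by apply: ler_wpM2l; [rewrite subr_ge0|exact: cC].
apply: phi_bound => // u; have [Ju|Ju] := pselect (J u).
  rewrite /g cutfM //; move: Ju; rewrite /J /oc /= in_itv /= => /andP[h1 h2].
  by rewrite ger0_norm ?subr_ge0 // lerD2l lerN2 ltW.
by rewrite /g cutfN // normr0 subr_ge0.
Qed.

Lemma oc_split s m t : s <= m -> m <= t -> oc s t = oc s m `|` oc m t /\ oc s m `&` oc m t = set0.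
Proof.
move=> sm mt; split; apply/seteqP; split=> // u; rewrite /oc /= !in_itv /=.
- move=> /andP[su ut]; have [um|mu] := leP u m; [left|right]; first by rewrite su.
  by rewrite ut.
- move=> [/andP[-> um]|/andP[mu ->]]; rewrite ?andbT /=; first exact: le_trans um mt.
  exact: le_lt_trans sm mu.
- by move=> [/andP[_ um] /andP[mu _]]; move: (lt_le_trans mu um); rewrite ltxx.
Qed.

(** Bisection: the two halves are orthogonal and each carries half the constant, so squared norms
    add up and every step gains a factor 1/2. *)
Lemma Nj_bound k s t x : s <= t ->
  hnorm d (Nj s t x) <= 2^-1 ^+ k * (2 * (t - s)) * hnorm d (P (oc s t) x).
Proof.
elim: k s t x => [|k IH] s t x st; first by rewrite expr0 mul1r; exact: Nj_base.
pose m := (s + t) / 2; have sm : s <= m by rewrite /m; lra.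
have mt : m <= t by rewrite /m; lra.
have [eU eI] := oc_split sm mt.
have m1 := moc s m; have m2 := moc m t.
have orth y z : rd (P (oc s m) y) (P (oc m t) z) = 0.
  by rewrite (P_sym hE) // -(P_I hE) // eI (P_0 hd hE) rd0r.
have e1 : Nj s t x = Nj s m x + Nj m t x.
  rewrite /Nj eU (P_setU hd hE) // addrACA -opprD; congr (_ - _).
  rewrite -phiD //; try exact: bcut; congr (phi _ _ _ _); apply/funext => u.
  rewrite /cutf -mulrDl; congr (_ * _); rewrite !indicE in_setU -natrD; congr (_%:R).
  have : ~ ((u \in oc s m) /\ (u \in oc m t)).
    by rewrite !inE => h; have : (oc s m `&` oc m t) u by []; rewrite eI.
  by case: (_ \in oc s m); case: (_ \in oc m t) => // h; exfalso; apply: h.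
have NP a b y : Nj a b y = P (oc a b) (Nj a b y).
  rewrite /Nj (linB (P_lin hE (moc a b))) (P_idem hE) // (cut_comp hd hE mid) //.
have eN : rd (Nj s t x) (Nj s t x) = rd (Nj s m x) (Nj s m x) + rd (Nj m t x) (Nj m t x).
  rewrite e1 [Nj s m x]NP [Nj m t x]NP rdDl // !rdDr // orth (rdC hd (P (oc m t) _)) orth.
  by rewrite addr0 add0r.
have eP : rd (P (oc s t) x) (P (oc s t) x) = rd (P (oc s m) x) (P (oc s m) x) + rd (P (oc m t) x) (P (oc m t) x).
  rewrite eU (P_setU hd hE) // rdDl // !rdDr // orth (rdC hd (P (oc m t) _)) orth.
  by rewrite addr0 add0r.
set c := 2^-1 ^+ k.+1 * _; have c0 : 0 <= c.
  by rewrite /c mulr_ge0 ?exprn_ge0 ?mulr_ge0 ?subr_ge0.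
have hn y : 0 <= hnorm d y by exact: hnorm_ge0.
have ec1 : c = 2^-1 ^+ k * (2 * (m - s)) by rewrite /c exprS /m; field.
have ec2 : c = 2^-1 ^+ k * (2 * (t - m)) by rewrite /c exprS /m; field.
apply: le_hnormP => //; first by rewrite mulr_ge0 ?hnorm_ge0.
rewrite exprMn (hnorm2 hd) eN eP mulrDr -!(hnorm2 hd) -!exprMn lerD //.
  by apply: lerXn2r; [exact: hn|by rewrite nnegrE mulr_ge0|by have := IH _ _ x sm; rewrite -ec1].
by apply: lerXn2r; [exact: hn|by rewrite nnegrE mulr_ge0|by have := IH _ _ x mt; rewrite -ec2].
Qed.

Lemma Nj0 s t x : s <= t -> P (oc s t) (Bo x) = phi hd hE (cutf id (oc s t)) (Co x).
Proof.
move=> st; apply/eqP; rewrite -subr_eq0; apply/eqP/(hnorm_eq0 hd)/eqP.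
rewrite eq_le hnorm_ge0 andbT.
apply: (@cvg_real_le _ (fun=> hnorm d (Nj s t x))
   (fun k => 2^-1 ^+ k * (2 * (t - s)) * hnorm d (P (oc s t) x))).
- by move=> k; exact: Nj_bound.
- exact: cvg_cst.
- by apply: cvg0Zr; apply: cvg0Zr; apply: cvg_expr; rewrite ger0_norm //; lra.
Qed.

Lemma sfam_integral : exists2 F : pvm, is_pvm d F & forall x, pvm_integral d F id (Co x, Bo x).
Proof.
exists E => // x.
have hB : exhaust (fun n => oc (- n%:R) n%:R).
  split.
  - by move=> n; exact: moc.
  - move=> n m nm; apply/subsetPset => t; rewrite /oc /= !in_itv /= => /andP[h h'].
    by rewrite (le_lt_trans _ h) ?lerN2 ?ler_nat //= (le_trans h') // ler_nat.
  - apply/seteqP; split=> // t _; exists (Num.truncn `|t|).+1 => //.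
    by rewrite /oc /= in_itv /=; have := truncnS_gt `|t|; rewrite ltr_norml => /andP[-> /ltW ->].
apply: (pvm_integral_exh (hE := hE) mid hB) => n; first exact: bdid.
by apply: Nj0; rewrite ge0_cp.
Qed.
End Family.

Theorem spectral_theorem (A : op H) : linear_op A -> adj d A = A ->
  exists E, is_spectral_measure d A E.
Proof.
move=> lA aA; have cA : hclosed (dprod d) A by rewrite -aA; exact: adj_closed.
have [A0 hl Au] := lA.
have symA x y x' y' : A (x, y) -> A (x', y') -> rd y x' = rd x y'.
  by move=> h; rewrite -{1}aA => /(adjP lA) /(_ _ _ h).
have Afun x y y' : A (x, y) -> A (x, y') -> y = y'.
  move=> h h'; apply/eqP; rewrite -subr_eq0; apply/eqP/Au.
  by have := hl (-1) _ _ _ _ h' h; rewrite !scaleN1r addNr addrC.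
have AD x y x' y' : A (x, y) -> A (x', y') -> A (x + x', y + y').
  by move=> h h'; have := hl 1 _ _ _ _ h h'; rewrite !scale1r.
have AB x y x' y' : A (x, y) -> A (x', y') -> A (x - x', y - y').
  by move=> h h'; have := hl (-1) _ _ _ _ h' h; rewrite !scaleN1r ![- _ + _]addrC.
have /choice[Co hCo] : forall z, exists c, exists b, A (c, b) /\ A (b, z - c).
  by move=> z; have := graph_resolvent z lA cA; rewrite aA.
have /choice[Bo hB] := hCo.
have h1 z : A (Co z, Bo z) := (hB z).1.
have h2 z : A (Bo z, z - Co z) := (hB z).2.
(* The difference (p, q) of two solutions gives pairs (p, q) and (q, -p) in the symmetric graph,
   whence the squared norms of [p] and [q] add up to 0. *)
have uniq z c b : A (c, b) -> A (b, z - c) -> c = Co z /\ b = Bo z.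
  move=> g1 g2; have k1 := AB _ _ _ _ g1 (h1 z); have := AB _ _ _ _ g2 (h2 z).
  have -> : z - c - (z - Co z) = - (c - Co z) by rewrite !opprB [z - c]addrC [RHS]addrC -addrA; congr (_ + _); rewrite addrC subrK.
  set p := c - Co z in k1 *; set q := b - Bo z in k1 *; move=> k2.
  have := symA _ _ _ _ k1 k2; rewrite rdNr // => /eqP; rewrite -addr_eq0.
  rewrite paddr_eq0 ?rd_ge0 // => /andP[/eqP/(rd_eq0 hd)/eqP + /eqP/(rd_eq0 hd)/eqP].
  by rewrite !subr_eq0 => /eqP -> /eqP ->.
have lin2 : lin Co /\ lin Bo.
  have h c x y : c *: Co x + Co y = Co (c *: x + y) /\ c *: Bo x + Bo y = Bo (c *: x + y).
    apply: uniq; first exact: hl.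
    have := hl c _ _ _ _ (h2 x) (h2 y); congr (A (_, _)).
    by rewrite scalerBr opprD addrACA.
  by split=> c x y; [case: (h c x y)|case: (h c x y)].
have [lC lB] := lin2.
have sC : sym Co.
  move=> x y; rewrite -{1}(subrK (Co y) y) -{2}(subrK (Co x) x).
  rewrite rdDr // rdDl //; congr (_ + _).
  by rewrite -(symA _ _ _ _ (h1 x) (h2 y)) (symA _ _ _ _ (h2 x) (h1 y)).
have pC0 x : rd (Co x) x = rd (Co x) (Co x) + rd (Bo x) (Bo x).
  by rewrite -{2}(subrK (Co x) x) rdDr // -(symA _ _ _ _ (h1 x) (h2 x)) addrC.
have pC : pos d Co by move=> x; rewrite pC0 addr_ge0 // rd_ge0.
have le1 x : hnorm d (Co x) ^+ 2 + hnorm d (Bo x) ^+ 2 <= hnorm d (Co x) * hnorm d x.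
  by rewrite !(hnorm2 hd) -pC0; exact: rd_le.
have cC : contr Co.
  move=> x; have := le1 x; have := @hnorm_ge0 _ _ d (Co x); have := @hnorm_ge0 _ _ d x.
  move: (hnorm d (Co x)) (hnorm d x) (hnorm d (Bo x)) => a b c b0 a0 h; nra.
have cB : contr Bo.
  move=> x; have := le1 x; have := cC x; have := @hnorm_ge0 _ _ d (Co x).
  have := @hnorm_ge0 _ _ d x; have := @hnorm_ge0 _ _ d (Bo x).
  move: (hnorm d (Co x)) (hnorm d x) (hnorm d (Bo x)) => a b c c0 b0 a0 ab h; nra.
have sB : sym Bo.
  move=> x y; rewrite -{1}(subrK (Co y) y) -{2}(subrK (Co x) x) rdDr // rdDl //.
  rewrite (symA _ _ _ _ (h1 x) (h1 y)) -(symA _ _ _ _ (h2 x) (h2 y)); congr (_ + _).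
have CA x y : A (x, y) -> Co y = Bo x.
  move=> hxy; have [|-> _] // := uniq y (Bo x) (x - Co x) (h2 x); exact: (AB _ _ _ _ hxy (h1 x)).
have BC x : Bo (Co x) = Co (Bo x) by rewrite (CA _ _ (h1 x)).
have iC x : Co x = 0 -> x = 0.
  move=> e; have := h1 x; rewrite e => /Au b0; have := h2 x; rewrite e b0 => /Au.
  by rewrite subr0.
have [F hF hI] := sfam_integral lB lC sB sC cB cC pC iC BC.
have mid := @measurable_id _ _ (setT : set R).
exists F; split=> //.
have aI := pvm_integral_adj hd hF mid; have lI := pvm_integral_lin hd hF mid.
(* One inclusion suffices because both sides are selfadjoint and taking adjoints reverses it. *)
suff AI : A `<=` pvm_integral d F id.
  apply/seteqP; split=> // w; rewrite -aI -[in X in _ -> X]aA => hw x y hxy; exact/hw/AI.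
have hd2 := hilbert_prod hd.
pose G0 := [set w : H * H | exists x, w = (Co x, Bo x)].
have sG0 : subsp G0.
  split; first by exists 0; rewrite (lin0 lC) (lin0 lB).
  by move=> c _ _ [x ->] [y ->]; exists (c *: x + y); rewrite lC lB.
have sG := hclosure_subsp hd2 sG0; have cG : hclosed (dprod d) (hclosure (dprod d) G0) by apply: hclosure_closed.
have GA : hclosure (dprod d) G0 `<=` A by apply: hclosure_le => // _ [x ->]; exact: h1.
have GI : hclosure (dprod d) G0 `<=` pvm_integral d F id.
  apply: hclosure_le; first by move=> _ [x ->].
  by rewrite -aI; exact: adj_closed.
move=> [a a'] haa; apply: GI.
pose w := proj hd2 sG cG (a, a').
have hw : A w by apply: GA; exact: proj_in.
have ho x := proj_orth hd2 sG cG (a, a') (hclosure_sub hd2 (ex_intro (fun y => (Co x, Bo x) = (Co y, Bo y)) x erefl) : hclosure (dprod d) G0 (Co x, Bo x)).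
have he : A (a - w.1, a' - w.2) by apply: AB => //; move: hw; case: (w).
(* The pairs (C x, B x) form a core: a pair of the graph orthogonal to all of them has its first
   component orthogonal to C x + (x - C x) = x for every [x]. *)
have e0 : a - w.1 = 0.
  apply: (rd_ext hd) => x; rewrite rd0l // -(ho x) -/w rd_prod /=.
  by rewrite (symA _ _ _ _ he (h2 x)) -rdDr // [Co x + _]addrC subrK.
have -> : (a, a') = w.
  move: he; rewrite e0 => /Au /eqP; rewrite subr_eq0 => /eqP e2.
  by move/eqP: e0; rewrite subr_eq0 => /eqP e1; rewrite e1 e2; case: (w).
exact: proj_in.
Qed.

End SpectralTheorem.

(** * Operators given by spectral integrals: forms, absolute values, eigenvectors *)

Section IntegralExtras.
Context {R : realType} {H : lmodType R[i]} (d : H -> H -> R[i]) (hd : hilbert d).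
Variables (E : pvm) (hE : is_pvm d E).
Local Notation P := (pvm_proj E).
Local Notation phi := (phi hd hE).
Local Notation I f := (pvm_integral d E f).
Local Notation meas := (measurable_fun (setT : set R)).
Implicit Types (f g : R -> R) (C : set R).

Lemma pvm_integral_P f C x : meas f -> measurable C -> bdon f C ->
  I f (P C x, phi (cutf f C) x).
Proof.
move=> mf mC bC; apply/(pvm_integral_levP hd hE mf) => n /=.
have bf := bmeas_cut mf mC bC; have mL := lev_meas n mf.
rewrite -phi_indicM // phi_P //; last exact: bmeas_cut mf mL (lev_bd f n).
rewrite -phi_indicM //; last exact: bmeas_cut mf mL (lev_bd f n).
by congr (phi _ _); apply/funext => t; rewrite /cutf mulrCA.
Qed.
Lemma pvm_integral_P0 f C x : meas f -> measurable C -> (forall t, C t -> f t = 0) ->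
  I f (P C x, 0).
Proof.
move=> mf mC f0; have bC : bdon f C by exists 0 => t /f0 ->; rewrite normr0.
have := pvm_integral_P x mf mC bC; congr (I f (_, _)).
apply: (hnorm_eq0 hd); apply/eqP; rewrite eq_le hnorm_ge0 andbT.
have := @phi_bound _ _ _ hd _ hE (cutf f C) 0 x (bmeas_cut mf mC bC); rewrite mul0r; apply=> t.
by have [Ct|Ct] := pselect (C t); [rewrite cutfM // f0|rewrite cutfN]; rewrite // normr0.
Qed.
Lemma pvm_integral_closed f : meas f -> closed_op d (I f).
Proof.
move=> mf; split; first exact: pvm_integral_lin.
rewrite (opclosureE hd); apply: hclosure_id; first exact: hilbert_prod.
by rewrite -(pvm_integral_adj hd hE mf); apply: (adj_closed hd); exact: pvm_integral_lin.
Qed.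
Lemma pvm_integral_dense f : meas f -> densely_defined d (I f).
Proof.
move=> mf x e e0; have [mL hL UL] := lev_exhaust mf.
have /hcvgP/(_ e e0)[N /(_ N (leqnn _)) hN] := P_cvg hd hE x mL hL UL.
exists (P (lev f N) x) => //; eexists; apply: pvm_integral_P => //; exact: lev_bd.
Qed.
Lemma pvm_integral_bounded f : bmeas f -> I f = [set w | w.2 = phi f w.1].
Proof.
move=> bf; have [mf [M hM]] := bf.
have bT : bdon f setT by exists M => t _; exact: hM.
have e x : I f (x, phi f x).
  have := pvm_integral_P x mf measurableT bT; rewrite (P_T hE); congr (I f (_, phi _ _)).
  by apply/funext => t; rewrite cutfM.
apply/seteqP; split=> [[x y] h|[x y] /= ->] //=.
exact: (pvm_integral_fun hd hE mf h (e x)).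
Qed.

Lemma spectral_int f (g : R -> R) x : meas f -> meas g -> (forall t, 0 <= g t) ->
  (\int[pvm_meas (spectral_measure d (I f)) x]_(t in setT) (g t)%:E =
   \int[pvm_meas E x]_(t in setT) (g (f t))%:E)%E.
Proof.
move=> mf mg g0.
transitivity (\int[pvm_meas (pvm_push E mf) x]_(t in setT) (g t)%:E)%E.
  apply: eq_measure_integral => C mC _.
  by rewrite (spectral_measure_mu hd (pvm_push_spectral hd hE mf)).
have mf' : measurable_fun setT (f : measurableTypeR R -> measurableTypeR R) := mf.
have := @ge0_integral_pushforward _ _ _ _ _ _ mf' (pvm_meas E x) setT (EFin \o g) measurableT.
rewrite preimage_setT => -> //; first exact/measurable_EFinP.
by move=> y _; rewrite lee_fin.
Qed.

End IntegralExtras.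

Section FunctionalParts.
Context {R : realType} {H : lmodType R[i]} (d : H -> H -> R[i]) (hd : hilbert d).
Variables (E : @pvm R H) (hE : is_pvm d E).
Local Notation rd := (rdot d).
Local Notation P := (pvm_proj E).
Local Notation phi := (phi hd hE).
Local Notation I f := (pvm_integral d E f).
Local Notation meas := (measurable_fun (setT : set R)).
Implicit Types (f g : R -> R) (C : set R) (x y : H).

Lemma pvm_dom_le f g x : meas f -> meas g -> (forall t, f t ^+ 2 <= 1 + g t ^+ 2) ->
  pvm_dom E g x -> pvm_dom E f x.
Proof.
move=> mf mg fg hg; rewrite /pvm_dom /=.
have mf2 : meas (fun t => f t ^+ 2) by exact: measurable_funX.
have mg2 : meas (fun t => g t ^+ 2) by exact: measurable_funX.
apply: (@le_lt_trans _ _ (\int[pvm_meas E x]_(t in setT) (1%:E + (g t ^+ 2)%:E))%E).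
  apply: ge0_le_integral => //.
  - by move=> t _; rewrite lee_fin sqr_ge0.
  - exact/measurable_EFinP.
  - by apply: emeasurable_funD => //; exact/measurable_EFinP.
  - by move=> t _; rewrite -EFinD lee_fin.
rewrite ge0_integralD //; last 2 first.
- by move=> t _; rewrite lee_fin sqr_ge0.
- exact/measurable_EFinP.
by apply: lte_add_pinfty => //; rewrite integral_cst // mul1e; exact: (mu_lty hE).
Qed.

Lemma sqrt_meas : meas (@Num.sqrt R).
Proof. apply: continuous_measurable_fun; exact: sqrt_continuous. Qed.
Definition sqp t : R := Num.sqrt (Num.max t 0).
Definition sqm t : R := Num.sqrt (Num.max (- t) 0).
Lemma sqp_meas : meas sqp.
Proof.
have m : meas (fun t => Num.max t 0) by apply: measurable_maxr.
exact: (measurableT_comp sqrt_meas m).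
Qed.
Lemma sqm_meas : meas sqm.
Proof.
have m : meas (fun t => Num.max (- t) 0) by apply: measurable_maxr => //; exact: measurable_funN.
exact: (measurableT_comp sqrt_meas m).
Qed.
Lemma sqp2 t : sqp t ^+ 2 = Num.max t 0.
Proof. by rewrite sqr_sqrtr // le_max lexx orbT. Qed.
Lemma sqm2 t : sqm t ^+ 2 = Num.max (- t) 0.
Proof. by rewrite sqr_sqrtr // le_max lexx orbT. Qed.
Lemma sqpm t : sqp t ^+ 2 - sqm t ^+ 2 = t.
Proof.
rewrite sqp2 sqm2; have [h|h] := lerP t 0; have [h'|h'] := lerP (- t) 0; rewrite ?sub0r ?subr0 ?opprK //; lra.
Qed.
Lemma sqp_le t : sqp t ^+ 2 <= 1 + t ^+ 2.
Proof. by rewrite sqp2 ge_max; have := sqr_ge0 (t - 1); have := sqr_ge0 t => *; apply/andP; split; nra. Qed.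
Lemma sqm_le t : sqm t ^+ 2 <= 1 + t ^+ 2.
Proof. by rewrite sqm2 ge_max; have := sqr_ge0 (t + 1); have := sqr_ge0 t => *; apply/andP; split; nra. Qed.

Let mid : meas id := @measurable_id _ _ setT.
Lemma dom_sqp x y : I id (x, y) -> exists z, I sqp (x, z).
Proof.
move=> [h _]; apply: (pvm_integral_dom hd hE sqp_meas).
exact: (pvm_dom_le sqp_meas mid sqp_le).
Qed.
Lemma dom_sqm x y : I id (x, y) -> exists z, I sqm (x, z).
Proof.
move=> [h _]; apply: (pvm_integral_dom hd hE sqm_meas).
exact: (pvm_dom_le sqm_meas mid sqm_le).
Qed.

(** On truncations [sqp]^2 - [sqm]^2 is the identity function in the bounded calculus. In the limit
    the second argument only has to lie in the domains of the two square roots, as form domain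
    vectors do. *)
Lemma sqpm_form x w y xp xm yp ym : I id (x, w) -> I sqp (x, xp) -> I sqm (x, xm) ->
  I sqp (y, yp) -> I sqm (y, ym) -> rd w y = rd xp yp - rd xm ym.
Proof.
move=> hw hxp hxm hyp hym.
pose B := lev (id : R -> R); have eB : exhaust B := lev_exhaust mid.
have bB k : bdon id (B k) := lev_bd id k.
have [mB nB UB] := eB.
have bd f : (forall t, f t ^+ 2 <= 1 + t ^+ 2) -> forall k, bdon f (B k).
  move=> hf k; have [M hM] := bB k; exists (1 + M ^+ 2) => t Bt.
  have := hf t; have := hM t Bt; rewrite -[id t]/t -(real_normK (num_real t)) -(real_normK (num_real (f t))).
  have := normr_ge0 t; have := normr_ge0 (f t); move: (`|t|) (`|f t|) => a b b0 a0 aM h.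
  have h2 : b ^+ 2 <= 1 + M ^+ 2 by apply: le_trans h _; rewrite lerD2l lerXn2r ?nnegrE ?(le_trans a0).
  have [b1|b1] := lerP b 1; first by rewrite (le_trans b1) // lerDl sqr_ge0.
  by apply: le_trans h2; rewrite expr2 ler_peMr // ltW.
have bp := bd _ sqp_le; have bm := bd _ sqm_le.
have c1 : rd (P (B k) w) y @[k --> \oo] --> rd w y.
  by apply: (hcvg_rdl hd); exact: (P_cvg hd hE).
have c2 f z z' v v' : meas f -> (forall k, bdon f (B k)) -> I f (z, z') -> I f (v, v') ->
    rd (phi (cutf f (B k)) z) (phi (cutf f (B k)) v) @[k --> \oo] --> rd z' v'.
  move=> mf bf h h'; by apply: (hcvg_rd hd); [exact: (pvm_integral_cvg hd hE mf h eB bf)|exact: (pvm_integral_cvg hd hE mf h' eB bf)].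
apply: (@cvg_real_unique _ (fun k => rd (P (B k) w) y)) => //.
have e k : rd (P (B k) w) y = rd (phi (cutf sqp (B k)) x) (phi (cutf sqp (B k)) y) -
    rd (phi (cutf sqm (B k)) x) (phi (cutf sqm (B k)) y).
  rewrite (pvm_integral_loc hd hE mid hw (mB k) (bB k)) /=.
  have bfp := bmeas_cut sqp_meas (mB k) (bp k); have bfm := bmeas_cut sqm_meas (mB k) (bm k).
  rewrite -!(phi_sym hd hE) // -(phiM hd hE x bfp bfp) -(phiM hd hE x bfm bfm) -(rdBl hd) -phiB; try exact: bmeasM.
  congr (rd (phi _ _) _); apply/funext => t; have [Bt|Bt] := pselect (B k t).
    by rewrite !cutfM // -!expr2 sqpm.
  by rewrite !cutfN // mul0r subr0.
under eq_fun do rewrite e; apply: cvgB.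
  exact: (c2 _ _ _ _ _ sqp_meas bp).
exact: (c2 _ _ _ _ _ sqm_meas bm).
Qed.

Lemma pvm_integral_ge0 x w : (forall z, P `]-oo, 0[ z = 0) -> I id (x, w) -> 0 <= rd w x.
Proof.
move=> h hw; have [xp hxp] := dom_sqp hw; have [xm hxm] := dom_sqm hw.
rewrite (sqpm_form hw hxp hxm hxp hxm).
have e : I sqm = I (fun=> 0).
  apply: (pvm_integral_ae hd hE (C := `]-oo, 0[%classic)) => //; first exact: sqm_meas.
  move=> t /=; rewrite in_itv /= => /negP; rewrite -leNgt => t0.
  by rewrite /sqm; have -> : Num.max (- t) 0 = 0; [apply/max_idPr; rewrite oppr_le0|rewrite sqrtr0].
have xm0 : xm = 0.
  rewrite e in hxm; have := pvm_integral_P0 hd hE x (@measurable_cst _ _ _ _ _ (0 : R)) measurableT (fun _ _ => erefl).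
  rewrite (P_T hE) => h0.
  exact: (pvm_integral_fun hd hE (@measurable_cst _ _ _ _ _ (0 : R)) hxm h0).
by rewrite xm0 (rd0r hd) subr0 rd_ge0.
Qed.

(** No domain is lost: integrability of f^4 implies that of f^2 for a finite measure. *)
Lemma pvm_integral_square f : meas f -> opcomp (I f) (I f) = I (fun t => f t ^+ 2).
Proof.
move=> mf; apply/seteqP; split=> [w /(pvm_comp hd hE w mf mf) [_]|w hw].
  by congr (I _ w); apply/funext => t; rewrite expr2.
apply/(pvm_comp hd hE w mf mf); split.
  apply: (@pvm_dom_le f (fun t => f t ^+ 2)) => //; first exact: measurable_funX.
    by move=> t; have := sqr_ge0 (f t ^+ 2 - 1); have := sqr_ge0 (f t); nra.
  by case: hw.
by move: hw; congr (I _ w); apply/funext => t; rewrite expr2.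
Qed.
Lemma opabs_integral f : meas f -> opabs d (I f) = I (fun t => `|f t|).
Proof.
move=> mf; rewrite /opabs /oppow (pvm_integral_adj hd hE mf) (pvm_integral_square mf).
have mf2 : meas (fun t => f t ^+ 2) by exact: measurable_funX.
rewrite (fcalcE hd _ (pvm_push_spectral hd hE mf2)) (pvm_integral_push hd hE mf2); last exact: measurable_powR.
by congr (I _); apply/funext => t /=; rewrite powR12_sqrt ?sqr_ge0 // sqrtr_sqr.
Qed.

(** The difference is defined only on the domain of int id dE, while the right side may have a
    larger one; truncated vectors form a core, so the closure makes up for it. *)
Lemma negative_part_integral :
  opclosure d (opscale 2^-1 (opsub (I (fun t => `|t|)) (I id))) = I (fun t => sqm t ^+ 2).
Proof.
have mn : meas (fun t => `|t|) by exact: normr_measurable.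
have m2 : meas (fun t => sqm t ^+ 2) by apply: measurable_funX; exact: sqm_meas.
have half : (2^-1 : R[i]) = (2^-1 : R)%:C.
  by rewrite [RHS]fmorphV; congr (_^-1); rewrite rmorph_nat.
have e t : sqm t ^+ 2 = 2^-1 * (`|t| - t).
  rewrite sqm2; have [h|h] := ger0P t.
    by rewrite subrr mulr0; apply/max_idPr; rewrite oppr_le0.
  by rewrite (_ : Num.max _ _ = - t); [lra|apply/max_idPl; rewrite oppr_ge0 ltW].
set N := opscale _ _.
have NI : N `<=` I (fun t => sqm t ^+ 2).
  move=> [x y] [z [[a [b [/= ha [b' [/= hb hb'] hz]]] hy]]].
  apply: (@pvm_integral_exh _ _ _ hd _ hE _ m2 (lev id) (x, y) (lev_exhaust mid)).
    by move=> k; exists (1 + k%:R ^+ 2) => t; rewrite /lev /= in_itv /= -ler_norml => ht;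
      rewrite ger0_norm ?sqr_ge0 // (le_trans (sqm_le t)) // lerD2l -(real_normK (num_real t)) lerXn2r ?nnegrE.
  move=> k /=; have mL := lev_meas k mid; have bid := lev_bd (id : R -> R) k.
  have bn : bdon (fun t => `|t|) (lev (id : R -> R) k).
    by have [M hM] := bid; exists M => t /hM; rewrite normr_id.
  have h1 := pvm_integral_loc hd hE mn ha mL bn; have h2 := pvm_integral_loc hd hE mid hb mL bid.
  rewrite /= in h1 h2 hz hy; rewrite hy hz hb' scaleN1r (linZ (P_lin hE mL)) (linB (P_lin hE mL)) h1 h2.
  have b1 := bmeas_cut mn mL bn; have b2 := bmeas_cut mid mL bid.
  rewrite -phiB // half -phiZ; last exact: bmeasB.
  congr (phi _ _); apply/funext => t; have [Lt|Lt] := pselect (lev id k t).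
    by rewrite !cutfM // e.
  by rewrite !cutfN // subrr mulr0.
rewrite (opclosureE hd); apply/seteqP; split.
  apply: hclosure_le => //.
  exact: (closed_graph hd (pvm_integral_closed hd hE m2).2).
move=> [x y] hxy.
pose B := lev (id : R -> R); have eB : exhaust B := lev_exhaust mid.
have [mB nB UB] := eB; have bB k : bdon id (B k) := lev_bd id k.
have bB2 k : bdon (fun t => sqm t ^+ 2) (B k).
  by exists (1 + k%:R ^+ 2) => t; rewrite /B /lev /= in_itv /= -ler_norml => ht;
    rewrite ger0_norm ?sqr_ge0 // (le_trans (sqm_le t)) // lerD2l -(real_normK (num_real t)) lerXn2r ?nnegrE.
have bn k : bdon (fun t => `|t|) (B k).
  by have [M hM] := bB k; exists M => t /hM; rewrite normr_id.
apply/hclosureP; exists (fun k => (P (B k) x, phi (cutf (fun t => sqm t ^+ 2) (B k)) x)); split.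
  move=> k; have h1 := pvm_integral_P hd hE x mid (mB k) (bB k).
  have h2 := pvm_integral_P hd hE x mn (mB k) (bn k).
  have hN : N (P (B k) x, 2^-1 *: (phi (cutf (fun t => `|t|) (B k)) x + -1 *: phi (cutf id (B k)) x)).
    by eexists; split; [eexists; eexists; split; [exact: h2|eexists; split; [exact: h1|]|]|].
  have := NI _ hN => h3; have h4 := pvm_integral_P hd hE x m2 (mB k) (bB2 k).
  by rewrite (pvm_integral_fun hd hE m2 h4 h3).
apply: (hcvg_prod hd); first exact: (P_cvg hd hE).
exact: (pvm_integral_cvg hd hE m2 hxy eB bB2).
Qed.

(** Away from [l] the function t - l is boundedly invertible, so an eigenvector has no component
    there; being concentrated on {l}, it sees only the value f l. *)
Lemma eigen_transfer (l : R) f x : meas f -> I id (x, l%:C *: x) -> I f (x, (f l)%:C *: x).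
Proof.
move=> mf hx; pose B k : set R := (`[l - k%:R, l + k%:R] `\` `]l - k.+1%:R^-1, l + k.+1%:R^-1[)%classic.
have inl k : `]l - k.+1%:R^-1, l + k.+1%:R^-1[%classic l.
  have : 0 < k.+1%:R^-1 :> R by rewrite invr_gt0.
  by rewrite /= in_itv /=; move: (k.+1%:R^-1) => r r0; apply/andP; split; lra.
have mB k : measurable (B k) by apply: measurableD; exact: measurable_itv.
have bB k : bdon id (B k).
  exists (`|l| + k%:R) => t [/= ht _]; move: ht; rewrite in_itv /= => /andP[h1 h2].
  by rewrite -[t](subrK l) [t - l + l]addrC (le_trans (ler_normD _ _)) // lerD2l ler_norml; apply/andP; split; lra.
have P0 k : P (B k) x = 0.
  pose g t : R := (t - l)^-1.
  have mg : meas g.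
    apply: measurable_funVr; exact: measurable_funB.
  have bg : bdon g (B k).
    exists k.+1%:R => t [_ /= ht]; rewrite /g normfV -[leRHS]invrK lef_pV2 ?posrE ?invr_gt0 //.
      rewrite leNgt; apply/negP => h; apply: ht; rewrite in_itv /=; move: h; rewrite ltr_norml => /andP[h1 h2].
      by move: (k.+1%:R^-1) h1 h2 => ? ? ?; apply/andP; split; lra.
    rewrite normr_gt0 subr_eq0; apply/eqP => tl; apply: ht; rewrite tl; exact: inl.
  have h1 := pvm_integral_loc hd hE mid hx (mB k) (bB k).
  have bi := bmeas_cut mid (mB k) (bB k); have bgc := bmeas_cut mg (mB k) bg.
  have bI := bmeas_indic (mB k).
  have h2 : phi (fun t => cutf id (B k) t - l * \1_(B k) t) x = 0.
    rewrite phiB //; last exact: bmeasZ.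
    by rewrite phiZ // (phi_indic hd hE) // -h1 /= (linZ (P_lin hE (mB k))) subrr.
  have e : (\1_(B k) : R -> R) = fun t => cutf g (B k) t * (cutf id (B k) t - l * \1_(B k) t).
    apply/funext => t; have [Bt|Bt] := pselect (B k t); last by rewrite indicE memNset // cutfN // mul0r.
    rewrite !cutfM // indicE mem_set // mulr1 /g mulVf // subr_eq0; apply/eqP => tl.
    case: Bt => _ /=; apply; rewrite tl; exact: inl.
  rewrite -(phi_indic hd hE) // e (phiM hd hE) //; last by apply: bmeasB => //; exact: bmeasZ.
  by rewrite h2 (lin0 (phi_lin hd hE bgc)).
have nB : nondecreasing_seq B.
  move=> k m km; apply/subsetPset => t [/= h1 h2]; split=> /=.
    move: h1; rewrite !in_itv /= => /andP[h3 h4]; have := km; rewrite -(ler_nat R) => h5.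
    by apply/andP; split; lra.
  apply: contra_not h2; rewrite !in_itv /= => /andP[h3 h4].
  have h5 : m.+1%:R^-1 <= k.+1%:R^-1 :> R by rewrite lef_pV2 ?posrE // ler_nat.
  by move: (m.+1%:R^-1 : R) (k.+1%:R^-1 : R) h3 h4 h5 => *; apply/andP; split; lra.
have UB : \bigcup_k B k = ~` [set l].
  apply/seteqP; split=> [t [k _ [_ /= h]] tl|t /= tl].
    apply: h; rewrite tl; exact: inl.
  have tl0 : 0 < `|t - l| by rewrite normr_gt0 subr_eq0; apply/eqP.
  have := truncnS_gt `|t - l|; have := truncnS_gt `|t - l|^-1.
  set a := (Num.truncn _).+1; set b := (Num.truncn _).+1 => h1 h2.
  exists (maxn a b) => //; split=> /=.
    have : `|t - l| <= (maxn a b)%:R by apply/ltW/(lt_le_trans h2); rewrite ler_nat leq_maxr.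
    by rewrite ler_norml in_itv /= => /andP[h3 h4]; apply/andP; split; lra.
  rewrite in_itv /= => /andP[h3 h4].
  have : `|t - l| < (maxn a b).+1%:R^-1.
    by rewrite ltr_norml; move: ((maxn a b).+1%:R^-1 : R) h3 h4 => *; apply/andP; split; lra.
  rewrite -[X in X < _]invrK ltf_pV2 ?posrE ?invr_gt0 // => h5.
  have h6 : a%:R <= (maxn a b).+1%:R :> R by rewrite ler_nat leqW // leq_maxl.
  by have := lt_trans (lt_le_trans h1 h6) h5; rewrite ltxx.
have mC : measurable (~` [set l] : set R) by exact: measurableC.
have Pc : P (~` [set l]) x = 0.
  have := P_cvgU hd hE x mB nB; rewrite UB => h.
  apply: (hcvg_unique hd h); under eq_fun do rewrite P0; exact: hcvg_cst.
have Px : P [set l] x = x.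
  rewrite -[LHS]addr0 -[X in _ + X]Pc -(P_setU hd hE) //; last by rewrite setICr.
  by rewrite setUv (P_T hE).
have bl : bdon f [set l] by exists `|f l| => t ->.
have := pvm_integral_P hd hE x mf (measurable_set1 l) bl; rewrite Px.
have -> // : phi (cutf f [set l]) x = (f l)%:C *: x.
have bI := bmeas_indic (measurable_set1 l).
rewrite -{2}Px -(phi_indic hd hE) // -phiZ //; congr (phi _ _); apply/funext => t.
have [->|h] := eqVneq t l; first by rewrite cutfM // indicE mem_set // mulr1.
by rewrite cutfN ?indicE ?memNset ?mulr0 //; apply/eqP.
Qed.

End FunctionalParts.

(** * The Hilbert space of Fourier coefficients *)

Section RealSums.
Context {R : realType} {n : nat}.
Local Notation Zn := (Zn n).
Implicit Types (f g a b : Zn -> R) (k : Zn).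

Definition esm f : \bar R := (\esum_(k in [set: Zn]) (f k)%:E)%E.
Definition summb f := (esm (fun k => `|f k|%R) < +oo)%E.

Lemma esm_le f (M : R) : (forall s : seq Zn, uniq s -> \sum_(k <- s) f k <= M) ->
  (esm f <= M%:E)%E.
Proof.
move=> h; apply: ub_ereal_sup => _ [F [finF _] <-].
by rewrite fsbig_finite //= sumEFin lee_fin; apply: h; exact: finmap.fset_uniq.
Qed.
Lemma esm_ge f (s : seq Zn) : uniq s -> ((\sum_(k <- s) f k)%:E <= esm f)%E.
Proof.
move=> us; apply: ereal_sup_ubound; exists [set` s]; first by split=> //; exact: finite_seq.
by rewrite -fsbig_seq // sumEFin.
Qed.
Lemma esm_ge0 f : (forall k, 0 <= f k) -> (0 <= esm f)%E.
Proof. by move=> f0; apply: esum_ge0 => k _; rewrite lee_fin. Qed.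
Lemma esm_mono f g : (forall k, f k <= g k) -> (esm f <= esm g)%E.
Proof. by move=> h; apply: le_esum => k _; rewrite lee_fin. Qed.
Lemma esm_fin f : (forall k, 0 <= f k) -> (esm f < +oo)%E -> esm f = (fine (esm f))%:E.
Proof. by move=> f0 foo; rewrite fineK // ge0_fin_numE // esm_ge0. Qed.
Lemma esmD f g : (forall k, 0 <= f k) -> (forall k, 0 <= g k) ->
  esm (fun k => f k + g k) = (esm f + esm g)%E.
Proof.
move=> f0 g0; rewrite /esm -esumD; try by move=> k _; rewrite lee_fin.
by apply: eq_esum => k _; rewrite EFinD.
Qed.
Lemma fine_esmD f g : (forall k, 0 <= f k) -> (forall k, 0 <= g k) ->
  (esm f < +oo)%E -> (esm g < +oo)%E ->
  fine (esm (fun k => f k + g k)) = fine (esm f) + fine (esm g).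
Proof. by move=> f0 g0 ff gf; rewrite esmD // fineD // ge0_fin_numE // esm_ge0. Qed.
Lemma esmZ (c : R) f : 0 <= c -> (forall k, 0 <= f k) -> (esm f < +oo)%E ->
  esm (fun k => c * f k) = (c%:E * esm f)%E.
Proof.
move=> c0 f0 foo; have cfoo := esum_scale_lty c0 f0 foo.
have [->|cn0] := eqVneq c 0.
  by rewrite mul0e /esm esum1 // => k _; rewrite mul0r.
have cp : 0 < c by rewrite lt_def cn0.
have cf0 k : 0 <= c * f k by rewrite mulr_ge0.
rewrite (esm_fin f0 foo) (esm_fin cf0 cfoo) -EFinM; congr EFin; apply/eqP; rewrite eq_le; apply/andP; split.
  rewrite -lee_fin -(esm_fin cf0 cfoo); apply: esm_le => s us; rewrite -mulr_sumr ler_pM2l //.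
  by rewrite -lee_fin -(esm_fin f0 foo) esm_ge.
rewrite -ler_pdivlMl // -lee_fin -(esm_fin f0 foo); apply: esm_le => s us.
by rewrite ler_pdivlMl // mulr_sumr -lee_fin -(esm_fin cf0 cfoo) esm_ge.
Qed.
Lemma esm_max f : summb f -> (esm (fun k => Num.max (f k) 0%R) < +oo)%E.
Proof.
apply: le_lt_trans; apply: esm_mono => k; rewrite ge_max normr_ge0 andbT; exact: ler_norm.
Qed.
Lemma summbN f : summb f -> summb (fun k => - f k).
Proof. by rewrite /summb; under [X in _ -> (esm X < _)%E]eq_fun do rewrite normrN. Qed.
Lemma summb_le f g : summb g -> (forall k, `|f k| <= g k) -> summb f.
Proof.
move=> gs h; apply: le_lt_trans gs; apply: esm_mono => k; apply: le_trans (h k) _; exact: ler_norm.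
Qed.
Lemma summbD f g : summb f -> summb g -> summb (fun k => f k + g k).
Proof.
move=> hf hg; apply: (@le_lt_trans _ _ (esm (fun k => `|f k| + `|g k|))).
  by apply: esm_mono => k; exact: ler_normD.
by rewrite esmD //; exact: lte_add_pinfty.
Qed.
Lemma summbZ c f : summb f -> summb (fun k => c * f k).
Proof.
move=> hf; rewrite /summb; under eq_fun do rewrite normrM.
exact: esum_scale_lty.
Qed.
Lemma summb_ge0 f : (forall k, 0 <= f k) -> (esm f < +oo)%E -> summb f.
Proof. by move=> f0; rewrite /summb; under [X in _ -> (esm X < _)%E]eq_fun do rewrite ger0_norm //. Qed.

Lemma max_split (x : R) : x = Num.max x 0 - Num.max (- x) 0.
Proof.
have [h|h] := lerP x 0; have [h'|h'] := lerP (- x) 0; rewrite ?sub0r ?subr0 ?opprK //; lra.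
Qed.
Lemma max_ge0 (x : R) : 0 <= Num.max x 0.
Proof. by rewrite le_max lexx orbT. Qed.
(** [rsum] splits a family into positive and negative parts; any other splitting into summable
    nonnegative families gives the same value, and additivity follows. *)
Lemma rsum_sub a b : (forall k, 0 <= a k) -> (forall k, 0 <= b k) ->
  (esm a < +oo)%E -> (esm b < +oo)%E ->
  rsum (fun k => a k - b k) = fine (esm a) - fine (esm b).
Proof.
move=> a0 b0 ha hb; rewrite /rsum -/(esm _) -/(esm _).
have hs : summb (fun k => a k - b k).
  by apply: summbD; [exact: summb_ge0|apply: summbN; exact: summb_ge0].
set p := (fun k => Num.max (a k - b k) 0); set q := (fun k => Num.max (- (a k - b k)) 0).
have p0 k : 0 <= p k by rewrite /p le_max lexx orbT.
have q0 k : 0 <= q k by rewrite /q le_max lexx orbT.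
have hp : (esm p < +oo)%E by exact: esm_max.
have hq : (esm q < +oo)%E by apply: esm_max; exact: summbN.
have e : fine (esm (fun k => p k + b k)) = fine (esm (fun k => q k + a k)).
  congr (fine (esm _)); apply/funext => k; rewrite /p /q.
  have := max_split (a k - b k).
  by move: (Num.max (a k - b k) 0) (Num.max (- (a k - b k)) 0) (a k) (b k) => x y z t h; lra.
move: e; rewrite (fine_esmD p0 b0 hp hb) (fine_esmD q0 a0 hq ha).
move: (fine (esm p)) (fine (esm q)) (fine (esm a)) (fine (esm b)) => x y z t h; lra.
Qed.
Lemma rsumD f g : summb f -> summb g -> rsum (fun k => f k + g k) = rsum f + rsum g.
Proof.
move=> hf hg; pose p h k := Num.max (h k : R) 0; pose m h k := Num.max (- (h k : R)) 0.
have p0 h k : 0 <= p h k by exact: max_ge0.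
have m0 h k : 0 <= m h k by exact: max_ge0.
have -> : (fun k => f k + g k) = fun k => (p f k + p g k) - (m f k + m g k).
  apply/funext => k; rewrite /p /m {1}(max_split (f k)) {1}(max_split (g k)).
  by rewrite addrACA opprD.
have pf : (esm (p f) < +oo)%E := esm_max hf.
have pg : (esm (p g) < +oo)%E := esm_max hg.
have mf : (esm (m f) < +oo)%E := esm_max (summbN hf).
have mg : (esm (m g) < +oo)%E := esm_max (summbN hg).
have h2 (x y : Zn -> R) : (forall k, 0 <= x k) -> (forall k, 0 <= y k) ->
    (esm x < +oo)%E -> (esm y < +oo)%E -> (esm (fun k => x k + y k)%R < +oo)%E.
  by move=> x0 y0 hx hy; rewrite esmD //; exact: lte_add_pinfty.
rewrite rsum_sub; [|by move=> k; exact: addr_ge0|by move=> k; exact: addr_ge0| |]; try exact: h2.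
rewrite (fine_esmD (p0 f) (p0 g) pf pg) (fine_esmD (m0 f) (m0 g) mf mg).
by rewrite opprD addrACA.
Qed.
Lemma rsumN f : rsum (fun k => - f k) = - rsum f.
Proof.
rewrite /rsum opprB; congr (fine _ - fine _).
by apply: eq_esum => k _; rewrite opprK.
Qed.
Lemma rsum_ge0E f : (forall k, 0 <= f k) -> rsum f = fine (esm f).
Proof.
move=> f0; rewrite /rsum [X in _ - fine X]esum1 ?subr0; last first.
  by move=> k _; congr EFin; apply/max_idPr; rewrite oppr_le0.
by congr fine; apply: eq_esum => k _; congr EFin; apply/max_idPl.
Qed.
Lemma rsumZ c f : summb f -> rsum (fun k => c * f k) = c * rsum f.
Proof.
have wlog_c c' : 0 <= c' -> summb f -> rsum (fun k => c' * f k) = c' * rsum f.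
  move=> c0 hf; pose p k := Num.max (f k) 0; pose m k := Num.max (- f k) 0.
  have p0 k : 0 <= p k by exact: max_ge0.
  have m0 k : 0 <= m k by exact: max_ge0.
  have hp := esm_max hf; have hm := esm_max (summbN hf).
  have -> : (fun k => c' * f k) = fun k => c' * p k - c' * m k.
    by apply/funext => k; rewrite -mulrBr /p /m -max_split.
  have cp := esum_scale_lty c0 p0 hp; have cm := esum_scale_lty c0 m0 hm.
  rewrite rsum_sub //; [|by move=> k; rewrite mulr_ge0|by move=> k; rewrite mulr_ge0].
  rewrite (esmZ c0 p0 hp) (esmZ c0 m0 hm) (esm_fin p0 hp) (esm_fin m0 hm) -!EFinM /=.
  by rewrite -mulrBr.
have [c0|c0] := lerP 0 c; first exact: wlog_c.
move=> hf; rewrite -[c]opprK mulNr -wlog_c ?oppr_ge0 1?ltW // -rsumN.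
by congr rsum; apply/funext => k; rewrite mulNr.
Qed.
Lemma rsum_comb (c1 c2 : R) f g h : summb f -> summb g -> summb h ->
  rsum (fun k => c1 * f k + c2 * g k + h k) = c1 * rsum f + c2 * rsum g + rsum h.
Proof.
move=> hf hg hh; have cf := summbZ c1 hf; have cg := summbZ c2 hg.
by rewrite (rsumD (summbD cf cg) hh) (rsumD cf cg) !rsumZ.
Qed.
Lemma esm_single f k : (forall j, j != k -> f j = 0) -> 0 <= f k -> esm f = (f k)%:E.
Proof.
move=> h fk; rewrite /esm (eq_esum (b := fun j => if j \in [set k] then (f j)%:E else 0%E)).
  by rewrite -esum_mkcond esum_set1 // lee_fin.
move=> j _; have [->|jk] := eqVneq j k; first by rewrite mem_set.
by rewrite memNset ?h // => /= /eqP; exact/negP.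
Qed.
Lemma rsum_single f k : (forall j, j != k -> f j = 0) -> rsum f = f k.
Proof.
move=> h; rewrite /rsum -/(esm (fun k => Num.max (f k) 0)) -/(esm (fun k => Num.max (- f k) 0)).
rewrite !(@esm_single _ k) ?le_max ?lexx ?orbT //.
- by rewrite /= -max_split.
- by move=> j jk; rewrite h // oppr0; apply/max_idPl.
- by move=> j jk; rewrite h //; apply/max_idPl.
Qed.
Lemma esm_shift (a : Zn) f : esm (fun k => f (k + a)) = esm f.
Proof.
rewrite /esm; apply/esym; apply: (@reindex_esum _ _ _ setT setT (fun k => k + a)).
split=> //; first by move=> x y _ _; exact: addIr.
by move=> y _; exists (y - a) => //; rewrite subrK.
Qed.
Lemma esm_opp f : esm (fun k => f (- k)) = esm f.
Proof.
rewrite /esm; apply/esym; apply: (@reindex_esum _ _ _ setT setT (fun k => - k)).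
split; [by []|by move=> x y _ _; exact: oppr_inj|].
by move=> y _; exists (- y) => //; rewrite opprK.
Qed.
Lemma rsum_shift (a : Zn) f : rsum (fun k => f (k + a)) = rsum f.
Proof.
by rewrite /rsum; congr (fine _ - fine _); [exact: (esm_shift a (fun k => Num.max (f k) 0))|
  exact: (esm_shift a (fun k => Num.max (- f k) 0))].
Qed.
Lemma rsum_opp f : rsum (fun k => f (- k)) = rsum f.
Proof.
by rewrite /rsum; congr (fine _ - fine _); [exact: (esm_opp (fun k => Num.max (f k) 0))|
  exact: (esm_opp (fun k => Num.max (- f k) 0))].
Qed.

End RealSums.

Section L2Hilbert.
Context {R : realType} {n : nat}.
Local Notation Zn := (Zn n).
Local Notation L2 := (L2 R n).
Implicit Types (u v w : L2) (k : Zn).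
Local Notation cf u k := (L2coef u k : R[i]).

Lemma L2_ext u v : (forall k, cf u k = cf v k) -> u = v.
Proof. by move=> h; apply/val_inj/funext. Qed.
Lemma L2D u v k : cf (u + v) k = cf u k + cf v k. Proof. by []. Qed.
Lemma L2N u k : cf (- u) k = - cf u k. Proof. by []. Qed.
Lemma L2Z c u k : cf (c *: u) k = c * cf u k. Proof. by []. Qed.
Lemma L20 k : cf 0 k = 0. Proof. by []. Qed.

Lemma l2P (f : Zn -> R[i]^o) : (esm (fun k => normc2 (f k)) < +oo)%E -> f \in @l2 R n.
Proof. by move=> h; apply/asboolP. Qed.
Lemma l2_esm u : (esm (fun k => normc2 (cf u k)) < +oo)%E.
Proof. by have /asboolP := L2P u. Qed.
Lemma normc2E (z : R[i]) : complex.Re (z * z^*) = normc2 z.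
Proof. by case: z => a b; rewrite /normc2 /=; ring. Qed.
Lemma normc2_conj (z : R[i]) : normc2 z^* = normc2 z.
Proof. by case: z => a b; rewrite /normc2 /= sqrrN. Qed.
Lemma normc2M (z w : R[i]) : normc2 (z * w) = normc2 z * normc2 w.
Proof. by case: z w => a b [c e]; rewrite /normc2 /=; ring. Qed.

Lemma Re_summb u v : summb (fun k => complex.Re (cf u k * (cf v k)^*)).
Proof.
apply: (@summb_le _ _ _ (fun k => normc2 (cf u k) + normc2 (cf v k))).
  by apply: summbD; apply: summb_ge0 => *; rewrite ?normc2_ge0 ?l2_esm.
move=> k; case: (cf u k) (cf v k) => a b [c e]; rewrite /normc2 /= ler_norml.
have := sqr_ge0 (a - c); have := sqr_ge0 (b - e); have := sqr_ge0 (a + c); have := sqr_ge0 (b + e).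
have := sqr_ge0 a; have := sqr_ge0 b; have := sqr_ge0 c; have := sqr_ge0 e.
by move=> *; apply/andP; split; nra.
Qed.
Lemma Im_summb u v : summb (fun k => complex.Im (cf u k * (cf v k)^*)).
Proof.
apply: (@summb_le _ _ _ (fun k => normc2 (cf u k) + normc2 (cf v k))).
  by apply: summbD; apply: summb_ge0 => *; rewrite ?normc2_ge0 ?l2_esm.
move=> k; case: (cf u k) (cf v k) => a b [c e]; rewrite /normc2 /= ler_norml.
have := sqr_ge0 (a - e); have := sqr_ge0 (b - c); have := sqr_ge0 (a + e); have := sqr_ge0 (b + c).
have := sqr_ge0 a; have := sqr_ge0 b; have := sqr_ge0 c; have := sqr_ge0 e.
by move=> *; apply/andP; split; nra.
Qed.

Lemma Re_dot u v : complex.Re (dot u v) = rsum (fun k => complex.Re (cf u k * (cf v k)^*)).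
Proof. by []. Qed.
Lemma dotxx u : complex.Re (dot u u) = fine (esm (fun k => normc2 (cf u k))).
Proof.
rewrite Re_dot -rsum_ge0E; last by move=> k; exact: normc2_ge0.
by congr rsum; apply/funext => k; exact: normc2E.
Qed.
Lemma dotxxE u : esm (fun k => normc2 (cf u k)) = (complex.Re (dot u u))%:E.
Proof. by rewrite dotxx; apply: esm_fin => [k|]; [exact: normc2_ge0|exact: l2_esm]. Qed.

Lemma dot_linear (c : R[i]) u v w : dot (c *: u + v) w = c * dot u w + dot v w.
Proof.
have E1 := rsum_comb (complex.Re c) (- complex.Im c) (Re_summb u w) (Im_summb u w) (Re_summb v w).
have E2 := rsum_comb (complex.Re c) (complex.Im c) (Im_summb u w) (Re_summb u w) (Im_summb v w).
have -> : dot (c *: u + v) w = (complex.Re c * complex.Re (dot u w) + - complex.Im c * complex.Im (dot u w)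
    + complex.Re (dot v w)) +i* (complex.Re c * complex.Im (dot u w) + complex.Im c * complex.Re (dot u w)
    + complex.Im (dot v w)).
  rewrite -[in RHS]E1 -[in RHS]E2 /dot; congr (_ +i* _); congr rsum; apply/funext => k; rewrite L2D L2Z; clear;
  by case: c (cf u k) (cf v k) (cf w k) => a b [? ?] [? ?] [? ?] /=; ring.
by case: c {E1 E2} (dot u w) (dot v w) => a b [? ?] [? ?] /=; congr (_ +i* _); ring.
Qed.
Lemma dot_conj u v : dot v u = (dot u v)^*.
Proof.
apply: complexP; rewrite /dot /=; last rewrite -rsumN; congr rsum; apply/funext => k.
  by case: (cf u k) (cf v k) => a b [c e] /=; ring.
by case: (cf u k) (cf v k) => a b [c e] /=; ring.
Qed.

Lemma ek_l2 k : (fun j : Zn => (j == k)%:R : R[i]^o) \in @l2 R n.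
Proof.
apply: l2P; rewrite (@esm_single _ _ _ k) ?ltry ?normc2_ge0 // => j /negbTE ->.
by rewrite /normc2 /= expr0n addr0.
Qed.
Definition ek k : L2 := MkL2 (ek_l2 k).
Lemma ekE k j : cf (ek k) j = (j == k)%:R. Proof. by []. Qed.
Lemma vacuumE : vacuum R n = ek 0.
Proof. exact: L2_ext. Qed.
Lemma dot_ek u k : dot u (ek k) = cf u k.
Proof.
rewrite /dot (@rsum_single _ _ _ k) 1?(@rsum_single _ _ _ k).
- by rewrite ekE eqxx /=; case: (cf u k) => a b /=; congr (_ +i* _); ring.
- by move=> j /negbTE jk; rewrite ekE jk /=; case: (cf u j) => a b /=; ring.
- by move=> j /negbTE jk; rewrite ekE jk /=; case: (cf u j) => a b /=; ring.
Qed.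

Lemma cf_le u k : normc2 (cf u k) <= complex.Re (dot u u).
Proof.
rewrite -lee_fin -dotxxE; have := @esm_ge R n (fun k => normc2 (cf u k)) [:: k] erefl.
by rewrite big_seq1.
Qed.

Lemma real_cauchy (a : nat -> R) : (forall e, 0 < e ->
  exists N, forall i j, (N <= i)%N -> (N <= j)%N -> `|a i - a j| < e) ->
  exists l : R, a i @[i --> \oo] --> l.
Proof.
move=> h; suff : cvgn a by move=> ha; exists (limn a).
apply: cauchy_cvg; apply: cauchy_exP => e e0; have [N hN] := h e e0.
by exists (a N); exists N => // i /= Ni; exact: hN.
Qed.

(** Coordinates converge because each is dominated by the norm; the tail estimate passes to the
    limit on finite sums and then to the supremum over them. *)
Lemma dot_complete (x : nat -> L2) : hcauchy (@dot R n) x -> exists y, hcvg (@dot R n) x y.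
Proof.
move=> hx.
have dot0 u : 0 <= complex.Re (dot u u).
  by rewrite dotxx fine_ge0 // esm_ge0 // => k; exact: normc2_ge0.
have hx2 e : 0 < e -> exists N, forall i j, (N <= i)%N -> (N <= j)%N ->
    complex.Re (dot (x i - x j) (x i - x j)) <= e ^+ 2.
  move=> e0; have [N hN] := hx e e0; exists N => i j Ni Nj.
  have := ltW (hN i j Ni Nj); rewrite /hnorm => h.
  by rewrite -[leLHS]sqr_sqrtr // ler_pXn2r ?nnegrE ?sqrtr_ge0 // ltW.
have cc (pr : R[i] -> R) (prB : forall a b : R[i], pr (a - b) = pr a - pr b)
    (pr2 : forall a : R[i], pr a ^+ 2 <= normc2 a) k : exists l : R, pr (cf (x i) k) @[i --> \oo] --> l.
  apply: real_cauchy => e e0; have [N hN] := hx2 _ (divr_gt0 e0 (ltr0Sn _ 1)).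
  exists N => i j Ni Nj; rewrite -prB.
  have := hN i j Ni Nj; have := cf_le (x i - x j) k; rewrite L2D L2N => h1 h2.
  rewrite -ltr_sqr ?nnegrE ?(ltW e0) // real_normK ?num_real //.
  apply: le_lt_trans (le_trans (le_trans (pr2 _) h1) h2) _.
  by rewrite ltr_sqr ?nnegrE ?ltW ?divr_gt0 //; lra.
have /choice[yr hr] : forall k, exists l : R, complex.Re (cf (x i) k) @[i --> \oo] --> l.
  by apply: cc => z; [move=> w; rewrite ReD ReN|rewrite /normc2 lerDl sqr_ge0].
have /choice[yi hi] : forall k, exists l : R, complex.Im (cf (x i) k) @[i --> \oo] --> l.
  by apply: cc => z; [move=> w; rewrite ImD ImN|rewrite /normc2 lerDr sqr_ge0].
pose y k : R[i]^o := yr k +i* yi k.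
have hy k i : normc2 (cf (x i) k - cf (x j) k) @[j --> \oo] --> normc2 (cf (x i) k - y k).
  rewrite /normc2; under eq_fun do rewrite ReD ReN ImD ImN; rewrite ReD ReN ImD ImN.
  apply: cvgD; rewrite expr2; under eq_fun do rewrite expr2.
    by apply: cvgM; (apply: cvgB; [exact: cvg_cst|exact: hr]).
  by apply: cvgM; (apply: cvgB; [exact: cvg_cst|exact: hi]).
have key e : 0 < e -> exists N, forall i, (N <= i)%N ->
    (esm (fun k => normc2 (cf (x i) k - y k))%R <= (e ^+ 2)%:E)%E.
  move=> e0; have [N hN] := hx2 e e0; exists N => i Ni; apply: esm_le => s us.
  have hs : \sum_(k <- s) normc2 (cf (x i) k - cf (x j) k) @[j --> \oo] -->
      \sum_(k <- s) normc2 (cf (x i) k - y k).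
    elim: {us} s => [|k s IH]; first by rewrite big_nil; under eq_fun do rewrite big_nil; exact: cvg_cst.
    by rewrite big_cons; under eq_fun do rewrite big_cons; apply: cvgD => //; exact: hy.
  apply: (ler_cvg_to hs (cvg_cst (e ^+ 2))); near=> j.
  have Nj : (N <= j)%N by near: j; exists N.
  have := hN i j Ni Nj; apply: le_trans; rewrite -lee_fin -dotxxE.
  exact: (@esm_ge R n (fun k => normc2 (cf (x i - x j) k)) s us).
have yl2 : y \in @l2 R n.
  have [N /(_ N (leqnn _)) hN] := key 1 ltr01.
  have h2 : (fun k => cf (x N) k - y k : R[i]^o) \in @l2 R n.
    by apply: l2P; apply: le_lt_trans hN _; rewrite ltry.
  (* Only the difference to some [x N] is known to be square summable, so [y] is recovered from
     it. *)
  have -> : y = (fun k => L2coef (x N) k) - (fun k => cf (x N) k - y k : R[i]^o).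
    apply/funext => k; change (y k = cf (x N) k - (cf (x N) k - y k)).
    by rewrite opprB addrC subrK.
  by apply: rpredB => //; exact: L2P.
exists (MkL2 yl2); apply/cvgr0Pnorm_lt => e e0.
have [N hN] := key _ (divr_gt0 e0 (ltr0Sn _ 1)).
exists N => // i /= Ni; rewrite ger0_norm ?hnorm_ge0 //.
have := hN i Ni; rewrite (_ : esm _ = esm (fun k => normc2 (cf (x i - MkL2 yl2) k))) //.
rewrite dotxxE lee_fin => h; apply: le_lt_trans (_ : _ <= e / 2) _; last by lra.
have e2 : 0 <= e / 2 by rewrite ltW // divr_gt0.
rewrite /hnorm -[leRHS](ger0_norm e2) -sqrtr_sqr.
exact: ler_wsqrtr.
Unshelve. all: by end_near. Qed.

Lemma dot_hilbert : hilbert (@dot R n).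
Proof.
split; [exact: dot_linear|exact: dot_conj| | |exact: dot_complete].
  by move=> u; rewrite dotxx fine_ge0 // esm_ge0 // => k; exact: normc2_ge0.
move=> u u0; apply: L2_ext => k; have := cf_le u k; rewrite u0 /normc2 => h.
have := sqr_ge0 (complex.Re (cf u k)); have := sqr_ge0 (complex.Im (cf u k)) => h1 h2.
have e1 : complex.Re (cf u k) ^+ 2 = 0 by lra.
have e2 : complex.Im (cf u k) ^+ 2 = 0 by lra.
by apply: complexP; apply/eqP; rewrite L20 /= -sqrf_eq0 ?e1 ?e2.
Qed.

Lemma ek_total u : (forall k, cf u k = 0) -> u = 0.
Proof. by move=> h; apply: L2_ext => k; rewrite h L20. Qed.
Lemma ek_dense (G : set L2) : subsp G -> (forall k, G (ek k)) ->
  forall u, hclosure (@dot R n) G u.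
Proof.
move=> sG hG; apply: (dense_orth dot_hilbert sG) => z hz; apply: ek_total => k.
apply: complexP; rewrite -dot_ek; first exact: hz.
by rewrite (imd dot_hilbert) hz //; exact: subspZ.
Qed.

End L2Hilbert.

(** * Twisted translations of Fourier modes *)

Section Shifts.
Context {R : realType} {n : nat}.
Local Notation Zn := (Zn n).
Local Notation L2 := (L2 R n).
Local Notation dot := (@dot R n).
Implicit Types (u v w : L2) (k a b : Zn) (ph : Zn -> R).
Local Notation cf u k := (L2coef u k : R[i]).

Lemma expi0 : expi (0 : R) = 1.
Proof. by rewrite /expi cos0 sin0. Qed.
Lemma expiD (s t : R) : expi (s + t) = expi s * expi t.
Proof. by apply: complexP; rewrite ?ReM ?ImM /= ?cosD ?sinD //; ring. Qed.
Lemma expi_conj (t : R) : (expi t)^* = expi (- t).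
Proof. by rewrite /expi cosN sinN. Qed.
Lemma expi_mulc (t : R) (z w : R[i]) : expi t * z * (expi t * w)^* = z * w^*.
Proof.
have h := cos2Dsin2 t; case: z w => a b [c e]; apply: complexP => /=.
  rewrite -[RHS]mul1r -h; ring.
rewrite -[RHS]mul1r -h; ring.
Qed.
Lemma normc2_expi (t : R) : normc2 (expi t) = 1.
Proof. by rewrite /normc2 /= cos2Dsin2. Qed.
Lemma expi_neq0 (t : R) : expi t != 0.
Proof.
apply/eqP => h; have := normc2_expi t; rewrite h /normc2 /= expr0n addr0 => /eqP.
by rewrite eq_sym oner_eq0.
Qed.

Lemma tsh_l2 ph a u : (fun k => expi (ph k) * cf u (k - a) : R[i]^o) \in @l2 R n.
Proof.
apply: l2P; rewrite -(esm_shift a).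
under eq_fun do rewrite normc2M normc2_expi mul1r addrK.
exact: l2_esm.
Qed.
(** A translation by [a] followed by unimodular phases. This class of unitaries is closed under
    products and inverses and contains all that is used of left and right multiplication by
    monomials. *)
Definition tsh ph a u : L2 := MkL2 (tsh_l2 ph a u).
Lemma tshE ph a u k : cf (tsh ph a u) k = expi (ph k) * cf u (k - a).
Proof. by []. Qed.
Lemma tsh_lin ph a : lin (tsh ph a).
Proof.
by move=> c x y; apply: L2_ext => k; rewrite L2D L2Z !tshE L2D L2Z mulrDr mulrCA.
Qed.
Lemma dot_tsh ph a u v : dot (tsh ph a u) (tsh ph a v) = dot u v.
Proof.
rewrite /Defs.dot; congr (_ +i* _); rewrite -[RHS](rsum_shift (- a)); congr rsum; apply/funext => k.
  have -> : cf (tsh ph a u) k * (cf (tsh ph a v) k)^* = cf u (k - a) * (cf v (k - a))^* => //.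
  exact: expi_mulc.
have -> : cf (tsh ph a u) k * (cf (tsh ph a v) k)^* = cf u (k - a) * (cf v (k - a))^* => //.
exact: expi_mulc.
Qed.
Lemma hnorm_tsh ph a u : hnorm dot (tsh ph a u) = hnorm dot u.
Proof. by rewrite /hnorm dot_tsh. Qed.
Lemma tsh_comp ph a ps b u : tsh ph a (tsh ps b u) = tsh (fun k => ph k + ps (k - a)) (a + b) u.
Proof. by apply: L2_ext => k; rewrite !tshE mulrA -expiD opprD addrA. Qed.
Lemma tsh_id u : tsh (fun=> 0) 0 u = u.
Proof. by apply: L2_ext => k; rewrite tshE expi0 mul1r subr0. Qed.
Definition tshV ph a := tsh (fun k => - ph (k + a)) (- a).
Lemma tshK ph a u : tshV ph a (tsh ph a u) = u.
Proof. by apply: L2_ext => k; rewrite !tshE mulrA -expiD !opprK addrK addNr expi0 mul1r. Qed.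
Lemma tshVK ph a u : tsh ph a (tshV ph a u) = u.
Proof. by apply: L2_ext => k; rewrite !tshE mulrA -expiD opprK subrK addrN expi0 mul1r. Qed.
Lemma tsh_ek ph a k : tsh ph a (ek k) = expi (ph (k + a)) *: ek (k + a).
Proof.
apply: L2_ext => j; rewrite L2Z tshE !ekE subr_eq.
by have [->|_] := eqVneq j (k + a); rewrite ?mulr0.
Qed.

End Shifts.

Section Graphs.
Context {R : realType} {H : lmodType R[i]}.
Implicit Types (f g : H -> H) (A : op H).

Definition gr f : op H := [set w | w.2 = f w.1].
Lemma grP f x y : gr f (x, y) <-> y = f x. Proof. by []. Qed.
Lemma gr_comp f g : opcomp (gr f) (gr g) = gr (f \o g).
Proof. by apply/seteqP; split=> [[x z] [y [/= /grP-> /grP->]]|[x z] /grP->] //; exists (g x). Qed.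
Lemma gr_id : opid = gr (@id H). Proof. by []. Qed.
Lemma gr_opinv f g : cancel f g -> cancel g f -> opinv (gr f) = gr g.
Proof. by move=> fg gf; apply/seteqP; split=> [[x y]|[x y] /grP->]; [move=> /grP /= ->; rewrite /gr /= fg|rewrite /opinv /gr /= gf]. Qed.
Lemma gr_inj f g : gr f = gr g -> f = g.
Proof. by move=> e; apply/funext => x; have : gr f (x, f x) by []; rewrite e. Qed.
Lemma gr_injE f g x : gr f = gr g -> f x = g x.
Proof. by move=> /gr_inj ->. Qed.
Lemma gr_app f x : app (gr f) x = f x.
Proof. by rewrite /app; case: xgetP => [y _ //|/(_ (f x))]; case. Qed.

Context (d : H -> H -> R[i]) (hd : hilbert d).
Lemma gr_bounded f M : lin f -> (forall x, hnorm d (f x) <= M * hnorm d x) -> bounded_op d (gr f).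
Proof.
move=> lf hM; split; last by exists M => x y /grP->.
  split; first by rewrite /gr /= (lin0 lf).
    by move=> c x y x' y'; rewrite /gr /= => -> ->; rewrite lf.
  by move=> y; rewrite /gr /= (lin0 lf).
by apply/seteqP; split=> // x _; exists (f x).
Qed.
Lemma bounded_gr A : bounded_op d A -> exists f, [/\ A = gr f, lin f &
  exists M, 0 <= M /\ forall x, hnorm d (f x) <= M * hnorm d x].
Proof.
move=> [[A0 Al Au] dA [M hM]].
have /choice[f hf] : forall x, exists y, A (x, y).
  by move=> x; have : [set: H] x by []; rewrite -dA.
have uA x y y' : A (x, y) -> A (x, y') -> y = y'.
  move=> h h'; apply/eqP; rewrite -subr_eq0; apply/eqP/Au.
  by have := Al (-1) _ _ _ _ h' h; rewrite !scaleN1r addNr addrC.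
exists f; split.
- apply/seteqP; split=> [[x y] h|[x y] /grP->] //; exact: (uA x).
- by move=> c x y; apply: (uA (c *: x + y)) => //; exact: Al.
- exists (Num.max M 0); split; first by rewrite le_max lexx orbT.
  move=> x; apply: le_trans (hM _ _ (hf x)) _; apply: ler_wpM2r; first exact: hnorm_ge0.
  by rewrite le_max lexx.
Qed.
Lemma gr_commute f A : (forall x y, A (x, y) -> A (f x, f y)) <-> opcomp (gr f) A `<=` opcomp A (gr f).
Proof.
split=> [h [x z] [y [hA /= /grP->]]|h x y hA]; first by exists (f x); split => //; exact: h.
by have [|y' [/grP-> //]] := h (x, f y); exists y.
Qed.
Lemma gr_adj f g : (forall x y, d (f x) y = d x (g y)) -> adj d (gr f) = gr g.
Proof.
move=> h; apply/seteqP; split=> [[x y] /= hw|[x y] /grP-> a b /grP->]; last exact: h.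
apply: (rd_ext hd) => z; rewrite ![rdot _ _ z](rdC hd) /rdot -(hw z (f z)) // h.
by [].
Qed.
Lemma gr_closed f M : lin f -> (forall x, hnorm d (f x) <= M * hnorm d x) -> closed_op d (gr f).
Proof.
move=> lf hM; split; first by have [] := gr_bounded lf hM.
rewrite (opclosureE hd); apply: hclosure_id; first exact: hilbert_prod.
move=> u [x y] hu hc; rewrite /gr /=.
have h1 := hcvg_fst hd hc; have h2 := hcvg_snd hd hc.
apply: (hcvg_unique hd h2).
have -> : (fun n => (u n).2) = fun n => f (u n).1 by apply/funext => n; exact: hu.
exact: (hcvg_bnd lf hM h1).
Qed.

End Graphs.

Section Torus.
Context {R : realType} {n : nat} (theta : 'M[R]_n) (htheta : theta^T = - theta).
Local Notation Zn := (Zn n).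
Local Notation L2 := (L2 R n).
Local Notation dot := (@dot R n).
Implicit Types (u v w : L2) (k a b : Zn) (j : 'I_n).
Local Notation cf u k := (L2coef u k : R[i]).
Local Notation hd := (@dot_hilbert R n).

(* [U^k], acting on [L2], is a twisted translation by [k], and so is [U^k] acting from the
   right; [Bil] is the bilinear form that governs both twists. *)
Definition Bil k a : R := pi * \sum_(l < n) \sum_(m < n) (k 0 l)%:~R * theta l m * (a 0 m)%:~R.

Lemma BilDl k a b : Bil (k + a) b = Bil k b + Bil a b.
Proof.
rewrite /Bil -mulrDr -big_split; congr (_ * _); apply: eq_bigr => l _ /=.
by rewrite -big_split; apply: eq_bigr => m _ /=; rewrite mxE rmorphD /= !mulrDl.
Qed.
Lemma BilC k a : Bil k a = - Bil a k.
Proof.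
rewrite /Bil -mulrN; congr (_ * _); rewrite exchange_big -sumrN; apply: eq_bigr => l _ /=.
rewrite -sumrN; apply: eq_bigr => m _ /=.
have /matrixP/(_ l m) := htheta; rewrite !mxE => ->; ring.
Qed.
Lemma BilNl k a : Bil (- k) a = - Bil k a.
Proof.
have : Bil (k - k) a = Bil k a + Bil (- k) a by exact: BilDl.
have : Bil (0 + 0) a = Bil 0 a + Bil 0 a by exact: BilDl.
rewrite subrr addr0 => h1 h2; lra.
Qed.
Lemma BilBl k a b : Bil (k - a) b = Bil k b - Bil a b.
Proof. by rewrite BilDl BilNl. Qed.
Lemma Bil0l a : Bil 0 a = 0.
Proof. by rewrite -(subrr (0 : Zn)) BilBl subrr. Qed.
Lemma Bilxx k : Bil k k = 0.
Proof. have := BilC k k; lra. Qed.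

Definition dl j : Zn := delta_mx 0 j.
Definition Ushift j := tsh (fun k => Bil (k - dl j) (dl j)) (dl j) : L2 -> L2.
Definition Rf a := tsh (fun k => - Bil k a) a : L2 -> L2.

Lemma Bil_dl k j : Bil k (dl j) = pi * \sum_(l < n) (k 0 l)%:~R * theta l j.
Proof.
rewrite /Bil; congr (_ * _); apply: eq_bigr => l _.
rewrite (bigD1 j) //= /dl mxE !eqxx /= mulr1 big1 ?addr0 // => m mj.
by rewrite mxE (negbTE mj) andbF mulr0.
Qed.
Lemma U_gr j : U theta j = gr (Ushift j).
Proof.
apply/seteqP; split=> [[u v] /= h|[u v] /grP-> k /=].
  apply: L2_ext => k; change (cf v k = cf (Ushift j u) k).
  by rewrite tshE Bil_dl -h subrK.
by rewrite -['e_j]/(dl j) addrK Bil_dl.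
Qed.
Lemma Uf_lin j : lin (Ushift j). Proof. exact: tsh_lin. Qed.
(** The two phases differ by [Bil] at (a, e_j) plus [Bil] at (e_j, a), which antisymmetry of [theta]
    cancels; this dictates the minus sign in [Rf]. *)
Lemma RU_comm a j u : Rf a (Ushift j u) = Ushift j (Rf a u).
Proof.
rewrite /Rf /Ushift !tsh_comp addrC; congr (tsh _ _ u); apply/funext => k.
rewrite !BilBl Bilxx (BilC (dl j) a); ring.
Qed.
Lemma Rf_ek a k : Rf a (ek k) = expi (- Bil k a) *: ek (k + a).
Proof. by rewrite /Rf tsh_ek BilDl Bilxx addr0. Qed.
Lemma Rf_vac a : Rf a (ek 0) = ek a.
Proof. by rewrite Rf_ek Bil0l oppr0 expi0 scale1r add0r. Qed.

Lemma adj_tsh ph a : adj dot (gr (tsh ph a)) = gr (tshV ph a).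
Proof. by apply: gr_adj => // [|x y]; [exact: hd|rewrite -[RHS](dot_tsh ph a) tshVK]. Qed.

Lemma opexpz_U j (m : int) : exists ph, opexpz (U theta j) m = gr (tsh ph (m *: dl j)).
Proof.
have pw (ph : Zn -> R) a N : exists ps, iter N (opcomp (gr (tsh ph a))) opid = gr (tsh ps (a *+ N)).
  elim: N => [|N [ps IH]].
    by exists (fun=> 0); rewrite gr_id mulr0n; congr gr; apply/funext => u; rewrite tsh_id.
  exists (fun k => ph k + ps (k - a)); rewrite iterS IH gr_comp mulrS; congr gr.
  by apply/funext => u /=; rewrite tsh_comp.
rewrite U_gr; case: m => N.
  have [ps h] := pw (fun k => Bil (k - dl j) (dl j)) (dl j) N.
  by exists ps; rewrite /= h -natz scaler_nat.
rewrite /opexpz (gr_opinv (g := tshV (fun k => Bil (k - dl j) (dl j)) (dl j))); last 2 first.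
- exact: tshK.
- exact: tshVK.
have [ps h] := pw (fun k => - Bil (k + dl j - dl j) (dl j)) (- dl j) N.+1.
exists ps; rewrite /tshV h; congr (gr (tsh _ _)).
by rewrite NegzE scaleNr mulNrn -natz scaler_nat.
Qed.

Lemma Upow_gr k : exists ph, Upow theta k = gr (tsh ph k).
Proof.
rewrite /Upow.
have h (s : seq 'I_n) : exists ph, \big[opcomp/opid]_(j <- s) opexpz (U theta j) (k 0 j) =
    gr (tsh ph (\sum_(j <- s) k 0 j *: dl j)).
  elim: s => [|j s [ps IH]].
    by exists (fun=> 0); rewrite !big_nil gr_id; congr gr; apply/funext => u; rewrite tsh_id.
  have [ph hj] := opexpz_U j (k 0 j).
  exists (fun m => ph m + ps (m - k 0 j *: dl j)); rewrite !big_cons IH hj gr_comp; congr gr.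
  by apply/funext => u /=; rewrite tsh_comp.
have [ph hs] := h (index_enum 'I_n); exists ph; rewrite hs; congr (gr (tsh _ _)).
by rewrite [RHS]row_sum_delta.
Qed.

Lemma Ubasis_ek k : exists t : R, Ubasis theta k = expi t *: ek k.
Proof.
rewrite /Ubasis; have [ph ->] := Upow_gr k; exists (ph k).
by rewrite gr_app vacuumE tsh_ek add0r.
Qed.

(** Coefficients in the basis U^k differ from Fourier coefficients by phases depending on [k] only,
    so conditions on moduli and diagonal operators are the same in both bases. *)
Lemma coefE k : exists t : R, forall u, coef theta u k = expi t * cf u k.
Proof.
have [t h] := Ubasis_ek k; exists (- t) => u; rewrite /coef h (dZr hd) dot_ek.
by congr (_ * _); rewrite -expi_conj.
Qed.
Lemma derivP j u v : Defs.deriv theta j (u, v) <->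
  forall k, cf v k = (0 +i* 1) * (k 0 j)%:~R * cf u k.
Proof.
split=> h k; have [t ht] := coefE k.
  have /= := h k; rewrite !ht mulrCA => /mulfI; apply; exact: expi_neq0.
by rewrite /= !ht mulrCA h.
Qed.

End Torus.

(** * The von Neumann algebra of the noncommutative torus *)

Section BoundedAdjoint.
Context {R : realType} {H : lmodType R[i]} (d : H -> H -> R[i]) (hd : hilbert d).
Implicit Types (x y z : H) (f g : H -> H) (A B : op H).
Local Notation rd := (rdot d).

Definition bl f := lin f /\ exists M : R, 0 <= M /\ forall x, hnorm d (f x) <= M * hnorm d x.

Lemma bl_bounded f : bl f -> bounded_op d (gr f).
Proof. by move=> [lf [M [_ hM]]]; exact: gr_bounded hM. Qed.
Lemma bounded_bl A : bounded_op d A -> exists2 f, bl f & A = gr f.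
Proof. by move=> /bounded_gr[f [e lf hM]]; exists f. Qed.
Lemma bl_cvg f u x : bl f -> hcvg d u x -> hcvg d (fun n => f (u n)) (f x).
Proof. by move=> [lf [M [_ hM]]]; exact: hcvg_bnd. Qed.
Lemma bl_id : bl id.
Proof. by split=> //; exists 1; split=> // x; rewrite mul1r. Qed.
Lemma bl_comp f g : bl f -> bl g -> bl (f \o g).
Proof.
move=> [lf [M [M0 hM]]] [lg [N [N0 hN]]]; split; first exact: lin_comp.
exists (M * N); split=> [|x]; first exact: mulr_ge0.
by rewrite -mulrA; apply: le_trans (hM _) _; apply: ler_wpM2l.
Qed.
Lemma bl_add f g : bl f -> bl g -> bl (fun x => f x + g x).
Proof.
move=> [lf [M [M0 hM]]] [lg [N [N0 hN]]]; split; first exact: lin_add.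
exists (M + N); split=> [|x]; first exact: addr_ge0.
by apply: le_trans (hnormD hd _ _) _; rewrite mulrDl lerD.
Qed.
Lemma bl_scale (c : R[i]) f : bl f -> bl (fun x => c *: f x).
Proof.
move=> [lf [M [M0 hM]]]; split; first exact: lin_scale.
exists (Num.sqrt (normc2 c) * M); split=> [|x]; first by rewrite mulr_ge0 ?sqrtr_ge0.
by rewrite (hnormZ hd) -mulrA ler_wpM2l ?sqrtr_ge0.
Qed.

Lemma d_ext x y : (forall z, d x z = d y z) -> x = y.
Proof. by move=> h; apply: (rd_ext hd) => z; rewrite /rdot h. Qed.

Lemma d_extr x y : (forall z, d z x = d z y) -> x = y.
Proof. by move=> h; apply: d_ext => z; rewrite !(ip_conj hd z) h. Qed.

(** The component [e] of a vector off the kernel that is orthogonal to the kernel represents the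
    functional, up to the scalar fixed by its value at [e]. *)
Lemma riesz (phi : H -> R[i]) (M : R) : (forall c x y, phi (c *: x + y) = c * phi x + phi y) ->
  (forall x, normc2 (phi x) <= M * rd x x) -> exists w, forall x, phi x = d x w.
Proof.
move=> lphi hM; pose K := [set x | phi x = 0].
have phi0 : phi 0 = 0.
  have := lphi 1 0 0; rewrite scale1r mul1r addr0 => /eqP.
  by rewrite -subr_eq0 opprD addNKr oppr_eq0 => /eqP.
have phiZ c x : phi (c *: x) = c * phi x by rewrite -[c *: x]addr0 lphi phi0 addr0.
have phiB x y : phi (x - y) = phi x - phi y.
  by rewrite addrC -scaleN1r lphi mulN1r addrC.
have sK : subsp K by split=> // c x y hx hy; rewrite /K /= lphi hx hy mulr0 addr0.
have n20 (z : R[i]) : normc2 z = 0 -> z = 0.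
  case: z => a b; rewrite /normc2 /= => h; have := sqr_ge0 a; have := sqr_ge0 b => ? ?.
  by congr (_ +i* _); apply/eqP; rewrite -sqrf_eq0; apply/eqP; lra.
have cK : hclosed d K.
  move=> u x hu hx; apply: n20; apply/eqP; rewrite eq_le normc2_ge0 andbT.
  apply: (@cvg_real_le _ (fun=> normc2 (phi x)) (fun n => M * (hnorm d (u n - x)) ^+ 2)).
  - move=> n; rewrite (hnorm2 hd); apply: le_trans (hM _); rewrite phiB (hu n) sub0r.
    by case: (phi x) => a b; rewrite /normc2 /= !sqrrN.
  - exact: cvg_cst.
  - by apply: cvg0Z; under eq_fun do rewrite expr2; rewrite -(mulr0 0); exact: (cvgM hx hx).
have [[x0 hx0]|hn] := pselect (exists x, phi x <> 0); last first.
  exists 0 => x; rewrite (d0r hd); apply: contrapT => h; apply: hn; by exists x.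
pose e := x0 - proj hd sK cK x0.
have pe : phi e = phi x0 by rewrite phiB (proj_in hd sK cK x0 : phi _ = 0) subr0.
have eK x : phi x = 0 -> d x e = 0.
  move=> hx; have := proj_orth hd sK cK x0; rewrite -/e => ho.
  apply: complexP; first by rewrite -/(rd x e) (rdC hd) ho.
  by rewrite (imd hd) (rdC hd); apply: (orth_i hd (G := K)) => //; exact: hx.
have en0 : phi e != 0 by apply/eqP; rewrite pe.
have de0 : d e e != 0.
  apply/eqP => h; have e0 : e = 0 by apply: (ip_eq0 hd); rewrite h.
  by move: en0; rewrite e0 phi0 eqxx.
exists ((phi e / d e e)^* *: e) => x; rewrite (dZr hd) conjCK.
have : d (x - (phi x / phi e) *: e) e = 0.
  by apply: eK; rewrite phiB phiZ divfK // subrr.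
rewrite (dBl hd) (dZl hd) => /eqP; rewrite subr_eq0 => /eqP ->.
by rewrite mulrCA divfK // divfK.
Qed.

Lemma bl_adj f : bl f -> exists2 g, bl g & forall x y, d (f x) y = d x (g y).
Proof.
move=> [lf [M [M0 hM]]].
have /choice[g hg] : forall y, exists w, forall x, d (f x) y = d x w.
  move=> y; apply: (@riesz (fun x => d (f x) y) (M ^+ 2 * rd y y)).
    by move=> c a b; rewrite lf (ip_linear hd).
  move=> x; have h1 : normc2 (d (f x) y) = rd (d y (f x) *: f x) y.
    by rewrite /rdot (dZl hd) (ip_conj hd (f x) y) mulrC normc2E.
  have h2 : normc2 (d y (f x)) = normc2 (d (f x) y) by rewrite (ip_conj hd (f x) y) normc2_conj.
  have := rd_le hd (d y (f x) *: f x) y; rewrite -h1 (hnormZ hd) h2 => h3.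
  set a := normc2 _ in h1 h2 h3 *; have a0 : 0 <= a by exact: normc2_ge0.
  have := hM x; rewrite -!(hnorm2 hd).
  move: (hnorm_ge0 d (f x)) (hnorm_ge0 d x) (hnorm_ge0 d y) (sqrtr_ge0 a) (sqr_sqrtr a0) h3.
  move: (hnorm d (f x)) (hnorm d x) (hnorm d y) (Num.sqrt a) => p q r b p0 q0 r0 b0 ba h3 pq.
  rewrite -ba in h3 *; rewrite -!exprMn; have : b <= M * q * r.
    have [->|bn] := eqVneq b 0; first by rewrite !mulr_ge0.
    have bp : 0 < b by rewrite lt_def bn.
    rewrite expr2 -mulrA ler_pM2l // in h3; apply: le_trans h3 _; exact: ler_wpM2r.
  move=> h; apply: lerXn2r; rewrite ?nnegrE ?mulr_ge0 //.
  by apply: le_trans h _; rewrite mulrAC.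
exists g; last by move=> x y; exact: hg.
have lg : lin g.
  by move=> c x y; apply/d_extr => z; rewrite -hg !(dDr hd) !(dZr hd) -!hg.
split=> //; exists M; split=> // y.
have h : rd (g y) (g y) = rd (f (g y)) y by rewrite /rdot hg.
have := rd_le hd (f (g y)) y; rewrite -h -(hnorm2 hd).
move: (hM (g y)) (hnorm_ge0 d (g y)) (hnorm_ge0 d y) (hnorm_ge0 d (f (g y))).
move: (hnorm d (g y)) (hnorm d y) (hnorm d (f (g y))) => p q r h1 p0 q0 r0 h2.
have [->|pn] := eqVneq p 0; first by rewrite mulr_ge0.
have pp : 0 < p by rewrite lt_def pn.
rewrite -(ler_pM2l pp) -expr2; apply: le_trans h2 _.
by rewrite mulrCA mulrA; apply: ler_wpM2r.
Qed.

(** The inclusion f A < A f for a possibly unbounded [A]: [f] preserves the domain and commutes with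
    [A] on it. *)
Definition inv_by f A := forall x y, A (x, y) -> A (f x, f y).

Section InvBy.
Variables (f : H -> H).
Lemma inv_comp A B : inv_by f A -> inv_by f B -> inv_by f (opcomp A B).
Proof. by move=> hA hB x y [z [hz hy]]; exists (f z); split; [exact: hB|exact: hA]. Qed.
Lemma inv_opinv A : inv_by f A -> inv_by f (opinv A).
Proof. by move=> hA x y; exact: hA. Qed.
Lemma inv_opid : inv_by f opid.
Proof. by move=> x y; rewrite /opid /= => ->. Qed.
Lemma inv_opclosure A : bl f -> inv_by f A -> inv_by f (opclosure d A).
Proof.
move=> bf hA x y; rewrite (opclosureE hd) => /hclosureP[u [hu hc]].
apply/hclosureP; exists (fun n => (f (u n).1, f (u n).2)); split.
  by move=> n; apply: hA; move: (hu n); case: (u n).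
by apply: (hcvg_prod hd); apply: bl_cvg => //; [exact: hcvg_fst hc|exact: hcvg_snd hc].
Qed.
End InvBy.
Lemma inv_adj f g A : (forall x y, d (f x) y = d x (g y)) -> inv_by f A -> inv_by g (adj d A).
Proof. by move=> fg hA x y hxy a b hab; rewrite /= -!fg; apply: hxy; exact: hA. Qed.
Lemma inv_gr f g : inv_by f (gr g) <-> forall x, f (g x) = g (f x).
Proof. by split=> [h x|h x y /grP ->]; [exact: h|rewrite /gr /= h]. Qed.

End BoundedAdjoint.

Section VonNeumann.
Context {R : realType} {n : nat} (theta : 'M[R]_n) (htheta : theta^T = - theta).
Local Notation Zn := (Zn n).
Local Notation L2 := (L2 R n).
Local Notation dot := (@dot R n).
Implicit Types (u v w : L2) (k a b : Zn) (j : 'I_n) (f g : L2 -> L2).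
Local Notation cf u k := (L2coef u k : R[i]).
Local Notation hd := (@dot_hilbert R n).
Local Notation Uf := (Ushift theta).
Local Notation Rf := (Rf theta).
Local Notation bl := (bl dot).
Local Notation one := (ek (0 : Zn) : L2).

(* the commutant of [Linf] and [Linf] itself, as sets of functions *)
Definition Mc f := bl f /\ forall j u, f (Uf j u) = Uf j (f u).
Definition Ma g := bl g /\ forall f, Mc f -> forall u, g (f u) = f (g u).

Let S0 : set (op L2) := [set T | exists j, T = U theta j \/ T = adj dot (U theta j)].

Lemma UfV_comm f j : (forall u, f (Uf j u) = Uf j (f u)) ->
  forall u, f (tshV (fun k => Bil theta (k - dl j) (dl j)) (dl j) u) =
    tshV (fun k => Bil theta (k - dl j) (dl j)) (dl j) (f u).
Proof.
move=> h u; rewrite -[LHS](tshK (fun k => Bil theta (k - dl j) (dl j)) (dl j)).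
by rewrite -/(Uf j _) -h /Ushift tshVK.
Qed.

Lemma commutant_S0 T : commutant dot S0 T <-> exists2 f, Mc f & T = gr f.
Proof.
split=> [[/bounded_bl[f bf ->] hT]|[f [bf hf] ->]].
  exists f => //; split=> // j u; have := hT (U theta j); rewrite U_gr // !gr_comp => h.
  by apply: (gr_injE u (h _)); exists j; left; rewrite U_gr.
split; first exact: bl_bounded.
move=> A [j [->|->]]; rewrite U_gr // ?adj_tsh // !gr_comp; congr gr; apply/funext => u /=.
  exact: hf.
by apply: UfV_comm => v; exact: hf.
Qed.

Lemma LinfP T : Linf theta T <-> exists2 g, Ma g & T = gr g.
Proof.
split=> [[/bounded_bl[g bg ->] hT]|[g [bg hg] ->]].
  exists g => //; split=> // f Mf u.
  have := hT (gr f); rewrite !gr_comp => h.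
  apply: (gr_injE u (h _)).
  by apply/commutant_S0; exists f.
split; first exact: bl_bounded.
move=> A /commutant_S0[f Mf ->]; rewrite !gr_comp; congr gr; apply/funext => u /=; exact: hg.
Qed.

Lemma Ma_Uf j : Ma (Uf j).
Proof.
split; last by move=> f [_ h] u; rewrite h.
by split; [exact: tsh_lin|exists 1; split=> // x; rewrite mul1r hnorm_tsh].
Qed.

(** The generators belong to [Linf], so the commutant of [Linf] is that of the generators: the
    triple commutant is the commutant. *)
Lemma commLinfP T : commutant dot (Linf theta) T <-> exists2 f, Mc f & T = gr f.
Proof.
split=> [[/bounded_bl[f bf ->] hT]|[f Mf ->]].
  exists f => //; split=> // j u; have := hT (gr (Uf j)); rewrite !gr_comp => h.
  apply: (gr_injE u (h _)).
  by apply/LinfP; exists (Uf j) => //; exact: Ma_Uf.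
split; first by apply: bl_bounded; exact: Mf.1.
by move=> A /LinfP[g Mg ->]; rewrite !gr_comp; congr gr; apply/funext => u /=; rewrite Mg.2.
Qed.

Lemma Mc_id : Mc id. Proof. by split=> //; exact: bl_id. Qed.
Lemma Mc_comp f g : Mc f -> Mc g -> Mc (f \o g).
Proof. by move=> [bf hf] [bg hg]; split; [exact: bl_comp|move=> j u /=; rewrite hg hf]. Qed.
Lemma Mc_add f g : Mc f -> Mc g -> Mc (fun u => f u + g u).
Proof.
move=> [bf hf] [bg hg]; split; first exact: (bl_add hd).
by move=> j u /=; rewrite hg hf (linD (@Uf_lin _ _ theta j)).
Qed.
Lemma Mc_scale c f : Mc f -> Mc (fun u => c *: f u).
Proof.
move=> [bf hf]; split; first exact: (bl_scale hd).
by move=> j u /=; rewrite hf (linZ (@Uf_lin _ _ theta j)).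
Qed.
Lemma Mc_sub f g : Mc f -> Mc g -> Mc (fun u => f u - g u).
Proof.
move=> hf hg; have := Mc_add hf (Mc_scale (-1) hg).
by congr Mc; apply/funext => u; rewrite scaleN1r.
Qed.
Lemma Mc_adj f g : Mc f -> (forall x y, dot (f x) y = dot x (g y)) -> Mc g.
Proof.
move=> [bf hf] fg; have [g' bg' hg'] := bl_adj hd bf.
have -> : g = g'.
  apply/funext => x; apply: (d_ext hd) => z; rewrite !(ip_conj hd z) -fg hg' //.
split=> // j u; apply: (d_ext hd) => z; rewrite !(ip_conj hd z); congr (_^*).
rewrite -(tshVK (fun k => Bil theta (k - dl j) (dl j)) (dl j) z) -/(Uf j _).
set z' := tshV _ _ z; rewrite [RHS]dot_tsh -!hg' -[RHS](dot_tsh (fun k => Bil theta (k - dl j) (dl j)) (dl j)).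
by rewrite -/(Uf j _) -/(Uf j _) hf.
Qed.
Lemma Mc_Rf a : Mc (Rf a).
Proof.
split; last by move=> j u; exact: RU_comm.
by split; [exact: tsh_lin|exists 1; split=> // x; rewrite mul1r hnorm_tsh].
Qed.

Lemma Ma_id : Ma id. Proof. by split=> //; exact: bl_id. Qed.
Lemma Ma_comp f g : Ma f -> Ma g -> Ma (f \o g).
Proof. by move=> [bf hf] [bg hg]; split; [exact: bl_comp|move=> h Mh u /=; rewrite hg // hf]. Qed.
Lemma Ma_add f g : Ma f -> Ma g -> Ma (fun u => f u + g u).
Proof.
move=> [bf hf] [bg hg]; split; first exact: (bl_add hd).
by move=> h Mh u /=; rewrite hg // hf // (linD Mh.1.1).
Qed.
Lemma Ma_scale c f : Ma f -> Ma (fun u => c *: f u).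
Proof.
move=> [bf hf]; split; first exact: (bl_scale hd).
by move=> h Mh u /=; rewrite hf // (linZ Mh.1.1).
Qed.
Lemma Ma_adj f g : Ma f -> (forall x y, dot (f x) y = dot x (g y)) -> Ma g.
Proof.
move=> [bf hf] fg; have [g' bg' hg'] := bl_adj hd bf.
have -> : g = g'.
  by apply/funext => x; apply: (d_ext hd) => z; rewrite !(ip_conj hd z) -fg hg'.
split=> // h Mh u; have [h' _ hh'] := bl_adj hd Mh.1; have Mh' := Mc_adj Mh hh'.
apply: (d_ext hd) => z; rewrite !(ip_conj hd z); congr (_^*).
rewrite -hg'; have e x y : dot (h' x) y = dot x (h y) by rewrite (ip_conj hd y) -hh' -(ip_conj hd).
by rewrite -!e -hg' hf.
Qed.

(** Right translations commute with the generators and move 1 to every mode, so 1 is cyclic for the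
    commutant. *)
Lemma Mc_dense : forall u, hclosure dot [set f one | f in Mc] u.
Proof.
apply: ek_dense.
  split; first by exists (fun x => 0 *: x); [exact: (Mc_scale 0 Mc_id)|rewrite scale0r].
  move=> c _ _ [f Mf <-] [g Mg <-]; exists (fun x => c *: f x + g x) => //.
  by apply: Mc_add => //; exact: Mc_scale.
by move=> k; exists (Rf k); [exact: Mc_Rf|rewrite Rf_vac].
Qed.
(** A map of the commutant intertwines the generators, and [inv_by] survives products and inverse
    relations, hence all monomials. *)
Lemma Ma_Upow k : exists2 g, Ma g & exists t, g one = expi t *: ek k.
Proof.
have [ph e] := Upow_gr theta k; exists (tsh ph k); last first.
  by exists (ph k); rewrite tsh_ek add0r.
split.
  by split; [exact: tsh_lin|exists 1; split=> // x; rewrite mul1r hnorm_tsh].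
move=> f [bf hf] u; apply/esym; move: u; apply/inv_gr; rewrite -e /Upow.
elim/big_ind : _ => [|A B|j _]; [exact: inv_opid|exact: inv_comp|].
have hU : inv_by f (U theta j) by rewrite U_gr //; apply/inv_gr => u; exact: hf.
have it A N : inv_by f A -> inv_by f (iter N (opcomp A) opid).
  by move=> hA; elim: N => [|N IH]; [exact: inv_opid|exact: inv_comp].
by case: (k 0 j) => N; apply: it => //; exact: inv_opinv.
Qed.
Lemma Ma_dense : forall u, hclosure dot [set f one | f in Ma] u.
Proof.
have sM : subsp [set f one | f in Ma].
  split; first by exists (fun x => 0 *: x); [exact: (Ma_scale 0 Ma_id)|rewrite scale0r].
  move=> c _ _ [f Mf <-] [g Mg <-]; exists (fun x => c *: f x + g x) => //.
  by apply: Ma_add => //; exact: Ma_scale.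
apply: ek_dense => // k; have [g Mg [t ht]] := Ma_Upow k.
rewrite -[ek k]scale1r -(mulVf (expi_neq0 t)) -scalerA -ht; apply: (subspZ sM); by exists g.
Qed.

(** A cyclic vector for the commutant is separating for the algebra. *)
Lemma Ma_sep f g : Ma f -> Ma g -> f one = g one -> f = g.
Proof.
move=> Mf Mg e; apply/funext => u.
have [v [hv cv]] := (hclosureP _ _ _).1 (Mc_dense u).
have h1 := bl_cvg Mf.1 cv; have h2 := bl_cvg Mg.1 cv.
apply: (hcvg_unique hd h1).
suff -> : (fun n => f (v n)) = (fun n => g (v n)) by [].
by apply/funext => m; have [c Mc_c <-] := hv m; rewrite Mf.2 // Mg.2 // e.
Qed.

Lemma J_l2 u : (fun k => (cf u (- k))^* : R[i]^o) \in @l2 R n.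
Proof.
apply: l2P; under eq_fun do rewrite normc2_conj.
by rewrite (esm_opp (fun k => normc2 (cf u k))); exact: l2_esm.
Qed.
(* the modular conjugation [x 1 |-> x^* 1] *)
Definition J u : L2 := MkL2 (J_l2 u).
Lemma JE u k : cf (J u) k = (cf u (- k))^*. Proof. by []. Qed.
Lemma JJ u : J (J u) = u.
Proof. by apply: L2_ext => k; rewrite !JE opprK complex.conjcK. Qed.
Lemma JD u v : J (u + v) = J u + J v.
Proof. by apply: L2_ext => k; rewrite L2D !JE L2D rmorphD. Qed.
Lemma JZ c u : J (c *: u) = c^* *: J u.
Proof. by apply: L2_ext => k; rewrite L2Z !JE L2Z rmorphM. Qed.
Lemma dot_J u v : dot (J u) (J v) = dot v u.
Proof.
rewrite /Defs.dot; congr (_ +i* _); rewrite -[RHS]rsum_opp; congr rsum; apply/funext => k.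
  by rewrite !JE; case: (cf u (- k)) (cf v (- k)) => a b [c e] /=; ring.
by rewrite !JE; case: (cf u (- k)) (cf v (- k)) => a b [c e] /=; ring.
Qed.
Lemma hnorm_J u : hnorm dot (J u) = hnorm dot u.
Proof. by rewrite /hnorm dot_J. Qed.

Lemma Rf_adj k u v : dot u (Rf k v) = dot (Rf (- k) u) v.
Proof.
have e : Rf k (Rf (- k) u) = u.
  apply: L2_ext => m; rewrite !tshE mulrA -expiD opprK subrK (BilC htheta _ (- k)) BilNl opprK.
  by rewrite (BilC htheta k (m - k)) BilBl Bilxx // subr0 opprK addNr expi0 mul1r.
by rewrite -{1}e dot_tsh.
Qed.
(** Modes are right translates of 1, and right translations commute with [f], so each coefficient of
    g 1 can be moved across. That g 1 and f 1 have equal norms is the trace property of [tau]. *)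
Lemma Ma_adj1 f g : Ma f -> (forall x y, dot (f x) y = dot x (g y)) -> g one = J (f one).
Proof.
move=> Mf fg; apply: L2_ext => k; rewrite -dot_ek (ip_conj hd (ek k)) -fg -(Rf_vac htheta k).
rewrite Mf.2; last exact: Mc_Rf.
rewrite -(ip_conj hd) (Rf_adj k one (f one)) (Rf_vac htheta (- k)) JE.
by rewrite (ip_conj hd (f one)) dot_ek.
Qed.
Lemma hnorm_adj1 f g : Ma f -> (forall x y, dot (f x) y = dot x (g y)) ->
  hnorm dot (g one) = hnorm dot (f one).
Proof. by move=> Mf fg; rewrite (Ma_adj1 Mf fg) hnorm_J. Qed.

Lemma adjC f g : (forall x y, dot (f x) y = dot x (g y)) -> forall x y, dot (g x) y = dot x (f y).
Proof. by move=> h x y; rewrite (ip_conj hd y) -h -(ip_conj hd). Qed.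

(** On vectors c 1 with [c] in the algebra, J a J is right multiplication by the adjoint of [a]: it
    sends c 1 to c a' 1. This commutes with multiplication from the left, and such vectors are
    dense. *)
Lemma Mc_JJ (a : L2 -> L2) : Ma a -> Mc (J \o a \o J).
Proof.
move=> Mfa; have bJ : bl (J \o a \o J).
  have [[la [M [M0 hM]]] _] := Mfa; split.
    by move=> c x y /=; rewrite JD JZ la JD JZ conjCK.
  by exists M; split=> // x /=; rewrite hnorm_J -(hnorm_J x).
split=> // j u.
have key c : Ma c -> forall a' : L2 -> L2, (forall x y, dot (a x) y = dot x (a' y)) ->
    (J \o a \o J) (c one) = c (a' one).
  move=> Mfc a' aa'; have [c' _ cc'] := bl_adj hd Mfc.1.
  have Mc' := Ma_adj Mfc cc'.
  rewrite /= -(Ma_adj1 Mfc cc') -(@Ma_adj1 (a \o c') (c \o a')) //; first exact: Ma_comp.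
  by move=> x y /=; rewrite aa' (adjC cc').
have [a' _ aa'] := bl_adj hd Mfa.1.
have [v [hv cv]] := (hclosureP _ _ _).1 (Ma_dense u).
have bU := (Ma_Uf j).1.
have h1 := bl_cvg bJ (bl_cvg bU cv); have h2 := bl_cvg bU (bl_cvg bJ cv).
apply: (hcvg_unique hd h1).
suff -> : (fun m => (J \o a \o J) (Uf j (v m))) = fun m => Uf j ((J \o a \o J) (v m)) by [].
apply/funext => m; have [c Mfc <-] := hv m.
rewrite (key c Mfc a' aa'); apply: (key (Uf j \o c) _ a' aa').
by apply: Ma_comp => //; exact: Ma_Uf.
Qed.
(** Exchanges an element of the algebra for one of the commutant with the same value at 1; the
    latter preserves domains of affiliated operators. *)
Lemma Ma_Mc_one f : Ma f -> exists2 c, Mc c & c one = f one.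
Proof.
move=> Mf; have [g _ fg] := bl_adj hd Mf.1; have Mg := Ma_adj Mf fg.
exists (J \o g \o J); first exact: Mc_JJ.
have e1 : J one = one by rewrite -(@Ma_adj1 id id) //; exact: Ma_id.
by rewrite /= e1 (Ma_adj1 Mf fg) JJ.
Qed.

Lemma affiliatedP A : affiliated theta A <->
  [/\ closed_op dot A, densely_defined dot A & forall f, Mc f -> inv_by f A].
Proof.
split=> [[cA dA h]|[cA dA h]]; split=> //.
  by move=> f Mf; apply/gr_commute; apply: h; apply/commLinfP; exists f.
by move=> T /commLinfP[f Mf ->]; apply/gr_commute; exact: h.
Qed.

End VonNeumann.

(** * Affiliated operators and the trace *)

Section AffiliatedOps.
Context {R : realType} {n : nat} (theta : 'M[R]_n) (htheta : theta^T = - theta).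
Local Notation L2 := (L2 R n).
Local Notation dot := (@dot R n).
Implicit Types (u v w x y : L2) (f g : R -> R) (c T : L2 -> L2).
Local Notation hd := (@dot_hilbert R n).
Local Notation rd := (rdot dot).
Local Notation Mc := (Mc theta).
Local Notation Ma := (Ma theta).
Local Notation one := (ek (0 : Zn n) : L2).
Local Notation meas := (measurable_fun (setT : set R)).

(** Says that the projections lie in [Linf], tested against its commutant. *)
Definition pvmM (E : @pvm R L2) := forall c, Mc c -> forall B x, measurable B ->
  c (pvm_proj E B x) = pvm_proj E B (c x).

Lemma selfadj_pvmM (A : op L2) (E : pvm) : is_spectral_measure dot A E ->
  (forall c, Mc c -> inv_by c A) -> pvmM E.
Proof.
move=> [hE eA] hA c Mcc B x mB.
have [c' bc' cc'] := bl_adj hd Mcc.1; have Mc' := Mc_adj Mcc cc'.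
have [[lc [M [M0 hM]]] _] := Mcc; have [lc' [M' [M'0 hM']]] := bc'.
have e1 y z : rd (c y) z = rd y (c' z) by rewrite /rdot cc'.
apply: (intertwine hd hE hE lc lc' (M := M + M') _ _ e1) => //.
- by move=> y; apply: le_trans (hM y) _; rewrite mulrDl lerDl mulr_ge0 ?hnorm_ge0.
- by move=> y; apply: le_trans (hM' y) _; rewrite mulrDl lerDr mulr_ge0 ?hnorm_ge0.
- by rewrite -eA; exact: hA.
- by rewrite -eA; exact: hA.
Qed.

Section PvmM.
Variables (E : @pvm R L2) (hE : is_pvm dot E) (EM : pvmM E).
Lemma Ma_phi f : bmeas f -> Ma (phi hd hE f).
Proof.
move=> bf; split.
  split; first exact: phi_lin.
  have [M hM] := phi_bnd hd hE bf; exists `|M|; split=> // x.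
  by apply: le_trans (hM x) _; rewrite ler_wpM2r ?hnorm_ge0 // ler_norm.
move=> c Mcc u; have [[lc [M [_ hM]]] _] := Mcc.
by rewrite (phi_comm hd hE u lc hM) // => B y mB; exact: EM.
Qed.
Lemma pvm_integral_inv f c : meas f -> Mc c -> inv_by c (pvm_integral dot E f).
Proof.
move=> mf Mcc x y; have [[lc [M [_ hM]]] _] := Mcc.
by apply: (pvm_integral_map hd hE mf lc hM) => B z mB; exact: EM.
Qed.
Lemma pvm_integral_affiliated f : meas f -> affiliated theta (pvm_integral dot E f).
Proof.
move=> mf; apply/affiliatedP; split.
- exact: (pvm_integral_closed hd hE).
- exact: (pvm_integral_dense hd hE).
- by move=> c; exact: pvm_integral_inv.
Qed.
End PvmM.

Section Polar.
Variables (Z : op L2) (aZ : affiliated theta Z).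
Local Notation ZZ := (opcomp (adj dot Z) Z).

Lemma aff_closed : closed_op dot Z. Proof. by have [] := aZ. Qed.
Lemma aff_dense : densely_defined dot Z. Proof. by have [] := aZ. Qed.
Lemma aff_inv c : Mc c -> inv_by c Z.
Proof. by have [_ _ h] := (affiliatedP theta Z).1 aZ; exact: h. Qed.
Lemma aff_adj_inv c : Mc c -> inv_by c (adj dot Z).
Proof.
move=> Mcc; have [c' _ cc'] := bl_adj hd Mcc.1.
apply: inv_adj (adjC cc') _; apply: aff_inv; exact: Mc_adj Mcc cc'.
Qed.
Lemma aff_square_inv c : Mc c -> inv_by c ZZ.
Proof. by move=> Mcc; apply: inv_comp; [exact: aff_adj_inv|exact: aff_inv]. Qed.
Lemma aff_spectral : exists E, is_spectral_measure dot ZZ E.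
Proof.
have [lZ sZ] := adj_comp_selfadj hd aff_closed aff_dense.
exact: (spectral_theorem hd).
Qed.
Lemma aff_fun x y y' : Z (x, y) -> Z (x, y') -> y = y'.
Proof.
have [[_ hl hu] _] := aff_closed => h h'.
apply/eqP; rewrite -subr_eq0; apply/eqP/hu.
by have := hl (-1) _ _ _ _ h' h; rewrite !scaleN1r addNr addrC.
Qed.

Lemma opabsE E : is_spectral_measure dot ZZ E ->
  opabs dot Z = pvm_integral dot E (fun t => t `^ 2^-1).
Proof. by move=> hE; rewrite /opabs /oppow (fcalcE hd _ hE). Qed.
Lemma LpnormE E r : is_spectral_measure dot ZZ E ->
  Lpnorm r Z =
  ((\int[pvm_meas E one]_(t in setT) ((t `^ 2^-1) `^ r)%:E) `^ r^-1)%E.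
Proof.
move=> hE; rewrite /Lpnorm /tau_fun (opabsE hE) vacuumE; congr (_ `^ _)%E.
rewrite (spectral_int hd hE.1 _ (measurable_powR _) (measurable_powR _)) //.
by move=> t; exact: powR_ge0.
Qed.

Variables (E : @pvm R L2) (hs : is_spectral_measure dot ZZ E).
Let hE : is_pvm dot E := hs.1.
Let eZ : ZZ = pvm_integral dot E id := hs.2.
Let EM : pvmM E := selfadj_pvmM hs aff_square_inv.
Local Notation P := (pvm_proj E).
Local Notation phi := (phi hd hE).
Let mid : meas id := @measurable_id _ _ setT.

Lemma square_rd x y z a b : ZZ (x, y) -> Z (x, z) -> Z (a, b) -> rd b z = rd a y.
Proof.
move=> [z' [h1 h2]] h3 h4; rewrite (aff_fun h3 h1) /rdot.
by congr complex.Re; exact: (h2 _ _ h4).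
Qed.
Lemma square_ge0 x : P `]-oo, 0[ x = 0.
Proof.
apply: (pvm_neg0 hd hE) => a b; rewrite -eZ => hab; have [z [h1 _]] := hab.
rewrite (rdC hd b) -(square_rd hab h1 h1); exact: rd_ge0 hd _.
Qed.
(** On the kernel of Z* Z the squared norm of the image under Z is the form of Z* Z, which is 0. *)
Lemma square_ker x : Z (P [set 0] x, 0).
Proof.
have : ZZ (P [set 0] x, 0) by rewrite eZ; apply: (pvm_integral_P0 hd hE) => // t ->.
move=> h; have [z [h1 _]] := h; have := square_rd h h1 h1.
by rewrite (rd0r hd) => /(rd_eq0 hd) z0; rewrite z0 in h1.
Qed.

(** Bounded away from 0 and from infinity, so that all real powers, negative ones included, are
    bounded on it. *)
Let C k : set R := `[k.+1%:R^-1, k.+1%:R]%classic.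
Let mC k : measurable (C k). Proof. exact: measurable_itv. Qed.
Let C0 k t : C k t -> 0 < t.
Proof. by rewrite /C /= in_itv /= => /andP[h _]; apply: lt_le_trans h. Qed.
Let bdC (s : R) k : bdon (fun t => t `^ s) (C k).
Proof.
exists (Num.max (k.+1%:R `^ s) (k.+1%:R^-1 `^ s)) => t Ct; rewrite ger0_norm ?powR_ge0 //.
have t0 := C0 Ct; move: Ct; rewrite /C /= in_itv /= => /andP[h1 h2]; rewrite le_max.
have [s0|s0] := lerP 0 s.
  by rewrite ge0_ler_powR ?nnegrE // ltW.
have [r r0 ->] : exists2 r, 0 <= r & s = - r by exists (- s); rewrite ?opprK // oppr_ge0 ltW.
apply/orP; right.
rewrite !powRN lef_pV2 ?posrE ?powR_gt0 ?invr_gt0 //.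
by rewrite ge0_ler_powR ?nnegrE ?invr_ge0 //; exact: ltW.
Qed.
Let bpow s k : bmeas (cutf (fun t => t `^ s) (C k)).
Proof. exact: bmeas_cut (measurable_powR _) (mC k) (bdC s k). Qed.
Let bid k : bdon id (C k).
Proof.
exists k.+1%:R => t Ct; rewrite ger0_norm; last exact: ltW (C0 Ct).
by move: Ct; rewrite /C /= in_itv /= => /andP[].
Qed.

Let Zon k x : exists z, Z (P (C k) x, z).
Proof.
have : ZZ (P (C k) x, phi (cutf id (C k)) x) by rewrite eZ; exact: (pvm_integral_P hd hE).
by move=> [z [hz _]]; exists z.
Qed.
Let Zf k x : L2 := xget 0 [set z | Z (P (C k) x, z)].
Let ZfP k x : Z (P (C k) x, Zf k x).
Proof. by rewrite /Zf; case: xgetP => [z _ //|/= h]; have [z hz] := Zon k x; case: (h z). Qed.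
Let ZfE k x z : Z (P (C k) x, z) -> Zf k x = z.
Proof. exact: aff_fun (ZfP k x). Qed.
Let Zf_rd k x a b : Z (a, b) -> rd b (Zf k x) = rd a (phi (cutf id (C k)) x).
Proof. by apply: square_rd (ZfP k x); rewrite eZ; exact: (pvm_integral_P hd hE). Qed.
Let Zf_PP k m x : (k <= m)%N -> Zf k (P (C m) x) = Zf k x.
Proof.
move=> km; apply: ZfE; have := ZfP k x; rewrite (P_sub hE) //.
move=> t; rewrite /C /= !in_itv /= => /andP[h1 h2]; apply/andP; split.
  by apply: le_trans h1; rewrite lef_pV2 ?posrE // ler_nat.
by apply: le_trans h2 _; rewrite ler_nat.
Qed.
Let Zf_le k x a : Z (x, a) -> rd a (Zf k x) = rd (Zf k x) (Zf k x).
Proof.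
move=> h; have bi := bmeas_cut mid (mC k) (bid k).
rewrite (Zf_rd k x h) (Zf_rd k x (ZfP k x)) (P_sym hE) // -(phi_P hd hE) // phi_cutP //.
Qed.
Let Zf_mono k m x : (k <= m)%N -> rd (Zf m x) (Zf k x) = rd (Zf k x) (Zf k x).
Proof. by move=> km; have := Zf_le k (ZfP m x); rewrite (Zf_PP x km). Qed.
Let Zf_bound k x a : Z (x, a) -> hnorm dot (Zf k x) <= hnorm dot a.
Proof.
move=> h; have := rd_le hd a (Zf k x); rewrite (Zf_le k h) -(hnorm2 hd) expr2.
have [->|h0] := eqVneq (hnorm dot (Zf k x)) 0; first by rewrite hnorm_ge0.
by rewrite ler_pM2r // lt_def h0 hnorm_ge0.
Qed.

(** The images of the truncations have increasing norms bounded by that of [a], so they converge.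
    The truncated vectors miss only the part of [x] on {0}, which Z kills, and closedness of Z
    identifies the limit. *)
Lemma spectral_cut_cvg x a : Z (x, a) -> hcvg dot (fun k => Zf k x) a.
Proof.
move=> h; pose r k := rd (Zf k x) (Zf k x).
have rB k m : (k <= m)%N -> rd (Zf m x - Zf k x) (Zf m x - Zf k x) = r m - r k.
  move=> km; rewrite (rdBl hd) !(rdBr hd) (rdC hd (Zf k x)) (Zf_mono x km) subrr subr0 //.
have nr : nondecreasing_seq r.
  by move=> k m km; rewrite -subr_ge0 -rB // rd_ge0 //; exact: hd.
have ur : has_ubound (range r).
  exists (rd a a) => _ [k _ <-]; rewrite /r -!(hnorm2 hd).
  by rewrite ler_sqr ?nnegrE ?hnorm_ge0 //; exact: Zf_bound.
have cr := nondecreasing_cvgn nr ur.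
have [b hb] : exists b, hcvg dot (fun k => Zf k x) b.
  apply: (ip_complete hd) => e e0; have e2 : 0 < e ^+ 2 by rewrite exprn_gt0.
  have /cvgrPdist_lt/(_ _ e2)[N _ hN] := cr.
  have r_le k : r k <= sup (range r) by apply: ub_le_sup => //; exists k.
  have key k m : (N <= k)%N -> (k <= m)%N -> hnorm dot (Zf m x - Zf k x) < e.
    move=> Nk km; rewrite -ltr_sqr ?nnegrE ?hnorm_ge0 ?(ltW e0) // (hnorm2 hd) rB //.
    have := hN k Nk; rewrite ger0_norm ?subr_ge0 //; apply: le_lt_trans.
    by rewrite lerD2r.
  exists N => i j Ni Nj; have [ij|ij] := leqP i j; last by apply: key => //; exact: ltnW.
  by rewrite (hnormC hd); exact: key.
have nC : nondecreasing_seq C.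
  move=> k m km; apply/subsetPset => t; rewrite /C /= !in_itv /= => /andP[h1 h2]; apply/andP; split.
    by apply: le_trans h1; rewrite lef_pV2 ?posrE // ler_nat.
  by apply: le_trans h2 _; rewrite ler_nat.
have UC : \bigcup_k C k = `]0, +oo[%classic.
  apply/seteqP; split=> [t [k _ /C0 t0]|t /=]; first by rewrite /= in_itv /= t0.
  rewrite in_itv /= andbT => t0.
  exists (maxn (Num.truncn t) (Num.truncn t^-1)) => //; rewrite /C /= in_itv /=; apply/andP; split.
    rewrite -[leRHS]invrK lef_pV2 ?posrE ?invr_gt0 //; apply/ltW/(lt_le_trans (truncnS_gt _)).
    by rewrite ler_nat ltnS leq_maxr.
  by apply/ltW/(lt_le_trans (truncnS_gt _)); rewrite ler_nat ltnS leq_maxl.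
have hP := P_cvgU hd hE x mC nC; rewrite UC in hP.
have Zb : Z (P `]0, +oo[ x, b).
  have Zc := closed_graph hd aff_closed.2.
  by apply: (Zc (fun k => (P (C k) x, Zf k x)) (_, b)); [move=> k; exact: ZfP|exact: (hcvg_prod hd hP hb)].
have ex : x = P `]0, +oo[ x + P [set 0] x.
  rewrite -(P_setU hd hE) //; last first.
    by apply/seteqP; split=> // t /= [+ t0]; rewrite t0 in_itv /= ltxx.
  rewrite -[LHS](P_T hE) -[RHS]add0r -(square_ge0 x) -(P_setU hd hE) //.
  - congr (P _ x); apply/seteqP; split=> // t _ /=; rewrite !in_itv /= andbT.
    by case: (ltgtP t 0) => h'; [left|right; left|right; right].
  - exact: measurableU.
  - apply/seteqP; split=> // t /= []; rewrite !in_itv /= andbT => t0 [t1|t1].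
      by have := lt_trans t0 t1; rewrite ltxx.
    by rewrite t1 ltxx in t0.
have Zxb : Z (x, b).
  rewrite ex -[b]addr0; have [[_ hl _] _] := aff_closed.
  by have := hl 1 _ _ _ _ Zb (square_ker x); rewrite !scale1r.
by rewrite (aff_fun h Zxb).
Qed.

(* [Zf k] factors as [W (h (h x))] with [W] a contraction and [h] a power of [Z^* Z] *)
Let W k x : L2 := Zf k (phi (cutf (fun t => t `^ (- 2^-1)) (C k)) x).
Let h k := phi (cutf (fun t => t `^ 4^-1) (C k)).
Let W_spec k : Ma (W k) /\ forall x, hnorm dot (W k x) <= 1 * hnorm dot x.
Proof.
have bf := bpow (- 2^-1) k; have lf := phi_lin hd hE bf.
have lZ : lin (Zf k).
  move=> c x y; apply: ZfE; have [[_ hl _] _] := aff_closed.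
  by have := hl c _ _ _ _ (ZfP k x) (ZfP k y); rewrite (P_lin hE (mC k)).
have lW : lin (W k) by move=> c x y; rewrite /W lf lZ.
have cW x : hnorm dot (W k x) <= 1 * hnorm dot x.
  rewrite mul1r; apply: le_hnorm; rewrite /W (Zf_rd k _ (ZfP k _)).
  have bi := bmeas_cut mid (mC k) (bid k).
  rewrite (P_sym hE) // -(phi_P hd hE) // (phi_cutP hd hE mid) //.
  rewrite (phi_sym hd hE bf) -(phiM hd hE x bi bf) -(phiM hd hE x bf (bmeasM bi bf)).
  (* The squared norm of W x is the form of t^(-1/2) t t^(-1/2), the indicator of [C k]; thus W is a
     partial isometry. *)
  have -> : (fun t => cutf (fun t0 => t0 `^ (- 2^-1)) (C k) t *
      (cutf id (C k) t * cutf (fun t0 => t0 `^ (- 2^-1)) (C k) t)) = \1_(C k).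
    apply/funext => t; have [Ct|Ct] := pselect (C k t); last by rewrite indicE memNset // cutfN // mul0r.
    rewrite !cutfM // indicE mem_set // mulrCA -powRD; last by apply/implyP => _; rewrite gt_eqF // (C0 Ct).
    have -> : - 2^-1 + - 2^-1 = - 1 :> R by lra.
    by rewrite powRN powRr1 ?ltW ?(C0 Ct) // divff // gt_eqF // (C0 Ct).
  rewrite (phi_indic hd hE) // (rdC hd) (P_norm hd hE) //.
  by rewrite -!(hnorm2 hd) ler_sqr ?nnegrE ?hnorm_ge0 //; exact: (P_contr hd hE).
split=> //; split; first by split=> //; exists 1.
move=> c Mcc u; rewrite /W; have := aff_inv Mcc (ZfP k (phi (cutf (fun t => t `^ (- 2^-1)) (C k)) u)).
rewrite (EM Mcc) // -((Ma_phi hE EM bf).2 c Mcc) => hh; exact: ZfE.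
Qed.
Let Whh k x : W k (h k (h k x)) = Zf k x.
Proof.
have b4 := bpow 4^-1 k; have bf := bpow (- 2^-1) k.
rewrite /W /h -(phiM hd hE x b4 b4) -(phiM hd hE x bf (bmeasM b4 b4)).
have -> : (fun t => cutf (fun t0 => t0 `^ (- 2^-1)) (C k) t *
    (cutf (fun t0 => t0 `^ 4^-1) (C k) t * cutf (fun t0 => t0 `^ 4^-1) (C k) t)) = \1_(C k).
  apply/funext => t; have [Ct|Ct] := pselect (C k t); last by rewrite indicE memNset // cutfN // mul0r.
  have tn0 : t != 0 by rewrite gt_eqF // (C0 Ct).
  rewrite !cutfM // indicE mem_set // -!powRD ?tn0 ?implybT //.
  have -> : - 2^-1 + (4^-1 + 4^-1) = 0 :> R by lra.
  by rewrite powRr0.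
by rewrite (phi_indic hd hE) //; apply: ZfE; have := ZfP k x; rewrite -{1}(P_idem hE).
Qed.

(* noncommutative Hoelder: with [Z = W h h] and [g = (W h)^*],
   [<Z (T 1), T' 1> = <T (h 1), T' (g 1)>] and [|g 1| = |W h 1|] since [tau] is a trace *)
Lemma L1_bound (e : R) T T' a : Mc T -> contr dot T -> Mc T' -> contr dot T' ->
  (Lpnorm 1 Z <= e%:E)%E -> Z (T one, a) -> rd a (T' one) <= e.
Proof.
move=> MT cT MT' cT' hle Za.
have hb k : rd (Zf k (T one)) (T' one) <= e.
  have b4 := bpow 4^-1 k; have Mh := Ma_phi hE EM b4.
  have MWh : Ma (W k \o h k) by apply: Ma_comp => //; exact: (W_spec k).1.
  have [g _ hg] := bl_adj hd MWh.1; have Mg := Ma_adj MWh hg.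
  have e1 : h k (T one) = T (h k one) := Mh.2 T MT one.
  rewrite -Whh e1 /rdot -[W k (h k _)]/((W k \o h k) _) hg Mg.2 //.
  apply: le_trans (rd_le hd _ _) _.
  apply: (@le_trans _ _ (hnorm dot (h k one) * hnorm dot (h k one))).
    apply: (ler_pM (hnorm_ge0 _ _) (hnorm_ge0 _ _) (cT _)).
    apply: le_trans (cT' _) _; rewrite (hnorm_adj1 htheta MWh hg).
    by have := (W_spec k).2 (h k one); rewrite mul1r.
  rewrite -expr2 (hnorm2 hd) -lee_fin; apply: le_trans hle.
  (* The squared norm of h 1 integrates t^(1/2) over [C k], and the L_1 norm of Z is the same
     integral over the whole line. *)
  rewrite (LpnormE 1 hs) invr1 poweRe1; last by apply: integral_ge0 => t _; rewrite lee_fin powR_ge0.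
  rewrite (phi_cut_norm hd hE (measurable_powR _) _ (mC k) (bdC _ k)).
  have m4 : meas (fun t => t `^ 4^-1 ^+ 2) by apply: measurable_funX; exact: measurable_powR.
  have m2 : meas (fun t => (t `^ 2^-1) `^ 1).
    exact: (measurableT_comp (measurable_powR 1) (measurable_powR 2^-1)).
  apply: ge0_le_integral => //.
  - move=> t _; rewrite lee_fin /cutf mulr_ge0 ?sqr_ge0 // indicE; exact: ler0n.
  - by apply/measurable_EFinP; exact: cutf_meas.
  - apply/measurable_EFinP; exact: m2.
  - move=> t _; rewrite lee_fin powRr1 ?powR_ge0 //.
    have [Ct|Ct] := pselect (C k t); last by rewrite cutfN // powR_ge0.
    rewrite cutfM // expr2 -powRD; last by apply/implyP => _; rewrite gt_eqF // (C0 Ct).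
    by have -> : 4^-1 + 4^-1 = 2^-1 :> R by lra.
apply: (@cvg_real_le _ (fun k => rd (Zf k (T one)) (T' one)) (fun=> e)) => //.
- by apply: (hcvg_rdl hd); exact: spectral_cut_cvg.
- exact: cvg_cst.
Qed.

End Polar.
End AffiliatedOps.

Section TraceForm.
Context {R : realType} {n : nat} (theta : 'M[R]_n) (htheta : theta^T = - theta).
Local Notation L2 := (L2 R n).
Local Notation dot := (@dot R n).
Implicit Types (u v x y : L2) (w : L2 * L2) (f g c m T : L2 -> L2).
Local Notation hd := (@dot_hilbert R n).
Local Notation hd2 := (hilbert_prod (@dot_hilbert R n)).
Local Notation rd := (rdot dot).
Local Notation Mc := (Mc theta).
Local Notation Ma := (Ma theta).
Local Notation one := (ek (0 : Zn n) : L2).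
Local Notation nrm := (hnorm dot).

(* For [xi] close to [1], compressing the projection onto the closure of the
   [(m 1, m xi)] yields a contraction of the commutant that maps [1], almost fixing it,
   into the orbit of [xi]. *)
Section Localize.
Variable xi : L2.
Let K0 : set (L2 * L2) := [set w | exists2 m, Ma m & w = (m one, m xi)].
Let K := hclosure (dprod dot) K0.
Let sK0 : subsp K0.
Proof.
split.
  exists (fun x => 0 *: x); first exact: (Ma_scale 0 (Ma_id theta)).
  by rewrite !scale0r.
move=> c _ _ [m Mm ->] [m' Mm' ->]; exists (fun x => c *: m x + m' x) => //.
by apply: Ma_add => //; exact: Ma_scale.
Qed.
Let sK : subsp K := hclosure_subsp hd2 sK0.
Let cK : hclosed (dprod dot) K. Proof. by apply: hclosure_closed; exact: hd2. Qed.
Local Notation Pr := (proj hd2 sK cK).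

Let K_inv m : Ma m -> forall w, K w -> K (m w.1, m w.2).
Proof.
move=> Mm w /hclosureP[u [hu cu]]; apply/hclosureP.
exists (fun k => (m (u k).1, m (u k).2)); split.
  move=> k; have [m' Mm' ->] := hu k; exists (m \o m') => //; exact: Ma_comp.
by apply: (hcvg_prod hd); apply: (bl_cvg Mm.1); [exact: (hcvg_fst hd cu)|exact: (hcvg_snd hd cu)].
Qed.
Let Pr_comm m w : Ma m -> (m (Pr w).1, m (Pr w).2) = Pr (m w.1, m w.2).
Proof.
move=> Mm; have [m' _ mm'] := bl_adj hd Mm.1; have Mm' := Ma_adj Mm mm'.
have e1 x y : rd (m x) y = rd x (m' y) by rewrite /rdot mm'.
apply: (proj_comm hd2 sK cK (F := fun w => (m w.1, m w.2)) (F' := fun w => (m' w.1, m' w.2))).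
- by move=> a b; rewrite !(rd_prod dot) /= !e1.
- exact: K_inv.
- exact: K_inv.
Qed.
Let lPr : lin Pr := proj_lin hd2 sK cK.

(** The factor 2 is calibrated on xi = 1: there [K] is the diagonal, the projection of (x, 0) is
    (x/2, x/2), and [locN] is the identity. *)
Definition locN x : L2 := 2%:R *: (Pr (x, 0)).2.
Let locC x : L2 := 2%:R *: (x - (Pr (0, x)).2).

Let two : (2%:R : R[i]) = (2%:R : R)%:C.
Proof. by apply: complexP; rewrite mulr2n ?ReD ?ImD /= ?addr0 -?mulr2n. Qed.
Let nrm2 x : nrm (2%:R *: x) = 2 * nrm x.
Proof. by rewrite two (hnormZr hd) ger0_norm. Qed.
Let nPr w : hnorm (dprod dot) (Pr w) <= hnorm (dprod dot) w := proj_contr hd2 sK cK w.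
Let nP2 w : nrm w.2 <= hnorm (dprod dot) w := hnorm_prod2 hd w.
Let npair2 x : hnorm (dprod dot) (0, x) = nrm x.
Proof. by rewrite /hnorm -!/(rdot _ _ _) (rd_prod dot) /= (rd0r hd) add0r. Qed.

(** For the projection (a, b) of (x, 0) one has |b|^2 = <x, a> - |a|^2 <= |x| |a| - |a|^2 <= |x|^2 /
    4. *)
Lemma locN_contr : contr dot locN.
Proof.
move=> x; rewrite /locN nrm2.
have := proj_orth hd2 sK cK (x, 0) (proj_in hd2 sK cK (x, 0)).
rewrite (rd_prod dot) /=; set a := (Pr (x, 0)).1; set b := (Pr (x, 0)).2.
rewrite (rdBl hd) sub0r (rdNl hd) => h.
have h2 := rd_le hd x a; have h3 : nrm b ^+ 2 = rd x a - nrm a ^+ 2 by rewrite !(hnorm2 hd); lra.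
have b0 := hnorm_ge0 dot b; have x0 := hnorm_ge0 dot x; have a0 := hnorm_ge0 dot a.
rewrite -ler_sqr ?nnegrE ?mulr_ge0 // exprMn h3.
move: (nrm a) (nrm x) (rd x a) h2 {h3 b0} x0 a0 => p q r h2 q0 p0.
have := sqr_ge0 (q - 2 * p); nra.
Qed.
Let locN_lin : lin locN.
Proof.
move=> c x y; rewrite /locN.
have -> : (c *: x + y, 0) = c *: (x, 0) + (y, 0) :> L2 * L2 by congr (_, _); rewrite /= ?scaler0 ?addr0.
by rewrite lPr /= scalerDr !scalerA mulrC.
Qed.
Lemma locN_Mc : Mc locN.
Proof.
split; first by split; [exact: locN_lin|exists 1; split=> // x; rewrite mul1r; exact: locN_contr].
move=> j u; have MU := Ma_Uf theta j; rewrite /locN (linZ MU.1.1).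
have /(congr1 snd) /= -> := Pr_comm (u, 0) MU.
by rewrite /= (lin0 MU.1.1).
Qed.
Let locC_Mc : Mc locC.
Proof.
apply: Mc_scale; apply: Mc_sub; first exact: Mc_id.
split.
  split; last first.
    exists 1; split=> // x; rewrite mul1r -[X in _ <= X]npair2; exact: le_trans (nP2 _) (nPr _).
  move=> c x y; have -> : (0, c *: x + y) = c *: (0, x) + (0, y) :> L2 * L2.
    by congr (_, _); rewrite /= ?scaler0 ?addr0.
  by rewrite lPr.
move=> j u; have MU := Ma_Uf theta j.
have /(congr1 snd) /= -> := Pr_comm (0, u) MU.
by rewrite /= (lin0 MU.1.1).
Qed.
Let Pr1 : Pr (one, xi) = (one, xi).
Proof. by apply: proj_id; apply: (hclosure_sub hd2); exists id => //; exact: Ma_id. Qed.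
(** The pair (1, xi) is fixed by the projection, so splitting it into (1, 0) and (0, xi) expresses N
    1 as a map of the commutant applied to [xi]; such maps preserve the domains that contain
    [xi]. *)
Lemma locN_one : locN one = locC xi.
Proof.
rewrite /locN /locC; congr (_ *: _).
have e : (one, xi) = (one, 0) + (0, xi) :> L2 * L2 by congr (_, _); rewrite /= ?addr0 ?add0r.
have := linD lPr (one, 0) (0, xi); rewrite -e Pr1 => /(congr1 snd) h.
by apply/eqP; rewrite eq_sym subr_eq; apply/eqP; exact: h.
Qed.
Lemma locN_dom (Y : op L2) y : (forall c, Mc c -> inv_by c Y) -> Y (xi, y) ->
  exists z, Y (locN one, z).
Proof. by move=> hY h; rewrite locN_one; exists (locC y); apply: hY h; exact: locC_Mc. Qed.

(** Write 2 (1, 0) = (1, 1) + (1, -1). The first pair is close to (1, xi), which lies in [K]. The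
    second is nearly orthogonal to [K]: against (m 1, m xi) it gives <m' 1, 1 - xi> with [m'] the
    adjoint of [m], and |m' 1| = |m 1|. *)
Lemma locN_close : nrm (locN one - one) <= 3 * nrm (xi - one).
Proof.
set r := nrm (xi - one).
have r' : nrm (one - xi) = r by rewrite (hnormC hd).
pose a := Pr (one, one); pose b := Pr (one, - one).
have ha : nrm (a.2 - xi) <= r.
  have e : (one, one) = (one, xi) + (0, one - xi) :> L2 * L2.
    by congr (_, _); rewrite /= ?addr0 // addrC subrK.
  have -> : a.2 - xi = (Pr (0, one - xi)).2.
    have := linD lPr (one, xi) (0, one - xi); rewrite -e Pr1 => /(congr1 snd) h.
    by apply/eqP; rewrite subr_eq addrC; apply/eqP; exact: h.
  rewrite -r' -(npair2 (one - xi)).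
  exact: le_trans (nP2 _) (nPr _).
have hb : nrm b.2 <= r.
  apply: le_trans (nP2 b) _.
  have key w : K w -> rd one w.1 - rd one w.2 <= r * hnorm (dprod dot) w.
    have key0 w' : K0 w' -> rd one w'.1 - rd one w'.2 <= r * hnorm (dprod dot) w'.
      move=> [m Mm ->] /=; have [m' _ mm'] := bl_adj hd Mm.1.
      rewrite -(rdBr hd) -(linB Mm.1.1).
      have -> : rd one (m (one - xi)) = rd (m' one) (one - xi) by rewrite /rdot -(adjC mm').
      apply: le_trans (rd_le hd _ _) _; rewrite r' mulrC ler_wpM2l ?hnorm_ge0 //.
      rewrite (hnorm_adj1 htheta Mm mm'); exact: (hnorm_prod1 hd (m one, m xi)).
    move=> /hclosureP[u [hu cu]].
    apply: (@cvg_real_le _ (fun k => rd (u k).1 one - rd (u k).2 one)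
      (fun k => r * hnorm (dprod dot) (u k))).
    - by move=> k; rewrite !(rdC hd _ one); exact: key0.
    - rewrite !(rdC hd one); apply: cvgB; apply: (hcvg_rdl hd).
        exact: (hcvg_fst hd cu).
      exact: (hcvg_snd hd cu).
    - by apply: cvgMr; apply: (hcvg_norm hd2 cu).
  have h1 : K b := proj_in hd2 sK cK _.
  have := key b h1.
  have -> : rd one b.1 - rd one b.2 = rdot (dprod dot) b b.
    have := proj_orth hd2 sK cK (one, - one) h1; rewrite -/b (rdBl hd2) => /eqP.
    by rewrite subr_eq0 => /eqP <-; rewrite (rd_prod dot) /= (rdNl hd).
  rewrite -(hnorm2 hd2); have := hnorm_ge0 (dprod dot) b.
  move: (hnorm (dprod dot) b) => q q0 h.
  have [->|q1] := eqVneq q 0; first exact: hnorm_ge0.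
  by rewrite expr2 ler_pM2r // in h; rewrite lt_def q1.
(* Three terms, each of norm at most |xi - 1|: the origin of the constant 3. *)
have e : locN one - one = (a.2 - xi) + (xi - one) + b.2.
  have e2 : (one, one) + (one, - one) = (one, 0) + (one, 0) :> L2 * L2.
    by congr (_, _); rewrite /= ?subrr ?addr0.
  have h := linD lPr (one, 0) (one, 0); rewrite -e2 (linD lPr) -/a -/b in h.
  have {}h : a.2 + b.2 = (Pr (one, 0)).2 + (Pr (one, 0)).2 := congr1 snd h.
  by rewrite subrKA addrAC h /locN scaler_nat mulr2n.
rewrite e; apply: le_trans (hnormD hd _ _) _.
have h3 := hnormD hd (a.2 - xi) (xi - one); rewrite -/r in h3.
by move: h3 ha hb; move: (nrm _) (nrm _) (nrm _) => *; lra.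
Qed.
End Localize.

(** The counterpart of [Ma_adj1] for the commutant, from the same computation with monomials of the
    algebra in place of right translations. *)
Lemma Mc_adj1 f g : Mc f -> (forall x y, dot (f x) y = dot x (g y)) -> g one = J (f one).
Proof.
move=> Mf fg.
suff h k : dot (g one) (ek k) = dot (J (f one)) (ek k).
  by apply: L2_ext => k; rewrite -!dot_ek h.
have [a Ma_a [t ht]] := Ma_Upow theta k.
have ek_a : ek k = (expi t)^-1 *: a one by rewrite ht scalerA mulVf ?expi_neq0 // scale1r.
rewrite ek_a !(dZr hd); congr (_ * _).
have [a' _ aa'] := bl_adj hd Ma_a.1.
rewrite (ip_conj hd (a one)) -fg -(Ma_a.2 _ Mf) aa' (Ma_adj1 htheta Ma_a aa').
rewrite -(ip_conj hd).
by rewrite -[f one in LHS](JJ (f one)) dot_J.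
Qed.

Lemma lmul_inv u c : Mc c -> inv_by c (lmul theta u).
Proof.
move=> Mcc; apply: (inv_opclosure hd Mcc.1) => x y [T [/commLinfP[f Mf ->] h1 h2]].
exists (gr (c \o f)); split.
- by apply/commLinfP; exists (c \o f) => //; exact: Mc_comp.
- by rewrite vacuumE in h1 *; move: h1; rewrite /gr /= => ->.
- by move: h2; rewrite /gr /= => ->.
Qed.
Lemma lmul_one u c : Mc c -> lmul theta u (c one, c u).
Proof.
move=> Mcc; rewrite /lmul (opclosureE hd); apply: (hclosure_sub hd2); exists (gr c); split.
- by apply/commLinfP; exists c.
- by rewrite vacuumE.
- by [].
Qed.
(* [lmul u] is closable: its adjoint contains [lmul (J u)] *)
Lemma lmul_J u x a c : Mc c -> lmul theta u (x, a) -> rd a (c one) = rd x (c (J u)).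
Proof.
move=> Mcc; rewrite /lmul (opclosureE hd) => /hclosureP[w [hw cw]].
have h1 := hcvg_fst hd cw; have h2 := hcvg_snd hd cw.
apply: (@cvg_real_unique _ (fun k => rd (w k).2 (c one))); first exact: (hcvg_rdl hd).
suff -> : (fun k => rd (w k).2 (c one)) = (fun k => rd (w k).1 (c (J u))) by exact: (hcvg_rdl hd).
apply/funext => k; have [T [/commLinfP[f Mf ->]]] := hw k.
rewrite vacuumE => /grP -> /grP ->.
have [f' _ ff'] := bl_adj hd Mf.1; have [c' _ cc'] := bl_adj hd Mcc.1.
have [Mf' Mc'] := (Mc_adj Mf ff', Mc_adj Mcc cc').
rewrite /rdot ff' -(adjC cc'); congr complex.Re.
have M1 : Mc (f' \o c) by exact: Mc_comp.
have -> : f' (c one) = J (c' (f one)).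
  by apply: (@Mc_adj1 (c' \o f) (f' \o c)); [exact: Mc_comp|move=> p q /=; rewrite (adjC cc') ff'].
by rewrite -{1}(JJ u) dot_J.
Qed.
Lemma lmul_oneE u c a : Mc c -> lmul theta u (c one, a) -> a = c u.
Proof.
move=> Mcc h; apply: (rd_ext hd) => z; rewrite ![rd _ z](rdC hd).
have [v [hv cv]] := (hclosureP _ _ _).1 (Mc_dense htheta z).
apply: (@cvg_real_unique _ (fun k => rd (v k) a)); first exact: (hcvg_rdl hd).
suff -> : (fun k => rd (v k) a) = (fun k => rd (v k) (c u)) by exact: (hcvg_rdl hd).
apply/funext => k; have [b Mb <-] := hv k.
by rewrite !(rdC hd (b one)) (lmul_J Mb h) (lmul_J Mb (lmul_one u Mcc)).
Qed.

(** The L_1 distance to a bounded element concerns this difference, and [L1_bound] asks it to be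
    affiliated. *)
Lemma aff_sub (X : op L2) m : affiliated theta X -> Ma m -> affiliated theta (opsub X (gr m)).
Proof.
move=> aX Mm; have [[[X0 Xl Xu] Xc] dX iX] := (affiliatedP theta X).1 aX.
have subP x b : opsub X (gr m) (x, b) <-> X (x, b + m x).
  split=> [[a [z [h1 [y [/= /grP -> ->]] /= ->]]]|h]; first by rewrite scaleN1r subrK.
  exists (b + m x), (- m x); split=> //=; last by rewrite addrK.
  by exists (m x); rewrite scaleN1r.
apply/affiliatedP; split.
- split.
    split.
    + by apply/subP; rewrite (lin0 Mm.1.1) addr0.
    + move=> c x y x' y' /subP h /subP h'; apply/subP; rewrite (Mm.1.1 c x x').
      by have := Xl c _ _ _ _ h h'; rewrite scalerDr addrACA.
    + by move=> y /subP; rewrite (lin0 Mm.1.1) addr0; exact: Xu.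
  rewrite (opclosureE hd); apply: hclosure_id; first exact: hd2.
  move=> u [x b] hu cu; apply/subP.
  have h1 := hcvg_fst hd cu; have h2 := hcvg_snd hd cu.
  have Xcl := closed_graph hd Xc.
  apply: (Xcl (fun k => ((u k).1, (u k).2 + m (u k).1)) (x, b + m x)).
    by move=> k; apply/subP; move: (hu k); case: (u k).
  by apply: (hcvg_prod hd) => //; apply: (hcvgD hd) => //; exact: (bl_cvg Mm.1).
- move=> x e e0; have [x' [y hy] hx'] := dX x e e0; exists x' => //.
  by exists (y - m x'); apply/subP; rewrite subrK.
- by move=> c Mcc x b /subP h; apply/subP; rewrite Mm.2 // -(linD Mcc.1.1); exact: iX.
Qed.

Section StrongProduct.
Variables (u v : L2) (s : L2 -> L2) (V : op L2).
Hypotheses (Ms : Ma s) (ss : forall x y, dot (s x) y = dot x (s y)).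
Hypothesis iV : forall c, Mc c -> inv_by c V.
Let Y : op L2 := opcomp (adj dot (lmul theta v))
  (opcomp (gr s) (opcomp V (opcomp (gr s) (lmul theta u)))).

Let iY c : Mc c -> inv_by c Y.
Proof.
move=> Mcc; have is_ : inv_by c (gr s) by apply/inv_gr => x; rewrite Ms.2.
have [c' _ cc'] := bl_adj hd Mcc.1; have Mc' := Mc_adj Mcc cc'.
apply: inv_comp; first by apply: inv_adj (adjC cc') _; exact: lmul_inv.
by do ![apply: inv_comp => //]; [exact: iV|exact: lmul_inv].
Qed.

(** Since N 1 determines what (lmul u) does to it, namely N u, the product unfolds factor by factor;
    the last factor is moved to the other side as an adjoint. *)
Let Y_one N y : Mc N -> Y (N one, y) ->
  exists w : L2, V (N (s u), w) /\ dot y (N one) = dot w (N (s v)).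
Proof.
move=> MN [a4 [[a3 [[a2 [[a1 [h1 h2]] h3]] h4]] h5]].
have e1 : a1 = N u := lmul_oneE MN h1.
have e2 : a2 = N (s u) by rewrite -Ms.2 // -e1; exact: h2.
have e4 : a4 = s a3 := h4.
exists a3; split; first by rewrite -e2; exact: h3.
have h6 : dot (N v) a4 = dot (N one) y := h5 _ _ (lmul_one v MN).
by rewrite (ip_conj hd (N one)) -h6 -(ip_conj hd) e4 ss Ms.2.
Qed.

Variable t : R[i].
Hypothesis ht : tau_L1 theta (opclosure dot Y) t.

Lemma strong_product_trace : exists (N : nat -> L2 -> L2) (w_ : nat -> L2),
  [/\ forall k, Mc (N k) /\ contr dot (N k),
      hcvg dot (fun k => N k one) one,
      forall k, V (N k (s u), w_ k),
      rd (w_ k) (N k (s v)) @[k --> \oo] --> complex.Re t &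
      complex.Im (dot (w_ k) (N k (s v))) @[k --> \oo] --> complex.Im t].
Proof.
have ht' := ht; set X := opclosure dot Y in ht'; have [[aX _] htau] := ht'.
have [cX dX _] := (affiliatedP theta X).1 aX.
have YX : Y `<=` X by rewrite /X (opclosureE hd); by move=> z hz; apply: (hclosure_sub hd2).
have /choice[N hN] : forall k : nat, exists N, [/\ Mc N, contr dot N,
    nrm (N one - one) <= 3 * k.+1%:R^-1 & exists y, Y (N one, y)].
  (* 1 is approached by the domain of the closure, and that point by the domain of the product
     itself, with half of the tolerance each; [locN] then yields a contraction. *)
  move=> k; have e0 : 0 < k.+1%:R^-1 / 2 :> R by rewrite divr_gt0 ?invr_gt0.
  have [x' [y' hxy] hx'] := dX one _ e0.
  have [x [y [hY h1 h2]]] := hxy _ e0.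
  exists (locN x); split; [exact: locN_Mc|exact: locN_contr| |].
    apply: le_trans (locN_close x) _; rewrite ler_pM2l //.
    rewrite -(subrKA x'); apply: le_trans (hnormD hd _ _) _; move: h1 hx' => /=.
    by rewrite [k.+1%:R^-1 in leRHS]splitr => h1 h2'; apply: ltW; exact: ltrD.
  exact: locN_dom iY hY.
have /choice[y hy] k : exists y, Y (N k one, y) by case: (hN k).
have /choice[w hw] k : exists w : L2, V (N k (s u), w) /\ dot (y k) (N k one) = dot w (N k (s v)).
  by have [MN _ _ _] := hN k; exact: Y_one (hy k).
have N1 : hcvg dot (fun k => N k one) one.
  apply: (@hcvg_le _ _ dot _ _ (fun k => 3 * k.+1%:R^-1)); first by move=> k; case: (hN k).
  by apply: cvg0Z; exact: cvg_harm.
(* Replace the product by a bounded [g] near it in L_1: for [g] the limit is clear, and [L1_bound],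
   with contractions N and c N, bounds the error uniformly in [k]. The choices c = 1 and c = i give
   real and imaginary parts. *)
have main (c : R[i]) : normc2 c = 1 ->
    rd (y k) (c *: N k one) @[k --> \oo] --> complex.Re (c^* * t).
  move=> c1; apply/cvgrPdist_lt => e e0.
  have e3 : 0 < e / 3 by rewrite divr_gt0.
  have [T [/LinfP[g Mg ->] hle htg]] := htau _ e3.
  have eg : tau (gr g) = dot (g one) one by rewrite /tau gr_app vacuumE.
  have hg : rd (g (N k one)) (c *: N k one) @[k --> \oo] --> rd (g one) (c *: one).
    apply: (hcvg_rd hd); first exact: (bl_cvg Mg.1).
    by apply: (hcvgZ hd).
  have bound k : `|rd (y k - g (N k one)) (c *: N k one)| <= e / 3.
    have [MN cN _ _] := hN k.
    have aS := aff_sub aX Mg.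
    have [E hE] := aff_spectral aS.
    have hS : opsub X (gr g) (N k one, y k - g (N k one)).
      exists (y k), (- g (N k one)); split=> //; first exact: (YX _ (hy k)).
      by exists (g (N k one)); rewrite scaleN1r.
    have cc (a : R[i]) : normc2 a = 1 -> Mc (fun x => a *: N k x) /\ contr dot (fun x => a *: N k x).
      move=> a1; split; first exact: Mc_scale.
      by move=> x; rewrite (hnormZ hd) a1 sqrtr1 mul1r; exact: cN.
    have [M1 k1] := cc c c1.
    have [|M2 k2] := cc (- c); first by rewrite -c1; case: (c) => a b; rewrite /normc2 /= !sqrrN.
    rewrite ler_norml; apply/andP; split.
      have := L1_bound htheta aS hE MN cN M2 k2 (ltW hle) hS.
      by rewrite scaleNr (rdNr hd) lerNl.
    exact: (L1_bound htheta aS hE MN cN M1 k1 (ltW hle) hS).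
  have ReM_le (z : R[i]) : `|complex.Re (c^* * z)| <= Normc.normc z.
    rewrite /Normc.normc -(sqrtr_sqr); case: c c1 {hg bound} z => a b c1 [p q] /=.
    apply: ler_wsqrtr; rewrite /normc2 /= in c1.
    have := sqr_ge0 (a * q - b * p).
    have -> : p ^+ 2 + q ^+ 2 = (a ^+ 2 + b ^+ 2) * (p ^+ 2 + q ^+ 2) by rewrite c1 mul1r.
    have -> : (a * p - - b * q) ^+ 2 = (a ^+ 2 + b ^+ 2) * (p ^+ 2 + q ^+ 2) - (a * q - b * p) ^+ 2 by ring.
    by rewrite gerBl.
  have /cvgrPdist_lt/(_ _ e3) := hg.
  apply: filterS => k hk.
  have -> : complex.Re (c^* * t) - rd (y k) (c *: N k one) =
      - complex.Re (c^* * (tau (gr g) - t)) + (rd (g one) (c *: one) - rd (g (N k one)) (c *: N k one))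
      - rd (y k - g (N k one)) (c *: N k one).
    have -> : rd (g one) (c *: one) = complex.Re (c^* * tau (gr g)) by rewrite eg /rdot (dZr hd).
    by rewrite (rdBl hd) mulrBr ReD ReN; ring.
  rewrite [e](_ : _ = e / 3 + e / 3 + e / 3); last by lra.
  apply: le_lt_trans (ler_normB _ _) _; apply: ltr_leD; last exact: bound.
  apply: le_lt_trans (ler_normD _ _) _; rewrite normrN; apply: ltrD => //.
  exact: le_lt_trans (ReM_le _) htg.
exists N, w; split=> //.
- by move=> k; case: (hN k).
- by move=> k; case: (hw k).
- have := main 1; rewrite /normc2 /= expr1n expr0n addr0 => /(_ erefl).
  have -> : (1%R^* * t : R[i]) = t by rewrite rmorph1 mul1r.
  suff -> : (fun k => rd (y k) (1 *: N k one)) = (fun k => rd (w k) (N k (s v))) by [].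
  by apply/funext => k; have [_ h] := hw k; rewrite scale1r /rdot h.
- have := main (0 +i* 1); rewrite /normc2 /= expr1n expr0n add0r => /(_ erefl).
  have -> : complex.Re ((0 +i* 1 : R[i])^* * t) = complex.Im t by case: (t) => a b /=; ring.
  suff -> : (fun k => rd (y k) ((0 +i* 1) *: N k one)) = (fun k => complex.Im (dot (w k) (N k (s v)))) by [].
  by apply/funext => k; have [_ h] := hw k; rewrite -(imd hd) h.
Qed.

End StrongProduct.

End TraceForm.

Section PotentialForm.
Context {R : realType} {n : nat} (theta : 'M[R]_n) (htheta : theta^T = - theta).
Local Notation L2 := (L2 R n).
Local Notation dot := (@dot R n).
Implicit Types (u v x y : L2) (c m T : L2 -> L2).
Local Notation hd := (@dot_hilbert R n).
Local Notation rd := (rdot dot).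
Local Notation Mc := (Mc theta).
Local Notation Ma := (Ma theta).
Local Notation one := (ek (0 : Zn n) : L2).
Local Notation nrm := (hnorm dot).

(** On vectors m 1 with [m] in the algebra, N commutes with [m], so convergence at 1 suffices; these
    vectors are dense and the maps are uniformly bounded. *)
Lemma Mc_strong (N : nat -> L2 -> L2) : (forall k, Mc (N k) /\ contr dot (N k)) ->
  hcvg dot (fun k => N k one) one -> forall z, hcvg dot (fun k => N k z) z.
Proof.
move=> hN h1 z; apply/hcvgP => e e0; have e3 : 0 < e / 3 by rewrite divr_gt0.
have [_ [m Mm <-] hm] := Ma_dense theta z e3.
have /hcvgP/(_ _ e3)[K hK] := bl_cvg Mm.1 h1.
exists K => k Kk; have [MN cN] := hN k.
have -> : N k z - z = - (N k (m one - z)) + (m (N k one) - m one) + (m one - z).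
  by rewrite (linB MN.1.1) Mm.2 // opprB !subrKA.
apply: le_lt_trans (hnormD hd _ _) _.
have h2 := hnormD hd (- N k (m one - z)) (m (N k one) - m one).
rewrite (hnormN hd) in h2; have h3 := cN (m one - z); have h4 := hK k Kk.
apply: (@le_lt_trans _ _ (nrm (m one - z) + nrm (m (N k one) - m one) + nrm (m one - z))).
  by rewrite lerD2r (le_trans h2) // lerD2r.
by move: h4 hm; move: (nrm (m one - z)) (nrm (m (N k one) - m one)) => b1 b2 *; lra.
Qed.

Lemma Linf_pvmM (V : op L2) E : affiliated theta V -> is_spectral_measure dot V E -> pvmM theta E.
Proof. by move=> aV hE; apply: (selfadj_pvmM hE) => c Mcc; exact: (aff_inv aV Mcc). Qed.

Variables (V : op L2) (aV : affiliated theta V) (E : @pvm R L2) (hs : is_spectral_measure dot V E).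
Let hE : is_pvm dot E := hs.1.
Let eV : V = pvm_integral dot E id := hs.2.
Let EM : pvmM theta E := Linf_pvmM aV hs.
Local Notation I f := (pvm_integral dot E f).
Variables (s : L2 -> L2) (Ms : Ma s) (ss : forall x y, dot (s x) y = dot x (s y)).
Definition strong_product u v : op L2 := opclosure dot (opcomp (adj dot (lmul theta v))
  (opcomp (gr s) (opcomp V (opcomp (gr s) (lmul theta u))))).

Lemma form_value u v t xp yp xm ym : tau_L1 theta (strong_product u v) t ->
  I (@sqp R) (s u, xp) -> I (@sqm R) (s u, xm) -> I (@sqp R) (s v, yp) -> I (@sqm R) (s v, ym) ->
  t = dot xp yp - dot xm ym.
Proof.
move=> ht hxp hxm hyp hym.
have iV c : Mc c -> inv_by c V by move=> Mcc; exact: (aff_inv aV Mcc).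
have [N [w [hN N1 hw c1 c2]]] := strong_product_trace htheta Ms ss iV ht.
have NN := Mc_strong hN N1.
(* The maps N preserve the domains of both square roots and commute with them, so N can be pulled
   out of each term and sent to the identity. *)
have key (a : R[i]) k : rd (w k) (a *: N k (s v)) =
    rd (N k xp) (N k (a *: yp)) - rd (N k xm) (N k (a *: ym)).
  have [MN _] := hN k; have := hw k; rewrite eV => hwk.
  have i1 := pvm_integral_inv hE EM (sqp_meas (R := R)) MN; have i2 := pvm_integral_inv hE EM (sqm_meas (R := R)) MN.
  rewrite -(linZ MN.1.1); apply: (sqpm_form hd hE hwk).
  - exact: i1.
  - exact: i2.
  - apply: i1; have [_ hl _] := pvm_integral_lin hd hE (sqp_meas (R := R)).
    have [h0 _ _] := pvm_integral_lin hd hE (sqp_meas (R := R)).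
    by have := hl a _ _ _ _ hyp h0; rewrite !addr0.
  - apply: i2; have [h0 hl _] := pvm_integral_lin hd hE (sqm_meas (R := R)).
    by have := hl a _ _ _ _ hym h0; rewrite !addr0.
have lim a : rd (w k) (a *: N k (s v)) @[k --> \oo] --> rd xp (a *: yp) - rd xm (a *: ym).
  under eq_fun do rewrite key; apply: cvgB; apply: (hcvg_rd hd); exact: NN.
apply: complexP.
  have := lim 1; rewrite !scale1r; under eq_fun do rewrite scale1r.
  by move=> h; rewrite (cvg_real_unique c1 h) ReD ReN.
have := lim (0 +i* 1); rewrite -!(imd hd); under eq_fun do rewrite -(imd hd).
by move=> h; rewrite (cvg_real_unique c2 h) ImD ImN.
Qed.

Lemma form_ge0 u t : (forall z, pvm_proj E `]-oo, 0[ z = 0) ->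
  tau_L1 theta (strong_product u u) t -> 0 <= complex.Re t.
Proof.
move=> h0 ht; have iV c : Mc c -> inv_by c V by move=> Mcc; exact: (aff_inv aV Mcc).
have [N [w [hN N1 hw c1 c2]]] := strong_product_trace htheta Ms ss iV ht.
apply: (@cvg_real_le _ (fun=> 0) (fun k => rd (w k) (N k (s u)))).
- move=> k; apply: (pvm_integral_ge0 hd hE h0); rewrite -eV; exact: hw.
- exact: cvg_cst.
- exact: c1.
Qed.

End PotentialForm.

(** * Noncommutative L_p norms of spectral integrals *)

Section LpNorms.
Context {R : realType} {n : nat} (theta : 'M[R]_n) (htheta : theta^T = - theta).
Local Notation L2 := (L2 R n).
Local Notation dot := (@dot R n).
Local Notation hd := (@dot_hilbert R n).
Local Notation one := (ek (0 : Zn n) : L2).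
Local Notation meas := (measurable_fun (setT : set R)).
Variables (E : @pvm R L2) (hE : is_pvm dot E).
Local Notation I f := (pvm_integral dot E f).

Lemma Lpnorm_integral f r : meas f ->
  Lpnorm r (I f) = ((\int[pvm_meas E one]_(t in setT) (`|f t| `^ r)%:E) `^ r^-1)%E.
Proof.
move=> mf; rewrite /Lpnorm /tau_fun (opabs_integral hd hE mf) vacuumE; congr (_ `^ _)%E.
have mn : meas (fun t => `|f t|) by exact: (measurableT_comp (@normr_measurable R setT) mf).
rewrite (spectral_int hd hE one mn (measurable_powR r)) // => t; exact: powR_ge0.
Qed.

(** An operator has 1 in its domain when it is in L_2, and L_2r lies in L_2 because the trace is
    finite: f^2 <= 1 + |f|^(2r) for r >= 1. *)
Lemma Lp_dom f r : meas f -> 1 <= r -> (Lpnorm (2 * r) (I f) < +oo)%E -> exists y, I f (one, y).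
Proof.
move=> mf r1; have r0 : 0 < 2 * r by lra.
have mg : meas (fun t => `|f t| `^ r).
  apply: (measurableT_comp (measurable_powR r)).
  exact: (measurableT_comp (@normr_measurable R setT) mf).
rewrite Lpnorm_integral // => h; apply: (pvm_integral_dom hd hE mf).
apply: (pvm_dom_le hE mf mg) => [t|].
  rewrite -(real_normK (num_real (f t))); have [f1|f1] := lerP (`|f t|) 1.
    apply: (@le_trans _ _ 1); last by rewrite lerDl sqr_ge0.
    by rewrite expr_le1.
  rewrite (le_trans _ (_ : (`|f t| `^ r) ^+ 2 <= _)) ?lerDr //.
  apply: lerXn2r; rewrite ?nnegrE ?powR_ge0 //.
  by rewrite -[leLHS](powRr1 (normr_ge0 _)); apply: ler_powR => //; exact: ltW.
rewrite /pvm_dom /=.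
have -> : (\int[pvm_meas E one]_t (((`|f t| `^ r) ^+ 2)%R%:E) =
    \int[pvm_meas E one]_t ((`|f t| `^ (2 * r))%R%:E))%E.
  by apply: eq_integral => t _; congr EFin; rewrite mulrC powRrM powR_mulrn // powR_ge0.
rewrite ltey; apply/eqP => ioo; move: h; rewrite ioo poweRyr ?ltxx //.
by rewrite invr_eq0 gt_eqF.
Qed.

Lemma negative_partE V : is_spectral_measure dot V E ->
  negative_part V = I (fun t => sqm t ^+ 2).
Proof.
move=> [_ eV]; rewrite /negative_part -(negative_part_integral hd hE) {2}eV.
have -> : opabs dot V = I (fun t => `|t|) by rewrite eV (opabs_integral hd hE) //; exact: measurable_id.
by [].
Qed.
Lemma Lpnorm_neg V q : 0 < q -> is_spectral_measure dot V E ->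
  Lpnorm q (negative_part V) = (Lpnorm (2 * q) (I (@sqm R)) `^ 2)%E.
Proof.
move=> q0 hs; have ms := @sqm_meas R; have ms2 : meas (fun t => sqm t ^+ 2) by exact: measurable_funX.
rewrite (negative_partE hs) !Lpnorm_integral //.
have -> : (\int[pvm_meas E one]_t ((`|sqm t ^+ 2| `^ q)%R%:E) =
    \int[pvm_meas E one]_t ((`|sqm t| `^ (2 * q))%R%:E))%E.
  by apply: eq_integral => t _; congr EFin; rewrite normrX powRrM powR_mulrn.
set i := (\int[_]_(_ in _) _)%E; have i0 : (0 <= i)%E.
  by apply: integral_ge0 => t _; rewrite lee_fin powR_ge0.
by rewrite -poweRrM; congr (_ `^ _)%E; rewrite invfM mulrAC mulVf // mul1r.
Qed.

Lemma Lp_sq (V : op L2) (q : R) (f : R -> R) : 0 < q -> meas f -> (forall t, f t ^+ 2 <= `|t|) -> pvmM theta E ->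
  is_spectral_measure dot V E -> Lp theta q V -> Lp theta (2 * q) (I f).
Proof.
move=> q0 mf fle EM [_ eV] [_ h]; split; first exact: pvm_integral_affiliated.
have mi : meas id by exact: measurable_id.
move: h; rewrite eV (Lpnorm_integral _ mi) (Lpnorm_integral _ mf).
set i := (\int[_]_(_ in _) _)%E; set j := (\int[_]_(_ in _) _)%E => h.
have ji : (j <= i)%E.
  apply: ge0_le_integral => //.
  - apply/measurable_EFinP; apply: (measurableT_comp (measurable_powR _)).
    exact: (measurableT_comp (@normr_measurable R setT) mf).
  - apply/measurable_EFinP; apply: (measurableT_comp (measurable_powR _)).
    exact: (@normr_measurable R setT).
  - move=> t _; rewrite lee_fin powRrM; apply: ge0_ler_powR; [exact: ltW|by rewrite nnegrE powR_ge0|by rewrite nnegrE|].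
    by rewrite powR_mulrn // real_normK ?num_real.
have i0 : (i < +oo)%E.
  rewrite ltey; apply/eqP => ioo; move: h; rewrite ioo poweRyr ?ltxx //.
  by rewrite invr_eq0 gt_eqF.
have j0 : (0 <= j)%E by apply: integral_ge0 => t _; rewrite lee_fin powR_ge0.
have : (j < +oo)%E := le_lt_trans ji i0.
by case: j j0 {ji} => // a a0 _; rewrite poweR_EFin ltry.
Qed.
Lemma sqp_abs (t : R) : sqp t ^+ 2 <= `|t|.
Proof. by rewrite sqp2 ge_max normr_ge0 ler_norm. Qed.
Lemma sqm_abs (t : R) : sqm t ^+ 2 <= `|t|.
Proof. by rewrite sqm2 ge_max normr_ge0 -normrN ler_norm. Qed.

(* by faithfulness of the trace *)
Lemma Lpnorm_neg0 V q : 0 < q -> pvmM theta E -> is_spectral_measure dot V E ->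
  Lpnorm q (negative_part V) = 0%E -> forall z, pvm_proj E `]-oo, 0[ z = 0.
Proof.
move=> q0 EM hs; have ms2 : meas (fun t => sqm t ^+ 2) by apply: measurable_funX; exact: sqm_meas.
rewrite (negative_partE hs) Lpnorm_integral //.
have mB : measurable (`]-oo, 0[%classic : set R) by exact: measurable_itv.
have mg : meas (fun t => `|sqm t ^+ 2| `^ q).
  apply: (measurableT_comp (measurable_powR q)).
  exact: (measurableT_comp (@normr_measurable R setT) ms2).
move=> /poweR_eq0_eq0; move=> /(_ (integral_ge0 _ _)) h.
have {h} h : (\int[pvm_meas E one]_t ((`|sqm t ^+ 2| `^ q)%R%:E) = 0)%E.
  by apply: h => t _; rewrite lee_fin powR_ge0.
have : (\int[pvm_meas E one]_t `|(`|sqm t ^+ 2| `^ q)%R%:E| = 0)%E.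
  by rewrite -[RHS]h; apply: eq_integral => t _; rewrite gee0_abs // lee_fin powR_ge0.
move=> /(ae_eq_integral_abs (pvm_meas E one) measurableT _).
have mgE : measurable_fun setT (EFin \o (fun t => `|sqm t ^+ 2| `^ q)) by exact/measurable_EFinP.
move=> /(_ mgE)[A [mA A0 hA]].
have BA : `]-oo, 0[%classic `<=` A.
  move=> t /=; rewrite in_itv /= => t0; apply: hA => /= /(_ Logic.I) /eqP; rewrite eqe.
  rewrite powR_eq0 normr_eq0 sqm2 => /andP[/eqP + _].
  by rewrite (_ : Num.max _ _ = - t) ?(max_idPl _) ?oppr_ge0 ?ltW // => /eqP; rewrite oppr_eq0 lt_eqF.
have m0 : pvm_meas E one `]-oo, 0[%classic = 0%E.
  by apply/eqP; rewrite eq_le measure_ge0 andbT -A0 le_measure // inE.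
have P1 : pvm_proj E `]-oo, 0[ one = 0.
  apply: (rd_eq0 hd); rewrite -(P_norm hd hE) //.
  by move: m0; rewrite (muE hE) // => -[].
move=> z; have bB := bmeas_indic mB.
have M1 := Ma_phi hE EM bB; have M2 := Ma_scale 0 (Ma_id theta).
have := Ma_sep htheta M1 M2; rewrite (phi_indic hd hE) // P1 scale0r => /(_ erefl) e.
by rewrite -(phi_indic hd hE) // e scale0r.
Qed.

End LpNorms.

(** * The weighted Hilbert space and the Laplace-Beltrami operator *)

Section Density.
Context {R : realType} {n : nat} (theta : 'M[R]_n) (htheta : theta^T = - theta).
Local Notation L2 := (L2 R n).
Local Notation dot := (@dot R n).
Implicit Types (u v x y : L2).
Local Notation hd := (@dot_hilbert R n).
Local Notation rd := (rdot dot).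
Local Notation Ma := (Ma theta).
Local Notation meas := (measurable_fun (setT : set R)).
Variables (nu : op L2) (hnu : smooth_density theta nu).

Lemma polar0 (T : L2 -> L2) : lin T -> (forall x, dot (T x) x = 0) -> forall x, T x = 0.
Proof.
move=> lT h x; apply: (d_ext hd) => y; rewrite (d0l hd).
have h1 : dot (T x) y + dot (T y) x = 0.
  have := h (x + y); rewrite (linD lT) (dDl hd) !(dDr hd) !h addr0 add0r //.
have h2 : dot (T x) y - dot (T y) x = 0.
  have := h (x + (0 +i* 1) *: y); rewrite (linD lT) (dDl hd) !(dDr hd) (linZ lT) !(dZl hd) !(dZr hd) !h.
  rewrite !mulr0 addr0 add0r => /(congr1 (fun z => (0 +i* 1) * z)); rewrite mulr0 => <-.
  by case: (dot (T x) y) (dot (T y) x) => a b [a' b'] /=; apply: complexP => /=; ring.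
move: h1 h2; case: (dot (T x) y) (dot (T y) x) => a b [a' b'] /=.
by move=> [h1 h2] [h3 h4]; congr (_ +i* _); lra.
Qed.

(** [positive_op] states nonnegativity of the complex form only; its values being real, polarization
    ([polar0]) makes the density symmetric. *)
Lemma density_fun : exists m mi, [/\ nu = gr m, Ma m /\ Ma mi, cancel m mi, cancel mi m &
  (forall x y, dot (m x) y = dot x (m y)) /\ forall x, 0 <= rd (m x) x].
Proof.
have [[/LinfP[m Mm em] _] [_ pos_nu] [/LinfP[mi Mmi emi] _]] := hnu.
have km : cancel m mi.
  move=> x; have h : opinv nu (m x, x) by rewrite em.
  by move: h; rewrite emi => /grP.
have kmi : cancel mi m.
  move=> x; have h : gr mi (x, mi x) by [].
  by move: h; rewrite -emi em => /grP.
have hp x : 0 <= dot (m x) x by apply: pos_nu; rewrite em.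
exists m, mi; split=> //; split; last by move=> x; have := hp x; rewrite lecE => /andP[].
have [m' bm' mm'] := bl_adj hd Mm.1.
suff e : forall x, m x = m' x by move=> x y; rewrite mm' -e.
move=> x; apply/eqP; rewrite -subr_eq0; apply/eqP; move: x.
apply: (@polar0 (fun x => m x - m' x)); first exact: lin_sub Mm.1.1 bm'.1.
move=> x; rewrite (dBl hd) (adjC mm') (ip_conj hd (m x)).
by have := hp x; case: (dot (m x) x) => a b; rewrite lecE /= => /andP[/eqP -> _]; apply: complexP => /=; ring.
Qed.

Lemma density_sqrt : exists m sf si, [/\ nu = gr m, sqrt_density nu = gr sf, Ma sf /\ Ma si,
  (forall x y, dot (sf x) y = dot x (sf y)) & [/\ (forall x, sf (sf x) = m x), cancel sf si & cancel si sf]].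
Proof.
have [m [mi [em [Mm Mmi] km kmi [sm pm]]]] := density_fun.
have lnu : linear_op nu by rewrite em; have [] := bl_bounded Mm.1.
have anu : adj dot nu = nu by rewrite em; exact: (gr_adj hd sm).
have [E hs] := spectral_theorem hd lnu anu.
have hE := hs.1; have eE := hs.2.
have EM : pvmM theta E.
  by apply: (selfadj_pvmM hs) => c Mcc; rewrite em; apply/inv_gr => x; rewrite Mm.2.
have mid : meas id := @measurable_id _ _ setT.
have mq : meas (fun t => t `^ 2^-1) := measurable_powR _.
have q2 t : 0 <= t -> (t `^ 2^-1) * (t `^ 2^-1) = t :> R.
  by move=> t0; rewrite powR12_sqrt // -expr2 sqr_sqrtr.
have E0 x : pvm_proj E `]-oo, 0[ x = 0.
  apply: (pvm_neg0 hd hE) => a b; rewrite -eE em => /grP ->; exact: pm.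
have domI x : exists y, pvm_integral dot E (fun t => t `^ 2^-1) (x, y).
  apply: (pvm_integral_dom hd hE mq); apply: (pvm_dom_le hE mq mid).
    move=> t; have [t0|t0] := lerP 0 t.
      rewrite expr2 q2 //; have := sqr_ge0 (t - 1); have := sqr_ge0 t; nra.
    (* Powers of negative numbers take the default value 1, since [ln] is 0 there. *)
    have -> : t `^ 2^-1 = 1 by rewrite /powR lt_eqF // ln0 ?mulr0 ?expR0 // ltW.
    by rewrite expr1n lerDl sqr_ge0.
  have : pvm_integral dot E id (x, m x) by rewrite -eE em.
  by case.
have /choice[sf hsf] := domI.
have es : sqrt_density nu = gr sf.
  rewrite /sqrt_density /oppow (fcalcE hd _ hs); apply/seteqP; split=> [[x y] h|[x y] /grP ->] //.
  exact: (pvm_integral_fun hd hE mq h (hsf x)).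
have lI := pvm_integral_lin hd hE mq.
have uI := pvm_integral_fun hd hE mq.
have lsf : lin sf.
  by move=> c x y; apply: (uI _ _ _ (hsf _)); have [_ hl _] := lI; exact: hl.
have ssf x y : dot (sf x) y = dot x (sf y).
  by have := hsf y; rewrite -(pvm_integral_adj hd hE mq) => h; exact: (h _ _ (hsf x)).
have sq x : sf (sf x) = m x.
  have : opcomp (pvm_integral dot E (fun t => t `^ 2^-1)) (pvm_integral dot E (fun t => t `^ 2^-1)) (x, sf (sf x)).
    by exists (sf x).
  move=> /(pvm_comp hd hE _ mq mq) [_].
  rewrite (@pvm_integral_ae _ _ _ hd _ hE _ id `]-oo, 0[%classic) //; last 2 first.
  - by apply: measurable_funM.
  - by move=> t /=; rewrite in_itv /= => /negP; rewrite -leNgt => t0; exact: q2.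
  by rewrite -eE em => /grP.
have Msf : Ma sf.
  split.
    split=> //; have [lm [M [M0 hM]]] := Mm.1; exists (1 + M); split; first by rewrite addr_ge0.
    (* The squared norm of sf x is the form of the density, at most [M] times that of [x], and M <=
       (1 + M)^2. *)
    move=> x; apply: (le_hnormP hd); first by rewrite mulr_ge0 ?addr_ge0 ?hnorm_ge0.
    have -> : rd (sf x) (sf x) = rd (m x) x by rewrite /rdot ssf sq -sm.
    apply: le_trans (rd_le hd _ _) _; apply: (@le_trans _ _ (M * hnorm dot x * hnorm dot x)).
      by apply: ler_wpM2r => //; exact: hnorm_ge0.
    rewrite exprMn expr2 -mulrA -expr2 -expr2 ler_wpM2r ?sqr_ge0 //.
    by have := sqr_ge0 M; rewrite sqrrD expr1n mul1r mulr2n; lra.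
  move=> c Mcc x; apply: (uI _ _ _ (hsf _)).
  exact: (pvm_integral_inv hE EM mq Mcc (hsf x)).
have inj : injective sf.
  by move=> x y /(congr1 sf); rewrite !sq => /(can_inj km).
exists m, sf, (sf \o mi); split=> //; first by split=> //; exact: Ma_comp.
split=> // x /=; last by rewrite sq kmi.
by apply: inj; rewrite sq kmi.
Qed.

End Density.

Section WeightedSpace.
Context {R : realType} {n : nat} (theta : 'M[R]_n) (htheta : theta^T = - theta).
Local Notation L2 := (L2 R n).
Local Notation dot := (@dot R n).
Implicit Types (u v x y : L2).
Local Notation hd := (@dot_hilbert R n).
Local Notation rd := (rdot dot).
Local Notation Ma := (Ma theta).
Local Notation nrm := (hnorm dot).
Variables (nu : op L2) (m sf si : L2 -> L2).
Hypotheses (em : nu = gr m) (es : sqrt_density nu = gr sf) (Msf : Ma sf) (Msi : Ma si)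
  (ssf : forall x y, dot (sf x) y = dot x (sf y)) (sq : forall x, sf (sf x) = m x)
  (ks : cancel sf si) (ksi : cancel si sf).

Definition vol : R := (2 * pi) ^+ n.
Lemma vol_gt0 : 0 < vol. Proof. by rewrite exprn_gt0 // mulr_gt0 // pi_gt0. Qed.
Local Notation dn := (dotnu nu).

(** Up to the constant [vol], the root of the density is a unitary from the weighted space to the
    unweighted one; completeness and all norms are transported by it. *)
Lemma dotnuE u v : dn u v = vol%:C * dot (sf u) (sf v).
Proof. by rewrite /dotnu em gr_app -sq ssf. Qed.
Lemma rd_nu u v : rdot dn u v = vol * rd (sf u) (sf v).
Proof. by rewrite /rdot dotnuE ReM /= mul0r subr0. Qed.
Lemma hnorm_nu u : hnorm dn u = Num.sqrt vol * nrm (sf u).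
Proof. by rewrite /hnorm -!/(rdot _ _ _) rd_nu sqrtrM // ltW // vol_gt0. Qed.

Lemma dotnu_hilbert : hilbert dn.
Proof.
have lsf := Msf.1.1; have v0 := vol_gt0.
have sv0 : 0 < Num.sqrt vol by rewrite sqrtr_gt0.
split.
- by move=> c x y z; rewrite !dotnuE lsf (ip_linear hd); ring.
- move=> x y; rewrite !dotnuE (ip_conj hd (sf x)).
  by case: (dot (sf x) (sf y)) => a b /=; apply: complexP => /=; ring.
- by move=> x; rewrite -/(rdot _ _ _) rd_nu mulr_ge0 ?(ltW v0) // rd_ge0 //; exact: hd.
- move=> x; rewrite -/(rdot _ _ _) rd_nu => /eqP; rewrite mulf_eq0 gt_eqF //= => /eqP/(rd_eq0 hd) h.
  by rewrite -(ks x) h (lin0 Msi.1.1).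
- move=> u hu.
  have [|y hy] := ip_complete hd (u := fun k => sf (u k)).
    move=> e e0; have [N hN] := hu (Num.sqrt vol * e) (mulr_gt0 sv0 e0); exists N => i j Ni Nj.
    by have := hN i j Ni Nj; rewrite hnorm_nu ltr_pM2l // (linB lsf).
  exists (si y); rewrite /hcvg; under eq_fun do rewrite hnorm_nu (linB lsf) ksi.
  exact: cvg0Z.
Qed.

(** Conjugating a closed operator by the bounded invertible [sf] leaves it closed, so the closure in
    [lambda_nu] adds nothing. *)
Lemma lambda_nuP (x : op L2) u f : closed_op dot x ->
  lambda_nu nu x (u, f) <-> x (sf u, sf f).
Proof.
move=> [_ xc]; have xcl := closed_graph hd xc.
have e : opcomp (opinv (gr sf)) (opcomp x (gr sf)) = [set w | x (sf w.1, sf w.2)].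
  rewrite (gr_opinv ks ksi); apply/seteqP; split=> [[a b] [y [[z [hz hy]] hb]]|[a b] /= hab].
    have ez : z = sf a := hz; have eb : b = si y := hb.
    by rewrite /= eb ksi -ez.
  exists (sf b); split; last by rewrite /gr /= ks.
  by exists (sf a).
rewrite /lambda_nu es e (opclosureE hd) hclosure_id //; first exact: (hilbert_prod hd).
move=> w [a b] hw cw /=.
apply: (xcl (fun k => (sf (w k).1, sf (w k).2)) (sf a, sf b)); first exact: hw.
by apply: (hcvg_prod hd); apply: (bl_cvg Msf.1); [exact: (hcvg_fst hd cw)|exact: (hcvg_snd hd cw)].
Qed.

End WeightedSpace.

Section SumsOfOperators.
Context {R : realType} {H : lmodType R[i]} {I : finType}.
Implicit Types (A : I -> op H).

Lemma opadd_sum A x z : (\big[opadd/opzero]_i A i) (x, z) ->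
  exists f : I -> H, (forall i, A i (x, f i)) /\ z = \sum_i f i.
Proof.
have key (r : seq I) : uniq r -> forall z, (\big[opadd/opzero]_(i <- r) A i) (x, z) ->
    exists f : I -> H, (forall i, i \in r -> A i (x, f i)) /\ z = \sum_(i <- r) f i.
  elim: r => [|j r IH] /=; first by move=> _ t; rewrite big_nil => h; exists (fun=> 0); rewrite big_nil.
  move=> /andP[jr ur] t; rewrite big_cons => -[a [b [/= ha hb ->]]].
  have [f [hf ->]] := IH ur _ hb.
  exists (fun i => if i == j then a else f i); split.
    by move=> i; rewrite inE; case: eqVneq => [->|_ /=] //; exact: hf.
  rewrite big_cons eqxx; congr (_ + _); apply: eq_big_seq => i ir.
  by case: eqVneq => // ij; rewrite -ij ir in jr.
move=> /(key _ (index_enum_uniq I))[f [hf ->]]; exists f; split=> // i.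
by apply: hf; rewrite mem_index_enum.
Qed.
Lemma opadd_gr (F : I -> H -> H) : \big[opadd/opzero]_i gr (F i) = gr (fun x => \sum_i F i x).
Proof.
apply/seteqP; split=> [[x z] /opadd_sum[f [hf ->]]|[x z] /grP ->].
  by rewrite /gr /=; apply: eq_bigr => i _; exact: hf.
have key (r : seq I) : (\big[opadd/opzero]_(i <- r) gr (F i)) (x, \sum_(i <- r) F i x).
  elim: r => [|j r IH]; first by rewrite !big_nil.
  by rewrite !big_cons; exists (F j x), (\sum_(i <- r) F i x).
exact: key.
Qed.
End SumsOfOperators.

(** * The kernel of the Laplacian consists of constants *)

Section LaplacianKernel.
Context {R : realType} {n : nat} (theta : 'M[R]_n) (htheta : theta^T = - theta).
Local Notation L2 := (L2 R n).
Local Notation dot := (@dot R n).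
Implicit Types (u v x y : L2).
Local Notation hd := (@dot_hilbert R n).
Local Notation rd := (rdot dot).
Local Notation Ma := (Ma theta).
Local Notation cf u k := (L2coef u k : R[i]).

Lemma deriv_parts j y z u w : Defs.deriv theta j (y, z) -> Defs.deriv theta j (u, w) ->
  dot z u = - dot y w.
Proof.
move=> /derivP hz /derivP hw; rewrite /Defs.dot.
have -> : (fun k => complex.Re (cf z k * (cf u k)^*)) = fun k => - complex.Re (cf y k * (cf w k)^*).
  apply/funext => k; rewrite hz hw; case: (cf y k) (cf u k) => a b [a' b'].
  by rewrite -[(k 0 j)%:~R]/((k 0 j)%:~R : R[i]) -(rmorph_int (real_complex R)) /=; ring.
have -> : (fun k => complex.Im (cf z k * (cf u k)^*)) = fun k => - complex.Im (cf y k * (cf w k)^*).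
  apply/funext => k; rewrite hz hw; case: (cf y k) (cf u k) => a b [a' b'].
  by rewrite -[(k 0 j)%:~R]/((k 0 j)%:~R : R[i]) -(rmorph_int (real_complex R)) /=; ring.
by rewrite !rsumN.
Qed.

Variables (g h : 'M[op L2]_n) (hg : riemannian_metric theta g h).
Variables (nu : op L2) (m sf si : L2 -> L2).
Hypotheses (em : nu = gr m) (es : sqrt_density nu = gr sf) (Msf : Ma sf)
  (ssf : forall x y, dot (sf x) y = dot x (sf y)) (sq : forall x, sf (sf x) = m x) (ks : cancel sf si).

Lemma metric_fun : exists gf hf : 'I_n -> 'I_n -> L2 -> L2,
  [/\ forall i j, g i j = gr (gf i j) /\ Ma (gf i j), forall i j, h i j = gr (hf i j) /\ Ma (hf i j),
      forall i k x, \sum_j gf i j (hf j k x) = if i == k then x else 0 &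
      forall u : 'I_n -> L2, 0 <= \sum_i \sum_j dot (gf i j (u j)) (u i)].
Proof.
have [smo _ inv pos] := hg.
have /choice[gf hgf] : forall ij : 'I_n * 'I_n, exists f, g ij.1 ij.2 = gr f /\ Ma f.
  by move=> [i j]; have [[/LinfP[f Mf ef] _] _] := smo i j; exists f.
have /choice[hf hhf] : forall ij : 'I_n * 'I_n, exists f, h ij.1 ij.2 = gr f /\ Ma f.
  by move=> [i j]; have [_ [/LinfP[f Mf ef] _]] := smo i j; exists f.
exists (fun i j => gf (i, j)), (fun i j => hf (i, j)); split.
- by move=> i j; exact: (hgf (i, j)).
- by move=> i j; exact: (hhf (i, j)).
- move=> i k x; have [+ _] := inv i k.
  under eq_bigr do rewrite (hgf (i, _)).1 (hhf (_, k)).1 gr_comp; rewrite opadd_gr => e.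
  have : gr (fun x => \sum_j (gf (i, j) \o hf (j, k)) x) (x, \sum_j gf (i, j) (hf (j, k) x)) by [].
  by rewrite e; case: eqP => _ h0; exact: h0.
- move=> u; have := pos u; congr (is_true (_ <= _)); apply: eq_bigr => i _; apply: eq_bigr => j _.
  by rewrite (hgf (i, j)).1 gr_app.
Qed.

(** The Cauchy-Schwarz argument for a form that is nonnegative but not assumed hermitian: [0 <= z]
    includes that z is real, which for l = i gives Re y = r, and real [l] then leaves a quadratic
    inequality. *)
Lemma null_scalar (r : R) (y q : R[i]) : 0 <= r -> 0 <= q ->
  (forall l : R[i], 0 <= l^* * r%:C + l * y + l * l^* * q) -> r = 0.
Proof.
move=> r0; case: y q => y1 y2 [q1 q2]; rewrite lecE /= => /andP[/eqP q20 q10] hl.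
have y1r : y1 = r.
  have := hl (0 +i* 1); rewrite lecE => /andP[/eqP + _]; rewrite q20 /= => h1.
  by rewrite -[RHS]addr0 -h1; ring.
(* With r = t (q1 + 1) the inequality at l = -t becomes -t^2 (q1 + 2) >= 0; the added 1 keeps the
   divisor positive. *)
pose t := r / (q1 + 1); have q11 : 0 < q1 + 1 by lra.
have := hl ((- t)%:C); rewrite lecE => /andP[_]; rewrite /= y1r => h2.
have {h2} h2 : 0 <= - 2 * t * r + t ^+ 2 * q1 by apply: le_trans h2 _; rewrite le_eqVlt; apply/orP; left; apply/eqP; ring.
have et : t * (q1 + 1) = r by rewrite divfK // gt_eqF.
have t0 : 0 <= t by rewrite divr_ge0 // ltW.
apply/eqP; rewrite eq_le r0 andbT -et; rewrite -et in h2.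
have h3 : t ^+ 2 * (q1 + 2) <= 0 by lra.
have q12 : 0 < q1 + 2 by lra.
have t2 : t ^+ 2 <= 0 by rewrite -(pmulr_lle0 _ q12).
have /eqP -> : t == 0 by rewrite -sqrf_eq0 eq_le t2 sqr_ge0.
by rewrite mul0r.
Qed.
(** A null vector [b] of a nonnegative form is orthogonal to everything; pairing it with a = g b
    itself gives the sum of the squared norms of the components of [a]. *)
Lemma radical (gf : 'I_n -> 'I_n -> L2 -> L2) (lg : forall i j, lin (gf i j)) (b : 'I_n -> L2) :
  (forall u : 'I_n -> L2, 0 <= \sum_i \sum_j dot (gf i j (u j)) (u i)) ->
  \sum_i \sum_j dot (gf i j (b j)) (b i) = 0 -> forall i, \sum_j gf i j (b j) = 0.
Proof.
move=> pos Qb; pose B (v w : 'I_n -> L2) := \sum_i \sum_j dot (gf i j (v j)) (w i).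
pose a i := \sum_j gf i j (b j).
have BE (l : R[i]) c : B (fun i => b i + l *: c i) (fun i => b i + l *: c i) =
    B b b + (l^* * B b c + l * B c b + l * l^* * B c c).
  rewrite /B !mulr_sumr -!big_split; apply: eq_bigr => i _ /=.
  rewrite !mulr_sumr -!big_split; apply: eq_bigr => j _ /=.
  rewrite (linD (lg i j)) (linZ (lg i j)) (dDl hd) !(dDr hd) !(dZl hd) !(dZr hd); ring.
have Ba : B b a = (\sum_i rd (a i) (a i))%:C.
  rewrite rmorph_sum; apply: eq_bigr => i _ /=; rewrite -(dxx hd) /a.
  by rewrite (d_suml hd).
set r := \sum_i _ in Ba; have r0 : 0 <= r by apply: sumr_ge0 => i _; exact: rd_ge0 hd _.
have posB l : 0 <= l^* * B b a + l * B a b + l * l^* * B a a.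
  by have := pos (fun i => b i + l *: a i); rewrite -/(B _ _) BE [B b b]Qb add0r.
have posa : 0 <= B a a := pos a.
have r_0 : r = 0 by apply: (null_scalar r0 posa) => l; rewrite -Ba; exact: posB.
move=> i; apply: (rd_eq0 hd); move/eqP: r_0; rewrite psumr_eq0; last by move=> *; exact: rd_ge0 hd _.
by move=> /allP/(_ i (mem_index_enum _))/eqP.
Qed.

(** Integrating by parts against [u] gives <h a, a> = 0 for a = nu^(1/2) du. Positivity is available
    for [g]: with b = h a, so that a = g b, the form of [g] vanishes at [b], hence a = g b = 0 by
    [radical]. Then du = 0 and only the mode 0 survives. *)
Lemma laplacian_ker u : laplacian theta h nu (u, 0) -> exists c : R[i], u = c *: ek 0.
Proof.
have [gf [hf [eg eh gh pos]]] := metric_fun.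
have lg i j : lin (gf i j) by have [_ [[]]] := eg i j.
have lh i j : lin (hf i j) by have [_ [[]]] := eh i j.
have lsf := Msf.1.1.
move=> [_ [y [[z [hz hy]] hy0]]].
have {hy0} y0 : y = 0.
  have := congr1 -%R hy0 => /= ; rewrite scaleN1r opprK oppr0 => h0; exact: esym h0.
have {hy} z0 : z = 0.
  have ez : z = m y by move: hy; rewrite em.
  by rewrite ez y0 -sq !(lin0 lsf).
have [z_ [hz_ ez]] := opadd_sum hz.
have hz2 i : exists zi : 'I_n -> L2, (forall j, opcomp (Defs.deriv theta i) (opcomp (sqrt_density nu)
   (opcomp (h i j) (opcomp (sqrt_density nu) (Defs.deriv theta j)))) (u, zi j)) /\ z_ i = \sum_j zi j.
  exact: opadd_sum (hz_ i).
have /choice[zz hzz] := hz2.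
have hd_ i j : exists d : L2, Defs.deriv theta j (u, d) /\
    Defs.deriv theta i (sf (hf i j (sf d)), zz i j).
  have [+ _] := hzz i => /(_ j) [y1 [[y2 [[y3 [[y4 [h1 h2]] h3]] h4]] h5]].
  rewrite es in h2 h4; rewrite (eh i j).1 in h3.
  have e3 : y3 = sf y4 := h2; have e2 : y2 = hf i j y3 := h3; have e1 : y1 = sf y2 := h4.
  by exists y4; split=> //; rewrite -e3 -e2 -e1.
have /choice[d hdd] : forall j, exists d, Defs.deriv theta j (u, d) by move=> j; have [d []] := hd_ j j; exists d.
have dE j d' : Defs.deriv theta j (u, d') -> d' = d j.
  by move=> /derivP h1; have /derivP h2 := hdd j; apply: L2_ext => k; rewrite h1 h2.
pose a j := sf (d j); pose b i := \sum_j hf i j (a j).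
have hparts i j : dot (zz i j) u = - dot (hf i j (a j)) (a i).
  by have [d' [/dE -> h2]] := hd_ i j; rewrite (deriv_parts h2 (hdd i)) ssf.
have ba0 : \sum_i dot (b i) (a i) = 0.
  have : dot z u = 0 by rewrite z0 (d0l hd).
  rewrite ez (d_suml hd); under eq_bigr do rewrite (hzz _).2 (d_suml hd).
  under eq_bigr do under eq_bigr do rewrite hparts.
  under eq_bigr do rewrite sumrN -(d_suml hd).
  by rewrite sumrN => /eqP; rewrite oppr_eq0 => /eqP.
have gb i : \sum_j gf i j (b j) = a i.
  under eq_bigr do rewrite (lin_sum (lg _ _)).
  rewrite exchange_big /=; under eq_bigr do rewrite gh.
  rewrite (bigD1 i) //= eqxx big1 ?addr0 // => k ki; by rewrite eq_sym (negbTE ki).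
have a0 i : a i = 0.
  rewrite -gb; apply: (radical lg pos); under eq_bigr do rewrite -(d_suml hd) gb.
  have -> : \sum_i dot (a i) (b i) = (\sum_i dot (b i) (a i))^*.
    by rewrite rmorph_sum; apply: eq_bigr => j _; exact: (ip_conj hd (b j) (a j)).
  by rewrite ba0 rmorph0.
have s0 : si 0 = 0 by rewrite -[X in si X](lin0 lsf) ks.
have d0 i : d i = 0 by rewrite -(ks (d i)) -/(a i) a0.
exists (cf u 0); apply: L2_ext => k; rewrite L2Z ekE.
have [->|k0] := eqVneq k 0; first by rewrite mulr1.
have [j kj] : exists j, k 0 j != 0.
  apply/existsP; apply: contraNT k0 => /existsPn h0; apply/eqP/matrixP => i j.
  by rewrite mxE ord1; apply/eqP; have := h0 j; rewrite negbK.
have /derivP/(_ k) := hdd j; rewrite d0 L20 mulr0 => /esym/eqP.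
rewrite mulf_eq0 mulf_eq0 intr_eq0 (negbTE kj) orbF => /orP[/eqP[]|/eqP -> //].
by move=> /eqP; rewrite oner_eq0.
Qed.

End LaplacianKernel.

(** * Compact operators *)

Section CompactOperators.
Context {R : realType} {H : lmodType R[i]} (d : H -> H -> R[i]) (hd : hilbert d).
Local Notation rd := (rdot d).
Local Notation nrm := (hnorm d).
Local Notation meas := (measurable_fun (setT : set R)).
Implicit Types (x y : H).
Variables (T : op H) (cT : compact_op d T) (f f' : H -> H).
Hypotheses (eT : T = gr f) (bf : bl d f) (bf' : bl d f') (ff' : forall x y, d (f x) y = d x (f' y)).

Let f'f x y : d (f' x) y = d x (f y).
Proof. by rewrite (ip_conj hd y) -ff' -(ip_conj hd). Qed.
Let square_gr : opcomp (adj d T) T = gr (f' \o f).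
Proof. by rewrite eT (gr_adj hd ff') gr_comp. Qed.
Let abs_spectral : exists E, is_spectral_measure d (gr (f' \o f)) E.
Proof.
have [lf [M [_ hM]]] := bf.
have cl : closed_op d T by rewrite eT; exact: (gr_closed hd lf hM).
have dn : densely_defined d T.
  by move=> x e e0; exists x; [rewrite eT; exists (f x)|rewrite subrr hnorm0].
have [lZ sZ] := adj_comp_selfadj hd cl dn; rewrite square_gr in lZ sZ.
exact: (spectral_theorem hd).
Qed.

Lemma abs_eigen x (l : R) : f' (f x) = l%:C *: x -> opabs d T (x, (l `^ 2^-1)%:C *: x).
Proof.
have [E hs] := abs_spectral; have hE := hs.1; have eE := hs.2.
move=> hx; rewrite /opabs /oppow square_gr (fcalcE hd _ hs).
apply: (eigen_transfer hd hE (f := fun t => t `^ 2^-1)); first exact: measurable_powR.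
by rewrite -eE.
Qed.
(** Squaring the eigenvalue equation turns it into one for T* T, whose form is the squared norm of f
    x. *)
Lemma abs_eigen_norm x (s : R) : 0 < s -> opabs d T (x, s%:C *: x) -> nrm (f x) = s * nrm x.
Proof.
have [E hs] := abs_spectral; have hE := hs.1; have eE := hs.2.
have mq : meas (fun t => t `^ 2^-1) := measurable_powR _.
move=> s0; rewrite /opabs /oppow square_gr (fcalcE hd _ hs) => hx.
have [h0 hl _] := pvm_integral_lin hd hE mq.
have h2 : opcomp (pvm_integral d E (fun t => t `^ 2^-1)) (pvm_integral d E (fun t => t `^ 2^-1))
    (x, s%:C *: (s%:C *: x)).
  by exists (s%:C *: x); split=> //=; have := hl s%:C _ _ _ _ hx h0; rewrite !addr0.
have E0 y : pvm_proj E `]-oo, 0[ y = 0.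
  apply: (pvm_neg0 hd hE) => a b; rewrite -eE => /grP -> /=.
  rewrite /rdot f'f; exact: (ip_ge0 hd).
have [_] := (pvm_comp hd hE _ mq mq).1 h2.
rewrite (@pvm_integral_ae _ _ _ hd _ hE _ id `]-oo, 0[%classic) //; last 2 first.
- exact: measurable_funM.
- move=> t /=; rewrite in_itv /= => /negP; rewrite -leNgt => t0.
  by rewrite powR12_sqrt // -expr2 sqr_sqrtr.
rewrite -eE => /grP /= e.
have : rd (f x) (f x) = s ^+ 2 * rd x x.
  by rewrite /rdot ff' -e -/(rdot _ _ _) !(rdZr hd) mulrA -expr2.
rewrite -!(hnorm2 hd) -exprMn => /eqP.
by rewrite eqrXn2 ?mulr_ge0 ?hnorm_ge0 ?ltW // => /eqP.
Qed.

(** The supremum [m] of |f x|^2 over unit vectors of [G] is attained: a maximizing sequence nearly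
    solves S x = m x with S = T* T, compactness makes f x, hence S x, converge along a subsequence,
    and so does x because m >= 1. *)
Lemma max_eigen (G : set H) a : subsp G -> hclosed d G -> (forall x, G x -> G (f' (f x))) ->
  G a -> a <> 0 -> nrm a <= nrm (f a) ->
  exists e (l : R), [/\ G e, rd e e = 1, f' (f e) = l%:C *: e & 1 <= l].
Proof.
move=> sG cG GS Ga a0 ha; have [lf [M [M0 hM]]] := bf.
have lf' := bf'.1.
pose B := [set rd (f x) (f x) | x in [set x | G x /\ rd x x = 1]].
have na0 : 0 < rd a a by rewrite lt_def rd_ge0 // andbT; apply/eqP => /(rd_eq0 hd).
pose u := ((nrm a)^-1)%:C *: a.
have n0 : 0 < nrm a by rewrite lt_def hnorm_ge0 andbT; apply/eqP => /(hnorm_eq0 hd).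
have u1 : rd u u = 1 by rewrite /u (rdZl hd) (rdZr hd) -(hnorm2 hd) mulrA -expr2 -exprMn mulVf ?expr1n // gt_eqF.
have Gu : G u by exact: subspZ.
have Bu : B (rd (f u) (f u)) by exists u.
have fu1 : 1 <= rd (f u) (f u).
  rewrite /u (linZ lf) (rdZl hd) (rdZr hd) -(hnorm2 hd) mulrA -expr2 -exprMn; apply: exprn_ege1.
  by rewrite mulrC ler_pdivlMr // mul1r.
have Bub : ubound B (M ^+ 2).
  move=> _ [x [Gx x1] <-]; rewrite -(hnorm2 hd); apply: lerXn2r; rewrite ?nnegrE ?hnorm_ge0 //.
  have := hM x; have -> : nrm x = 1 by rewrite /hnorm -/(rdot _ _ _) x1 sqrtr1.
  by rewrite mulr1.
have sB : has_sup B by split; [exists (rd (f u) (f u))|exists (M ^+ 2)].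
pose m := sup B; have m1 : 1 <= m by apply: le_trans fu1 _; exact: (ub_le_sup (sB.2)).
have m0 : 0 < m by lra.
have fm x : G x -> rd (f x) (f x) <= m * rd x x.
  move=> Gx; have [x0|x0] := eqVneq x 0; first by rewrite x0 (lin0 lf) !(rd0l hd) mulr0.
  have nx : 0 < nrm x by rewrite lt_def hnorm_ge0 andbT; apply: contra_neq x0 => /(hnorm_eq0 hd).
  have := ub_le_sup sB.2 (x := rd (f (((nrm x)^-1)%:C *: x)) (f (((nrm x)^-1)%:C *: x))).
  rewrite (linZ lf) (rdZl hd) (rdZr hd) mulrA -expr2 => h.
  rewrite -ler_pdivrMr; last by rewrite -(hnorm2 hd) exprn_gt0.
  rewrite mulrC -(hnorm2 hd x) -exprVn; apply: h.
  exists (((nrm x)^-1)%:C *: x); last by rewrite (linZ lf) (rdZl hd) (rdZr hd) mulrA -expr2.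
  split; first exact: subspZ.
  by rewrite (rdZl hd) (rdZr hd) -(hnorm2 hd) mulrA -expr2 -exprMn mulVf ?expr1n // gt_eqF.
pose S x := f' (f x).
have Sm x : G x -> nrm (S x) <= m * nrm x.
  move=> Gx; have h1 : nrm (S x) ^+ 2 <= nrm (f (S x)) * nrm (f x).
    by rewrite (hnorm2 hd) /rdot {1}/S f'f; rewrite mulrC; exact: rd_le.
  have h2 : nrm (f (S x)) ^+ 2 <= m * nrm (S x) ^+ 2 by rewrite !(hnorm2 hd); apply: fm; exact: GS.
  have h3 : nrm (f x) ^+ 2 <= m * nrm x ^+ 2 by rewrite !(hnorm2 hd); exact: fm.
  move: (hnorm_ge0 d (S x)) (hnorm_ge0 d x) (hnorm_ge0 d (f (S x))) (hnorm_ge0 d (f x)) h1 h2 h3.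
  move: (nrm (S x)) (nrm x) (nrm (f (S x))) (nrm (f x)) => p q b c p0 q0 b0 c0 h1 h2 h3.
  have [->|p1] := eqVneq p 0; first by rewrite mulr_ge0 // ltW.
  have pp : 0 < p by rewrite lt_def p1.
  rewrite -(ler_pM2l pp) -expr2; apply: le_trans h1 _.
  rewrite -ler_sqr ?nnegrE; [|by rewrite mulr_ge0|by rewrite !mulr_ge0 // ltW].
  have -> : (p * (m * q)) ^+ 2 = (m * p ^+ 2) * (m * q ^+ 2) by ring.
  by rewrite exprMn; apply: ler_pM => //; exact: sqr_ge0.
have /choice[x_ hx_] : forall k : nat, exists x, [/\ G x, rd x x = 1 & m - k.+1%:R^-1 < rd (f x) (f x)].
  move=> k; have k0 : 0 < k.+1%:R^-1 :> R by rewrite invr_gt0.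
  by have [_ [x [Gx x1] <-] h] := sup_adherent k0 sB; exists x.
(* Expanded, the left side is at most m^2 - 2 m (m - 1/(k+1)) + m^2. *)
have Sx k : nrm (S (x_ k) - m%:C *: x_ k) ^+ 2 <= 2 * m * k.+1%:R^-1.
  have [Gx x1 h] := hx_ k; rewrite (hnorm2 hd) (rdBl hd) !(rdBr hd) !(rdZl hd) !(rdZr hd) x1.
  have h1 : rd (S (x_ k)) (S (x_ k)) <= m ^+ 2.
    have := Sm _ Gx; have -> : nrm (x_ k) = 1 by rewrite /hnorm -/(rdot _ _ _) x1 sqrtr1.
    by rewrite mulr1 -(hnorm2 hd) => h2; rewrite lerXn2r ?nnegrE ?hnorm_ge0 // ltW.
  have h2 : rd (S (x_ k)) (x_ k) = rd (f (x_ k)) (f (x_ k)) by rewrite /rdot /S f'f.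
  rewrite (rdC hd (x_ k)) h2; move: (rd (f _) _) (rd (S _) _) (k.+1%:R^-1 : R) h h1 => p q r h h1; nra.
have [||phi [y [mphi hy]]] := cT.2 x_ (fun k => f (x_ k)).
- by move=> k; rewrite eT.
- by exists 1 => k; have [_ x1 _] := hx_ k; rewrite /hnorm -/(rdot _ _ _) x1 sqrtr1.
have phi_ge k : (k <= phi k)%N by elim: k => // k IH; exact: leq_ltn_trans IH (mphi k).
have hy' : hcvg d (fun k => f (x_ (phi k))) y by exact: hy.
have c1 : hcvg d (fun k => S (x_ (phi k))) (f' y) := bl_cvg bf' hy'.
have c2 : hcvg d (fun k => m%:C *: x_ (phi k)) (f' y).
  have c3 : hcvg d (fun k => S (x_ (phi k)) - m%:C *: x_ (phi k)) 0.
    apply: (@hcvg_le _ _ d _ _ (fun k => Num.sqrt (2 * m * k.+1%:R^-1))).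
      move=> k; rewrite subr0 -[leLHS]ger0_norm ?hnorm_ge0 // -sqrtr_sqr; apply: ler_wsqrtr.
      apply: le_trans (Sx (phi k)) _; rewrite ler_pM2l ?mulr_gt0 // lef_pV2 ?posrE // ler_nat ltnS.
      exact: phi_ge.
    rewrite -(sqrtr0 R); apply: (continuous_cvg _ (@sqrt_continuous R 0)).
    by apply: cvg0Z; exact: cvg_harm.
  have := hcvgB hd c1 c3; rewrite subr0.
  by under eq_fun do rewrite opprB addrC subrK.
have c4 : hcvg d (fun k => x_ (phi k)) ((m^-1)%:C *: f' y).
  have := hcvgZ hd (m^-1)%:C c2; under eq_fun do rewrite scalerA -rmorphM /= mulVf ?gt_eqF // scale1r.
  by [].
exists ((m^-1)%:C *: f' y), m; split.
- by apply: (cG _ _ _ c4) => k; case: (hx_ (phi k)).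
- apply: (@cvg_real_unique _ (fun k => rd (x_ (phi k)) (x_ (phi k)))); first exact: (hcvg_rd hd).
  have -> : (fun k => rd (x_ (phi k)) (x_ (phi k))) = fun=> 1 by apply/funext => k; case: (hx_ (phi k)).
  exact: cvg_cst.
- have c5 : hcvg d (fun k => S (x_ (phi k))) (S ((m^-1)%:C *: f' y)) by apply: (bl_cvg bf'); exact: (bl_cvg bf).
  rewrite -[LHS]/(S _) (hcvg_unique hd c5 c1) scalerA -rmorphM /= mulfV ?gt_eqF // scale1r //.
- exact: m1.
Qed.

Definition eigen_family k (e : nat -> H) (l : nat -> R) :=
  (forall i, (i < k)%N -> [/\ d (e i) (e i) = 1, f' (f (e i)) = (l i)%:C *: e i & 1 <= l i]) /\
  (forall i j, (i < k)%N -> (j < k)%N -> i != j -> d (e i) (e j) = 0).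

(** The orthogonal complement of the eigenvectors found so far is closed and invariant under T* T,
    and the hypothesis provides a vector in it to start [max_eigen]; this takes the place of the
    min-max principle. *)
Lemma greedy N : (forall k (e : nat -> H), (k < N)%N -> exists a, [/\ a <> 0,
    forall i, (i < k)%N -> d a (e i) = 0 & nrm a <= nrm (f a)]) ->
  forall k, (k <= N)%N -> exists e l, eigen_family k e l.
Proof.
move=> h; elim=> [|k IH] kN; first by exists (fun=> 0), (fun=> 0); split=> [] [].
have [e [l [he ho]]] := IH (ltnW kN).
have [a [a0 ae ha]] := h k e kN.
pose G := [set x | forall i, (i < k)%N -> d x (e i) = 0].
have sG : subsp G.
  split=> [i ik|c x y Gx Gy i ik]; first by rewrite (d0l hd).
  by rewrite (ip_linear hd) Gx // Gy // mulr0 addr0.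
have cG : hclosed d G.
  move=> u x Gu cu i ik; apply: complexP.
    apply: (@cvg_real_unique _ (fun n => rd (u n) (e i))); first exact: (hcvg_rdl hd).
    have -> : (fun n => rd (u n) (e i)) = fun=> 0 by apply/funext => n; rewrite /rdot Gu.
    exact: cvg_cst.
  rewrite (imd hd); apply: (@cvg_real_unique _ (fun n => rd (u n) ((0 +i* 1) *: e i))).
    exact: (hcvg_rdl hd).
  have -> : (fun n => rd (u n) ((0 +i* 1) *: e i)) = fun=> 0.
    by apply/funext => n; rewrite /rdot (dZr hd) Gu // mulr0.
  exact: cvg_cst.
have GS x : G x -> G (f' (f x)).
  move=> Gx i ik; have [_ he2 _] := he i ik.
  by rewrite f'f ff' he2 (dZr hd) Gx // mulr0.
have [e1 [l1 [Ge n1 Se l1_]]] := max_eigen sG cG GS ae a0 ha.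
exists (fun i => if (i < k)%N then e i else e1), (fun i => if (i < k)%N then l i else l1); split.
  move=> i; rewrite ltnS leq_eqVlt => /predU1P[->|ik]; last by rewrite ik; exact: he.
  by rewrite ltnn; split=> //; rewrite (dxx hd) n1.
have lt_eq i : (i < k.+1)%N -> (i < k)%N \/ i = k by rewrite ltnS leq_eqVlt => /predU1P[]; [right|left].
move=> i j /lt_eq[ik|->] /lt_eq[jk|->] ij; rewrite ?ltnn ?ik ?jk.
- exact: ho.
- by rewrite (ip_conj hd e1) Ge // rmorph0.
- exact: Ge.
- by rewrite eqxx in ij.
Qed.

(** Grouped by the value of the square root of [l i], the orthonormal family shows that the
    multiplicities of the eigenvalues >= 1 of |T| add up to at least N + 1. *)
Lemma singular_ge1 N e l : eigen_family N.+1 e l -> 1 <= singular_value d T N.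
Proof.
move=> [he ho]; rewrite /singular_value; set A := (X in sup X); have [lf [M [M0 hM]]] := bf.
pose s i := l i `^ 2^-1.
have s1 i : (i < N.+1)%N -> 1 <= s i.
  move=> iN; have [_ _ l1] := he i iN; rewrite /s powR12_sqrt ?(le_trans _ l1) //.
  by rewrite -[leLHS](sqrtr1 R) ler_wsqrtr.
have mult (r : R) : ((count (fun i => s i == r) (iota 0 N.+1))%:R%:E <= eigen_mult (opabs d T) r)%E.
  set q := [seq i <- iota 0 N.+1 | s i == r]; rewrite -size_filter -/q.
  have uq : uniq q by rewrite filter_uniq // iota_uniq.
  have qP (j : 'I_(size q)) : (nth 0%N q j < N.+1)%N /\ s (nth 0%N q j) = r.
    by have := mem_nth 0%N (ltn_ord j); rewrite -/q mem_filter mem_iota /= add0n => /andP[/eqP ? ?].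
  apply: ereal_sup_ubound; exists (size q) => //=; exists (fun j => e (nth 0%N q j)).
    move=> c hc j; have : d (\sum_(i < size q) c i *: e (nth 0%N q i)) (e (nth 0%N q j)) = 0 by rewrite hc (d0l hd).
    rewrite (d_suml hd) (bigD1 j) //= big1 => [|i ij]; last first.
      rewrite (dZl hd) ho ?mulr0 //; [exact: (qP i).1|exact: (qP j).1|].
      by rewrite nth_uniq.
    have [h _ _] := he _ (qP j).1.
    by rewrite addr0 (dZl hd) h mulr1.
  move=> j; have [h1 h2] := qP j; have [_ h3 _] := he _ h1.
  by rewrite -h2; exact: abs_eigen.
have A1 : A 1.
  right; split=> //.
  pose r := undup [seq s i | i <- iota 0 N.+1].
  apply: (@le_trans _ _ (\sum_(x <- r) (count (fun i => s i == x) (iota 0 N.+1))%:R%:E)%E).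
    rewrite sumEFin lee_fin -natr_sum ler_nat.
    under eq_bigr do rewrite -sum1_count big_mkcond /=.
    rewrite exchange_big /= -[leqLHS](size_iota 0) -sum1_size big_seq [leqRHS]big_seq.
    apply: leq_sum => i iN; rewrite -big_mkcond sum1_count.
    rewrite (eq_count (a2 := pred1 (s i))); last by move=> x; rewrite /= eq_sym.
    by rewrite count_uniq_mem ?undup_uniq // mem_undup map_f.
  apply: (@le_trans _ _ (\sum_(x <- r) eigen_mult (opabs d T) x)%E).
    by apply: lee_sum => x _; exact: mult.
  apply: esum_ge; exists [set` r].
    split; first exact: finite_seq.
    move=> x /=; rewrite mem_undup; have /allP h : all (fun t : R => 1 <= t) [seq s i | i <- iota 0 N.+1].
      by rewrite all_map; apply/allP => i; rewrite mem_iota add0n => /andP[_ iN]; exact: s1.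
    exact: h.
  by rewrite -fsbig_seq // undup_uniq.
(* The set must be bounded for the real supremum to mean anything: an eigenvalue of |T| above the
   norm bound [M] would have zero eigenvectors. *)
apply: ub_le_sup => //; exists M => t [-> //|[t0 ht]].
apply: contrapT => /negP; rewrite -ltNge => Mt.
move: ht; rewrite esum1 ?lee_fin ?lern0 // => x /= tx.
rewrite /eigen_mult; apply/eqP; rewrite eq_le; apply/andP; split; last first.
  by apply: ereal_sup_ubound; exists 0%N => //; exists (fun=> 0) => [c _ []|[]].
apply: ub_ereal_sup => _ [k [u iu hu] <-]; rewrite lee_fin.
case: k u iu hu => // k u iu hu; exfalso.
have x0 : 0 < x by exact: lt_le_trans t0 tx.
have := abs_eigen_norm x0 (hu ord0); have := hM (u ord0) => h1 h2.
have u0 : nrm (u ord0) = 0.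
  apply/eqP; rewrite eq_le hnorm_ge0 andbT; rewrite h2 in h1.
  rewrite -(pmulr_rle0 _ (_ : 0 < x - M)); last by rewrite subr_gt0 (lt_le_trans Mt).
  by rewrite mulrBl subr_le0.
have h3 : \sum_(i < k.+1) ((i == ord0)%:R : R[i]) *: u i = 0.
  rewrite big1 // => i _; have [->|_] := eqVneq i ord0; last by rewrite scale0r.
  by rewrite (hnorm_eq0 hd u0) scaler0.
by have /eqP := iu _ h3 ord0; rewrite eqxx oner_eq0.
Qed.

Lemma weak_schatten_lower (r : R) N : (forall k (e : nat -> H), (k < N.+1)%N -> exists a, [/\ a <> 0,
    forall i, (i < k)%N -> d a (e i) = 0 & nrm a <= nrm (f a)]) ->
  ((N.+1%:R `^ r^-1)%:E <= weak_schatten_norm d r T)%E.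
Proof.
move=> /greedy/(_ _ (leqnn _))[e [l hel]]; have h := singular_ge1 hel.
apply: (@le_trans _ _ ((N.+1%:R `^ r^-1 * singular_value d T N)%:E)); last first.
  by apply: ereal_sup_ubound; exists N.
by rewrite lee_fin ler_peMr // powR_ge0.
Qed.

End CompactOperators.

(** * Counting negative eigenvalues *)

Section EigenvalueCount.
Context {R : realType} {H : lmodType R[i]} (A : op H).

Lemma eigen_mult_ge0 (l : R) : (0 <= eigen_mult A l)%E.
Proof.
apply: ereal_sup_ubound; exists 0%N => //; exists (fun=> 0) => [c _|] [] //.
Qed.

(** A sum of suprema over all negative [l] is reduced to finite families of eigenvectors.
    Independence is offered only for coefficients supported on a single eigenvalue, because
    independence across eigenvalues rests on orthogonality, shown later from the form. *)
Lemma negative_eigenvalues_le (K : R) :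
  (forall (I : finType) (u : I -> H) (l : I -> R), (forall i, l i < 0 /\ A (u i, (l i)%:C *: u i)) ->
    (forall c : I -> R[i], (forall i j, l i != l j -> c i = 0 \/ c j = 0) ->
       \sum_i c i *: u i = 0 -> forall i, c i = 0) -> #|I|%:R <= K) ->
  (negative_eigenvalues A <= K%:E)%E.
Proof.
move=> hK; pose S (l : R) (m : nat) := exists2 u : 'I_m -> H, lin_indep u & forall i, A (u i, l%:C *: u i).
have S0 l : S l 0%N by exists (fun=> 0) => [c _|] [].
have fam (s : seq R) (m : R -> nat) : uniq s -> (forall l, l \in s -> l < 0) ->
    (forall l, l \in s -> S l (m l)) -> (\sum_(l <- s) m l)%N%:R <= K.
  move=> us s0 hm; pose si (i : 'I_(size s)) := nth 0 s i.
  have si_in i : si i \in s by rewrite mem_nth.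
  pose u i := s2val (cid2 (hm _ (si_in i))).
  have ui i : lin_indep (u i) := s2valP (cid2 (hm _ (si_in i))).
  have hu i : forall j, A (u i j, (si i)%:C *: u i j) := s2valP' (cid2 (hm _ (si_in i))).
  pose I := {i : 'I_(size s) & 'I_(m (si i))}.
  have cI : #|{: I}| = (\sum_(l <- s) m l)%N.
    rewrite card_tagged sumnE big_map big_enum /= (big_nth 0) big_mkord.
    by apply: eq_bigr => i _; rewrite card_ord.
  rewrite -cI; apply: (hK I (fun p => u (tag p) (tagged p)) (fun p => si (tag p))).
    by move=> p; split; [exact: s0 | exact: hu].
  move=> c hc e [i j]; apply/eqP; apply: contraT => ci.
  have ne i' j' : i' != i -> c (existT _ i' j') = 0.
    move=> ii; have ll : si i' != si i by rewrite nth_uniq.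
    by have [//|/eqP] := hc (existT _ i' j') (existT _ i j) ll; rewrite (negPf ci).
  have : \sum_i' \sum_j' c (Tagged (fun i => 'I_(m (si i))) j') *: u i' j' = 0.
    by rewrite -[RHS]e sig_big_dep; apply: eq_bigr => -[].
  rewrite (bigD1 i) //= [X in _ + X]big1 ?addr0.
    by move=> /(ui i (fun j => c (existT _ i j)))/(_ j) h; rewrite h eqxx in ci.
  by move=> i' ii; rewrite big1 // => j' _; rewrite ne // scale0r.
(* The suprema are replaced one at a time; [y] accumulates the multiplicities already chosen. *)
have step (s : seq R) : forall (y : nat), (forall m : R -> nat, (forall l, l \in s -> S l (m l)) ->
     (y + \sum_(l <- s) m l)%N%:R <= K) -> uniq s ->
    (y%:R%:E + \sum_(l <- s) eigen_mult A l <= K%:E)%E.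
  elim: s => [|l s IH] y hy us.
    by rewrite big_nil adde0 lee_fin; have := hy (fun=> 0%N) (fun l _ => S0 l); rewrite big_nil addn0.
  have /andP[ls us'] : (l \notin s) && uniq s by [].
  have ext a : S l a -> ((y + a)%N%:R%:E + \sum_(l <- s) eigen_mult A l <= K%:E)%E.
    move=> Sa; apply: IH => // m hm; have := hy (fun t => if t == l then a else m t).
    rewrite big_cons eqxx addnA => h; rewrite (eq_big_seq (fun t => if t == l then a else m t)).
      by apply: h => t; rewrite inE; case: eqP => [->|] //= _; exact: hm.
    by move=> t ts; case: eqP => // tl; rewrite -tl ts in ls.
  have := ext _ (S0 l); rewrite addn0; set sm := (\sum_(l <- s) _)%E in ext * => h0.
  have sm0 : (0 <= sm)%E by apply: sume_ge0 => *; exact: eigen_mult_ge0.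
  have smf : sm \is a fin_num.
    rewrite ge0_fin_numE //; apply: (@le_lt_trans _ _ K%:E); last by rewrite ltry.
    by apply: le_trans h0; rewrite lee_paddl // lee_fin.
  rewrite big_cons -/sm -(fineK smf); move: ext; rewrite -(fineK smf); set z := fine sm => ext.
  rewrite addeCA addeC -EFinD -leeBrDl // -EFinB; apply: ub_ereal_sup => _ [a Sa <-].
  rewrite lee_fin /=; have := ext a Sa; rewrite -EFinD lee_fin natrD; lra.
apply: ub_ereal_sup => _ [F [finF F0] <-]; rewrite fsbig_finite //= -[leLHS]add0e.
apply: (step _ 0%N); last exact: finmap.fset_uniq.
move=> m hm; rewrite add0n; apply: fam => //; first exact: finmap.fset_uniq.
by move=> l; rewrite in_fset_set // => /set_mem /F0.
Qed.
End EigenvalueCount.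

Section NegativeForm.
Context {R : realType} {H : lmodType R[i]} (d d' : H -> H -> R[i]) (hd : hilbert d) (hd' : hilbert d').
Local Notation rd := (rdot d).
Variables (I : finType) (u a zp zm : I -> H) (l : I -> R).
Hypotheses (l0 : forall i, l i < 0)
  (free : forall c : I -> R[i], (forall i j, l i != l j -> c i = 0 \/ c j = 0) ->
     \sum_i c i *: u i = 0 -> forall i, c i = 0)
  (form : forall i j, (l i)%:C * d (u i) (u j) = d (a i) (a j) + (d' (zp i) (zp j) - d' (zm i) (zm j))).

Local Notation comb c x := (\sum_i c i *: (x : I -> H) i).

Lemma d_comb (e : H -> H -> R[i]) (he : hilbert e) c (x : I -> H) :
  e (comb c x) (comb c x) = \sum_i \sum_j c i * Num.conj (c j) * e (x i) (x j).
Proof.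
rewrite (d_suml he); apply: eq_bigr => i _; rewrite (dZl he) (d_sumr he) mulr_sumr.
by apply: eq_bigr => j _; rewrite (dZr he) mulrA.
Qed.

(** The right side of [form] is hermitian, so both eigenvalues multiply the same inner product. *)
Lemma eigen_orthogonal i j : l i != l j -> d (u i) (u j) = 0.
Proof.
move=> lij; have e : (l i)%:C * d (u i) (u j) = (l j)%:C * d (u i) (u j).
  have lc (r : R) : (r%:C : R[i])^* = r%:C by rewrite /= oppr0.
  rewrite form (ip_conj hd (u j) (u i)) -[X in _ = X * _]lc -rmorphM form !rmorphD rmorphN /=.
  by rewrite -(ip_conj hd) -!(ip_conj hd').
apply/eqP; have /eqP : ((l i)%:C - (l j)%:C) * d (u i) (u j) = 0 by rewrite mulrBl e subrr.
rewrite mulf_eq0 => /orP[|//]; rewrite subr_eq0 => /eqP[] h; by rewrite h eqxx in lij.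
Qed.

Lemma comb_free c : comb c u = 0 -> forall i, c i = 0.
Proof.
move=> e i; pose c' j := if l j == l i then c j else 0.
have -> : c i = c' i by rewrite /c' eqxx.
apply: free.
  move=> j k; rewrite /c'; case: (eqVneq (l k) (l i)) => [->|_ _]; [case: (eqVneq (l j) (l i)) => [_ //|_ _]; by left|by right].
apply: (ip_eq0 hd); rewrite -[RHS](_ : complex.Re (d (comb c u) (comb c' u)) = 0).
  congr complex.Re; rewrite !(d_suml hd); apply: eq_bigr => j _; rewrite !(dZl hd) !(d_sumr hd) /c'.
  case: eqVneq => // lj; rewrite mul0r big1 ?mulr0 // => k _; rewrite (dZr hd).
  by case: eqVneq => [lk|]; rewrite ?rmorph0 ?mul0r // eigen_orthogonal ?mulr0 // lk.
by rewrite e (d0l hd).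
Qed.

Lemma form_negative c : (exists i, c i != 0) ->
  rd (comb c a) (comb c a) + (Defs.hnorm d' (comb c zp)) ^+ 2 < (Defs.hnorm d' (comb c zm)) ^+ 2.
Proof.
(* The roots of -l i are absorbed into the coefficients. As only pairs with equal eigenvalues
   contribute, the form at the combination is minus the squared norm of the rescaled combination of
   eigenvectors. *)
move=> [i ci]; pose s i : R := Num.sqrt (- l i); pose c' i := (s i)%:C * c i.
have s0 j : 0 < s j by rewrite sqrtr_gt0 oppr_gt0.
have w0 : 0 < rd (comb c' u) (comb c' u).
  rewrite lt_def rd_ge0 // andbT; apply/eqP => /(rd_eq0 hd)/comb_free/(_ i)/eqP.
  by rewrite mulf_eq0 (negPf ci) orbF => /eqP[] h; have := s0 i; rewrite h ltxx.
have key : d (comb c a) (comb c a) + (d' (comb c zp) (comb c zp) - d' (comb c zm) (comb c zm)) =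
    - d (comb c' u) (comb c' u).
  rewrite !(d_comb hd) !(d_comb hd') -sumrB -big_split -sumrN /=; apply: eq_bigr => j _.
  rewrite -sumrB -big_split -sumrN /=; apply: eq_bigr => k _.
  rewrite -mulrBr -mulrDr -form /c'; have [ljk|ljk] := eqVneq (l j) (l k); last first.
    by rewrite eigen_orthogonal // !mulr0 oppr0.
  have -> : s k = s j by rewrite /s ljk.
  have e : ((l j)%:C : R[i]) = - ((s j)%:C * (s j)%:C).
    by rewrite -rmorphM /= -expr2 sqr_sqrtr ?oppr_ge0 ?ltW // rmorphN opprK.
  have -> : Num.conj ((s j)%:C * c k) = (s j)%:C * Num.conj (c k) by rewrite rmorphM; congr (_ * _); exact: conjc_real.
  rewrite e; ring.
rewrite !(hnorm2 hd'); move: w0; have := congr1 (@complex.Re R) key.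
rewrite !ReD !ReN -!/(rdot _ _ _); move: (rdot d _ _) (rdot d _ _) (rdot d' _ _) (rdot d' _ _) => p q r t; lra.
Qed.

Lemma linear_conditions k (M : I -> 'I_k -> R[i]) : (k < #|I|)%N ->
  exists2 c : I -> R[i], (exists i, c i != 0) & forall j, \sum_i c i * M i j = 0.
Proof.
move=> kI; pose A : 'M[R[i]]_(#|I|, k) := \matrix_(i, j) M (enum_val i) j.
have : (0 < \rank (kermx A))%N by rewrite mxrank_ker subn_gt0 (leq_ltn_trans (rank_leq_col A)).
rewrite lt0n mxrank_eq0 => nz; pose v := nz_row (kermx A).
have v0 : v != 0 by rewrite nz_row_eq0.
have vA : v *m A = 0 by apply/sub_kermxP; exact: nz_row_sub.
exists (fun i => v 0 (enum_rank i)).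
  have /rV0Pn[j vj] := v0; by exists (enum_val j); rewrite enum_valK.
move=> j; have := congr1 (fun B : 'rV_k => B 0 j) vA; rewrite !mxE => h; rewrite -[RHS]h.
rewrite [RHS](reindex (@enum_rank I)) /=; last by exists enum_val => i _; rewrite ?enum_rankK ?enum_valK.
by apply: eq_bigr => i _; rewrite mxE enum_rankK.
Qed.

(** There are k + 1 linear conditions, [k] of orthogonality and one that cancels the constant
    components [kap], whence the requirement of more than k + 1 vectors. *)
Lemma negative_vector (kap : I -> R[i]) k (e : nat -> H) : (k.+1 < #|I|)%N ->
  exists c : I -> R[i], [/\ \sum_i c i * kap i = 0, forall j, (j < k)%N -> d (comb c a) (e j) = 0 &
    rd (comb c a) (comb c a) + hnorm d' (comb c zp) ^+ 2 < hnorm d' (comb c zm) ^+ 2].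
Proof.
move=> kI; pose M (i : I) (j : 'I_k.+1) := if (j < k)%N then d (a i) (e j) else kap i.
have [c c0 hc] := linear_conditions M kI; exists c; split; last exact: form_negative.
  by rewrite -[RHS](hc ord_max); apply: eq_bigr => i _; rewrite /M /= ltnn.
move=> j jk; rewrite (d_suml hd) -[RHS](hc (Ordinal (ltnW jk : (j < k.+1)%N))).
by apply: eq_bigr => i _; rewrite (dZl hd) /M /= jk.
Qed.

End NegativeForm.

Section InversePowers.
Context {R : realType} {H : lmodType R[i]} (d : H -> H -> R[i]) (hd : hilbert d).
Variables (E : @pvm R H) (hE : is_pvm d E).
Local Notation I f := (pvm_integral d E f).

(** As 0 to a nonzero power is 0, t^(-s) t^s is the indicator of t <> 0: the inverse power recovers
    [u] up to its component in the kernel. *)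
Lemma inverse_power (s : R) u a : s != 0 -> I (fun t => t `^ s) (u, a) ->
  exists2 b, I (fun t => t `^ (- s)) (a, b) & I id (u - b, 0).
Proof.
move=> s0 h; pose C : set R := ~` [set 0].
have m0 : measurable ([set 0] : set R) by exact: measurable_set1.
have mC : measurable C by exact: measurableC.
have e : (fun t : R => t `^ (- s) * t `^ s) = \1_C.
  apply/funext => t; rewrite indicE powRN; have [->|t0] := eqVneq t 0.
    by rewrite powR0 // mulr0 memNset //=; apply.
  by rewrite mulVf ?mem_set //= ?powR_eq0 ?(negPf t0) //; apply/eqP.
have [_] := pvm_comp hd hE (u, pvm_proj E C u) (measurable_powR (- s)) (measurable_powR s).
case; first split=> /=; first by case: h.
  rewrite e pvm_integral_bounded; last exact: bmeas_indic.
  by rewrite /= phi_indic.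
move=> a' [/= h1 h2]; have ea : a' = a := pvm_integral_fun hd hE (measurable_powR s) h1 h.
exists (pvm_proj E C u); first by rewrite -ea.
have -> : u - pvm_proj E C u = pvm_proj E [set 0] u.
  rewrite -[X in X - _](P_T hE) -(setvU [set 0]) (P_setU hd hE) //; last by rewrite setICl.
  by rewrite addrC addKr.
exact: (pvm_integral_P0 hd hE).
Qed.

End InversePowers.

(** * Counting negative eigenvalues of the Schroedinger operator *)

Section SchrodingerCount.
Context {R : realType} {n : nat} (theta : 'M[R]_n) (htheta : theta^T = - theta).
Local Notation L2 := (L2 R n).
Local Notation dot := (@dot R n).
Local Notation one := (ek (0 : Zn n) : L2).
Implicit Types (u v x y : L2).
Variables (g h : 'M[op L2]_n) (hg : riemannian_metric theta g h).
Variables (nu : op L2) (m sf si : L2 -> L2).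
Hypotheses (em : nu = gr m) (es : sqrt_density nu = gr sf) (Msf : Ma theta sf) (Msi : Ma theta si)
  (ssf : forall x y, dot (sf x) y = dot x (sf y)) (sq : forall x, sf (sf x) = m x)
  (ks : cancel sf si) (ksi : cancel si sf).
Local Notation dn := (dotnu nu).
Let hd := @dot_hilbert R n.
Let hdn : hilbert dn := dotnu_hilbert em Msf Msi ssf sq ks ksi.
Variables (p q : R) (p0 : 0 < p) (q1 : 1 <= q) (n0 : (0 < n)%N).
Variables (V : op L2) (Vq : Lp theta q V) (EV : @pvm R L2) (hV : is_spectral_measure dot V EV).
Local Notation A := (schrodinger theta h nu p V).
Let hEV : is_pvm dot EV := hV.1.
Let aV : affiliated theta V := Vq.1.
Let s0 : R := n%:R / (4 * p).
Local Notation xp := (pvm_integral dot EV sqp).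
Local Notation xm := (pvm_integral dot EV sqm).

(** A pair in the graph supplies a value of the form at (u, u), hence a pair in a power of the
    Laplacian, and [fcalc] is inhabited only along with a spectral measure. *)
Lemma schrodinger_spectral u f : A (u, f) -> exists E, is_spectral_measure dn (laplacian theta h nu) E.
Proof.
by move=> [su /(_ u su)[a [b [t [[hs _] _ _ _]]]]]; exists (spectral_measure dn (laplacian theta h nu)).
Qed.

Lemma schrodinger_sym_form (E : pvm) u v f f' : is_spectral_measure dn (laplacian theta h nu) E -> A (u, f) -> A (v, f') ->
  exists a b t, [/\ pvm_integral dn E (fun t => t `^ s0) (u, a), pvm_integral dn E (fun t => t `^ s0) (v, b),
    tau_L1 theta (strong_product theta V sf u v) t & dn f v = dn a b + (@vol R n)%:C * t].
Proof.
move=> hs [_ /= hA] [/= sv _]; have [a [b [t [h1 h2 h3 h4]]]] := hA v sv.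
exists a, b, t; split; last exact: h4.
- by move: h1; rewrite /laplacian_pow /oppow (fcalcE hdn _ hs).
- by move: h2; rewrite /laplacian_pow /oppow (fcalcE hdn _ hs).
- by move: h3; rewrite es.
Qed.

Lemma family_zero (I : finType) (u : I -> L2) (l : I -> R) : (forall i, u i = 0) ->
  (forall c : I -> R[i], (forall i j, l i != l j -> c i = 0 \/ c j = 0) ->
     \sum_i c i *: u i = 0 -> forall i, c i = 0) -> #|I| = 0%N.
Proof.
move=> u0 hc; apply: eq_card0 => i; exfalso.
have := hc (fun j => (j == i)%:R) _ _ i; rewrite eqxx => h1.
suff /eqP : (1 : R[i]) = 0 by rewrite oner_eq0.
apply: h1 => [j k|]; last by rewrite big1 // => j _; rewrite u0 scaler0.
by case: (eqVneq j i) => [->|_ _]; [case: (eqVneq k i) => [->|_ _]; [rewrite eqxx|right]|left].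
Qed.

(** Covers a vanishing negative part, where the bound is 0 even if no constant is admissible. The
    spectral measure of V then has no negative part by faithfulness of the trace, so the form is
    nonnegative. *)
Lemma schrodinger_nonneg : Lpnorm q (negative_part V) = 0%E -> (negative_eigenvalues A <= 0)%E.
Proof.
have q0 : 0 < q by exact: lt_le_trans ltr01 q1.
move=> h0; have EM := Linf_pvmM aV hV.
have P0 := Lpnorm_neg0 htheta hEV q0 EM hV h0.
apply: negative_eigenvalues_le => I u l hu fr; rewrite (family_zero _ fr) // => i.
have [l0 Au] := hu i; have [E hs] := schrodinger_spectral Au.
have [a [b [t [h1 h2 h3 h4]]]] := schrodinger_sym_form hs Au Au.
have eb : b = a := pvm_integral_fun hdn hs.1 (measurable_powR s0) h2 h1; rewrite eb in h4.
have t0 := form_ge0 htheta aV hV Msf ssf P0 h3.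
apply: (rd_eq0 hdn); have Rz (r : R) (z : R[i]) : complex.Re (r%:C * z) = r * complex.Re z by rewrite ReM /= mul0r subr0.
have : l i * rdot dn (u i) (u i) = rdot dn a a + @vol R n * complex.Re t.
  suff h5 (z1 z2 : R[i]) (k : R) : (l i)%:C * z1 = z2 + k%:C * t ->
      l i * complex.Re z1 = complex.Re z2 + k * complex.Re t by apply: h5; rewrite -(dZl hdn).
  by move=> /(congr1 (@complex.Re R)); rewrite ReD !Rz.
have := rd_ge0 hdn a; have := rd_ge0 hdn (u i); have := mulr_ge0 (ltW (@vol_gt0 R n)) t0.
move: (rdot dn (u i) (u i)) (rdot dn a a) (_ * complex.Re t) l0 => r r' w l0 w0 r0 r0' e; nra.
Qed.

(** Needed for the constant components of eigenvectors. The vector 1 is in the domain by [Lp_dom],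
    and sf 1 is the image of 1 under a map of the commutant, which preserves the domain. *)
Lemma dom_density (f : R -> R) : measurable_fun setT f -> (forall t, f t ^+ 2 <= `|t|) ->
  exists o, pvm_integral dot EV f (sf one, o).
Proof.
have q0 : 0 < q by exact: lt_le_trans ltr01 q1.
move=> mf fle; have EM := Linf_pvmM aV hV.
have [_ Lf] := Lp_sq hEV q0 mf fle EM hV Vq.
have [y hy] := Lp_dom hEV mf q1 Lf.
have [c Mcc <-] := Ma_Mc_one htheta Msf.
by exists (c y); apply: (pvm_integral_inv hEV EM mf Mcc).
Qed.

Definition cwikel_admissible (C : R) := 0 <= C /\ forall x : op L2, Lp theta (2 * q) x ->
  let T := opcomp (lambda_nu nu x) (laplacian_pow theta h nu (- (n%:R / (4 * p)))) in
  weak_schatten dn (2 * p) T /\ (weak_schatten_norm dn (2 * p) T <= C%:E * Lpnorm (2 * q) x)%E.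

(** Reads the boundedness of X D^(-s) as a domain statement: it is defined everywhere, so X is
    defined at D^(-s) a. It is applied to the positive part as well, to put eigenvectors in the
    domain of X+. *)
Lemma cwikel_domain (C : R) (E : pvm) (f : R -> R) : cwikel_admissible C -> is_spectral_measure dn (laplacian theta h nu) E ->
  measurable_fun setT f -> (forall t, f t ^+ 2 <= `|t|) ->
  let x := pvm_integral dot EV f in
  let T := opcomp (lambda_nu nu x) (laplacian_pow theta h nu (- s0)) in
  exists2 F : L2 -> L2, bl dn F /\ T = gr F &
    forall a b, pvm_integral dn E (fun t => t `^ (- s0)) (a, b) -> x (sf b, sf (F a)).
Proof.
have q0 : 0 < q by exact: lt_le_trans ltr01 q1.
move=> [_ hC] hs mf fle x T; have EM := Linf_pvmM aV hV.
have [[[bT _] _] _] := hC x (Lp_sq hEV q0 mf fle EM hV Vq).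
have [F bF eT] := bounded_bl bT; exists F => // a b hb.
have [b' [/= h1 h2]] : T (a, F a) by rewrite [T]eT; exact/grP.
have h1' : pvm_integral dn E (fun t => t `^ (- s0)) (a, b').
  by move: h1; rewrite /laplacian_pow /oppow (fcalcE hdn _ hs).
have eb : b' = b := pvm_integral_fun hdn hs.1 (measurable_powR (- s0)) h1' hb.
apply/(lambda_nuP es Msf ks ksi); last by rewrite -eb.
exact: pvm_integral_closed.
Qed.

Lemma cwikel_count (C r : R) : cwikel_admissible C -> Lpnorm (2 * q) xm = r%:E ->
  (negative_eigenvalues A <= (1 + (C * r) `^ (2 * p))%:E)%E.
Proof.
have q0 : 0 < q by exact: lt_le_trans ltr01 q1.
move=> hC er; have EM := Linf_pvmM aV hV.
have [lxp _] := pvm_integral_closed hd hEV (@sqp_meas R).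
have [lxm _] := pvm_integral_closed hd hEV (@sqm_meas R).
have [wp hwp] := dom_density (@sqp_meas R) (@sqp_abs R).
have [wm hwm] := dom_density (@sqm_meas R) (@sqm_abs R).
apply: negative_eigenvalues_le => I u l hu fr.
have [I1|I2] := leqP #|I| 1%N.
  by apply: (@le_trans _ _ (1 : R)); [rewrite (ler_nat R _ 1)|rewrite lerDl powR_ge0].
have [i0 _] : exists i0 : I, true by case/card_gt0P: (ltnW I2) => i _; exists i.
have [E hs] := schrodinger_spectral (hu i0).2.
have [Fp [bFp _] hFp] := cwikel_domain hC hs (@sqp_meas R) (@sqp_abs R).
have [Fm [bFm eTm] hFm] := cwikel_domain hC hs (@sqm_meas R) (@sqm_abs R).
have s00 : s0 != 0.
  by rewrite mulf_neq0 // ?invr_neq0 ?mulf_neq0 // ?gt_eqF // ltr0n.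
have /choice[a ha] i : exists a, pvm_integral dn E (fun t => t `^ s0) (u i, a).
  by have [a [b [t [h1 _ _ _]]]] := schrodinger_sym_form hs (hu i).2 (hu i).2; exists a.
have /choice[kap hk] i : exists c : R[i], exists2 b, pvm_integral dn E (fun t => t `^ (- s0)) (a i, b) &
    u i = b + c *: one.
  have [b hb h1] := inverse_power hdn hs.1 s00 (ha i).
  have [c hc] : exists c : R[i], u i - b = c *: one.
    by apply: (laplacian_ker hg em es Msf ssf sq ks); rewrite hs.2.
  by exists c, b => //; rewrite -hc addrC subrK.
have lsf := Msf.1.1; have lsi := Msi.1.1; have lFm := bFm.1.
have hxp i : xp (sf (u i), sf (Fp (a i)) + kap i *: wp).
  have [b hb ->] := hk i; have [_ hl _] := lxp.
  by have := hl (kap i) _ _ _ _ hwp (hFp _ _ hb); rewrite (linD lsf) (linZ lsf) addrC [X in (_, X)]addrC.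
have hxm i : xm (sf (u i), sf (Fm (a i)) + kap i *: wm).
  have [b hb ->] := hk i; have [_ hl _] := lxm.
  by have := hl (kap i) _ _ _ _ hwm (hFm _ _ hb); rewrite (linD lsf) (linZ lsf) addrC [X in (_, X)]addrC.
(* These are X+ u and X- u, with the contribution of the constant component of [u i] kept
   separate. *)
pose zp i := si (sf (Fp (a i)) + kap i *: wp); pose zm i := si (sf (Fm (a i)) + kap i *: wm).
have form i j : (l i)%:C * dn (u i) (u j) = dn (a i) (a j) + (dn (zp i) (zp j) - dn (zm i) (zm j)).
  have [a1 [b1 [t [h1 h2 h3 h4]]]] := schrodinger_sym_form hs (hu i).2 (hu j).2.
  have ea : a1 = a i := pvm_integral_fun hdn hs.1 (measurable_powR s0) h1 (ha i).
  have eb : b1 = a j := pvm_integral_fun hdn hs.1 (measurable_powR s0) h2 (ha j).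
  rewrite -(dZl hdn) h4 ea eb; congr (_ + _).
  rewrite (form_value htheta aV hV Msf ssf h3 (hxp i) (hxm i) (hxp j) (hxm j)).
  by rewrite !(dotnuE em ssf sq) /zp /zm !ksi mulrBr.
(* N + 2 eigenvectors will give N + 1 singular values >= 1: one dimension goes to the kernel of the
   Laplacian. *)
have [N eN] : exists N, #|I| = N.+2 by case: #|I| I2 => [|[|N]] // _; exists N.
have EMm := Lp_sq hEV q0 (@sqm_meas R) (@sqm_abs R) EM hV Vq.
have [_ /(_ _ EMm)[[cT _] hT]] := hC; have [Fm' bFm' adjF] := bl_adj hdn bFm.
have low : forall k (e : nat -> L2), (k < N.+1)%N -> exists b, [/\ b <> 0,
    forall i, (i < k)%N -> dn b (e i) = 0 & hnorm dn b <= hnorm dn (Fm b)].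
  move=> k e kN; have kI : (k.+1 < #|I|)%N by rewrite eN.
  have [c [c1 c2 c3]] := negative_vector hdn hdn (fun i => (hu i).1) fr form kap e kI.
  (* The condition on [kap] cancels the constant components, so X- at the combination is X- D^(-s)
     applied to the combination of the [a i]. *)
  have ez : \sum_i c i *: zm i = Fm (\sum_i c i *: a i).
    rewrite (lin_sum lFm) (eq_bigr (fun i => Fm (c i *: a i) + (c i * kap i) *: si wm)).
      by rewrite big_split /= -scaler_suml c1 scale0r addr0.
    by move=> i _; rewrite /zm (linD lsi) ks (linZ lsi) (linZ lFm) scalerDr scalerA.
  rewrite ez in c3; exists (\sum_i c i *: a i); split => // [b0|].
    move: c3; rewrite b0 (lin0 lFm) (hnorm0 hdn) (rd0l hdn) add0r expr0n /= ltNge sqr_ge0 //.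
  apply: (le_hnorm); rewrite -!(hnorm2 hdn) in c3 *.
  by apply: le_trans (ltW c3); rewrite lerDl sqr_ge0.
have := weak_schatten_lower hdn cT eTm bFm bFm' adjF (2 * p) low.
move=> /le_trans/(_ hT); rewrite er -EFinM lee_fin => h1.
have p2 : 0 < 2 * p by rewrite mulr_gt0.
have Cr : 0 <= C * r by apply: le_trans h1; exact: powR_ge0.
rewrite eN -[N.+2]addn1 natrD addrC lerD2l.
have -> : N.+1%:R = (N.+1%:R `^ (2 * p)^-1) `^ (2 * p) :> R by rewrite -powRrM mulVf ?gt_eqF // powRr1.
apply: ge0_ler_powR => //; rewrite ?nnegrE ?powR_ge0 // ltW //.
Qed.

End SchrodingerCount.

Local Open Scope ring_scope.

Theorem theorem6p1 (R : realType) (n : nat) (hn : (2 <= n)%N)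
  (theta : 'M[R]_n) (htheta : (theta^T)%R = - theta)
  (g ginv : 'M[op (L2 R n)]_n) (hg : riemannian_metric theta g ginv)
  (nu : op (L2 R n)) (hnu : smooth_density theta nu)
  (p q : R) (hp : 0 < p)
  (hq : (p != 1 /\ q = Num.max p 1) \/ (p = 1 /\ 1 < q))
  (V : op (L2 R n)) (hV : adj (@dot R n) V = V) (hVq : Lp theta q V) :
  (negative_eigenvalues (schrodinger theta ginv nu p V) - 1 <=
   cwikel_constant theta ginv nu p q `^ (2 * p) *
   Lpnorm q (negative_part V) `^ p)%E.
Proof.
have q1 : 1 <= q by case: hq => [[_ ->]|[_ /ltW//]]; rewrite le_max lexx orbT.
have q0 : 0 < q by exact: lt_le_trans ltr01 q1.
have n0 : (0 < n)%N by exact: ltnW.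
have p2 : 0 < 2 * p by rewrite mulr_gt0.
have [m [sf [si [em es [Msf Msi] ssf [sq ks ksi]]]]] := density_sqrt hnu.
have [lV _] := aff_closed hVq.1.
have [EV hEV] := spectral_theorem (@dot_hilbert R n) lV hV.
have [_ xm_lty] := Lp_sq hEV.1 q0 (@sqm_meas R) (@sqm_abs R) (Linf_pvmM hVq.1 hEV) hEV hVq.
have [r r0 er] : exists2 r : R, 0 <= r & Lpnorm (2 * q) (pvm_integral (@dot R n) EV (@sqm R)) = r%:E.
  move: xm_lty; have : (0 <= Lpnorm (2 * q) (pvm_integral (@dot R n) EV (@sqm R)))%E by exact: poweR_ge0.
  by case: (Lpnorm _ _) => // r r0 _; exists r.
have eneg : Lpnorm q (negative_part V) = ((r `^ 2)%:E)%E.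
  by rewrite (Lpnorm_neg hEV.1 q0 hEV) er poweR_EFin.
have rhs0 : (0 <= cwikel_constant theta ginv nu p q `^ (2 * p) * Lpnorm q (negative_part V) `^ p)%E.
  by apply: mule_ge0; exact: poweR_ge0.
set N := negative_eigenvalues _.
have [N1|N1] := leP (N - 1)%E 0%E; first exact: le_trans rhs0.
(* From here on there is more than one negative eigenvalue, which [schrodinger_nonneg] excludes when
   the negative part vanishes; [r] can be divided by. *)
have r1 : 0 < r.
  rewrite lt_def r0 andbT; apply: contraTneq N1 => re; rewrite -leNgt.
  have : (N <= 0)%E.
    apply: (schrodinger_nonneg htheta _ em es Msf Msi ssf sq ks ksi _ q1 hVq hEV).
    by rewrite eneg re powR0.
  by move=> h; apply: le_trans (leeB h (lexx 1%E)) _; rewrite sub0e oppe_le0.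
have count C : cwikel_admissible theta ginv nu p q C -> (N - 1 <= ((C * r) `^ (2 * p))%:E)%E.
  move=> hC; rewrite leeBlDr // addeC -EFinD.
  exact: (cwikel_count htheta hg em es Msf Msi ssf sq ks ksi hp q1 n0 hVq hEV hC er).
rewrite eneg /cwikel_constant; set c := ereal_inf _.
have rp : 0 < r `^ 2 `^ p by rewrite powR_gt0 // powR_gt0.
(* If the count is infinite then no constant is admissible, and the infimum over the empty set is
   +oo, as is its product with a positive norm. *)
case: (N - 1)%E N1 count => [y||] // y0 count; last first.
  have -> : c = +oo%E.
    rewrite /c; set S := (X in ereal_inf X); suff -> : S = set0 by rewrite ereal_inf0.
    by apply/seteqP; split=> // _ [C hC <-]; have := count C hC.
  by rewrite poweRyr ?gt_eqF // poweR_EFin gt0_mulye ?lte_fin.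
have y0' : 0 < y by [].
(* Solving the estimate for [C] gives a lower bound valid for every admissible constant, which
   passes to the infimum. *)
have cge : ((y `^ (2 * p)^-1 / r)%:E <= c)%E.
  apply: le_ereal_inf_tmp => _ [C hC <-]; rewrite lee_fin ler_pdivrMr //.
  have := count C hC; rewrite lee_fin => h.
  have Cr : 0 <= C * r by rewrite mulr_ge0 //; case: hC.
  have -> : C * r = (C * r) `^ (2 * p) `^ (2 * p)^-1 by rewrite -powRrM mulfV ?gt_eqF // powRr1.
  by apply: ge0_ler_powR => //; rewrite ?nnegrE ?powR_ge0 // ?invr_ge0 ltW.
(* At that lower bound the powers of [r] cancel, since (r^2)^p = r^(2p), and exactly [y] remains. *)
apply: (@le_trans _ _ (((y `^ (2 * p)^-1 / r)%:E `^ (2 * p)) * (r `^ 2)%:E `^ p)%E).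
  rewrite !poweR_EFin -EFinM lee_fin powRM ?invr_ge0 ?powR_ge0 // -powRrM mulVf ?gt_eqF //.
  rewrite -mulrA -[r `^ 2 `^ p]powRrM -powRM ?invr_ge0 // mulVf ?gt_eqF // powR1 mulr1 powRr1 // ltW //.
apply: lee_wpmul2r; first exact: poweR_ge0.
have c0 : (0 <= (y `^ (2 * p)^-1 / r)%:E)%E by rewrite lee_fin mulr_ge0 ?powR_ge0 ?invr_ge0.
apply: gt0_ler_poweR; rewrite ?in_itv /= ?leey ?andbT //; [exact: ltW|exact: le_trans cge].
Qed.
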